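(* Let $(X_i)_{i\in\mathbb Z}$ be the $p$-dimensional Gaussian linear process described in the context, and suppose Conditions (A) and (G) of the context hold. Let $\tilde\beta=(4\beta-3)\wedge(2\beta-1)$ and $$\rho(n)=\sup_{u\in\mathbb R}\left|\mathbb P\left(n^{1/2}|\hat\Sigma_n-\Sigma|_\infty\ge u\right)-\mathbb P\left(|Z|_\infty\ge u\right)\right|,\qquad \Psi(p,n)=\frac{\log^{(5\tilde\beta+12)/(4\tilde\beta+8)}(pn)}{n^{\tilde\beta/(4\tilde\beta+8)}}.$$ Then $$\rho(n)\le C\,\Psi(p,n),$$ where $C>0$ is a constant related to $C_0$ and $c_0$. In particular, if $\Psi(p,n)\to0$, then $\rho(n)\to0$.
   Context: Setting. Let $(\epsilon_t)_{t\in\mathbb Z}$ be i.i.d. $N(0,I_d)$ vectors in $\mathbb R^d$, let $A_t\in\mathbb R^{p\times d}$ ($t\ge0$), and let $X_i=\sum_{t=0}^\infty A_t\epsilon_{i-t}\in\mathbb R^p$. Put $\Sigma=\mathbb E[X_iX_i^\top]$, $\Gamma_k=\mathrm{Cov}(X_t,X_{t-k})$ for $k\in\mathbb Z$, and $\hat\Sigma_n=n^{-1}\sum_{i=1}^nX_iX_i^\top$. Condition (A): for some $\beta>3/4$ and a constant $C_0>0$, the coefficient matrices satisfy $\max_{1\le j\le p}\left(\sum_{l=1}^d (A_t)_{jl}^2\right)^{1/2}\le C_0(1\vee t)^{-\beta}$ for all $t\ge0$. Condition (G): there is a constant $c_0>0$ such that for all $1\le s,t\le p$, $\sum_{k=-\infty}^\infty\left((\Gamma_k)_{ss}(\Gamma_k)_{tt}+(\Gamma_k)_{st}(\Gamma_k)_{ts}\right)\ge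 c_0$. Notation: $\mathrm{Vec}(\cdot)$ stacks the columns of a matrix; $|\cdot|_\infty$ is the maximum absolute entry of a vector or matrix; $a\wedge b=\min\{a,b\}$, $a\vee b=\max\{a,b\}$; $\log^a(x)=(\log x)^a$. $Z$ is a $p^2$-dimensional Gaussian vector with mean zero and the same covariance matrix as $S_n=n^{1/2}\mathrm{Vec}(\hat\Sigma_n-\Sigma)$.
   Formalization: The bound is stated for pn > 1: when p = n = 1 one has log(pn) = 0, so Ψ(1,1) = 0, while ρ(1) > 0, and the inequality fails in that single case. *)

(* Defs.v *)
From HB Require Import structures.
From mathcomp Require Import all_boot all_order all_algebra.
From mathcomp Require Import all_classical all_reals all_analysis.

Set Implicit Arguments.
Unset Strict Implicit.
Unset Printing Implicit Defensive.

Import Order.TTheory GRing.Theory Num.Theory.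
Import numFieldNormedType.Exports.

Local Open Scope classical_set_scope.
Local Open Scope ring_scope.

Section random_vectors.
Context {d : measure_display} {T : measurableType d} {R : realType}.
Variable P : probability T R.

Definition random_vector k (Y : T -> 'cV[R]_k) : Prop :=
  forall i, measurable_fun setT (fun w => Y w i 0).

Definition sigma_of k (Y : T -> 'cV[R]_k) : set (set T) :=
  g_sigma_preimage (fun i w => Y w i 0).

Definition mutually_independent (I : choiceType) k (Y : I -> T -> 'cV[R]_k) :
    Prop :=
  forall (J : seq I) (E : I -> set T), uniq J ->
    (forall i, i \in J -> sigma_of (Y i) (E i)) ->
    P (\bigcap_(i in [set` J]) E i) = (\prod_(i <- J) P (E i))%E.

(* N(m, v) on the line, v being the variance. [normal_prob] takes the standard
   deviation, and at standard deviation 0 it is not a point mass. *)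
Definition normal_law (m v : R) (B : set R) : \bar R :=
  if v == 0 then dirac m B else normal_prob m (Num.sqrt v) B.

(* Y ~ N(m, C): every linear combination a^T Y has law N(a^T m, a^T C a).
   C may be singular. *)
Definition gaussian_vector k (Y : T -> 'cV[R]_k) (m : 'cV[R]_k) (C : 'M[R]_k) :
    Prop :=
  random_vector Y /\
  forall (a : 'cV[R]_k) (B : set R), measurable B ->
    P [set w | B ((a^T *m Y w) 0 0)] =
    normal_law ((a^T *m m) 0 0) ((a^T *m C *m a) 0 0) B.

Definition cross_covmx k l (Y : T -> 'cV[R]_k) (Y' : T -> 'cV[R]_l) :
    'M[R]_(k, l) :=
  \matrix_(i, j) fine (covariance P (fun w => Y w i 0) (fun w => Y' w j 0)).

Definition covmx k (Y : T -> 'cV[R]_k) : 'M[R]_k := cross_covmx Y Y.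

Definition iid_standard_gaussian k (eps : int -> T -> 'cV[R]_k) : Prop :=
  (forall t, gaussian_vector (eps t) 0 1%:M) /\ mutually_independent eps.

(* The series defining X_i converges almost surely. *)
Definition gaussian_linear_process p k (eps : int -> T -> 'cV[R]_k)
    (A : nat -> 'M[R]_(p, k)) (X : int -> T -> 'cV[R]_p) : Prop :=
  [/\ iid_standard_gaussian eps,
      (forall i, random_vector (X i)) &
      forall i, {ae P, forall w,
        series (fun t : nat => A t *m eps (i - t%:Z) w) @ \oo --> X i w}].

End random_vectors.

(* A two-sided series; it is only used for absolutely summable families, for
   which the order of summation is immaterial. *)
Definition int_sum {R : realType} (f : int -> R) : R :=
  limn (series (fun k : nat => f k%:Z)) +
  limn (series (fun k : nat => f (- k.+1%:Z))).

Definition Vec {R : realType} p (M : 'M[R]_p) : 'cV[R]_(p * p) :=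
  (* [mxvec] is row-major, hence the inner transpose *)
  (mxvec M^T)^T.

Section linear_process.
Context {d : measure_display} {T : measurableType d} {R : realType}.
Variables (P : probability T R) (p : nat) (X : int -> T -> 'cV[R]_p).

(* The processes considered are stationary, so Sigma and Gamma are evaluated at
   time 0. *)
Definition Sigma : 'M[R]_p :=
  \matrix_(i, j) fine ('E_P[fun w => (X 0 w i 0 * X 0 w j 0)%R])%E.

Definition Gamma (k : int) : 'M[R]_p := cross_covmx P (X 0) (X (- k)).

Definition Sigma_hat (n : nat) (w : T) : 'M[R]_p :=
  n%:R^-1 *: \sum_(1 <= i < n.+1) (X i%:Z w *m (X i%:Z w)^T).

Definition S_ (n : nat) (w : T) : 'cV[R]_(p * p) :=
  Num.sqrt n%:R *: Vec (Sigma_hat n w - Sigma).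

(* The norm `|_| on matrices is the maximum absolute entry. *)
Definition rho {d' : measure_display} {T' : measurableType d'}
    (P' : probability T' R) (Z : T' -> 'cV[R]_(p * p)) (n : nat) : R :=
  sup [set `| fine (P [set w | u <= Num.sqrt n%:R * `|Sigma_hat n w - Sigma| ])
              - fine (P' [set w | u <= `|Z w| ]) | | u in [set: R]].

Definition condition_G (c0 : R) : Prop :=
  forall s t : 'I_p,
    c0 <= int_sum (fun k => Gamma k s s * Gamma k t t + Gamma k s t * Gamma k t s).

End linear_process.

Definition condition_A {R : realType} p d (beta C0 : R) (A : nat -> 'M[R]_(p, d)) :
    Prop :=
  forall (t : nat) (j : 'I_p),
    Num.sqrt (\sum_(l < d) A t j l ^+ 2) <= C0 * (maxn 1 t)%:R `^ (- beta).

Definition beta_tilde {R : realType} (beta : R) : R :=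
  Num.min (4 * beta - 3) (2 * beta - 1).

Definition Psi {R : realType} (beta : R) (p n : nat) : R :=
  let b := beta_tilde beta in
  ln (p * n)%:R `^ ((5 * b + 12) / (4 * b + 8)) / n%:R `^ (b / (4 * b + 8)).

(* Main.v *)
(* Up to signs, the entries of sqrt n (Sigma_hat - Sigma) are centred quadratic
   forms V_j = Y' Q_j Y - tr (Q_j K) in one Gaussian vector Y with covariance K,
   the values X_1, ..., X_n.  Rotate from Z to V along U_t = sin t V + cos t Z and
   let m be a smoothed indicator of a rectangle.  Gaussian integration by parts in
   Y and in Z shows that the derivative of E m(U_t) is the expectation of
   (tau - E tau) paired with the Hessian of m at U_t, where
   tau_jk = 2 (Q_j Y)' K (Q_k Y) has mean Cov(V_j, V_k).  The differences
   tau_jk - E tau_jk are again centred quadratic forms; a further integration by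
   parts gives a recursion for their even moments, and moments of order log(p n)
   control all of them simultaneously.

   The Hessian of m vanishes unless max_j (U_t - x)_j lies in a short interval.
   For Z such an interval has small probability, by an anti-concentration bound
   obtained by integrating Z_j times the soft-max weights by parts; for U_t the
   probability is compared with the one for Z at the price of twice the distance
   being estimated, which is then absorbed.

   The covariances decay like (1 v k)^(1 - 2 beta).  The powers of log(p n) and
   of 1/(4 beta - 3) that this leaves are harmless: unless the claimed bound exceeds
   1, n^(4 beta - 3) is at least a large power of log(p n) and 1/(4 beta - 3) is at
   most log n. *)

Require Import Defs.
From HB Require Import structures.
From mathcomp Require Import all_boot all_order all_algebra.
From mathcomp Require Import all_classical all_reals all_analysis.
From mathcomp Require Import measurable_realfun ring lra zify.

Set Implicit Arguments.
Unset Strict Implicit.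
Unset Printing Implicit Defensive.

Import Order.TTheory GRing.Theory Num.Theory.
Import numFieldNormedType.Exports.

Local Open Scope classical_set_scope.
Local Open Scope ring_scope.

(** * Expectation *)

(** The vector to be compared is always singular: the entries (s, t) and (t, s) of the sample
    covariance coincide, and each entry occurs with both signs. Densities in several variables are
    therefore avoided. Gaussian families are described by characteristic functions, integration by
    parts is the first-order term of the rotation invariance of two independent copies, and the
    anti-concentration bound uses variances only. Condition (G) enters solely through the lower
    bound for these variances. The constant must not depend on beta. Up to logarithms and powers of
    1/b the argument gives n^(-b/4), with b = 4 beta - 3 for beta below 15/16, whereas the exponent
    b0/(4 b0 + 8) in [Psi], with b0 = [beta_tilde beta], stays below both 1/4 and b0/8. This slack
    pays for the powers of 1/b, and it allows a larger beta to be replaced by 15/16 or by 2, so that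
    the constants of the power sums stay bounded. *)

Definition Ex {d} {T : measurableType d} {R : realType} (P : probability T R)
  (f : T -> R) : R := \int[P]_w f w.

Definition Li {d} {T : measurableType d} {R : realType} (P : probability T R)
  (f : T -> R) : Prop := P.-integrable setT (EFin \o f).

Section expectation.
Context {d} {T : measurableType d} {R : realType}.
Variable P : probability T R.
Implicit Types f g : T -> R.

Lemma Li_meas f : Li P f -> measurable_fun setT f.
Proof. by move=> /integrableP[/measurable_EFinP]. Qed.

Lemma Li_cst c : Li P (fun _ => c).
Proof.
exact: (finite_measure_integrable_cst P c measurableT).
Qed.

Lemma Li_dom f g : measurable_fun setT f -> (forall w, `|f w| <= g w) ->
  Li P g -> Li P f.
Proof.
move=> mf fg; apply: le_integrable => //; first exact/measurable_EFinP.
move=> w _ /=; rewrite lee_fin; apply: (le_trans (fg w)); exact: ler_norm.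
Qed.

Lemma Li_bnd f C : measurable_fun setT f -> (forall w, `|f w| <= C) -> Li P f.
Proof. by move=> mf fC; apply: (Li_dom mf fC); exact: Li_cst. Qed.

Lemma LiD f g : Li P f -> Li P g -> Li P (fun w => f w + g w).
Proof. by move=> If Ig; apply: (integrableD measurableT If Ig). Qed.

Lemma LiB f g : Li P f -> Li P g -> Li P (fun w => f w - g w).
Proof. by move=> If Ig; apply: (integrableB measurableT If Ig). Qed.

Lemma LiZ c f : Li P f -> Li P (fun w => c * f w).
Proof. by move=> If; apply: (integrableZl measurableT c If). Qed.

Lemma Li_abs f : Li P f -> Li P (fun w => `|f w|).
Proof. by move=> If; apply: (integrable_norm If). Qed.

Lemma Li_sum I (s : seq I) (p : pred I) (F : I -> T -> R) :
  (forall i, Li P (F i)) -> Li P (fun w => \sum_(i <- s | p i) F i w).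
Proof.
move=> H; elim: s => [|i s IH].
  by rewrite [X in Li P X](_ : _ = fun _ => 0); [exact: Li_cst|apply/funext => w; rewrite big_nil].
have [pi|pi] := boolP (p i).
  rewrite [X in Li P X](_ : _ = fun w => F i w + \sum_(i <- s | p i) F i w); first exact: LiD.
  by apply/funext => w; rewrite big_cons pi.
by rewrite [X in Li P X](_ : _ = fun w => \sum_(i <- s | p i) F i w)//; apply/funext => w; rewrite big_cons (negbTE pi).
Qed.

Lemma ExD f g : Li P f -> Li P g -> Ex P (fun w => f w + g w) = Ex P f + Ex P g.
Proof. by move=> If Ig; rewrite /Ex RintegralD. Qed.

Lemma ExB f g : Li P f -> Li P g -> Ex P (fun w => f w - g w) = Ex P f - Ex P g.
Proof. by move=> If Ig; rewrite /Ex RintegralB. Qed.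

Lemma ExZ c f : Li P f -> Ex P (fun w => c * f w) = c * Ex P f.
Proof. by move=> If; rewrite /Ex RintegralZl. Qed.

Lemma Ex_cst c : Ex P (fun _ => c) = c.
Proof.
rewrite /Ex Rintegral_cst//.
rewrite [X in fine X](_ : _ = 1%E) ?mulr1//; exact: probability_setT.
Qed.

Lemma eq_Ex f g : f =1 g -> Ex P f = Ex P g.
Proof. by move=> fg; congr Ex; apply/funext. Qed.

Lemma Ex_sum I (s : seq I) (p : pred I) (F : I -> T -> R) :
  (forall i, Li P (F i)) ->
  Ex P (fun w => \sum_(i <- s | p i) F i w) = \sum_(i <- s | p i) Ex P (F i).
Proof.
move=> H; elim: s => [|i s IH].
  by rewrite big_nil -[RHS]Ex_cst; apply: eq_Ex => w; rewrite big_nil.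
rewrite big_cons; case: ifPn => pi; last first.
  by rewrite -IH; apply: eq_Ex => w; rewrite big_cons (negbTE pi).
rewrite -IH -ExD//; last exact: Li_sum.
by apply: eq_Ex => w; rewrite big_cons pi.
Qed.

Lemma Ex_le f g : Li P f -> Li P g -> (forall w, f w <= g w) -> Ex P f <= Ex P g.
Proof. by move=> If Ig fg; rewrite /Ex le_Rintegral. Qed.

Lemma Ex_ge0 f : (forall w, 0 <= f w) -> 0 <= Ex P f.
Proof. by move=> f0; exact: Rintegral_ge0. Qed.

Lemma Ex_abs f : Li P f -> `|Ex P f| <= Ex P (fun w => `|f w|).
Proof. by move=> If; exact: le_normr_Rintegral. Qed.

Lemma Ex_bnd f g : measurable_fun setT f -> Li P g -> (forall w, `|f w| <= g w) ->
  `|Ex P f| <= Ex P g.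
Proof.
move=> mf Ig fg; have If := Li_dom mf fg Ig.
by apply: (le_trans (Ex_abs If)); apply: Ex_le => //; exact: Li_abs.
Qed.

Lemma Ex_indic A : measurable A -> Ex P (\1_A) = fine (P A).
Proof. by move=> mA; rewrite /Ex /Rintegral integral_indic// setIT. Qed.

Lemma Ex_dct (F : nat -> T -> R) f (C : R) :
  (forall n, measurable_fun setT (F n)) -> measurable_fun setT f ->
  (forall n w, `|F n w| <= C) ->
  {ae P, forall w, F n w @[n --> \oo] --> f w} ->
  Ex P (F n) @[n --> \oo] --> Ex P f.
Proof.
move=> mF mf FC Ff.
have [] := @dominated_convergence _ T R P setT measurableT
   (fun n w => (F n w)%:E) (fun w => (f w)%:E) (fun _ => C%:E).
- by move=> n; apply/measurable_EFinP.
- exact/measurable_EFinP.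
- by move: Ff; apply: filterS => w H _; apply/fine_cvgP; split => //; exact: nearW.
- exact: Li_cst.
- by apply: aeW => w n _ /=; rewrite lee_fin.
move=> If _ H; apply: fine_cvg; rewrite fineK; last first.
  by apply: integrable_fin_num.
exact: H.
Qed.

Lemma prob_fin A : measurable A -> P A \is a fin_num.
Proof. by apply: fin_num_measure. Qed.

End expectation.

(** * Product probability spaces and Fubini *)

Section product.
Context {d} {T : measurableType d} {d'} {T' : measurableType d'} {R : realType}.
Variables (P : probability T R) (P' : probability T' R).

Definition PP : probability (T * T')%type R := (P \x P')%E.

(** The inner integral is finite for almost every point only, so passing to its real value under the
    outer integral is an almost-everywhere equality. *)
Lemma Ex_fubini1 (F : T * T' -> R) : Li PP F ->
  Ex PP F = Ex P (fun w => Ex P' (fun w' => F (w, w'))).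
Proof.
move=> IF.
have /= H := @integral12_prod_meas1 _ _ T T' R P P' (EFin \o F) IF.
rewrite /Ex /Rintegral.
rewrite -[X in fine X = _]H.
congr fine; apply: ae_eq_integral => //.
- exact: (@measurable_fubini_F _ _ T T' R P P' (EFin \o F) IF).
- apply/measurable_EFinP.
  apply: (@measurableT_comp _ _ _ _ _ _ (@fine R)) => //.
  exact: (@measurable_fubini_F _ _ T T' R P P' (EFin \o F) IF).
- have := @ae_integrable1 _ _ T T' R P P' (EFin \o F) IF.
  apply: filterS => w Iw _ /=.
  rewrite fineK//.
  by have := integrable_fin_num measurableT Iw.
Qed.

Lemma Ex_fubini2 (F : T * T' -> R) : Li PP F ->
  Ex PP F = Ex P' (fun w' => Ex P (fun w => F (w, w'))).
Proof.
move=> IF.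
have /= H := @integral21_prod_meas1 _ _ T T' R P P' (EFin \o F) IF.
rewrite /Ex /Rintegral.
rewrite -[X in fine X = _]H.
congr fine; apply: ae_eq_integral => //.
- exact: (@measurable_fubini_G _ _ T T' R P P' (EFin \o F) IF).
- apply/measurable_EFinP.
  apply: (@measurableT_comp _ _ _ _ _ _ (@fine R)) => //.
  exact: (@measurable_fubini_G _ _ T T' R P P' (EFin \o F) IF).
- have := @ae_integrable2 _ _ T T' R P P' (EFin \o F) IF.
  apply: filterS => w Iw _ /=.
  rewrite fineK//.
  by have := integrable_fin_num measurableT Iw.
Qed.

Lemma Ex_meas1 (F : T * T' -> R) : Li PP F ->
  measurable_fun setT (fun w => Ex P' (fun w' => F (w, w'))).
Proof.
move=> IF; apply: (@measurableT_comp _ _ _ _ _ _ (@fine R)) => //.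
exact: (@measurable_fubini_F _ _ T T' R P P' (EFin \o F) IF).
Qed.

Lemma Ex_meas2 (F : T * T' -> R) : Li PP F ->
  measurable_fun setT (fun w' => Ex P (fun w => F (w, w'))).
Proof.
move=> IF; apply: (@measurableT_comp _ _ _ _ _ _ (@fine R)) => //.
exact: (@measurable_fubini_G _ _ T T' R P P' (EFin \o F) IF).
Qed.

Lemma Li_prod (f : T -> R) (g : T' -> R) : Li P f -> Li P' g ->
  Li PP (fun z => f z.1 * g z.2).
Proof.
move=> If Ig; have mf := Li_meas If; have mg := Li_meas Ig.
have mfg : measurable_fun setT (fun z : T * T' => f z.1 * g z.2).
  by apply: measurable_funM; [exact: (measurableT_comp mf)|exact: (measurableT_comp mg)].
apply/(@integrable12ltyP _ _ T T' R P P'); first exact/measurable_EFinP.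
rewrite [X in (X < _)%E](_ : _ =
  ((\int[P]_x `|(f x)%:E| * \int[P']_y `|(g y)%:E|))%E); last first.
  rewrite -ge0_integralZr//; first last.
  - exact: integral_ge0.
  - by apply: measurableT_comp => //; exact/measurable_EFinP.
  apply: eq_integral => x _ /=.
  rewrite -ge0_integralZl//; last first.
    by apply/measurable_EFinP; exact: measurableT_comp.
  by apply: eq_integral => y _ /=; rewrite normrM EFinM.
move/integrableP : If => [_ If]; move/integrableP : Ig => [_ Ig].
apply: lte_mul_pinfty => //.
all: rewrite ?ge0_fin_numE//; try exact: integral_ge0.
Qed.

Lemma Li_fst (f : T -> R) : Li P f -> Li PP (fun z => f z.1).
Proof.
move=> If; have := Li_prod If (Li_cst P' 1).
by under eq_fun do rewrite mulr1.
Qed.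

Lemma Li_snd (g : T' -> R) : Li P' g -> Li PP (fun z => g z.2).
Proof.
move=> If; have := Li_prod (Li_cst P 1) If.
by under eq_fun do rewrite mul1r.
Qed.

Lemma Ex_prod (f : T -> R) (g : T' -> R) : Li P f -> Li P' g ->
  Ex PP (fun z => f z.1 * g z.2) = Ex P f * Ex P' g.
Proof.
move=> If Ig; rewrite Ex_fubini1; last exact: Li_prod.
under eq_Ex do rewrite /= ExZ//.
by under eq_Ex do rewrite mulrC; rewrite ExZ// mulrC.
Qed.

End product.

(** * Elementary estimates for sine, cosine and the exponential *)

Section trig.
Context {R : realType}.
Implicit Types u v : R.

Lemma MVT_le (f df : R -> R) (a b : R) : a <= b -> (forall x : R, is_derive x (1 : R) f (df x)) ->
  exists c, [/\ a <= c, c <= b & f b - f a = df c * (b - a)].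
Proof.
move=> ab fdf.
have [|c] := @MVT_segment R f df a b ab.
  apply/continuous_subspaceT => r.
  exact/differentiable_continuous/derivable1_diffP.
by rewrite in_itv/= => /andP[? ?] ?; exists c.
Qed.

Lemma abs_sin_le v : `|sin v| <= `|v|.
Proof.
wlog v0 : v / 0 <= v.
  move=> H; case: (leP 0 v) => [/H//|/ltW v0].
  by rewrite -[X in X <= _]normrN -sinN -[X in _ <= X]normrN; apply: H; rewrite oppr_ge0.
have [c [_ _]] := @MVT_le sin cos 0 v v0 (fun x => is_derive_sin x).
rewrite sin0 !subr0 => ->; by rewrite normrM ler_piMl// ler_norml cos_le1 cos_geN1.
Qed.

(** Half-angle formula: 1 - cos v is twice the square of sin (v / 2). *)
Lemma one_sub_cos v : 0 <= 1 - cos v <= v ^+ 2 / 2.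
Proof.
have -> : v = (v / 2) *+ 2 by rewrite mulr2n; field.
set w := v / 2.
rewrite cos_mulr2n cos2sin2.
have := abs_sin_le w; rewrite -ler_sqr ?nnegrE// !real_normK ?num_real//.
have := sqr_ge0 (sin w).
move: (sin w) => t h1 h2.
have -> : 1 - ((1 - t ^+ 2) *+ 2 - 1) = 2 * t ^+ 2 by rewrite mulr2n; ring.
have -> : (w *+ 2) ^+ 2 / 2 = 2 * w ^+ 2 by rewrite mulr2n; field.
by rewrite mulr_ge0// ler_wpM2l.
Qed.

Lemma sin_sub_id v : `|sin v - v| <= v ^+ 2 /\ `|sin v - v| <= `|v| ^+ 3.
Proof.
wlog v0 : v / 0 <= v.
  move=> H; case: (leP 0 v) => [/H//|/ltW v0].
  have -> : `|sin v - v| = `|sin (- v) - - v| by rewrite sinN -opprD normrN.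
  rewrite -[`|v|]normrN -sqrrN; apply: H.
  by rewrite oppr_ge0.
have [c [c0 cv]] := @MVT_le (fun x => sin x - x) (fun x => cos x - 1) 0 v v0 _.
rewrite sin0 !subr0 => ->.
have /andP[h1 h2] := one_sub_cos c.
have := cos_geN1 c => h3.
have h4 : `|cos c - 1| <= v ^+ 2 / 2.
  rewrite distrC ger0_norm// (le_trans h2)// ler_wpM2r ?invr_ge0// ler_sqr//.
rewrite normrM (ger0_norm v0).
split; last first.
  by rewrite exprSr ler_wpM2r// (le_trans h4)//; have := sqr_ge0 v; lra.
have [v2|v2] := leP v 2.
  rewrite expr2 ler_wpM2r//; apply: (le_trans h4); nra.
rewrite expr2 ler_wpM2r// distrC ger0_norm//; lra.
Qed.

Lemma cos_taylor3 v : `|1 - cos v - v ^+ 2 / 2| <= `|v| ^+ 3.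
Proof.
wlog v0 : v / 0 <= v.
  move=> H; case: (leP 0 v) => [/H//|/ltW v0].
  by rewrite -[`|v|]normrN -(cosN v) -sqrrN; apply: H; rewrite oppr_ge0.
have [|c [c0 cv]] := @MVT_le (fun x => 1 - cos x - x ^+ 2 / 2) (fun x => sin x - x) 0 v v0.
  by move=> x; apply: is_derive_eq; rewrite /GRing.scale /=; field.
have -> : 1 - cos 0 - 0 ^+ 2 / 2 = 0 :> R by rewrite cos0 expr0n/=; ring.
rewrite !subr0 => ->.
rewrite normrM (ger0_norm v0) exprSr ler_wpM2r//.
have [h _] := sin_sub_id c; apply: (le_trans h).
by rewrite ler_sqr.
Qed.

Lemma cos_taylor u v : `|cos (u + v) - cos u + v * sin u| <= 2 * v ^+ 2.
Proof.
rewrite cosD.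
have -> : cos u * cos v - sin u * sin v - cos u + v * sin u =
  cos u * - (1 - cos v) - sin u * (sin v - v) by ring.
apply: (le_trans (ler_normB _ _)).
have -> : 2 * v ^+ 2 = v ^+ 2 + v ^+ 2 by ring.
apply: lerD; rewrite normrM.
  have /andP[h1 h2] := one_sub_cos v.
  rewrite normrN (ger0_norm h1) -[leRHS]mul1r ler_pM ?cos_max//.
  by rewrite (le_trans h2)//; have := sqr_ge0 v; lra.
by rewrite -[leRHS]mul1r ler_pM ?sin_max//; have [] := sin_sub_id v.
Qed.

Lemma sin_taylor u v : `|sin (u + v) - sin u - v * cos u| <= 2 * v ^+ 2.
Proof.
rewrite sinD.
have -> : sin u * cos v + cos u * sin v - sin u - v * cos u =
  sin u * - (1 - cos v) + cos u * (sin v - v) by ring.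
apply: (le_trans (ler_normD _ _)).
have -> : 2 * v ^+ 2 = v ^+ 2 + v ^+ 2 by ring.
apply: lerD; rewrite normrM.
  have /andP[h1 h2] := one_sub_cos v.
  rewrite normrN (ger0_norm h1) -[leRHS]mul1r ler_pM ?sin_max//.
  by rewrite (le_trans h2)//; have := sqr_ge0 v; lra.
by rewrite -[leRHS]mul1r ler_pM ?cos_max//; have [] := sin_sub_id v.
Qed.

(** Only the tangent inequality exp x >= 1 + x is used, at u and at -u. *)
Lemma expR_taylor u : `|expR u - 1 - u| <= u ^+ 2 * expR `|u|.
Proof.
have e1 := expR_ge1Dx u.
rewrite ger0_norm; last lra.
have [u0|u0] := leP 0 u.
  rewrite (ger0_norm u0).
  have := expR_ge1Dx (- u); rewrite expRN => h.
  have e0 := expR_gt0 u.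
  have : (1 - u) * expR u <= 1.
    by rewrite -ler_pdivlMr// div1r.
  nra.
rewrite ltr0_norm//.
have h := expR_ge1Dx (- u).
have : expR u * expR (- u) = 1 by rewrite expRxMexpNx_1.
have := expR_gt0 u; have := expR_gt0 (- u); nra.
Qed.

(** Replaces differentiation at 0: an identity between first-order terms holds as soon as their
    difference, times a small k, is of order k^2. Stein's identity, the first two Gaussian moments
    and the integration by parts are all obtained in this way. *)
Lemma lin_le_sq_eq0 (A C : R) :
  (forall k, 0 < k <= 1 -> `|A| * k <= C * k ^+ 2) -> A = 0.
Proof.
move=> H; apply/eqP; rewrite -normr_eq0; apply/eqP.
have C1 : 0 <= C by have := H 1; rewrite ltr01 lexx expr1n !mulr1 => /(_ isT); apply: le_trans.
apply/eqP; rewrite eq_le normr_ge0 andbT leNgt; apply/negP => A0.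
pose k := Num.min 1 (`|A| / (2 * (C + 1))).
have C2 : 0 < 2 * (C + 1) by lra.
have k0 : 0 < k by rewrite lt_min ltr01 divr_gt0.
have k1 : k <= 1 by rewrite ge_min lexx.
have k2 : k * (2 * (C + 1)) <= `|A| by rewrite -ler_pdivlMr// ge_min lexx orbT.
have := H k; rewrite k0 k1 => /(_ isT).
rewrite expr2 mulrA ler_pM2r//; nra.
Qed.

Lemma is_derive_sq (f : R -> R) x l C :
  (forall h, `|h| <= 1 -> `|f (x + h) - f x - h * l| <= C * h ^+ 2) -> is_derive x 1 f l.
Proof.
move=> H.
have C0 : 0 <= C.
  by have := H 1; rewrite normr1 lexx expr1n mulr1 => /(_ isT); apply: le_trans.
have cv : h^-1 *: ((f \o shift x) (h *: 1) - f x) @[h --> 0^'] --> l.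
  apply/cvgrPdist_le => /= e e0; near=> h.
  have h0 : h != 0 by near: h; exact: nbhs_dnbhs_neq.
  have h1 : `|h| <= 1 by near: h; apply: dnbhs0_le.
  have h2 : `|h| <= e / (C + 1) by near: h; apply: dnbhs0_le; rewrite divr_gt0//; lra.
  rewrite /= [h *: 1]mulr1 (addrC h).
  rewrite distrC /GRing.scale /=.
  have -> : h^-1 * (f (x + h) - f x) - l = h^-1 * (f (x + h) - f x - h * l) by field.
  rewrite normrM normfV ler_pdivrMl ?normr_gt0//.
  apply: (le_trans (H h h1)).
  rewrite -real_normK ?num_real// expr2 mulrCA ler_wpM2l//.
  rewrite ler_pdivlMr in h2; last lra.
  have := normr_ge0 h; nra.
by apply: DeriveDef; [apply/cvg_ex; exists l|exact/cvg_lim].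
Unshelve. all: by end_near. Qed.

End trig.

(** * The normal law *)

Section normal.
Context {R : realType}.
Variable s : R.
Hypothesis s0 : s != 0.
Notation mu := (@lebesgue_measure R).
Notation N := (normal_prob 0 s : probability (measurableTypeR R) R).

Lemma measurable_shift (h : R) : measurable_fun [set: measurableTypeR R] (fun x : measurableTypeR R => (x + h)%R : measurableTypeR R).
Proof. exact: measurable_funD. Qed.

(** The shifted measure gives half-open intervals their length, which characterises Lebesgue
    measure. *)
Lemma lebesgue_shift (h : R) (A : set R) : measurable A ->
  pushforward mu (fun x : R => (x + h)%R : measurableTypeR R) A = mu A.
Proof.
move=> mA; apply/esym/lebesgue_measure_unique => //; first exact: measurable_shift.
move=> ? _ [[a b]] _ <- /=; rewrite /pushforward.
rewrite [X in _ = mu X](_ : _ = `]a - h, b - h]%classic); last first.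
  by apply/seteqP; split => x /=; rewrite !in_itv/= ltrBlDr lerBrDr.
rewrite !lebesgue_measure_itv/= !lte_fin ltrD2r.
case: ifPn => // _; rewrite -!EFinD; congr EFin; ring.
Qed.

Lemma integral_shift (h : R) (f : R -> \bar R) : measurable_fun [set: R] f ->
  (forall x, 0 <= f x)%E -> (\int[mu]_x f (x + h)%R = \int[mu]_x f x)%E.
Proof.
move=> mf f0.
transitivity (\int[pushforward mu (fun x : R => (x + h)%R : measurableTypeR R)]_x f x)%E.
  by rewrite ge0_integral_pushforward//; exact: measurable_shift.
apply: eq_measure_integral => //; first exact: measurable_shift.
by move=> ? A mA _; exact: lebesgue_shift.
Qed.

(** The Radon-Nikodym derivative of the normal law agrees almost everywhere with [normal_pdf], since
    both have the same integrals over measurable sets. *)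
Lemma normal_int_ge0 (f : R -> \bar R) : measurable_fun [set: R] f ->
  (forall x, 0 <= f x)%E ->
  (\int[N]_x f x = \int[mu]_x (f x * (normal_pdf 0 s x)%:E))%E.
Proof.
move=> mf f0.
have dom := @normal_prob_dominates R 0 s.
rewrite -(Radon_Nikodym_SigmaFinite.change_of_variables dom)//.
have mpdf : measurable_fun setT (EFin \o normal_pdf 0 s : R -> \bar R).
  by apply/measurable_EFinP; exact: measurable_normal_pdf.
apply: ae_eq_integral => //.
- apply: emeasurable_funM => //.
  exact: measurable_int (Radon_Nikodym_SigmaFinite.f_integrable dom).
- exact: emeasurable_funM.
- apply: ae_eqe_mul2l => /=.
  apply: integral_ae_eq => //=.
  + exact: Radon_Nikodym_SigmaFinite.f_integrable.
  + by move=> E ET mE; rewrite -Radon_Nikodym_SigmaFinite.f_integral.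
Qed.

Lemma normal_pdf_shift (h x : R) :
  normal_pdf 0 s (x - h) = normal_pdf 0 s x * expR ((h * x - h ^+ 2 / 2) / s ^+ 2).
Proof.
rewrite !normal_pdfE// -mulrA; congr (_ * _).
rewrite /normal_fun -expRD; congr expR.
rewrite !subr0 mulr2n; field.
by rewrite s0 -mulr2n mulrn_eq0/= expf_eq0/= s0.
Qed.

(** Cameron-Martin formula on the line: translating a centred normal variable amounts to tilting its
    density by an exponential. *)
Lemma normal_shift_ge0 (h : R) (f : R -> R) : measurable_fun [set: R] f ->
  (forall x, 0 <= f x) ->
  (\int[N]_x (f (x + h))%:E =
   \int[N]_x (f x * expR ((h * x - h ^+ 2 / 2) / s ^+ 2))%:E)%E.
Proof.
move=> mf f0.
have me : measurable_fun [set: R] (fun x => expR ((h * x - h ^+ 2 / 2) / s ^+ 2)).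
  by apply: measurableT_comp => //; apply: measurable_funM => //; apply: measurable_funB => //; exact: measurable_funM.
rewrite !normal_int_ge0//; first last.
- by move=> x; rewrite lee_fin.
- apply/measurable_EFinP; apply: (measurableT_comp mf); exact: measurable_shift.
- by move=> x; rewrite lee_fin mulr_ge0// expR_ge0.
- by apply/measurable_EFinP; exact: measurable_funM.
pose g (x : R) := (f x * normal_pdf 0 s (x - h))%:E.
transitivity (\int[mu]_x g (x + h)%R)%E.
  by apply: eq_integral => x _; rewrite /g addrK EFinM.
rewrite integral_shift; first last.
- by move=> x; rewrite /g lee_fin mulr_ge0// normal_pdf_ge0.
- apply/measurable_EFinP; apply: measurable_funM => //.
  by apply: (measurableT_comp (measurable_normal_pdf 0 s)); exact: (measurable_shift (- h)).
by apply: eq_integral => x _; rewrite /g normal_pdf_shift -EFinM; congr EFin; ring.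
Qed.

Lemma Li_expR (k : R) : Li N (fun x => expR (k * x)).
Proof.
have me : measurable_fun [set: R] (fun x : R => expR (k * x)).
  by apply: measurableT_comp => //; exact: measurable_funM.
apply/integrableP; split; first exact/measurable_EFinP.
(* The shift k s^2 is the one whose tilt is exp (k x) up to a constant factor; applied to the
   function 1, the formula makes the integral of the tilt finite. *)
have := @normal_shift_ge0 (k * s ^+ 2) (fun _ => 1) (measurable_cst _) (fun _ => ler01).
rewrite [LHS](_ : _ = 1%E); last first.
  by rewrite integral_cst// mul1e; exact: probability_setT.
have E x : 1 * expR ((k * s ^+ 2 * x - (k * s ^+ 2) ^+ 2 / 2) / s ^+ 2) =
   expR (- (k ^+ 2 * s ^+ 2 / 2)) * expR (k * x).
  by rewrite mul1r -expRD; congr expR; field.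
under [X in _ = X -> _]eq_integral do rewrite E EFinM.
rewrite ge0_integralZl//; first last.
- exact/measurable_EFinP.
move=> H; under eq_integral do rewrite /= ger0_norm ?expR_ge0//.
move: H; case: (\int[_]_x _)%E => //=; first by move=> ? _; exact: ltry.
by rewrite gt0_muley// lte_fin expR_gt0.
Qed.

Lemma Li_expR_abs (k : R) : 0 <= k -> Li N (fun x => expR (k * `|x|)).
Proof.
move=> k0; apply: (@Li_dom _ _ _ N _ (fun x => expR (k * x) + expR (- k * x))).
- apply: measurableT_comp => //; apply: measurable_funM => //; exact: measurableT_comp.
- move=> x; rewrite ger0_norm ?expR_ge0//.
  case: (ger0P x) => _; first by rewrite lerDl expR_ge0.
  by rewrite mulrN mulNr lerDr expR_ge0.
- by apply: LiD; exact: Li_expR.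
Qed.

Lemma exprn_le_expR (n : nat) (x : R) : `|x| ^+ n <= n`!%:R * expR `|x|.
Proof.
have n0 : 0 < n`!%:R :> R by rewrite ltr0n fact_gt0.
case: n n0 => [|n] n0; first by rewrite expr0 fact0 mul1r; have := expR_ge1Dx `|x|; have := normr_ge0 x; lra.
have := @expR_ge1Dxn R `|x| n (normr_ge0 x).
rewrite -ler_pdivrMl// mulrC; lra.
Qed.

(** The exponential factor is the one in the remainder of [expR_taylor], which is integrated in
    [normal_stein]. *)
Lemma Li_normal_moment (n : nat) : Li N (fun x => `|x| ^+ n * expR `|x|).
Proof.
apply: (@Li_dom _ _ _ N _ (fun x => n`!%:R * expR (2 * `|x|))).
- apply: measurable_funM => //; first exact: measurable_funX.
  by apply: measurableT_comp => //; exact: measurable_funM.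
- move=> x; rewrite ger0_norm ?mulr_ge0 ?expR_ge0 ?exprn_ge0//.
  have -> : 2 * `|x| = `|x| + `|x| by ring.
  rewrite expRD mulrA ler_wpM2r ?expR_ge0//; exact: exprn_le_expR.
- by apply: LiZ; exact: Li_expR_abs.
Qed.

Lemma Li_normal_pow (n : nat) : Li N (fun x => `|x| ^+ n).
Proof.
apply: (@Li_dom _ _ _ N _ (fun x => `|x| ^+ n * expR `|x|)); last exact: Li_normal_moment.
- exact: measurable_funX.
- move=> x; rewrite ger0_norm ?exprn_ge0// ler_peMr ?exprn_ge0//.
  by rewrite -expR0 ler_expR.
Qed.

(** The nonnegative case applies to f + C and to the constant C; subtracting the two gives the
    formula for f. *)
Lemma normal_shift (k : R) (f : R -> R) (C : R) : measurable_fun [set: R] f ->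
  (forall x, `|f x| <= C) ->
  Ex N (fun x => f (x + k * s ^+ 2)) =
  expR (- (k ^+ 2 * s ^+ 2 / 2)) * Ex N (fun x => f x * expR (k * x)).
Proof.
move=> mf fC.
set h := k * s ^+ 2.
have me : measurable_fun [set: R] (fun x : R => expR (k * x)).
  by apply: measurableT_comp => //; exact: measurable_funM.
have main (g : R -> R) D : measurable_fun [set: R] g -> (forall x, 0 <= g x <= D) ->
  Ex N (fun x => g (x + h)) = expR (- (k ^+ 2 * s ^+ 2 / 2)) * Ex N (fun x => g x * expR (k * x)).
  move=> mg g0.
  rewrite -ExZ; last first.
    apply: (@Li_dom _ _ _ N _ (fun x => D * expR (k * x))).
    - exact: measurable_funM.
    - move=> x; have /andP[g1 g2] := g0 x.
      by rewrite normrM !ger0_norm ?expR_ge0// ler_wpM2r// expR_ge0.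
    - by apply: LiZ; exact: Li_expR.
  rewrite /Ex /Rintegral (@normal_shift_ge0 h g)//; last by move=> x; have /andP[] := g0 x.
  congr fine; apply: eq_integral => x _; congr EFin.
  rewrite mulrCA; congr (_ * _); rewrite -expRD; congr expR.
  by rewrite /h; field.
have C0 : 0 <= C by apply: le_trans (fC 0).
have mfC : measurable_fun [set: R] (fun x => f x + C) by exact: measurable_funD.
have H1 := main (fun x => f x + C) (C + C) mfC.
have H2 := main (fun _ => C) C (measurable_cst _).
have {}H1 := H1 (fun x => _); have {}H2 := H2 (fun x => _).
have I1 : Li N (fun x => f (x + h)).
  apply: (@Li_bnd _ _ _ N _ C) => //; apply: (measurableT_comp mf); exact: measurable_shift.
have I2 : Li N (fun x => f x * expR (k * x)).
  apply: (@Li_dom _ _ _ N _ (fun x => C * expR (k * x))).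
  - exact: measurable_funM.
  - by move=> x; rewrite normrM (ger0_norm (expR_ge0 _)) ler_wpM2r// expR_ge0.
  - by apply: LiZ; exact: Li_expR.
have I3 : Li N (fun x => C * expR (k * x)) by apply: LiZ; exact: Li_expR.
have {}H1 : Ex N (fun x => f (x + h) + C) =
  expR (- (k ^+ 2 * s ^+ 2 / 2)) * Ex N (fun x => f x * expR (k * x) + C * expR (k * x)).
  rewrite H1; last by move=> x; have := fC x; rewrite ler_norml => /andP[? ?]; apply/andP; split; lra.
  by congr (_ * _); apply: eq_Ex => x; rewrite mulrDl.
have {}H2 := H2 (introT andP (conj C0 (lexx C))).
rewrite (ExD I1 (Li_cst _ _)) (ExD I2 I3) mulrDr -H2 in H1.
by apply: (addIr (Ex N (fun _ => C))).
Qed.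

End normal.

(** * The characteristic function of the normal law *)

Section normal_charfun.
Context {R : realType}.
Variable s : R.
Hypothesis s0 : s != 0.
Notation N := (normal_prob 0 s : probability (measurableTypeR R) R).

Lemma Li_normal_mul (f : R -> R) (b : R) : measurable_fun [set: R] f -> (forall x, `|f x| <= 1) ->
  Li N (fun x => x * f (b * x)).
Proof.
move=> mf f1.
apply: (@Li_dom _ _ _ N _ (fun x => `|x| ^+ 1)).
- by apply: measurable_funM => //; exact: (measurableT_comp mf).
- by move=> x; rewrite normrM expr1 ler_piMr.
- exact: Li_normal_pow.
Qed.

(** First-order term in k of [normal_shift]. The functions f and g stand for cosine and sine up to
    order and sign, for which the addition theorem expands the shifted side exactly. *)
Lemma normal_stein (f g : R -> R) (b : R) :
  measurable_fun [set: R] f -> measurable_fun [set: R] g ->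
  (forall x, `|f x| <= 1) -> (forall x, `|g x| <= 1) ->
  (forall u v, f (u + v) = f u * cos v + g u * sin v) ->
  Ex N (fun x => x * f (b * x)) = s ^+ 2 * b * Ex N (fun x => g (b * x)).
Proof.
move=> mf mg f1 g1 fg.
have mfb : measurable_fun [set: R] (fun x => f (b * x)) by exact: (measurableT_comp mf).
have mgb : measurable_fun [set: R] (fun x => g (b * x)) by exact: (measurableT_comp mg).
have If : Li N (fun x => f (b * x)) by exact: (@Li_bnd _ _ _ N _ 1).
have Ig : Li N (fun x => g (b * x)) by exact: (@Li_bnd _ _ _ N _ 1).
have Ixf := Li_normal_mul b mf f1.
set M := Ex N (fun x => x * f (b * x)).
set G := Ex N (fun x => g (b * x)).
set F := Ex N (fun x => f (b * x)).
pose M2 := Ex N (fun x => `|x| ^+ 2 * expR `|x|).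
have M20 : 0 <= M2 by apply: Ex_ge0 => x; rewrite mulr_ge0 ?expR_ge0.
have F1 : `|F| <= 1.
  by rewrite -[leRHS](@Ex_cst _ _ _ N); apply: Ex_bnd => //; exact: Li_cst.
have G1 : `|G| <= 1.
  by rewrite -[leRHS](@Ex_cst _ _ _ N); apply: Ex_bnd => //; exact: Li_cst.
apply/esym/eqP; rewrite -subr_eq0; apply/eqP.
(* The constant collects the five remainder bounds [t1] to [t5] below. *)
apply: (@lin_le_sq_eq0 _ _ (2 * b ^+ 2 * s ^+ 4 + s ^+ 2 + s ^+ 2 * `|M| + M2)) => k /andP[k0 k1].
set h := k * s ^+ 2.
have H := @normal_shift _ s s0 k _ 1 mfb (fun x => f1 _).
have me : measurable_fun [set: R] (fun x : R => expR (k * x)) by exact: measurableT_comp.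
pose rem (x : R) := f (b * x) * (expR (k * x) - 1 - k * x).
have mrem : measurable_fun [set: R] rem.
  by apply: measurable_funM => //; apply: measurable_funB => //; exact: measurable_funB.
have remle x : `|rem x| <= k ^+ 2 * (`|x| ^+ 2 * expR `|x|).
  rewrite /rem normrM -[leRHS]mul1r ler_pM//.
  apply: (le_trans (expR_taylor _)).
  rewrite exprMn -mulrA -[x ^+ 2]real_normK ?num_real// ler_wpM2l ?sqr_ge0//.
  rewrite ler_wpM2l ?sqr_ge0// ler_expR normrM ler_piMl//.
  by rewrite gtr0_norm.
have Irem0 : Li N (fun x => k ^+ 2 * (`|x| ^+ 2 * expR `|x|)).
  by apply: LiZ; exact: Li_normal_moment.
have Irem : Li N rem by exact: (@Li_dom _ _ _ N rem _ mrem remle Irem0).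
have remB : `|Ex N rem| <= k ^+ 2 * M2.
  by rewrite -ExZ; [exact: Ex_bnd|exact: Li_normal_moment].
have EL : Ex N (fun x => f (b * (x + k * s ^+ 2))) = cos (b * h) * F + sin (b * h) * G.
  rewrite -!ExZ// -ExD; [|exact: LiZ|exact: LiZ].
  by apply: eq_Ex => x; rewrite mulrDr fg (mulrC (cos _)) (mulrC (sin _)).
have ER : Ex N (fun x => f (b * x) * expR (k * x)) = F + k * M + Ex N rem.
  rewrite -ExZ// -ExD//; last exact: LiZ.
  rewrite -ExD//; last by apply: LiD => //; exact: LiZ.
  by apply: eq_Ex => x; rewrite /rem; ring.
rewrite EL ER in H.
set e := expR (- (k ^+ 2 * s ^+ 2 / 2)) in H.
have e1 : `|e - 1| <= k ^+ 2 * s ^+ 2.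
  have := expR_ge1Dx (- (k ^+ 2 * s ^+ 2 / 2)); rewrite -/e => h1.
  have h3 : 0 <= k ^+ 2 * s ^+ 2 by rewrite mulr_ge0 ?sqr_ge0.
  have h2 : e <= 1 by rewrite /e expR_le1 oppr_le0 divr_ge0.
  rewrite ler0_norm; lra.
have e01 : 0 <= e <= 1.
  by rewrite expR_ge0 expR_le1 oppr_le0 divr_ge0// mulr_ge0 ?sqr_ge0.
rewrite -[X in _ * X](gtr0_norm k0) -normrM.
have -> : (s ^+ 2 * b * G - M) * k =
  - (sin (b * h) - b * h) * G + (e - 1) * F + (1 - cos (b * h)) * F + (e - 1) * k * M + e * Ex N rem.
  rewrite /h.
  have : sin (b * h) * G = e * (F + k * M + Ex N rem) - cos (b * h) * F by rewrite -H; ring.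
  rewrite -/h => HH.
  have -> : - (sin (b * h) - b * h) * G = b * h * G - sin (b * h) * G by ring.
  by rewrite HH /h; ring.
have [s1 _] := sin_sub_id (b * h).
have /andP[c1 c2] := one_sub_cos (b * h).
have hh : (b * h) ^+ 2 = b ^+ 2 * s ^+ 4 * k ^+ 2 by rewrite /h; ring.
rewrite hh in s1 c2.
have Q : 0 <= b ^+ 2 * s ^+ 4 * k ^+ 2 by rewrite -hh sqr_ge0.
have t1 : `|- (sin (b * h) - b * h) * G| <= b ^+ 2 * s ^+ 4 * k ^+ 2.
  by rewrite normrM normrN -[leRHS]mulr1 ler_pM.
have t2 : `|(e - 1) * F| <= k ^+ 2 * s ^+ 2 by rewrite normrM -[leRHS]mulr1 ler_pM.
have t3 : `|(1 - cos (b * h)) * F| <= b ^+ 2 * s ^+ 4 * k ^+ 2.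
  by rewrite normrM -[leRHS]mulr1 ler_pM// ger0_norm// (le_trans c2)//; lra.
have t4 : `|(e - 1) * k * M| <= k ^+ 2 * s ^+ 2 * `|M|.
  rewrite !normrM ler_wpM2r// -[leRHS]mulr1 ler_pM// gtr0_norm//.
have t5 : `|e * Ex N rem| <= k ^+ 2 * M2.
  case/andP: e01 => ? ?.
  by rewrite normrM -[leRHS]mul1r ler_pM// ger0_norm.
have -> : (2 * b ^+ 2 * s ^+ 4 + s ^+ 2 + s ^+ 2 * `|M| + M2) * k ^+ 2 =
  b ^+ 2 * s ^+ 4 * k ^+ 2 + k ^+ 2 * s ^+ 2 + b ^+ 2 * s ^+ 4 * k ^+ 2 + k ^+ 2 * s ^+ 2 * `|M| + k ^+ 2 * M2 by ring.
do 4! (apply: (le_trans (ler_normD _ _)); apply: lerD => //).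
Qed.

Let F0 (f : R -> R) (b : R) := Ex N (fun x => f (b * x)).

(** Stein's identity makes F(b) = E f(b X) a solution of F' = - s^2 b F, so F(b) exp (s^2 b^2 / 2)
    is constant. Here g is the derivative of f, and cosine and sine are treated together. *)
Lemma normal_charfun_aux (f g : R -> R) :
  measurable_fun [set: R] f -> measurable_fun [set: R] g ->
  (forall x, `|f x| <= 1) -> (forall x, `|g x| <= 1) ->
  (forall u v, g (u + v) = g u * cos v - f u * sin v) ->
  (forall u v, `|f (u + v) - f u - v * g u| <= 2 * v ^+ 2) ->
  forall b, F0 f b = f 0 * expR (- (s ^+ 2 * b ^+ 2 / 2)).
Proof.
move=> mf mg f1 g1 fg ft b.
have mfb a : measurable_fun [set: R] (fun x => f (a * x)) by exact: (measurableT_comp mf).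
have If a : Li N (fun x => f (a * x)).
  by apply: (@Li_bnd _ _ _ N _ 1 (mfb a)) => x; exact: f1.
have D a : is_derive a (1:R) (F0 f) (- (s ^+ 2 * a) * F0 f a).
  have -> : - (s ^+ 2 * a) * F0 f a = Ex N (fun x => x * g (a * x)).
    rewrite (@normal_stein g (fun u => - f u) a)//.
    - have -> : Ex N (fun x => - f (a * x)) = - 1 * F0 f a.
        by rewrite /F0 -ExZ//; apply: eq_Ex => x; rewrite mulN1r.
      by ring.
    - exact: measurableT_comp.
    - by move=> x; rewrite normrN.
    - by move=> u v; rewrite fg mulNr.
  apply: (@is_derive_sq _ _ _ _ (2 * Ex N (fun x => `|x| ^+ 2))) => h _.
  rewrite /F0 -ExZ; last exact: Li_normal_mul.
  rewrite -ExB// -ExB//; first last.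
  - by apply: LiZ; exact: Li_normal_mul.
  - exact: LiB.
  rewrite (mulrAC 2) -ExZ; last exact: Li_normal_pow.
  apply: Ex_bnd.
  - apply: (@Li_meas _ _ _ N); apply: LiB; first exact: LiB.
    by apply: LiZ; exact: Li_normal_mul.
  - by apply: LiZ; exact: Li_normal_pow.
  - move=> x; have := ft (a * x) (h * x).
    rewrite -mulrDl !exprMn real_normK ?num_real// => H.
    by rewrite (mulrA h) -(mulrA 2).
pose H (a : R) := F0 f a * expR (s ^+ 2 * a ^+ 2 / 2).
have HD a : is_derive a (1:R) H 0.
  have E1 : is_derive a (1:R) (fun a : R => s ^+ 2 * a ^+ 2 / 2) (s ^+ 2 * a).
    by apply: is_derive_eq; rewrite /GRing.scale /=; field.
  have E2 : is_derive a (1:R) (fun a : R => expR (s ^+ 2 * a ^+ 2 / 2)) (expR (s ^+ 2 * a ^+ 2 / 2) * (s ^+ 2 * a)).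
    exact: (@is_derive1_comp _ expR (fun a : R => s ^+ 2 * a ^+ 2 / 2)).
  have := @is_deriveM _ _ (F0 f) _ _ _ _ _ (D a) E2.
  move=> E3; apply: is_derive_eq; rewrite /GRing.scale /=; ring.
have HH := @is_derive_0_is_cst R H b 0 HD.
rewrite /H in HH.
have F00 : F0 f 0 = f 0.
  by rewrite /F0 -[RHS](@Ex_cst _ _ _ N); apply: eq_Ex => x; rewrite mul0r.
rewrite expr0n/= mulr0 mul0r expR0 mulr1 F00 in HH.
by rewrite -HH -mulrA -expRD subrr expR0 mulr1.
Qed.

Lemma measurable_sin : measurable_fun [set: R] (@sin R).
Proof. apply: continuous_measurable_fun; exact: continuous_sin. Qed.
Lemma measurable_cos : measurable_fun [set: R] (@cos R).
Proof. apply: continuous_measurable_fun; exact: continuous_cos. Qed.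

Lemma normal_cos b : Ex N (fun x => cos (b * x)) = expR (- (s ^+ 2 * b ^+ 2 / 2)).
Proof.
rewrite [LHS](@normal_charfun_aux cos (fun x => - sin x)) ?cos0 ?mul1r//.
- exact: measurable_cos.
- apply: measurableT_comp => //; exact: measurable_sin.
- exact: cos_max.
- by move=> x; rewrite normrN sin_max.
- by move=> u v; rewrite sinD; ring.
- by move=> u v; rewrite mulrN opprK; exact: cos_taylor.
Qed.

Lemma normal_sin b : Ex N (fun x => sin (b * x)) = 0.
Proof.
rewrite [LHS](@normal_charfun_aux sin cos) ?sin0 ?mul0r//.
- exact: measurable_sin.
- exact: measurable_cos.
- exact: sin_max.
- exact: cos_max.
- by move=> u v; rewrite cosD.
- by move=> u v; exact: sin_taylor.
Qed.

End normal_charfun.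

(** * Characteristic functions determine the law *)

(* Measurability along every measurable family replaces a sigma-algebra on [I -> R]. *)
Definition cmeas {I : finType} {R : realType} (f : (I -> R) -> R) : Prop :=
  forall d (T : measurableType d) (Y : I -> T -> R),
    (forall i, measurable_fun setT (Y i)) ->
    measurable_fun setT (fun w => f (fun i => Y i w)).

Definition dot {I : finType} {R : realType} (a y : I -> R) : R := \sum_i a i * y i.

(** * Rectangle probabilities determine the law *)

Section law.
Context {I : finType} {R : realType}.
Context {d} {T : measurableType d} {d'} {T' : measurableType d'}.
Variables (P : probability T R) (P' : probability T' R).
Variables (Y : I -> T -> R) (Y' : I -> T' -> R).
Hypothesis mY : forall i, measurable_fun setT (Y i).
Hypothesis mY' : forall i, measurable_fun setT (Y' i).

Let n := #|I|.
Notation V := (n.-tuple (measurableTypeR R)).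
Let tau (w : T) : V := [tuple Y (enum_val i) w | i < n].
Let tau' (w : T') : V := [tuple Y' (enum_val i) w | i < n].
Let rect (c : 'I_n -> R) : set V := [set t | forall i, tnth t i < c i].

Let mtau : measurable_fun setT tau.
Proof.
apply/measurable_fun_tnthP => i; rewrite /tau.
by apply: (eq_measurable_fun (Y (enum_val i))) => // w _; rewrite /= tnth_mktuple.
Qed.
Let mtau' : measurable_fun setT tau'.
Proof.
apply/measurable_fun_tnthP => i; rewrite /tau'.
by apply: (eq_measurable_fun (Y' (enum_val i))) => // w _; rewrite /= tnth_mktuple.
Qed.

Let Grect : set (set V) := [set A | exists c, A = rect c].

Let coor (i : 'I_n) (c : R) : <<s Grect >> [set t : V | tnth t i < c].
Proof.
rewrite (_ : [set t : V | _] = \bigcup_k rect (fun j => if j == i then c else k%:R)).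
  apply: sigma_algebra_bigcup => k; apply: sub_gen_smallest.
  by exists (fun j => if j == i then c else k%:R).
apply/seteqP; split => t /=; last first.
  by move=> [k _ /(_ i)]; rewrite eqxx.
move=> ti.
pose M := \sum_j `|tnth t j|.
exists (Num.truncn M).+1 => // j; case: ifPn => [/eqP ->//|_].
apply: (le_lt_trans (ler_norm _)).
apply: (@le_lt_trans _ _ M); last exact: truncnS_gt.
by rewrite /M (bigD1 j)//= lerDl sumr_ge0.
Qed.

(** By [coor] a half-space is a countable union of rectangles, so the coordinates are already
    measurable for the sigma-algebra generated by rectangles. *)
Let mV : measurable = <<s Grect >> :> set (set V).
Proof.
apply/seteqP; split; last first.
  apply: smallest_sub; first exact: sigma_algebra_measurable.
  move=> _ [c ->].
  rewrite (_ : rect c = \bigcap_(i in [set: 'I_n]) [set t | tnth t i < c i]).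
    apply: fin_bigcap_measurable => // i _.
    rewrite (_ : [set t | _] = setT `&` (@tnth _ (measurableTypeR R))^~ i @^-1` `]-oo, c i[%classic).
      by apply: measurable_tnth => //; exact: measurable_itv.
    by rewrite setTI; apply/seteqP; split => t /=; rewrite in_itv.
  by apply/seteqP; split => [t H i _|t H i]; [exact: H|exact: H].
pose W : measurableType _ := g_sigma_algebraType Grect.
apply: smallest_sub; first exact: smallest_sigma_algebra.
rewrite -bigcup_seq; move=> A [i /= _ [B mB <-]].
have : measurable_fun [set: W] (fun t : W => (tnth t i : measurableTypeR R)).
  apply: (measurability _ (RGenInftyO.measurableE R)) => _ [_ [x ->] <-].
  rewrite setTI; have := coor i x.
  by rewrite (_ : [set t | _] = (tnth (T:=measurableTypeR R))^~ i @^-1` `]-oo, x[%classic)//;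
    apply/seteqP; split => t /=; rewrite in_itv.
by move=> /(_ measurableT B mB).
Qed.

Hypothesis rectE : forall c : I -> R,
  P [set w | forall i, Y i w < c i] = P' [set w | forall i, Y' i w < c i].

(** Rectangles are stable under intersection and countably many of them cover the space, so finite
    measures that agree on them are equal. *)
Let push_eq (A : set V) : measurable A -> pushforward P tau A = pushforward P' tau' A.
Proof.
move=> mA.
apply: (@measure_unique _ R V Grect (fun k => rect (fun _ => k%:R)) mV) => //.
- move=> _ _ [c ->] [c' ->]; exists (fun i => Num.min (c i) (c' i)).
  apply/seteqP; split => t /=.
    by move=> [h1 h2] i; rewrite lt_min h1 h2.
  by move=> h; split => i; have := h i; rewrite lt_min => /andP[].
- by move=> i; exists (fun _ => i%:R).
- apply/seteqP; split => // t _.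
  pose M := \sum_j `|tnth t j|.
  exists (Num.truncn M).+1 => //= j.
  apply: (le_lt_trans (ler_norm _)).
  apply: (@le_lt_trans _ _ M); last exact: truncnS_gt.
  by rewrite /M (bigD1 j)//= lerDl sumr_ge0.
- move=> _ [c ->] /=; rewrite /pushforward.
  have := rectE (fun i => c (enum_rank i)).
  rewrite (_ : [set w | _] = tau @^-1` rect c); last first.
    apply/seteqP; split => w /= h i; last by have := h (enum_rank i); rewrite tnth_mktuple enum_rankK.
    by rewrite tnth_mktuple; have := h (enum_val i); rewrite enum_valK.
  rewrite (_ : [set w | _] = tau' @^-1` rect c)//.
    apply/seteqP; split => w /= h i; last by have := h (enum_rank i); rewrite tnth_mktuple enum_rankK.
    by rewrite tnth_mktuple; have := h (enum_val i); rewrite enum_valK.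
- move=> k /=; rewrite /pushforward.
  apply: (@le_lt_trans _ _ 1%E); last exact: ltry.
  apply: probability_le1.
  rewrite -[X in measurable X]setTI; apply: mtau => //.
  by rewrite mV; apply: sub_gen_smallest; exists (fun _ => k%:R).
Qed.

Let int_eq (g : V -> \bar R) : measurable_fun setT g -> (forall t, 0 <= g t)%E ->
  (\int[P]_w g (tau w) = \int[P']_w g (tau' w))%E.
Proof.
move=> mg g0.
have := @ge0_integral_pushforward _ _ T V R tau mtau P setT g measurableT mg (fun x _ => g0 x).
rewrite preimage_setT => <-.
have := @ge0_integral_pushforward _ _ T' V R tau' mtau' P' setT g measurableT mg (fun x _ => g0 x).
rewrite preimage_setT => <-.
by apply: eq_measure_integral => //; first [exact: mtau|exact: mtau'|by move=> *; exact: push_eq].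
Qed.

Lemma law_eq (f : (I -> R) -> R) : cmeas f ->
  Ex P (fun w => f (fun i => Y i w)) = Ex P' (fun w => f (fun i => Y' i w)) /\
  (Li P (fun w => f (fun i => Y i w)) -> Li P' (fun w => f (fun i => Y' i w))).
Proof.
move=> mf.
pose g (t : V) : R := f (fun i => tnth t (enum_rank i)).
have mg : measurable_fun [set: V] g.
  by apply: mf => i; exact: measurable_tnth.
have mfY := mf _ _ _ mY; have mfY' := mf _ _ _ mY'.
have gt w : g (tau w) = f (fun i => Y i w).
  by congr f; apply/funext => i; rewrite tnth_mktuple enum_rankK.
have gt' w : g (tau' w) = f (fun i => Y' i w).
  by congr f; apply/funext => i; rewrite tnth_mktuple enum_rankK.
have megf : measurable_fun [set: V] (EFin \o g) by exact/measurable_EFinP.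
split.
  rewrite /Ex /Rintegral; congr fine.
  under eq_integral do rewrite -gt.
  under [RHS]eq_integral do rewrite -gt'.
  rewrite integralE [RHS]integralE; congr (_ - _)%E.
    have := @int_eq ((EFin \o g)^\+%E) (measurable_funepos megf) (fun t => funepos_ge0 _ _).
    by move=> H; transitivity (\int[P]_w (EFin \o g)^\+%E (tau w))%E; [|rewrite H];
      apply: eq_integral => w _; rewrite !unlock.
  have := @int_eq ((EFin \o g)^\-%E) (measurable_funeneg megf) (fun t => funeneg_ge0 _ _).
  by move=> H; transitivity (\int[P]_w (EFin \o g)^\-%E (tau w))%E; [|rewrite H];
    apply: eq_integral => w _; rewrite !unlock.
move=> /integrableP[_ H]; apply/integrableP; split; first exact/measurable_EFinP.
move: H; have := @int_eq (fun t => `|(g t)%:E|)%E _ (fun t => abse_ge0 _).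
move=> /(_ (measurableT_comp (@abse_measurable _ _) megf)) => H.
under eq_integral do rewrite /= -gt.
under [X in _ -> (X < _)%E]eq_integral do rewrite /= -gt'.
by rewrite H.
Qed.

End law.

(** * Narrow normal laws approximate half-line indicators *)

Section tail.
Context {R : realType}.
Notation mu := (@lebesgue_measure R).

(** On A the density with standard deviation s is at most [k] times the density with standard
    deviation 2 s, and the latter has total mass 1. *)
Lemma normal_tail (x s r : R) (A : set R) : 0 < s -> 0 <= r -> measurable A ->
  (forall y, A y -> r <= `|y - x|) ->
  (normal_prob x s A <= (2 * expR (- (3 * r ^+ 2 / (8 * s ^+ 2))))%:E)%E.
Proof.
move=> s0 r0 mA Ar.
have s_neq0 : s != 0 by rewrite gt_eqF.
have s2_neq0 : 2 * s != 0 by rewrite mulf_neq0.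
set k := 2 * _.
have pk : normal_peak (2 * s) = normal_peak s / 2.
  rewrite /normal_peak.
  have -> : (2 * s) ^+ 2 * pi *+ 2 = 2 ^+ 2 * (s ^+ 2 * pi *+ 2) :> R by rewrite !mulr2n; ring.
  by rewrite sqrtrM ?sqr_ge0// sqrtr_sqr ger0_norm// invfM mulrC.
have le y : A y -> normal_pdf x s y <= k * normal_pdf x (2 * s) y.
  move=> Ay; rewrite !normal_pdfE//= pk /normal_fun /k.
  have -> : 2 * expR (- (3 * r ^+ 2 / (8 * s ^+ 2))) *
    (normal_peak s / 2 * expR (- (y - x) ^+ 2 / ((2 * s) ^+ 2 *+ 2))) =
    normal_peak s * (expR (- (3 * r ^+ 2 / (8 * s ^+ 2))) * expR (- (y - x) ^+ 2 / ((2 * s) ^+ 2 *+ 2))) by field.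
  rewrite ler_wpM2l ?normal_peak_ge0// -expRD ler_expR.
  have r2 : r ^+ 2 <= (y - x) ^+ 2.
    by rewrite -[X in _ <= X]real_normK ?num_real// ler_sqr ?nnegrE//; exact: Ar.
  have -> : - (3 * r ^+ 2 / (8 * s ^+ 2)) + - (y - x) ^+ 2 / ((2 * s) ^+ 2 *+ 2) =
    - (3 * r ^+ 2 + (y - x) ^+ 2) / (8 * s ^+ 2).
    rewrite mulr2n; field; rewrite s_neq0/=.
    have -> : (2 * s) ^+ 2 + (2 * s) ^+ 2 = 8 * s ^+ 2 by ring.
    by rewrite mulf_neq0// expf_neq0.
  have -> : - (y - x) ^+ 2 / (s ^+ 2 *+ 2) = - (4 * (y - x) ^+ 2) / (8 * s ^+ 2).
    rewrite mulr2n; field; rewrite s_neq0/=.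
    have -> : s ^+ 2 + s ^+ 2 = 2 * s ^+ 2 by ring.
    by rewrite mulf_neq0// expf_neq0.
  rewrite ler_pM2r ?invr_gt0 ?mulr_gt0 ?exprn_gt0//; lra.
have mp t : measurable_fun [set: R] (EFin \o normal_pdf x t).
  by apply/measurable_EFinP; exact: measurable_normal_pdf.
rewrite /normal_prob.
apply: (@le_trans _ _ (\int[mu]_(y in A) (k%:E * (normal_pdf x (2 * s) y)%:E))%E).
  apply: ge0_le_integral => //.
  - by move=> y _; rewrite lee_fin normal_pdf_ge0.
  - by apply: measurable_funTS; exact: (mp s).
  - apply: measurable_funTS; apply: emeasurable_funM; first exact: measurable_cst.
    exact: (mp (2 * s)).
rewrite ge0_integralZl//; first last.
- by rewrite lee_fin /k mulr_ge0// expR_ge0.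
- by move=> y _; rewrite lee_fin normal_pdf_ge0.
- by apply: measurable_funTS; exact: (mp (2 * s)).
rewrite -[leRHS]mule1 lee_wpmul2l//; first by rewrite lee_fin /k mulr_ge0// expR_ge0.
exact: (@probability_le1 _ _ _ (normal_prob x (2 * s))).
Qed.

Lemma expRN_le (u : R) : 0 < u -> expR (- u) <= u^-1.
Proof.
move=> u0; rewrite expRN lef_pV2 ?posrE ?expR_gt0//.
by have := expR_ge1Dx u; lra.
Qed.

Lemma le_dist (x y e : R) : y <= x - e \/ x + e <= y -> e <= `|y - x|.
Proof.
move=> h; have := ler_norm (x - y); have := ler_norm (y - x); rewrite (distrC x y).
by case: h => h; lra.
Qed.

(** The standard deviation (n+1)^-2 is small against the margin (n+1)^-1 left below c. Hence the
    mass tends to 1 when x < c and to 0 otherwise, also at x = c. The interval is bounded so that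
    the uniform law on it is available. *)
Lemma normal_cvg_lt (c x : R) :
  fine (normal_prob x (n.+1%:R ^- 2) `[c - n.+1%:R^-1 - n.+1%:R, c - n.+1%:R^-1]) @[n --> \oo]
  --> (((x < c)%R : nat)%:R : R).
Proof.
pose rate (n : nat) : R := 6 / n.+1%:R.
have rate0 : rate n @[n --> \oo] --> (0 : R).
  rewrite -[X in _ --> X](mulr0 6); apply: cvgM; first exact: cvg_cst.
  exact: cvg_harmonic.
have tl (n : nat) (A : set R) : measurable A -> (forall y, A y -> n.+1%:R^-1 <= `|y - x|) ->
  0 <= fine (normal_prob x (n.+1%:R ^- 2) A) <= rate n.
  move=> mA Ay; have n0 : 0 < n.+1%:R :> R by rewrite ltr0n.
  have s0 : 0 < (n.+1%:R ^- 2 : R) by rewrite invr_gt0 exprn_gt0.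
  have r0 : 0 <= (n.+1%:R^-1 : R) by rewrite invr_ge0.
  pose N : probability (measurableTypeR R) R := normal_prob x (n.+1%:R ^- 2).
  have NA : (N A <= _)%E := normal_tail s0 r0 mA Ay.
  rewrite -[normal_prob _ _ A]/(N A) fine_ge0//=.
  rewrite -lee_fin fineK; last exact: prob_fin.
  apply: (le_trans NA); rewrite lee_fin.
  have E : 3 * (n.+1%:R^-1) ^+ 2 / (8 * (n.+1%:R ^- 2) ^+ 2) = 3 * n.+1%:R ^+ 2 / 8 :> R.
    by field; rewrite gt_eqF.
  rewrite E.
  have n1 : 1 <= n.+1%:R :> R by rewrite ler1n.
  have u0 : 0 < 3 * n.+1%:R ^+ 2 / 8 :> R by rewrite divr_gt0// mulr_gt0// exprn_gt0.
  have := expRN_le u0; rewrite /rate => H.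
  apply: (@le_trans _ _ (2 * (3 * n.+1%:R ^+ 2 / 8)^-1)); first by rewrite ler_wpM2l.
  have -> : 2 * (3 * n.+1%:R ^+ 2 / 8)^-1 = (16 / 3 / n.+1%:R) / n.+1%:R :> R by field; rewrite gt_eqF.
  rewrite ler_wpM2r ?invr_ge0 ?(ltW n0)// ler_pdivrMr//; lra.
have [xc|cx] := ltP x c; last first.
  apply: (@squeeze_cvgr _ _ _ _ (fun _ => 0) rate); [|exact: cvg_cst|exact: rate0].
  apply: nearW => n; apply: tl => // y /=; rewrite in_itv/= => /andP[_ yc].
  by apply: le_dist; left; apply: (le_trans yc); rewrite lerD2r.
apply: (@squeeze_cvgr _ _ _ _ (fun n => 1 - rate n) (fun _ => 1)); [|rewrite -[X in _ --> X](subr0 1); apply: cvgB => //; exact: cvg_cst|exact: cvg_cst].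
near=> n.
have n0 : 0 < n.+1%:R :> R by rewrite ltr0n.
have n1 : n.+1%:R^-1 <= (c - x) / 2.
  by near: n; apply: (cvgr_le (0:R)); [exact: cvg_harmonic|rewrite divr_gt0// subr_gt0].
have n2 : c - x <= n.+1%:R.
  near: n; exists (Num.truncn (c - x)) => // k /= hk.
  by apply/ltW/(lt_le_trans (truncnS_gt _)); rewrite ler_nat.
pose N : probability (measurableTypeR R) R := normal_prob x (n.+1%:R ^- 2).
set I := `[_, _]%classic.
rewrite -[normal_prob _ _ I]/(N I).
have mI : measurable I by exact: measurable_itv.
have /andP[t1 t2] : 0 <= fine (N (~` I)) <= rate n.
  apply: tl; first exact: measurableC.
  move=> y; rewrite /I /= in_itv/= => /negP; rewrite negb_and -!ltNge => /orP[h|h].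
    apply: le_dist; left; apply/ltW/(lt_le_trans h).
    by rewrite addrAC lerD2r lerBlDr -lerBlDl.
  apply: le_dist; right; apply/ltW/(le_lt_trans _ h).
  clear -n1; move: (n.+1%:R^-1) n1 => e n1; lra.
have E := probability_setC N mI.
have fI : N I \is a fin_num by exact: prob_fin.
have {}E : fine (N (~` I)) = 1 - fine (N I) by rewrite [X in fine X]E fineB.
rewrite E in t1 t2; clear -t1 t2; move: (rate n) (fine (N I)) t1 t2 => u v t1 t2; apply/andP; split; lra.
Unshelve. all: by end_near. Qed.

End tail.

Section kernel.
Context {R : realType}.
Implicit Types a b s x y : R.
Notation N s := (normal_prob 0 s : probability (measurableTypeR R) R).

Definition bump s x y : R := expR (- (s ^- 2 * (x - y) ^+ 2 / 2)).

(** A Gaussian kernel is the Fourier transform of the normal law with inverse standard deviation. *)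
Lemma bump_cos s x y : s != 0 -> bump s x y = Ex (N s^-1) (fun b => cos (b * (x - y))).
Proof.
move=> s0; rewrite /bump.
rewrite -[LHS](_ : expR (- ((s^-1) ^+ 2 * (x - y) ^+ 2 / 2)) = _); last by rewrite exprVn.
rewrite -normal_cos ?invr_neq0//.
by apply: eq_Ex => z; rewrite mulrC.
Qed.

Lemma bump_ge0 s x y : 0 <= bump s x y. Proof. exact: expR_ge0. Qed.
Lemma bump_le1 s x y : bump s x y <= 1.
Proof. by rewrite expR_le1 oppr_le0 divr_ge0// mulr_ge0 ?sqr_ge0// invr_ge0 sqr_ge0. Qed.

Lemma measurable_bump s d (T : measurableType d) (f g : T -> R) :
  measurable_fun setT f -> measurable_fun setT g ->
  measurable_fun setT (fun w => bump s (f w) (g w)).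
Proof.
move=> mf mg; apply: measurableT_comp => //; apply: measurableT_comp => //.
apply: measurable_funM => //; apply: measurable_funM => //.
by apply: measurable_funX; apply: measurable_funB.
Qed.

(** The mass of an interval is written as a multiple of an expectation under the uniform law, so
    that Fubini for probability measures applies to it. *)
Lemma normal_prob_bump s a b (ab : a < b) x : 0 < s ->
  fine (normal_prob x s `[a, b]) =
  (b - a) * normal_peak s * Ex (uniform_prob ab : probability (measurableTypeR R) R) (fun y => bump s x y).
Proof.
move=> s0.
have mb : measurable_fun [set: R] (fun y => bump s x y).
  exact: measurable_bump.
rewrite -ExZ; last first.
  apply: (@Li_bnd _ _ _ _ _ 1) => // y; rewrite ger0_norm ?bump_ge0 ?bump_le1//.
rewrite /Ex /Rintegral integral_uniform//; first last.
- by move=> y; rewrite lee_fin mulr_ge0 ?bump_ge0// mulr_ge0 ?normal_peak_ge0// subr_ge0 ltW.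
- by apply/measurable_EFinP; exact: measurable_funM.
congr fine.
under eq_integral do rewrite -mulrA EFinM.
rewrite ge0_integralZl//; first last.
- by rewrite lee_fin subr_ge0 ltW.
- by move=> y _; rewrite lee_fin mulr_ge0 ?bump_ge0 ?normal_peak_ge0.
- by apply/measurable_EFinP; apply: measurable_funTS; exact: measurable_funM.
rewrite muleA -EFinM mulVf ?mul1e ?subr_eq0 ?gt_eqF//.
apply: eq_integral => y _; rewrite normal_pdfE ?gt_eqF//; congr EFin; congr (_ * _).
rewrite /normal_fun /bump; congr expR; rewrite mulr2n -sqrrN opprB.
by field; rewrite gt_eqF//= -mulr2n mulrn_eq0/= expf_eq0/= gt_eqF.
Qed.

End kernel.

(** * From cosines to indicators *)

Section step.
Context {R : realType} {d} {T : measurableType d}.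
Variables (P : probability T R) (U xi G : T -> R).
Hypotheses (mU : measurable_fun setT U) (mxi : measurable_fun setT xi) (mG : measurable_fun setT G).
Hypothesis (G1 : forall w, `|G w| <= 1).
Notation N s := (normal_prob 0 s : probability (measurableTypeR R) R).

Lemma mcos (f : T -> R) : measurable_fun setT f -> measurable_fun setT (fun w => cos (f w)).
Proof. move=> mf; apply: (measurableT_comp _ mf); exact: measurable_cos. Qed.

Let Gc (u : R) (k : T -> R) : measurable_fun setT k -> measurable_fun setT (fun w => G w * cos (U w + u) * k w).
Proof.
move=> mk; apply: measurable_funM => //; apply: measurable_funM => //.
by apply: mcos; exact: measurable_funD.
Qed.

Let Gc1 (u : R) (k : R) w : `|k| <= 1 -> `|G w * cos (U w + u) * k| <= 1.
Proof.
move=> k1; rewrite !normrM -[leRHS]mulr1 ler_pM// -[leRHS]mulr1 ler_pM//; exact: cos_max.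
Qed.

(** By [bump_cos] the kernel is a mixture of cosines in xi, and a product of two cosines is the
    average of two cosines. The integral is thus determined by those of G cos (U + t xi + v). *)
Lemma step_bump (s u y : R) : s != 0 ->
  Ex P (fun w => G w * cos (U w + u) * bump s (xi w) y) =
  Ex (N s^-1) (fun b => 2^-1 * (Ex P (fun w => G w * cos (U w + b * xi w + (u - b * y))) +
                                Ex P (fun w => G w * cos (U w + (- b) * xi w + (u + b * y))))).
Proof.
move=> s0.
pose F (z : T * R) := G z.1 * cos (U z.1 + u) * cos (z.2 * (xi z.1 - y)).
have mF : measurable_fun setT F.
  apply: measurable_funM.
    apply: measurable_funM; first exact: (measurableT_comp mG).
    apply: (measurableT_comp (@measurable_cos R)); apply: measurable_funD => //.
    exact: (measurableT_comp mU).
  apply: (measurableT_comp (@measurable_cos R)); apply: measurable_funM => //.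
  by apply: measurable_funB => //; exact: (measurableT_comp mxi).
have IF : Li (PP P (N s^-1)) F.
  by apply: (@Li_bnd _ _ _ _ _ 1) => // z; apply: Gc1; exact: cos_max.
have I1 (v b : R) : Li P (fun w => G w * cos (U w + b * xi w + v)).
  apply: (@Li_bnd _ _ _ _ _ 1).
    apply: measurable_funM => //; apply: mcos; apply: measurable_funD => //.
    by apply: measurable_funD => //; exact: measurable_funM.
  by move=> w; rewrite normrM -[leRHS]mulr1 ler_pM// cos_max.
transitivity (Ex (PP P (N s^-1)) F); last first.
  rewrite Ex_fubini2//; apply: eq_Ex => b.
  rewrite -ExD// -ExZ; last exact: LiD.
  apply: eq_Ex => w; rewrite /F /=.
  have -> : U w + b * xi w + (u - b * y) = (U w + u) + b * (xi w - y) by ring.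
  have -> : U w + - b * xi w + (u + b * y) = (U w + u) - b * (xi w - y) by ring.
  by move: (U w + u) (b * (xi w - y)) => A B; rewrite cosD cosB; field.
rewrite Ex_fubini1//; apply: eq_Ex => w; rewrite bump_cos// -ExZ//.
apply: (@Li_bnd _ _ _ _ _ 1); last by move=> b; exact: cos_max.
by apply: (measurableT_comp (@measurable_cos R)); exact: measurable_funM.
Qed.

Lemma step_unif (s u a b : R) (ab : a < b) : 0 < s ->
  Ex P (fun w => G w * cos (U w + u) * fine (normal_prob (xi w) s `[a, b])) =
  (b - a) * normal_peak s * Ex (uniform_prob ab : probability (measurableTypeR R) R)
    (fun y => Ex P (fun w => G w * cos (U w + u) * bump s (xi w) y)).
Proof.
move=> s0.
pose F (z : T * R) := G z.1 * cos (U z.1 + u) * bump s (xi z.1) z.2.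
have mF : measurable_fun setT F.
  apply: measurable_funM.
    apply: measurable_funM; first exact: (measurableT_comp mG).
    apply: (measurableT_comp (@measurable_cos R)); apply: measurable_funD => //.
    exact: (measurableT_comp mU).
  by apply: measurable_bump => //; exact: (measurableT_comp mxi).
have b1 x y : `|bump s x y| <= 1 by rewrite ger0_norm ?bump_ge0 ?bump_le1.
pose Un : probability (measurableTypeR R) R := uniform_prob ab.
have IF : Li (PP P Un) F by apply: (@Li_bnd _ _ _ _ _ 1) => // z; exact: Gc1.
rewrite -(Ex_fubini2 IF) (Ex_fubini1 IF).
rewrite -ExZ; last first.
  apply: (@Li_bnd _ _ _ _ _ 1); first exact: (@Ex_meas1 _ _ _ _ _ P Un F IF).
  move=> w; rewrite -[leRHS](Ex_cst Un); apply: Ex_bnd; last by move=> y; exact: Gc1.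
    by rewrite /F /=; apply: measurable_funM => //; exact: measurable_bump.
  exact: Li_cst.
apply: eq_Ex => w; rewrite (normal_prob_bump ab)//.
rewrite mulrCA; congr (_ * _); rewrite -ExZ//.
by apply: (@Li_bnd _ _ _ _ _ 1) => //; exact: measurable_bump.
Qed.

Lemma step_lim (u c : R) :
  Ex P (fun w => G w * cos (U w + u) * fine (normal_prob (xi w) (n.+1%:R ^- 2)
     `[c - n.+1%:R^-1 - n.+1%:R, c - n.+1%:R^-1])) @[n --> \oo] -->
  Ex P (fun w => G w * cos (U w + u) * ((xi w < c)%R : nat)%:R).
Proof.
apply: (@Ex_dct _ _ _ P _ _ 1).
- move=> n; apply: Gc.
  have ab : c - n.+1%:R^-1 - n.+1%:R < c - n.+1%:R^-1 by rewrite gtrBl ltr0n.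
  have s0 : 0 < (n.+1%:R ^- 2 : R) by rewrite invr_gt0 exprn_gt0// ltr0n.
  under eq_fun do rewrite (normal_prob_bump ab _ s0).
  apply: measurable_funM => //.
  pose Un : probability (measurableTypeR R) R := uniform_prob ab.
  apply: (@Ex_meas1 _ T _ (measurableTypeR R) R P Un (fun z => bump (n.+1%:R ^- 2) (xi z.1) z.2)).
  apply: (@Li_bnd _ _ _ _ _ 1); last by move=> z; rewrite ger0_norm ?bump_ge0 ?bump_le1.
  by apply: measurable_bump => //; exact: (measurableT_comp mxi).
- apply: Gc.
  rewrite (_ : (fun w => _) = \1_(xi @^-1` `]-oo, c[%classic)); last first.
    by apply/funext => w; rewrite indicE; congr (nat_of_bool _)%:R; apply/idP/idP; rewrite inE/= in_itv.
  apply: measurable_indic; rewrite -[X in measurable X]setTI; apply: mxi => //.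
- move=> n w; apply: Gc1.
  pose N : probability (measurableTypeR R) R := normal_prob (xi w) (n.+1%:R ^- 2).
  rewrite -[normal_prob _ _ _]/(N _) ger0_norm ?fine_ge0//.
  rewrite -lee_fin fineK; first exact: probability_le1.
  exact: prob_fin.
- apply: aeW => w; apply: cvgM; first exact: cvg_cst.
  exact: normal_cvg_lt.
Qed.

End step.

Section step2.
Context {R : realType} {d} {T : measurableType d} {d'} {T' : measurableType d'}.
Variables (P : probability T R) (U xi G : T -> R) (P' : probability T' R) (U' xi' G' : T' -> R).
Hypotheses (mU : measurable_fun setT U) (mxi : measurable_fun setT xi) (mG : measurable_fun setT G).
Hypotheses (mU' : measurable_fun setT U') (mxi' : measurable_fun setT xi') (mG' : measurable_fun setT G').
Hypothesis (G1 : forall w, `|G w| <= 1).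
Hypothesis (G1' : forall w, `|G' w| <= 1).
Hypothesis H : forall t u : R, Ex P (fun w => G w * cos (U w + t * xi w + u)) =
   Ex P' (fun w => G' w * cos (U' w + t * xi' w + u)).

(** An indicator xi < c is a limit of interval masses of narrow normal laws, these are averages of
    kernels, and kernels are mixtures of cosines; each passage preserves the equality of the two
    expectations. *)
Lemma step_lt (u c : R) :
  Ex P (fun w => G w * cos (U w + u) * ((xi w < c)%R : nat)%:R) =
  Ex P' (fun w => G' w * cos (U' w + u) * ((xi' w < c)%R : nat)%:R).
Proof.
have L := @step_lim _ _ _ P _ _ _ mU mxi mG G1 u c.
have L' := @step_lim _ _ _ P' _ _ _ mU' mxi' mG' G1' u c.
rewrite -(cvg_lim _ L)// -(cvg_lim _ L')//; congr (lim (_ @ \oo)).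
apply/funext => n.
have ab : c - n.+1%:R^-1 - n.+1%:R < c - n.+1%:R^-1 by rewrite gtrBl ltr0n.
have s0 : 0 < (n.+1%:R ^- 2 : R) by rewrite invr_gt0 exprn_gt0// ltr0n.
rewrite (@step_unif _ _ _ P _ _ _ mU mxi mG G1 _ _ _ _ ab)// (@step_unif _ _ _ P' _ _ _ mU' mxi' mG' G1' _ _ _ _ ab)//; congr (_ * _).
apply: eq_Ex => y.
rewrite (@step_bump _ _ _ P _ _ _ mU mxi mG G1) ?gt_eqF// (@step_bump _ _ _ P' _ _ _ mU' mxi' mG' G1') ?gt_eqF//; apply: eq_Ex => b.
by rewrite !H.
Qed.

End step2.

Lemma cmeas_dot (I : finType) (R : realType) (a : I -> R) : cmeas (fun y => dot a y).
Proof. by move=> d T Y mY; apply: measurable_sum => i; exact: measurable_funM. Qed.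

Section charfun_uniq.
Context {I : finType} {R : realType}.
Context {d} {T : measurableType d} {d'} {T' : measurableType d'}.
Variables (P : probability T R) (P' : probability T' R).
Variables (Y : I -> T -> R) (Y' : I -> T' -> R).
Hypothesis mY : forall i, measurable_fun setT (Y i).
Hypothesis mY' : forall i, measurable_fun setT (Y' i).
Hypothesis Hcos : forall a : I -> R, Ex P (fun w => cos (dot a (fun i => Y i w))) =
   Ex P' (fun w => cos (dot a (fun i => Y' i w))).
Hypothesis Hsin : forall a : I -> R, Ex P (fun w => sin (dot a (fun i => Y i w))) =
   Ex P' (fun w => sin (dot a (fun i => Y' i w))).

Let ind (c : I -> R) (J : seq I) (y : I -> R) : R := \prod_(i <- J) ((y i < c i)%R : nat)%:R.

Let ind1 c J y : `|ind c J y| <= 1.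
Proof.
rewrite /ind; elim: J => [|i J IH]; first by rewrite big_nil normr1.
by rewrite big_cons normrM -[leRHS]mul1r ler_pM//; case: (_ < _); rewrite ?normr1 ?normr0.
Qed.

Lemma mlt d0 (T0 : measurableType d0) (f : T0 -> R) (c : R) : measurable_fun setT f ->
  measurable_fun setT (fun w => ((f w < c)%R : nat)%:R : R).
Proof.
move=> mf.
rewrite (_ : (fun w => _) = \1_(f @^-1` `]-oo, c[%classic)); last first.
  by apply/funext => w; rewrite indicE; congr (nat_of_bool _)%:R; apply/idP/idP; rewrite inE/= in_itv.
by apply: measurable_indic; rewrite -[X in measurable X]setTI; apply: mf.
Qed.

Let mind c J : cmeas (ind c J).
Proof.
move=> d0 T0 Z mZ; rewrite /ind; elim: J => [|i J IH].
  by under eq_fun do rewrite big_nil; exact: measurable_cst.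
under eq_fun do rewrite big_cons.
by apply: measurable_funM => //; exact: mlt.
Qed.

(** Induction on [J]: [step_lt] adds the next indicator, and its hypothesis, a cosine with an
    additional multiple of one coordinate, is the induction hypothesis for another vector a. The
    phase u lets one identity cover both cosine and sine. *)
Let key (c : I -> R) (J : seq I) : forall (a : I -> R) (u : R),
  Ex P (fun w => ind c J (fun i => Y i w) * cos (dot a (fun i => Y i w) + u)) =
  Ex P' (fun w => ind c J (fun i => Y' i w) * cos (dot a (fun i => Y' i w) + u)).
Proof.
elim: J => [|i J IH] a u.
  have E d0 (T0 : measurableType d0) (P0 : probability T0 R) (Z : I -> T0 -> R) :
     (forall i, measurable_fun setT (Z i)) ->
     Ex P0 (fun w => ind c [::] (fun i => Z i w) * cos (dot a (fun i => Z i w) + u)) =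
     cos u * Ex P0 (fun w => cos (dot a (fun i => Z i w))) - sin u * Ex P0 (fun w => sin (dot a (fun i => Z i w))).
    move=> mZ; have md := cmeas_dot a mZ.
    have I1 : Li P0 (fun w => cos (dot a (fun i => Z i w))).
      apply: (@Li_bnd _ _ _ _ _ 1); first exact: (measurableT_comp (@measurable_cos R)).
      by move=> w; exact: cos_max.
    have I2 : Li P0 (fun w => sin (dot a (fun i => Z i w))).
      apply: (@Li_bnd _ _ _ _ _ 1); first exact: (measurableT_comp (@measurable_sin R)).
      by move=> w; exact: sin_max.
    rewrite -!ExZ// -ExB; [|exact: LiZ|exact: LiZ].
    by apply: eq_Ex => w; rewrite /ind big_nil mul1r cosD; ring.
  by rewrite !E// Hcos Hsin.
have md := cmeas_dot a mY; have md' := cmeas_dot a mY'.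
have := @step_lt R _ _ _ _ P (fun w => dot a (fun i => Y i w)) (Y i) (fun w => ind c J (fun i => Y i w))
  P' (fun w => dot a (fun i => Y' i w)) (Y' i) (fun w => ind c J (fun i => Y' i w))
  md (mY i) (mind c J mY) md' (mY' i) (mind c J mY') (fun w => ind1 _ _ _) (fun w => ind1 _ _ _).
move=> /(_ _ u (c i)) H.
have : forall t u : R,
  Ex P (fun w => ind c J (fun i => Y i w) * cos (dot a (fun i => Y i w) + t * Y i w + u)) =
  Ex P' (fun w => ind c J (fun i => Y' i w) * cos (dot a (fun i => Y' i w) + t * Y' i w + u)).
  move=> t v.
  have E (y : I -> R) : dot a y + t * y i = dot (fun j => a j + (j == i)%:R * t) y.
    rewrite /dot; under [RHS]eq_bigr do rewrite mulrDl.
    rewrite big_split /=; congr (_ + _).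
    rewrite (bigD1 i)//= eqxx mul1r big1 ?addr0// => j /negbTE ->.
    by rewrite !mul0r.
  under eq_Ex do rewrite E.
  under [RHS]eq_Ex do rewrite E.
  exact: IH.
move/H => {}H.
have E d0 (T0 : measurableType d0) (P0 : probability T0 R) (Z : I -> T0 -> R) :
  Ex P0 (fun w => ind c (i :: J) (fun i => Z i w) * cos (dot a (fun i => Z i w) + u)) =
  Ex P0 (fun w => ind c J (fun i => Z i w) * cos (dot a (fun i => Z i w) + u) * ((Z i w < c i)%R : nat)%:R).
  by apply: eq_Ex => w; rewrite /ind big_cons; ring.
by rewrite !E.
Qed.

(** For a = 0, u = 0 and all coordinates in the list, [key] compares probabilities of rectangles, to
    which [law_eq] applies. *)
Lemma law_uniq (f : (I -> R) -> R) : cmeas f ->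
  Ex P (fun w => f (fun i => Y i w)) = Ex P' (fun w => f (fun i => Y' i w)) /\
  (Li P (fun w => f (fun i => Y i w)) -> Li P' (fun w => f (fun i => Y' i w))).
Proof.
apply: law_eq => // c.
have E d0 (T0 : measurableType d0) (P0 : probability T0 R) (Z : I -> T0 -> R) :
  (forall i, measurable_fun setT (Z i)) ->
  P0 [set w | forall i, Z i w < c i] = (Ex P0 (fun w => ind c (enum I) (fun i => Z i w) * cos (dot (fun _ => 0) (fun i => Z i w) + 0)))%:E.
  move=> mZ.
  have mA : measurable [set w | forall i, Z i w < c i].
    rewrite (_ : [set w | _] = \bigcap_(i in [set: I]) (Z i @^-1` `]-oo, c i[%classic)).
      apply: fin_bigcap_measurable => // i _.
      by rewrite -[X in measurable X]setTI; apply: mZ.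
    by apply/seteqP; split => [w H i _|w H i] /=; [rewrite in_itv/= H|have := H i Logic.I; rewrite /= in_itv].
  rewrite -[LHS]fineK; last exact: prob_fin.
  rewrite -Ex_indic//; congr EFin; apply: eq_Ex => w.
  rewrite [dot _ _]big1; last by move=> i _; rewrite mul0r.
  rewrite addr0 cos0 mulr1 indicE /ind.
  have [H|H] := pselect (forall i, Z i w < c i).
    by rewrite mem_set//= big1// => i _; rewrite H.
  rewrite memNset//=.
  have [i ni] : exists i, ~ (Z i w < c i) by apply/existsNP.
  by rewrite big_enum/= (bigD1 i)//= (negbTE (introN idP ni)) mul0r.
rewrite !E//; congr EFin; exact: key.
Qed.

End charfun_uniq.

(** * Gaussian vectors *)

Section Lall.
Context {R : realType} {d} {T : measurableType d} (P : probability T R).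
Implicit Types f g : T -> R.

(** Absolute moments of every order are required because this class, unlike the integrable
    functions, is closed under products. *)
Definition Lall f : Prop := measurable_fun setT f /\ forall n : nat, Li P (fun w => `|f w| ^+ n).

Lemma Lall_dom f g : measurable_fun setT f -> (forall w, `|f w| <= `|g w|) -> Lall g -> Lall f.
Proof.
move=> mf fg [mg Ig]; split => // n; apply: (Li_dom _ _ (Ig n)).
  by apply: measurable_funX; exact: measurableT_comp.
by move=> w; rewrite normrX normr_id lerXn2r// nnegrE.
Qed.

Lemma Lall_cst c : Lall (fun _ => c).
Proof. by split => // n; exact: Li_cst. Qed.

Lemma Lall_abs f : Lall f -> Lall (fun w => `|f w|).
Proof. by move=> [mf If]; apply: (Lall_dom (g := f)) => //; [exact: measurableT_comp|move=> w; rewrite normr_id]. Qed.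

Lemma LallD f g : Lall f -> Lall g -> Lall (fun w => f w + g w).
Proof.
move=> [mf If] [mg Ig]; split; first exact: measurable_funD.
move=> n; apply: (@Li_dom _ _ _ P _ (fun w => 2 ^+ n * (`|f w| ^+ n + `|g w| ^+ n))).
- by apply: measurable_funX; apply: measurableT_comp => //; exact: measurable_funD.
- move=> w; rewrite normrX normr_id.
  have h : `|f w + g w| <= 2 * Num.max `|f w| `|g w|.
    apply: (le_trans (ler_normD _ _)); have -> : 2 * Num.max `|f w| `|g w| = Num.max `|f w| `|g w| + Num.max `|f w| `|g w| by ring.
    by apply: lerD; rewrite le_max lexx ?orbT.
  apply: (@le_trans _ _ ((2 * Num.max `|f w| `|g w|) ^+ n)).
    by rewrite lerXn2r ?nnegrE// mulr_ge0// le_max normr_ge0.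
  rewrite exprMn ler_wpM2l ?exprn_ge0//.
  by rewrite /Num.max; case: ifP => _; [rewrite lerDr|rewrite lerDl]; rewrite exprn_ge0.
- by apply: LiZ; exact: LiD.
Qed.

Lemma LallM f g : Lall f -> Lall g -> Lall (fun w => f w * g w).
Proof.
move=> [mf If] [mg Ig]; split; first exact: measurable_funM.
move=> n; apply: (@Li_dom _ _ _ P _ (fun w => `|f w| ^+ (n + n) + `|g w| ^+ (n + n))).
- by apply: measurable_funX; apply: measurableT_comp => //; exact: measurable_funM.
- move=> w; rewrite normrX normr_id normrM exprMn !exprD.
  set a := `|f w| ^+ n; set b := `|g w| ^+ n.
  have := sqr_ge0 (a - b); have a0 : 0 <= a by rewrite exprn_ge0.
  have b0 : 0 <= b by rewrite exprn_ge0.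
  nra.
- exact: LiD.
Qed.

Lemma LallZ c f : Lall f -> Lall (fun w => c * f w).
Proof. by move=> If; apply: LallM => //; exact: Lall_cst. Qed.

Lemma LallX f n : Lall f -> Lall (fun w => f w ^+ n).
Proof.
move=> If; elim: n => [|n IH].
  by under eq_fun do rewrite expr0; exact: Lall_cst.
by under eq_fun do rewrite exprS; exact: LallM.
Qed.

Lemma Lall_sum I (s : seq I) (F : I -> T -> R) : (forall i, Lall (F i)) ->
  Lall (fun w => \sum_(i <- s) F i w).
Proof.
move=> H; elim: s => [|i s IH].
  by rewrite (_ : (fun w => _) = fun _ => 0); [exact: Lall_cst|apply/funext => w; rewrite big_nil].
rewrite (_ : (fun w => _) = fun w => F i w + \sum_(i <- s) F i w); first exact: LallD.
by apply/funext => w; rewrite big_cons.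
Qed.

Lemma Lall_Li f : Lall f -> Li P f.
Proof. by move=> [mf /(_ 1%N) If]; apply: (Li_dom mf _ If) => w; rewrite expr1. Qed.

End Lall.

Definition quad {I : finType} {R : realType} (K : I -> I -> R) (a b : I -> R) : R :=
  \sum_i \sum_j a i * K i j * b j.

(* Centred Gaussian families are specified by their characteristic function, which
   passes to linear images, independent pairs and limits. *)
Definition gauss {I : finType} {R : realType} {d} {T : measurableType d}
  (P : probability T R) (Y : I -> T -> R) (K : I -> I -> R) : Prop :=
  (forall i, measurable_fun setT (Y i)) /\
  forall a : I -> R, Ex P (fun w => cos (dot a (fun i => Y i w))) = expR (- (quad K a a / 2))
     /\ Ex P (fun w => sin (dot a (fun i => Y i w))) = 0.

Lemma dot_lin {I J : finType} {R : realType} (B : J -> I -> R) a y :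
  dot a (fun j => dot (B j) y) = dot (fun i => \sum_j a j * B j i) y.
Proof.
rewrite /dot; under eq_bigr do rewrite mulr_sumr.
rewrite exchange_big /=; apply: eq_bigr => i _.
by rewrite mulr_suml; apply: eq_bigr => j _; rewrite mulrA.
Qed.

Lemma quad_sumr {I J : finType} {R : realType} (K : I -> I -> R) (a : J -> R) (B : J -> I -> R) b :
  quad K b (fun i => \sum_j a j * B j i) = \sum_j a j * quad K b (B j).
Proof.
rewrite /quad; under [RHS]eq_bigr do rewrite mulr_sumr.
rewrite [RHS]exchange_big /=; apply: eq_bigr => i _.
under [RHS]eq_bigr do rewrite mulr_sumr.
rewrite [RHS]exchange_big /=; apply: eq_bigr => k _.
by rewrite mulr_sumr; apply: eq_bigr => j _; ring.
Qed.

Lemma quad_suml {I J : finType} {R : realType} (K : I -> I -> R) (a : J -> R) (B : J -> I -> R) b :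
  quad K (fun i => \sum_j a j * B j i) b = \sum_j a j * quad K (B j) b.
Proof.
rewrite /quad; under [RHS]eq_bigr do rewrite mulr_sumr.
rewrite [RHS]exchange_big /=; apply: eq_bigr => i _.
under [RHS]eq_bigr do rewrite mulr_sumr.
rewrite [RHS]exchange_big /=; apply: eq_bigr => k _.
by rewrite -mulrA mulr_suml; apply: eq_bigr => j _; ring.
Qed.

Lemma quad_lin {I J : finType} {R : realType} (K : I -> I -> R) (B : J -> I -> R) (a b : J -> R) :
  quad K (fun i => \sum_j a j * B j i) (fun i => \sum_j b j * B j i) =
  quad (fun j k => quad K (B j) (B k)) a b.
Proof.
rewrite quad_suml /quad; apply: eq_bigr => j _.
rewrite -/(quad K (B j) _) quad_sumr mulr_sumr; apply: eq_bigr => k _.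
by rewrite /quad; ring.
Qed.

Lemma measurable_dot {I : finType} {R : realType} d (T : measurableType d) (Y : I -> T -> R) a :
  (forall i, measurable_fun setT (Y i)) -> measurable_fun setT (fun w => dot a (fun i => Y i w)).
Proof. exact: cmeas_dot. Qed.

Section gauss_basic.
Context {I : finType} {R : realType} {d} {T : measurableType d}.
Variables (P : probability T R) (Y : I -> T -> R) (K : I -> I -> R).
Hypothesis GY : gauss P Y K.

Lemma gauss_meas i : measurable_fun setT (Y i). Proof. by case: GY. Qed.

Lemma gauss_lin (J : finType) (B : J -> I -> R) :
  gauss P (fun j w => dot (B j) (fun i => Y i w)) (fun j k => quad K (B j) (B k)).
Proof.
case: GY => mY H; split; first by move=> j; exact: measurable_dot.
move=> a; have [H1 H2] := H (fun i => \sum_j a j * B j i).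
by rewrite -quad_lin; split; [rewrite -H1|rewrite -H2]; apply: eq_Ex => w; rewrite dot_lin.
Qed.

Lemma gauss_law d' (T' : measurableType d') (P' : probability T' R) (Y' : I -> T' -> R) :
  gauss P' Y' K -> forall f : (I -> R) -> R, cmeas f ->
  Ex P (fun w => f (fun i => Y i w)) = Ex P' (fun w => f (fun i => Y' i w)) /\
  (Li P (fun w => f (fun i => Y i w)) -> Li P' (fun w => f (fun i => Y' i w))).
Proof.
case: GY => mY H [mY' H'] f mf; apply: law_uniq => // a.
  by have [-> _] := H a; have [-> _] := H' a.
by have [_ ->] := H a; have [_ ->] := H' a.
Qed.

(** Positivity is not part of [gauss]; it is forced by the characteristic function being at most
    1. *)
Lemma quad_ge0 a : 0 <= quad K a a.
Proof.
case: GY => mY H; have [E _] := H a.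
have : Ex P (fun w => cos (dot a (fun i => Y i w))) <= Ex P (fun _ => 1).
  apply: Ex_le.
  - apply: (@Li_bnd _ _ _ P _ 1); last by move=> w; exact: cos_max.
    by apply: (measurableT_comp (@measurable_cos R)); exact: measurable_dot.
  - exact: Li_cst.
  - by move=> w; exact: cos_le1.
by rewrite E Ex_cst expR_le1; lra.
Qed.

End gauss_basic.

Lemma cmeas1 {R : realType} (h : R -> R) : measurable_fun setT h ->
  cmeas (fun y : unit -> R => h (y tt)).
Proof. by move=> mh d T Y mY; exact: (measurableT_comp mh (mY tt)). Qed.

Section gauss1.
Context {R : realType}.
Notation N s := (normal_prob 0 s : probability (measurableTypeR R) R).

Lemma sum_unit (F : unit -> R) : \sum_i F i = F tt.
Proof. by rewrite (bigD1 tt)//= big1 ?addr0// => -[]. Qed.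

Lemma gauss_normal s : s != 0 -> gauss (N s) (fun (_ : unit) (x : R) => x) (fun _ _ => s ^+ 2).
Proof.
move=> s0; split; first by move=> _; exact: measurable_id.
move=> a; rewrite /dot /quad; split.
  under eq_Ex do rewrite sum_unit.
  by rewrite normal_cos// !sum_unit; congr expR; ring.
by under eq_Ex do rewrite sum_unit; rewrite normal_sin.
Qed.

Lemma gauss_zero d (T : measurableType d) (P : probability T R) :
  gauss P (fun (_ : unit) _ => 0) (fun _ _ => 0).
Proof.
split => // a; rewrite /dot /quad !sum_unit mulr0 mul0r mul0r oppr0 expR0; split.
  by rewrite cos0 Ex_cst.
by rewrite sin0 Ex_cst.
Qed.

(** Integrability depends on the law only, so it is transferred from an explicit normal variable, or
    from the constant 0 when the variance vanishes. *)
Lemma gauss1_pow d (T : measurableType d) (P : probability T R) (Y : unit -> T -> R) K n :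
  gauss P Y K -> Li P (fun w => `|Y tt w| ^+ n).
Proof.
move=> G; have := quad_ge0 G (fun _ => 1).
rewrite /quad !sum_unit mul1r mulr1 => K0.
have mh : cmeas (fun y : unit -> R => `|y tt| ^+ n).
  by apply: (cmeas1 (h := fun x => `|x| ^+ n)); exact: measurable_funX.
have EK : K = fun _ _ => K tt tt by apply/funext => -[]; apply/funext => -[].
have [K00|K1] := eqVneq (K tt tt) 0.
  have G0 := gauss_zero P.
  rewrite EK K00 in G.
  have [_] := gauss_law G0 G mh; apply.
  exact: Li_cst.
have s0 : Num.sqrt (K tt tt) != 0 by rewrite sqrtr_eq0 -ltNge lt_def K1.
have G0 := gauss_normal s0; rewrite sqr_sqrtr// -EK in G0.
have [_] := gauss_law G0 G mh; apply; exact: Li_normal_pow.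
Qed.

End gauss1.

Section gauss_moments.
Context {I : finType} {R : realType} {d} {T : measurableType d}.
Variables (P : probability T R) (Y : I -> T -> R) (K : I -> I -> R).
Hypothesis GY : gauss P Y K.

Lemma Lall_gauss_dot a : Lall P (fun w => dot a (fun i => Y i w)).
Proof.
split; first by apply: measurable_dot => i; exact: (gauss_meas GY).
move=> n; have := gauss_lin GY (fun (_ : unit) => a) => G.
exact: (gauss1_pow n G).
Qed.

Lemma Lall_gauss i : Lall P (Y i).
Proof.
have := Lall_gauss_dot (fun j => (j == i)%:R).
congr (Lall P _); apply/funext => w; rewrite /dot (bigD1 i)//= eqxx mul1r big1 ?addr0//.
by move=> j /negbTE ->; rewrite mul0r.
Qed.

(** The mean of sin (k X) vanishes for all k, and sin (k X) differs from k X by at most k^2 X^2. *)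
Lemma Ex_gauss_dot a : Ex P (fun w => dot a (fun i => Y i w)) = 0.
Proof.
set X := fun w => _; have LX := Lall_gauss_dot a.
have [mX IX] := LX.
apply: (@lin_le_sq_eq0 _ _ (Ex P (fun w => `|X w| ^+ 2))) => k /andP[k0 k1].
have [_ H] := GY; have [_ S] := H (fun i => k * a i).
have E w : dot (fun i => k * a i) (fun i => Y i w) = k * X w.
  by rewrite /X /dot mulr_sumr; apply: eq_bigr => i _; rewrite mulrA.
rewrite (eq_Ex P (fun w => congr1 sin (E w))) in S.
have Is : Li P (fun w => sin (k * X w)).
  apply: (@Li_bnd _ _ _ P _ 1); last by move=> w; exact: sin_max.
  by apply: (measurableT_comp (@measurable_sin R)); exact: measurable_funM.
rewrite -[X in _ * X](gtr0_norm k0) -normrM (mulrC _ k) -ExZ; last exact: Lall_Li.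
rewrite -[X in `|X|]subr0 -S -ExB//; last by apply: LiZ; exact: Lall_Li.
rewrite (mulrC (Ex P _)) -ExZ; last exact: IX.
apply: Ex_bnd; last first.
- move=> w; rewrite distrC.
  have [h _] := sin_sub_id (k * X w); apply: (le_trans h).
  by rewrite exprMn real_normK ?num_real.
- by apply: LiZ; exact: IX.
- by apply: measurable_funB; [exact: measurable_funM|exact: Li_meas Is].
Qed.

(** Comparison of the terms of order k^2 in E cos (k X) = exp (- k^2 q / 2); after division by k the
    error is still of order k^2. *)
Lemma Ex_gauss_dot2 a : Ex P (fun w => dot a (fun i => Y i w) ^+ 2) = quad K a a.
Proof.
set X := fun w => dot a (fun i => Y i w); have LX := Lall_gauss_dot a.
have [mX IX] := LX.
have IX2 : Li P (fun w => X w ^+ 2) by exact: (Lall_Li (LallX 2 LX)).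
have q0 := quad_ge0 GY a; set q := quad K a a in q0 *.
apply/eqP; rewrite -subr_eq0; apply/eqP.
set M := Ex P (fun w => `|X w| ^+ 3).
apply: (@lin_le_sq_eq0 _ _ (2 * M + q ^+ 2 * expR q)) => k /andP[k0 k1].
have [_ H] := GY; have [S _] := H (fun i => k * a i).
have E w : dot (fun i => k * a i) (fun i => Y i w) = k * X w.
  by rewrite /X /dot mulr_sumr; apply: eq_bigr => i _; rewrite mulrA.
rewrite (eq_Ex P (fun w => congr1 cos (E w))) in S.
have Eq : quad K (fun i => k * a i) (fun i => k * a i) = k ^+ 2 * q.
  rewrite /q /quad mulr_sumr; apply: eq_bigr => i _; rewrite mulr_sumr; apply: eq_bigr => j _; ring.
rewrite Eq in S.
have Ic : Li P (fun w => cos (k * X w)).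
  apply: (@Li_bnd _ _ _ P _ 1); last by move=> w; exact: cos_max.
  by apply: (measurableT_comp (@measurable_cos R)); exact: measurable_funM.
have B : `|1 - expR (- (k ^+ 2 * q / 2)) - k ^+ 2 / 2 * Ex P (fun w => X w ^+ 2)| <= k ^+ 3 * M.
  rewrite -S -[X in X - _ - _](Ex_cst P) -ExB//; last exact: Li_cst.
  rewrite -ExZ// -ExB//; first last.
  - exact: LiZ.
  - by apply: LiB => //; exact: Li_cst.
  rewrite -ExZ; last exact: IX.
  apply: Ex_bnd; last first.
  - move=> w; have := cos_taylor3 (k * X w).
    by rewrite normrM (gtr0_norm k0) !exprMn mulrAC.
  - by apply: LiZ; exact: IX.
  - apply: measurable_funB; last by apply: measurable_funM => //; exact: measurable_funX.
    by apply: measurable_funB => //; exact: Li_meas Ic.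
set u := - (k ^+ 2 * q / 2) in B.
have k21 : k ^+ 2 <= 1 by rewrite expr_le1// ltW.
have uq : `|u| <= q.
  rewrite /u normrN ger0_norm; last by rewrite divr_ge0// mulr_ge0// sqr_ge0.
  have := sqr_ge0 k; nra.
have B2 : `|expR u - 1 - u| <= k ^+ 4 * (q ^+ 2 / 4) * expR q.
  apply: (le_trans (expR_taylor u)).
  have -> : u ^+ 2 = k ^+ 4 * (q ^+ 2 / 4) by rewrite /u; field.
  apply: ler_wpM2l; last by rewrite ler_expR.
  by apply: mulr_ge0; [exact: exprn_ge0 (ltW k0)|rewrite divr_ge0 ?sqr_ge0].
set e := expR u in B B2; set X2 := Ex P _ in B *.
have -> : `|X2 - q| * k = 2 / k * `|k ^+ 2 / 2 * (X2 - q)|.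
  rewrite [X in _ = _ * X]normrM ger0_norm ?divr_ge0 ?sqr_ge0//; field; by rewrite gt_eqF.
have -> : k ^+ 2 / 2 * (X2 - q) = - (1 - e - k ^+ 2 / 2 * X2) - (e - 1 - u).
  by rewrite /u; ring.
have k2 : 0 < 2 / k by rewrite divr_gt0.
rewrite -ler_pdivlMl//.
apply: (le_trans (ler_normB _ _)); rewrite normrN.
apply: (le_trans (lerD B B2)).
have -> : (2 / k)^-1 * ((2 * M + q ^+ 2 * expR q) * k ^+ 2) = k ^+ 3 * M + k ^+ 3 * (q ^+ 2 * expR q / 2).
  by field; rewrite gt_eqF.
rewrite lerD2l.
have -> : k ^+ 4 * (q ^+ 2 / 4) * expR q = k ^+ 3 * (k * (q ^+ 2 * expR q / 4)) by ring.
apply: ler_wpM2l; first by rewrite exprn_ge0// ltW.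
have : 0 <= q ^+ 2 * expR q by rewrite mulr_ge0 ?sqr_ge0 ?expR_ge0.
nra.
Qed.

Lemma Ex_gauss i : Ex P (Y i) = 0.
Proof.
rewrite -(Ex_gauss_dot (fun j => (j == i)%:R)); apply: eq_Ex => w.
rewrite /dot (bigD1 i)//= eqxx mul1r big1 ?addr0//.
by move=> j /negbTE ->; rewrite mul0r.
Qed.

End gauss_moments.

(** * Gaussian integration by parts *)

Definition pairf {I J : finType} {R : realType} {T T' : Type} (Y : I -> T -> R) (Z : J -> T' -> R)
  (s : I + J) (z : T * T') : R := match s with inl i => Y i z.1 | inr j => Z j z.2 end.

Definition blk {I J : finType} {R : realType} (K : I -> I -> R) (L : J -> J -> R) (s t : I + J) : R :=
  match s, t with inl i, inl j => K i j | inr i, inr j => L i j | _, _ => 0 end.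

Lemma dot_sum {I J : finType} {R : realType} (a y : I + J -> R) :
  dot a y = dot (fun i => a (inl i)) (fun i => y (inl i)) + dot (fun j => a (inr j)) (fun j => y (inr j)).
Proof. by rewrite /dot big_sumType. Qed.

Lemma quad_blk {I J : finType} {R : realType} (K : I -> I -> R) (L : J -> J -> R) a b :
  quad (blk K L) a b = quad K (fun i => a (inl i)) (fun i => b (inl i)) + quad L (fun j => a (inr j)) (fun j => b (inr j)).
Proof.
rewrite /quad big_sumType/=; congr (_ + _); apply: eq_bigr => i _; rewrite big_sumType/=.
  by rewrite [X in _ + X]big1 ?addr0// => j _; rewrite mulr0 mul0r.
by rewrite [X in X + _]big1 ?add0r// => j _; rewrite mulr0 mul0r.
Qed.

Section prodcs.
Context {R : realType} {d} {T : measurableType d} {d'} {T' : measurableType d'}.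
Variables (P : probability T R) (P' : probability T' R) (A : T -> R) (B : T' -> R).
Hypotheses (mA : measurable_fun setT A) (mB : measurable_fun setT B).

Lemma Li_cos d0 (T0 : measurableType d0) (P0 : probability T0 R) f : measurable_fun setT f -> Li P0 (fun w => cos (f w)).
Proof.
move=> mf; apply: (@Li_bnd _ _ _ _ _ 1); last by move=> w; exact: cos_max.
exact: (measurableT_comp (@measurable_cos R)).
Qed.
Lemma Li_sin d0 (T0 : measurableType d0) (P0 : probability T0 R) f : measurable_fun setT f -> Li P0 (fun w => sin (f w)).
Proof.
move=> mf; apply: (@Li_bnd _ _ _ _ _ 1); last by move=> w; exact: sin_max.
exact: (measurableT_comp (@measurable_sin R)).
Qed.

Lemma Ex_cosD : Ex (PP P P') (fun z => cos (A z.1 + B z.2)) =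
  Ex P (fun w => cos (A w)) * Ex P' (fun w => cos (B w)) - Ex P (fun w => sin (A w)) * Ex P' (fun w => sin (B w)).
Proof.
rewrite -!Ex_prod; [|exact: Li_sin..|exact: Li_cos|exact: Li_cos].
rewrite -ExB; last first.
- by apply: (@Li_prod _ _ _ _ _ P P' (fun w => sin (A w)) (fun w => sin (B w))); exact: Li_sin.
- by apply: (@Li_prod _ _ _ _ _ P P' (fun w => cos (A w)) (fun w => cos (B w))); exact: Li_cos.
by apply: eq_Ex => z; rewrite cosD.
Qed.

Lemma Ex_sinD : Ex (PP P P') (fun z => sin (A z.1 + B z.2)) =
  Ex P (fun w => sin (A w)) * Ex P' (fun w => cos (B w)) + Ex P (fun w => cos (A w)) * Ex P' (fun w => sin (B w)).
Proof.
rewrite -!Ex_prod; [|exact: Li_cos|exact: Li_sin|exact: Li_sin|exact: Li_cos].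
rewrite -ExD; last first.
- by apply: (@Li_prod _ _ _ _ _ P P' (fun w => cos (A w)) (fun w => sin (B w))); [exact: Li_cos|exact: Li_sin].
- by apply: (@Li_prod _ _ _ _ _ P P' (fun w => sin (A w)) (fun w => cos (B w))); [exact: Li_sin|exact: Li_cos].
by apply: eq_Ex => z; rewrite sinD.
Qed.

End prodcs.

Section gauss_prod.
Context {I J : finType} {R : realType} {d} {T : measurableType d} {d'} {T' : measurableType d'}.
Variables (P : probability T R) (P' : probability T' R).
Variables (Y : I -> T -> R) (K : I -> I -> R) (Z : J -> T' -> R) (L : J -> J -> R).
Hypotheses (GY : gauss P Y K) (GZ : gauss P' Z L).

Lemma gauss_pair : gauss (PP P P') (pairf Y Z) (blk K L).
Proof.
have mY := gauss_meas GY; have mZ := gauss_meas GZ.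
split.
  by move=> [i|j] /=; [exact: (measurableT_comp (mY i))|exact: (measurableT_comp (mZ j))].
move=> a; rewrite quad_blk.
have mA := measurable_dot (fun i => a (inl i)) mY.
have mB := measurable_dot (fun j => a (inr j)) mZ.
have [c1 s1] := (proj2 GY) (fun i => a (inl i)).
have [c2 s2] := (proj2 GZ) (fun j => a (inr j)).
split.
  transitivity (Ex (PP P P') (fun z => cos (dot (fun i => a (inl i)) (fun i => Y i z.1) + dot (fun j => a (inr j)) (fun j => Z j z.2)))).
    by apply: eq_Ex => z; rewrite dot_sum.
  rewrite (Ex_cosD P P' mA mB) c1 c2 s1 s2 mul0r subr0 -expRD; congr expR; ring.
transitivity (Ex (PP P P') (fun z => sin (dot (fun i => a (inl i)) (fun i => Y i z.1) + dot (fun j => a (inr j)) (fun j => Z j z.2)))).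
  by apply: eq_Ex => z; rewrite dot_sum.
by rewrite (Ex_sinD P P' mA mB) s1 s2 mul0r mulr0 addr0.
Qed.

End gauss_prod.

Lemma quad_comb {I : finType} {R : realType} (K : I -> I -> R) (a b : I -> R) (u v u' v' : R) :
  quad K (fun i => u * a i + v * b i) (fun i => u' * a i + v' * b i) =
  u * u' * quad K a a + u * v' * quad K a b + v * u' * quad K b a + v * v' * quad K b b.
Proof.
rewrite /quad !mulr_sumr -!big_split/=; apply: eq_bigr => i _.
rewrite !mulr_sumr -!big_split/=; apply: eq_bigr => j _; ring.
Qed.

Lemma dot_comb {I : finType} {R : realType} (a b y : I -> R) (u v : R) :
  dot (fun i => u * a i + v * b i) y = u * dot a y + v * dot b y.
Proof. rewrite /dot !mulr_sumr -big_split/=; apply: eq_bigr => i _; ring. Qed.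

Section gauss_rot.
Context {I : finType} {R : realType} {d} {T : measurableType d}.
Variables (P : probability T R) (Y : I -> T -> R) (K : I -> I -> R).
Hypotheses (GY : gauss P Y K).
Variables c s : R.
Hypothesis cs : c ^+ 2 + s ^+ 2 = 1.

Definition rotf (t : I + I) (z : T * T) : R :=
  match t with inl i => c * Y i z.1 + s * Y i z.2 | inr i => - s * Y i z.1 + c * Y i z.2 end.

(** Two independent copies keep their joint law under a rotation mixing them; this invariance is the
    source of [ibp]. *)
Lemma gauss_rot : gauss (PP P P) rotf (blk K K).
Proof.
have mY := gauss_meas GY.
split.
  by move=> [i|j] /=; apply: measurable_funD; apply: measurable_funM => //; exact: (measurableT_comp (mY _)).
move=> a; rewrite quad_blk.
pose a1 i := a (inl i); pose a2 i := a (inr i).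
pose b1 i := c * a1 i + (- s) * a2 i; pose b2 i := s * a1 i + c * a2 i.
have E z : dot a (fun t => rotf t z) = dot b1 (fun i => Y i z.1) + dot b2 (fun i => Y i z.2).
  rewrite dot_sum /dot -!big_split/=; apply: eq_bigr => i _.
  by rewrite /b1 /b2 /a1 /a2 /=; ring.
have Q : quad K (fun i => a (inl i)) (fun i => a (inl i)) + quad K (fun i => a (inr i)) (fun i => a (inr i)) = quad K b1 b1 + quad K b2 b2.
  rewrite !quad_comb -[LHS]mul1r -cs /a1 /a2; ring.
have mA := measurable_dot b1 mY; have mB := measurable_dot b2 mY.
have [c1 s1] := (proj2 GY) b1; have [c2 s2] := (proj2 GY) b2.
rewrite Q; split.
  rewrite (eq_Ex _ (fun z => congr1 cos (E z))).
  by rewrite (Ex_cosD P P mA mB) c1 c2 s1 s2 mul0r subr0 -expRD; congr expR; ring.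
rewrite (eq_Ex _ (fun z => congr1 sin (E z))).
by rewrite (Ex_sinD P P mA mB) s1 s2 mul0r mulr0 addr0.
Qed.

End gauss_rot.

(** * Test functions of polynomial growth *)

Section N1.
Context {I : finType} {R : realType}.
Implicit Types x h : I -> R.
Definition L1 x : R := \sum_i `|x i|.
Definition N1 x : R := 1 + L1 x.
Lemma L1_ge0 x : 0 <= L1 x. Proof. exact: sumr_ge0. Qed.
Lemma N1_ge1 x : 1 <= N1 x. Proof. by rewrite lerDl L1_ge0. Qed.
Lemma N1_gt0 x : 0 < N1 x. Proof. exact: lt_le_trans (N1_ge1 x). Qed.
Lemma N1_ge0 x : 0 <= N1 x. Proof. exact: ltW (N1_gt0 x). Qed.
Lemma le_L1 x i : `|x i| <= L1 x.
Proof. by rewrite /L1 (bigD1 i)//= lerDl sumr_ge0. Qed.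
Lemma L1_le_N1 x : L1 x <= N1 x. Proof. by rewrite lerDr. Qed.
Lemma le_N1 x i : `|x i| <= N1 x. Proof. exact: le_trans (le_L1 x i) (L1_le_N1 x). Qed.
Lemma L1D x h : L1 (fun i => x i + h i) <= L1 x + L1 h.
Proof. by rewrite /L1 -big_split/=; apply: ler_sum => i _; exact: ler_normD. Qed.
Lemma N1D x h : N1 (fun i => x i + h i) <= N1 x * N1 h.
Proof.
have := L1D x h; have := L1_ge0 x; have := L1_ge0 h; rewrite /N1; move: (L1 _) (L1 x) (L1 h) => a b c; nra.
Qed.

(* [df] is the gradient of [f]; all bounds, including the one on the second-order
   remainder, are polynomial. *)
Definition TP (f : (I -> R) -> R) (df : I -> (I -> R) -> R) : Prop :=
  [/\ cmeas f, (forall i, cmeas (df i)) &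
   exists (C : R) (n : nat), 0 <= C /\ forall x, [/\ `|f x| <= C * N1 x ^+ n,
     (forall i, `|df i x| <= C * N1 x ^+ n) &
     forall h, `|f (fun i => x i + h i) - f x - \sum_i df i x * h i| <= C * (N1 x * N1 h) ^+ n * L1 h ^+ 2]].

End N1.

Section ibp.
Context {I : finType} {R : realType} {d} {T : measurableType d}.
Variables (P : probability T R) (Y : I -> T -> R) (K : I -> I -> R).
Hypotheses (GY : gauss P Y K).
Hypothesis symK : forall i j, K i j = K j i.

Lemma Lall_N1 : Lall P (fun w => N1 (fun i => Y i w)).
Proof.
apply: LallD; first exact: Lall_cst.
by apply: Lall_sum => i; apply: Lall_abs; exact: (Lall_gauss GY).
Qed.

Lemma Lall_poly (f : T -> R) C n : measurable_fun setT f -> (forall w, `|f w| <= C * N1 (fun i => Y i w) ^+ n) -> Lall P f.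
Proof.
move=> mf fC; apply: (@Lall_dom _ _ _ _ _ (fun w => C * N1 (fun i => Y i w) ^+ n)) => //.
  by move=> w; exact: le_trans (fC w) (ler_norm _).
by apply: LallZ; apply: LallX; exact: Lall_N1.
Qed.

Lemma Ex_gauss2 i j : Ex P (fun w => Y i w * Y j w) = K i j.
Proof.
have dE (k : I) (y : I -> R) : dot (fun l => (l == k)%:R) y = y k.
  by rewrite /dot (bigD1 k)//= eqxx mul1r big1 ?addr0// => l /negbTE ->; rewrite mul0r.
have qE k l : quad K (fun i => (i == k)%:R) (fun i => (i == l)%:R) = K k l.
  rewrite /quad (bigD1 k)//= [X in _ + X]big1 ?addr0; last first.
    by move=> m /negbTE ->; apply: big1 => ? _; rewrite !mul0r.
  rewrite (bigD1 l)//= !eqxx mul1r mulr1 big1 ?addr0//.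
  by move=> m /negbTE ->; rewrite mulr0.
have LY k : Lall P (Y k) by exact: (Lall_gauss GY).
have I2 k l : Li P (fun w => Y k w * Y l w) by exact: (Lall_Li (LallM (LY k) (LY l))).
have Ed k : Ex P (fun w => Y k w * Y k w) = K k k.
  by rewrite -qE -(Ex_gauss_dot2 GY); apply: eq_Ex => w; rewrite dE expr2.
have := Ex_gauss_dot2 GY (fun k => 1 * (k == i)%:R + 1 * (k == j)%:R).
rewrite quad_comb !qE (symK j i).
rewrite (_ : (fun w => _) = fun w => Y i w * Y i w + (2 * (Y i w * Y j w) + Y j w * Y j w)); last first.
  by apply/funext => w; rewrite dot_comb !dE; ring.
rewrite !ExD//; [|exact: LiZ|by apply: LiD => //; exact: LiZ].
rewrite ExZ// !Ed; lra.
Qed.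

Lemma Lall_TP f df : TP f df -> Lall P (fun w => f (fun i => Y i w)) /\ forall i, Lall P (fun w => df i (fun i => Y i w)).
Proof.
have mY := gauss_meas GY.
move=> [mf mdf [C [n [C0 H]]]]; split; [|move=> i]; apply: (@Lall_poly _ C n).
- exact: mf.
- by move=> w; have [] := H (fun i => Y i w).
- exact: mdf.
- by move=> w; have [_ + _] := H (fun i => Y i w); apply.
Qed.

(** For an independent copy Y' the mean of f(Y) Y'_i0 is 0, and it stays 0 after rotating the pair
    by an angle with sine s. The term of first order in s is the difference of the two sides. *)
Lemma ibp f df i0 : TP f df ->
  Ex P (fun w => Y i0 w * f (fun i => Y i w)) = \sum_j K i0 j * Ex P (fun w => df j (fun i => Y i w)).
Proof.
move=> Hf; have mY := gauss_meas GY; have [Lf Ldf] := Lall_TP Hf.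
have [mf mdf [C [n [C0 H]]]] := Hf.
have LY k : Lall P (Y k) by exact: (Lall_gauss GY).
have GG := gauss_pair GY GY.
pose Wf (z : T * T) := N1 (fun i => Y i z.1) * N1 (fun i => Y i z.2).
have mfst (g : T -> R) : measurable_fun setT g -> measurable_fun setT (fun z : T * T => g z.1) by move=> mg; exact: (measurableT_comp mg).
have msnd (g : T -> R) : measurable_fun setT g -> measurable_fun setT (fun z : T * T => g z.2) by move=> mg; exact: (measurableT_comp mg).
have Lfst (g : T -> R) : Lall P g -> Lall (PP P P) (fun z => g z.1).
  by move=> [mg Ig]; split; [exact: mfst|move=> k; exact: (Li_fst P (Ig k))].
have Lsnd (g : T -> R) : Lall P g -> Lall (PP P P) (fun z => g z.2).
  by move=> [mg Ig]; split; [exact: msnd|move=> k; exact: (Li_snd P (Ig k))].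
have LW : Lall (PP P P) Wf by apply: LallM; [exact: (Lfst _ Lall_N1)|exact: (Lsnd _ Lall_N1)].
(* [H0] dominates the remainder divided by s^2: the first summand bounds the Taylor error of f, the
   sum bounds the higher-order products in the gradient term. *)
pose H0 z := C * (3 * Wf z ^+ 2) ^+ n * (8 * Wf z ^+ 3) + \sum_(j : I) C * Wf z ^+ n * (4 * Wf z ^+ 2).
have LH0 : Lall (PP P P) H0.
  apply: LallD.
    apply: LallM; last by apply: LallZ; exact: LallX.
    by apply: LallZ; apply: LallX; apply: LallZ; exact: LallX.
  apply: Lall_sum => j; apply: LallM; last by apply: LallZ; exact: LallX.
  by apply: LallZ; exact: LallX.
apply/eqP; rewrite -subr_eq0; apply/eqP.
apply: (@lin_le_sq_eq0 _ _ (Ex (PP P P) H0)) => s /andP[s0 s1].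
pose c := Num.sqrt (1 - s ^+ 2).
have s21 : s ^+ 2 <= 1 by rewrite expr_le1// ltW.
have cs : c ^+ 2 + s ^+ 2 = 1 by rewrite sqr_sqrtr ?subr_ge0// subrK.
have c0 : 0 <= c by rewrite sqrtr_ge0.
have c1 : c <= 1 by have := sqr_ge0 s; nra.
have c2 : 1 - c <= s ^+ 2 by nra.
have GR := gauss_rot GY cs.
pose Phi (y : I + I -> R) := f (fun i => y (inl i)) * y (inr i0).
have mPhi : cmeas Phi by move=> ? ? Z mZ; apply: measurable_funM => //; exact: mf.
have LPhi : Lall (PP P P) (fun z => Phi (fun t => pairf Y Y t z)).
  by apply: LallM; [exact: (Lfst _ Lf)|exact: (Lsnd _ (LY i0))].
have [E1 I1] := gauss_law GG GR mPhi.
have {}I1 := I1 (Lall_Li LPhi).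
have E2 : Ex (PP P P) (fun z => Phi (fun t => pairf Y Y t z)) = 0.
  rewrite /Phi /=.
  by rewrite (@Ex_prod _ _ _ _ _ P P (fun w => f (fun i => Y i w)) (Y i0)) ?(Ex_gauss GY) ?mulr0//; exact: Lall_Li.
rewrite E2 in E1.
set R1 := fun z => Phi _ in E1 I1.
pose A1 (z : T * T) := f (fun i => Y i z.1) * Y i0 z.2.
pose A2 (z : T * T) := f (fun i => Y i z.1) * Y i0 z.1.
pose A3 (j : I) (z : T * T) := df j (fun i => Y i z.1) * (Y j z.2 * Y i0 z.2).
have LA1 : Lall (PP P P) A1 by [].
have LA2 : Lall (PP P P) A2 by exact: (Lfst (fun w => f (fun i => Y i w) * Y i0 w) (LallM Lf (LY i0))).
have LA3 j : Lall (PP P P) (A3 j) by apply: LallM; [exact: (Lfst _ (Ldf j))|exact: (Lsnd (fun w => Y j w * Y i0 w) (LallM (LY j) (LY i0)))].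
pose B z := c * A1 z - s * A2 z + s * \sum_j A3 j z.
have IB : Li (PP P P) B.
  apply: Lall_Li; apply: LallD; last by apply: LallZ; exact: Lall_sum.
  by apply: LallD; [exact: LallZ|under eq_fun do rewrite -mulNr; exact: LallZ].
have EB : Ex (PP P P) B = - s * (Ex P (fun w => Y i0 w * f (fun i => Y i w)) - \sum_j K i0 j * Ex P (fun w => df j (fun i => Y i w))).
  rewrite ExD; last 2 first.
    by apply: LiB; apply: LiZ; exact: Lall_Li.
    by apply: LiZ; apply: Li_sum => j; exact: Lall_Li.
  rewrite ExB; last 2 first.
    by apply: LiZ; exact: Lall_Li.
    by apply: LiZ; exact: Lall_Li.
  rewrite !ExZ; last 3 first.
    by apply: Li_sum => j; exact: Lall_Li.
    exact: Lall_Li.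
    exact: Lall_Li.
  have -> : Ex (PP P P) A1 = 0 by exact: E2.
  have -> : Ex (PP P P) A2 = Ex P (fun w => Y i0 w * f (fun i => Y i w)).
    rewrite /A2 Ex_fubini1; last exact: Lall_Li.
    by apply: eq_Ex => w; rewrite /A2 /= Ex_cst mulrC.
  rewrite Ex_sum; last by move=> j; exact: Lall_Li.
  have EA3 j : Ex (PP P P) (A3 j) = K i0 j * Ex P (fun w => df j (fun i => Y i w)).
    rewrite (@Ex_prod _ _ _ _ _ P P (fun w => df j (fun i => Y i w)) (fun w => Y j w * Y i0 w)).
    - by rewrite Ex_gauss2 symK mulrC.
    - exact: Lall_Li.
    - by apply: Lall_Li; exact: LallM.
  by under eq_bigr do rewrite EA3; ring.
rewrite -[X in _ * X](gtr0_norm s0) -normrM.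
have -> : `|(Ex P (fun w => Y i0 w * f (fun i => Y i w)) - \sum_j K i0 j * Ex P (fun w => df j (fun i => Y i w))) * s| = `|Ex (PP P P) (fun z => R1 z - B z)|.
  rewrite ExB// -E1 EB sub0r normrN mulNr normrN; congr `|_|; ring.
rewrite mulrC -ExZ; last exact: Lall_Li.
apply: Ex_bnd.
- exact: (Li_meas (LiB I1 IB)).
- by apply: LiZ; exact: Lall_Li.
move=> z.
pose y i := Y i z.1; pose y' i := Y i z.2; pose h i := s * y' i - (1 - c) * y i.
have [fb dfb rb] := H y.
have W1 : 1 <= Wf z by rewrite -[leLHS]mulr1 ler_pM// N1_ge1.
have yW i : `|y i| <= Wf z.
  by apply: (le_trans (le_N1 y i)); rewrite -[leLHS]mulr1 ler_wpM2l ?N1_ge0 ?N1_ge1.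
have yW' i : `|y' i| <= Wf z.
  by apply: (le_trans (le_N1 y' i)); rewrite -[leLHS]mul1r ler_wpM2r ?N1_ge0 ?N1_ge1.
have R1E : R1 z = f (fun i => y i + h i) * (- s * y i0 + c * y' i0).
  by rewrite /R1 /Phi /=; congr (f _ * _); apply/funext => i; rewrite /h /y /y'; ring.
have hL : L1 h <= s * (2 * Wf z).
  have : L1 h <= s * (L1 y + L1 y').
    rewrite /L1 -big_split/= mulr_sumr; apply: ler_sum => i _.
    rewrite /h; apply: (le_trans (ler_normB _ _)); rewrite mulrDr addrC.
    apply: lerD; rewrite normrM; last by rewrite gtr0_norm.
    rewrite ler_wpM2r// ger0_norm ?subr_ge0//; nra.
  move/le_trans; apply; rewrite ler_wpM2l ?(ltW s0)//.
  have := L1_ge0 y; have := L1_ge0 y'; rewrite /Wf /N1 -/y -/y' => ? ?; nra.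
have hN : N1 h <= 3 * Wf z by rewrite /N1; nra.
have W0 : 0 <= Wf z by apply: le_trans W1.
set r := f (fun i => y i + h i) - f y - \sum_i df i y * h i in rb *.
have -> : R1 z - B z = (f (fun i => y i + h i) - f y - \sum_i df i y * h i) * (- s * y i0 + c * y' i0)
   + \sum_j df j y * ((s * y' j - (1 - c) * y j) * (- s * y i0 + c * y' i0) - s * (y' j * y' i0)).
  rewrite R1E /B /A1 /A2 /A3 -/y -/y'.
  have -> : \sum_j df j y * ((s * y' j - (1 - c) * y j) * (- s * y i0 + c * y' i0) - s * (y' j * y' i0)) =
    (\sum_i df i y * h i) * (- s * y i0 + c * y' i0) - s * \sum_j df j y * (y' j * y' i0).
    by rewrite mulr_suml mulr_sumr -sumrB; apply: eq_bigr => j _; rewrite /h; ring.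
  rewrite -[\sum_j df j y * (Y j z.2 * Y i0 z.2)]/(\sum_j df j y * (y' j * y' i0)).
  by rewrite -[Y i0 z.2]/(y' i0) -[Y i0 z.1]/(y i0); ring.
apply: (le_trans (ler_normD _ _)); rewrite /H0 [X in _ <= X]mulrDr; apply: lerD.
  rewrite normrM.
  have X2 : `|- s * y i0 + c * y' i0| <= 2 * Wf z.
    apply: (le_trans (ler_normD _ _)); rewrite !normrM normrN (gtr0_norm s0) (ger0_norm c0).
    have := yW i0; have := yW' i0; have := normr_ge0 (y i0); have := normr_ge0 (y' i0); nra.
  apply: (@le_trans _ _ ((C * (3 * Wf z ^+ 2) ^+ n * (s * (2 * Wf z)) ^+ 2) * (2 * Wf z))).
    apply: ler_pM => //.
    apply: (le_trans (rb h)); apply: ler_pM.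
    - by rewrite mulr_ge0// exprn_ge0// mulr_ge0 ?N1_ge0.
    - exact: sqr_ge0.
    - rewrite ler_wpM2l// lerXn2r ?nnegrE ?mulr_ge0 ?N1_ge0//.
      have yN : N1 y <= Wf z by rewrite -[leLHS]mulr1 ler_wpM2l ?N1_ge0 ?N1_ge1.
      have -> : 3 * Wf z ^+ 2 = Wf z * (3 * Wf z) by ring.
      by apply: ler_pM; rewrite ?N1_ge0.
    - by rewrite lerXn2r ?nnegrE ?L1_ge0// mulr_ge0 ?(ltW s0)// mulr_ge0.
  by rewrite le_eqVlt; apply/orP; left; apply/eqP; ring.
apply: (le_trans (ler_norm_sum _ _ _)); rewrite mulr_sumr; apply: ler_sum => j _.
rewrite normrM.
have dj : `|df j y| <= C * Wf z ^+ n.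
  apply: (le_trans (dfb j)); rewrite ler_wpM2l// lerXn2r ?nnegrE ?N1_ge0//.
  by rewrite -[leLHS]mulr1 ler_wpM2l ?N1_ge0 ?N1_ge1.
have -> : s ^+ 2 * (C * Wf z ^+ n * (4 * Wf z ^+ 2)) = (C * Wf z ^+ n) * (s ^+ 2 * (4 * Wf z ^+ 2)) by ring.
apply: ler_pM => //.
have -> : (s * y' j - (1 - c) * y j) * (- s * y i0 + c * y' i0) - s * (y' j * y' i0) =
  - (s ^+ 2 * (y' j * y i0)) + (- (s * (1 - c) * (y' j * y' i0))) + ((1 - c) * s * (y j * y i0)) + (- ((1 - c) * c * (y j * y' i0))) by ring.
have -> : s ^+ 2 * (4 * Wf z ^+ 2) = s ^+ 2 * Wf z ^+ 2 + s ^+ 2 * Wf z ^+ 2 + s ^+ 2 * Wf z ^+ 2 + s ^+ 2 * Wf z ^+ 2 by ring.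
have key (k u v : R) : 0 <= k <= s ^+ 2 -> `|u| <= Wf z -> `|v| <= Wf z -> `|k * (u * v)| <= s ^+ 2 * Wf z ^+ 2.
  move=> /andP[k0 k1] uW vW; rewrite normrM (ger0_norm k0) ler_pM// expr2 normrM ler_pM//.
have kc : 0 <= 1 - c by rewrite subr_ge0.
have q1 : 0 <= s ^+ 2 <= s ^+ 2 by rewrite sqr_ge0 lexx.
have q2 : 0 <= s * (1 - c) <= s ^+ 2 by apply/andP; split; nra.
have q3 : 0 <= (1 - c) * s <= s ^+ 2 by rewrite mulrC.
have q4 : 0 <= (1 - c) * c <= s ^+ 2 by apply/andP; split; nra.
do 3! (apply: (le_trans (ler_normD _ _)); apply: lerD; last by rewrite ?normrN; exact: key).
by rewrite normrN; exact: key.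
Qed.

End ibp.

(** * Sums, products and compositions of test functions *)

Section TPcalc.
Context {I : finType} {R : realType}.
Implicit Types (f g : (I -> R) -> R) (df dg : I -> (I -> R) -> R).

Definition TPb (C : R) (n : nat) f df : Prop := forall x : I -> R, [/\ `|f x| <= C * N1 x ^+ n,
     (forall i, `|df i x| <= C * N1 x ^+ n) &
     forall h, `|f (fun i => x i + h i) - f x - \sum_i df i x * h i| <= C * (N1 x * N1 h) ^+ n * L1 h ^+ 2].

Lemma W_ge1 (x h : I -> R) : 1 <= N1 x * N1 h.
Proof. by rewrite -[leLHS]mulr1 ler_pM// N1_ge1. Qed.

Lemma le_xW (x h : I -> R) : N1 x <= N1 x * N1 h.
Proof. by rewrite -[leLHS]mulr1 ler_wpM2l ?N1_ge0 ?N1_ge1. Qed.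

Lemma TPb_mono C C' n n' f df : 0 <= C -> C <= C' -> (n <= n')%N -> TPb C n f df -> TPb C' n' f df.
Proof.
move=> C0 CC nn H x; have [h1 h2 h3] := H x.
have e (w : R) : 1 <= w -> C * w ^+ n <= C' * w ^+ n'.
  by move=> w1; apply: ler_pM => //; [rewrite exprn_ge0// (le_trans _ w1)|exact: ler_weXn2l].
split; first by apply: (le_trans h1); exact: e (N1_ge1 x).
  by move=> i; apply: (le_trans (h2 i)); exact: e (N1_ge1 x).
by move=> h; apply: (le_trans (h3 h)); apply: ler_wpM2r; [exact: sqr_ge0|exact: e (W_ge1 x h)].
Qed.

Lemma TP2 f df g dg : TP f df -> TP g dg -> exists (C : R) (n : nat), [/\ 0 <= C, TPb C n f df & TPb C n g dg].
Proof.
move=> [_ _ [C [n [C0 H]]]] [_ _ [C' [n' [C0' H']]]]; exists (C + C'), (n + n')%N; split.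
- exact: addr_ge0.
- by apply: TPb_mono H => //; rewrite ?lerDl// leq_addr.
- by apply: TPb_mono H' => //; rewrite ?lerDr// leq_addl.
Qed.

Lemma eq_TP f df g dg : f =1 g -> (forall i, df i =1 dg i) -> TP f df -> TP g dg.
Proof. by move=> /funext <- H; have -> : dg = df by apply/funext => i; apply/funext => x; rewrite H. Qed.

Lemma cmeas_cst (c : R) : cmeas (fun _ : I -> R => c).
Proof. by move=> d T Y mY; exact: measurable_cst. Qed.
Lemma cmeas_coord (i : I) : cmeas (fun x : I -> R => x i).
Proof. by move=> d T Y mY; exact: mY. Qed.
Lemma cmeasD f g : cmeas f -> cmeas g -> cmeas (fun x => f x + g x).
Proof. by move=> mf mg d T Y mY; apply: measurable_funD; [exact: mf|exact: mg]. Qed.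
Lemma cmeasM f g : cmeas f -> cmeas g -> cmeas (fun x => f x * g x).
Proof. by move=> mf mg d T Y mY; apply: measurable_funM; [exact: mf|exact: mg]. Qed.
Lemma cmeas_sum J (s : seq J) (F : J -> (I -> R) -> R) : (forall j, cmeas (F j)) -> cmeas (fun x => \sum_(j <- s) F j x).
Proof. by move=> mF d T Y mY; apply: measurable_sum => j; exact: mF. Qed.

Lemma TP_cst (c : R) : TP (fun _ : I -> R => c) (fun _ _ => 0).
Proof.
split; [exact: cmeas_cst|by move=> i; exact: cmeas_cst|exists `|c|, 0%N; split => // x; split].
- by rewrite mulr1.
- by move=> i; rewrite normr0 mulr_ge0.
- move=> h; rewrite subrr sub0r big1; last by move=> i _; rewrite mul0r.
  by rewrite oppr0 normr0; apply: mulr_ge0; [rewrite mulr1|exact: sqr_ge0].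
Qed.

Lemma TP_coord (i : I) : TP (fun x : I -> R => x i) (fun j _ => (j == i)%:R).
Proof.
split; [exact: cmeas_coord|by move=> j; exact: cmeas_cst|exists 1, 1%N; split => // x; split].
- by rewrite mul1r expr1 le_N1.
- by move=> j; rewrite mul1r expr1; apply: le_trans (N1_ge1 x); case: (_ == _); rewrite ?normr1 ?normr0.
- move=> h; rewrite (bigD1 i)//= eqxx mul1r big1 ?addr0; last by move=> j /negbTE ->; rewrite mul0r.
  have -> : x i + h i - x i - true%:R * h i = 0 by rewrite /=; ring.
  rewrite normr0; apply: mulr_ge0; last exact: sqr_ge0.
  by rewrite expr1; apply: le_trans (W_ge1 x h).
Qed.

Lemma TP_add f df g dg : TP f df -> TP g dg -> TP (fun x => f x + g x) (fun i x => df i x + dg i x).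
Proof.
move=> Hf Hg; have [C [n [C0 Bf Bg]]] := TP2 Hf Hg.
have [mf mdf _] := Hf; have [mg mdg _] := Hg.
split; [exact: cmeasD|by move=> i; exact: cmeasD|exists (2 * C), n; split; first exact: mulr_ge0].
move=> x; have [f1 f2 f3] := Bf x; have [g1 g2 g3] := Bg x; split.
- by apply: (le_trans (ler_normD _ _)); lra.
- by move=> i; apply: (le_trans (ler_normD _ _)); have := f2 i; have := g2 i; lra.
- move=> h; have := f3 h; have := g3 h.
  have -> : f (fun i => x i + h i) + g (fun i => x i + h i) - (f x + g x) - \sum_i (df i x + dg i x) * h i =
    (f (fun i => x i + h i) - f x - \sum_i df i x * h i) + (g (fun i => x i + h i) - g x - \sum_i dg i x * h i).
    under eq_bigr do rewrite mulrDl.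
    by rewrite big_split/=; ring.
  set t := C * _ ^+ n * _; move=> ? ?; apply: (le_trans (ler_normD _ _)).
  have -> : 2 * C * (N1 x * N1 h) ^+ n * L1 h ^+ 2 = t + t by rewrite /t; ring.
  exact: lerD.
Qed.

Lemma incr_bound C n f df x h : 0 <= C -> TPb C n f df ->
  `|f (fun i => x i + h i) - f x| <= 2 * C * (N1 x * N1 h) ^+ n.+1 * L1 h /\
  `|\sum_i df i x * h i| <= C * (N1 x * N1 h) ^+ n * L1 h /\
  `|f (fun i => x i + h i)| <= C * (N1 x * N1 h) ^+ n.
Proof.
move=> C0 H; have [f1 f2 f3] := H x.
have W1 := W_ge1 x h; set W := N1 x * N1 h in W1 *.
have W0 : 0 <= W by apply: le_trans W1.
have xW : C * N1 x ^+ n <= C * W ^+ n.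
  by rewrite ler_wpM2l// lerXn2r ?nnegrE ?N1_ge0//; exact: le_xW.
have S : `|\sum_i df i x * h i| <= C * W ^+ n * L1 h.
  apply: (le_trans (ler_norm_sum _ _ _)); rewrite /L1 mulr_sumr; apply: ler_sum => i _.
  by rewrite normrM ler_wpM2r//; exact: le_trans (f2 i) xW.
split; last split => //.
  have -> : f (fun i => x i + h i) - f x = (f (fun i => x i + h i) - f x - \sum_i df i x * h i) + \sum_i df i x * h i by ring.
  apply: (le_trans (ler_normD _ _)).
  apply: (le_trans (lerD (f3 h) S)).
  have hW : L1 h <= W by apply: (le_trans (L1_le_N1 h)); rewrite -[leLHS]mul1r ler_wpM2r ?N1_ge0 ?N1_ge1.
  have L0 := L1_ge0 h.
  have Wn : 0 <= C * W ^+ n by rewrite mulr_ge0// exprn_ge0.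
  rewrite [W ^+ n.+1]exprS; set t := C * W ^+ n in Wn *.
  have -> : 2 * C * (W * W ^+ n) * L1 h = 2 * t * W * L1 h by rewrite /t; ring.
  have : t * L1 h * L1 h <= t * L1 h * W by rewrite ler_wpM2l// mulr_ge0.
  have : t * L1 h <= t * L1 h * W by rewrite -[leLHS]mulr1 ler_wpM2l// mulr_ge0.
  rewrite expr2; lra.
have [g1 _ _] := H (fun i => x i + h i); apply: (le_trans g1).
by rewrite ler_wpM2l// lerXn2r ?nnegrE ?N1_ge0//; exact: N1D.
Qed.

Lemma TP_mul f df g dg : TP f df -> TP g dg -> TP (fun x => f x * g x) (fun i x => df i x * g x + f x * dg i x).
Proof.
move=> Hf Hg; have [C [n [C0 Bf Bg]]] := TP2 Hf Hg.
have [mf mdf _] := Hf; have [mg mdg _] := Hg.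
split; [exact: cmeasM|by move=> i; apply: cmeasD; exact: cmeasM|].
exists (4 * C ^+ 2), (n + n).+1; split; first by rewrite mulr_ge0 ?sqr_ge0.
move=> x; have [f1 f2 f3] := Bf x; have [g1 g2 g3] := Bg x.
have N0 := N1_ge0 x.
have t0 : 0 <= C * N1 x ^+ n by rewrite mulr_ge0// exprn_ge0.
have e : (C * N1 x ^+ n) * (C * N1 x ^+ n) <= C ^+ 2 * N1 x ^+ (n + n).+1.
  have -> : (C * N1 x ^+ n) * (C * N1 x ^+ n) = C ^+ 2 * N1 x ^+ (n + n) by rewrite exprD; ring.
  by rewrite ler_wpM2l ?sqr_ge0// ler_weXn2l ?N1_ge1.
have e0 : 0 <= C ^+ 2 * N1 x ^+ (n + n).+1 by rewrite mulr_ge0 ?sqr_ge0 ?exprn_ge0.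
split.
- rewrite normrM; apply: (@le_trans _ _ ((C * N1 x ^+ n) * (C * N1 x ^+ n))); first exact: ler_pM.
  by move: e e0; rewrite -!mulrA; lra.
- move=> i; apply: (le_trans (ler_normD _ _)); rewrite !normrM.
  have := ler_pM (normr_ge0 _) (normr_ge0 _) (f2 i) g1.
  have := ler_pM (normr_ge0 _) (normr_ge0 _) f1 (g2 i).
  by move: e e0; rewrite -!mulrA; lra.
move=> h.
have -> : f (fun i => x i + h i) * g (fun i => x i + h i) - f x * g x - \sum_i (df i x * g x + f x * dg i x) * h i =
  (f (fun i => x i + h i) - f x - \sum_i df i x * h i) * g (fun i => x i + h i)
  + (\sum_i df i x * h i) * (g (fun i => x i + h i) - g x) + f x * (g (fun i => x i + h i) - g x - \sum_i dg i x * h i).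
  have -> : \sum_i (df i x * g x + f x * dg i x) * h i = (\sum_i df i x * h i) * g x + f x * \sum_i dg i x * h i.
    by rewrite mulr_suml mulr_sumr -big_split/=; apply: eq_bigr => i _; ring.
  by ring.
have [ig [_ bg]] := incr_bound x h C0 Bg.
have [_ [sf _]] := incr_bound x h C0 Bf.
have W1 := W_ge1 x h; set W := N1 x * N1 h in W1 ig bg sf f3 g3 *.
have W0 : 0 <= W by apply: le_trans W1.
have L0 := L1_ge0 h.
have Wn0 : 0 <= W ^+ n by rewrite exprn_ge0.
have fW : `|f x| <= C * W ^+ n.
  apply: (le_trans f1); rewrite ler_wpM2l// lerXn2r ?nnegrE//; exact: le_xW.
have b1 := ler_pM (normr_ge0 _) (normr_ge0 _) (f3 h) bg.
have b2 := ler_pM (normr_ge0 _) (normr_ge0 _) sf ig.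
have b3 := ler_pM (normr_ge0 _) (normr_ge0 _) fW (g3 h).
apply: (le_trans (ler_normD _ _)); apply: (le_trans (lerD (ler_normD _ _) (lexx _))).
rewrite !normrM; apply: (le_trans (lerD (lerD b1 b2) b3)).
rewrite -/W [W ^+ n.+1]exprS [W ^+ (n + n).+1]exprS exprD; set w := W ^+ n in Wn0 *; set l := L1 h in L0 *.
have -> : C * w * l ^+ 2 * (C * w) + C * w * l * (2 * C * (W * w) * l) + C * w * (C * w * l ^+ 2) =
  (C * w * l) ^+ 2 * (2 + 2 * W) by ring.
have -> : 4 * C ^+ 2 * (W * (w * w)) * l ^+ 2 = (C * w * l) ^+ 2 * (4 * W) by ring.
rewrite ler_wpM2l ?sqr_ge0//; lra.
Qed.

Lemma TP_scale c f df : TP f df -> TP (fun x => c * f x) (fun i x => c * df i x).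
Proof.
move=> Hf; apply: eq_TP (TP_mul (TP_cst c) Hf) => //.
by move=> i x; rewrite mul0r add0r.
Qed.

Lemma TP_sum J (s : seq J) (F : J -> (I -> R) -> R) dF : (forall j, TP (F j) (dF j)) ->
  TP (fun x => \sum_(j <- s) F j x) (fun i x => \sum_(j <- s) dF j i x).
Proof.
move=> H; elim: s => [|j s IH].
  by apply: eq_TP (TP_cst 0) => [x|i x]; rewrite big_nil.
by apply: eq_TP (TP_add (H j) IH) => [x|i x]; rewrite big_cons.
Qed.

Lemma TP_exp f df n : TP f df -> TP (fun x => f x ^+ n) (fun i x => n%:R * f x ^+ n.-1 * df i x).
Proof.
move=> Hf; elim: n => [|n IH].
  by apply: eq_TP (TP_cst 1) => [x|i x]; rewrite ?expr0 ?mul0r.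
apply: eq_TP (TP_mul Hf IH) => [x|i x]; first by rewrite exprS.
case: n {IH} => [|n]; first by rewrite !expr0 !mul0r mulr0 addr0; ring.
by rewrite /= -[in RHS]natr1 exprS; ring.
Qed.

(* As [TP], with uniform bounds. *)
Definition BT {J : finType} (phi : (J -> R) -> R) (dphi : J -> (J -> R) -> R) : Prop :=
  [/\ cmeas phi, (forall j, cmeas (dphi j)) & exists B : R, 0 <= B /\ forall u, [/\ `|phi u| <= B,
    (forall j, `|dphi j u| <= B) &
    forall k, `|phi (fun j => u j + k j) - phi u - \sum_j dphi j u * k j| <= B * L1 k ^+ 2]].

Lemma TP_unif (J : finType) (G : J -> (I -> R) -> R) dG : (forall j, TP (G j) (dG j)) ->
  exists (C : R) (n : nat), 0 <= C /\ forall j, TPb C n (G j) (dG j).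
Proof.
move=> H.
have : forall j, exists Cn : R * nat, 0 <= Cn.1 /\ TPb Cn.1 Cn.2 (G j) (dG j).
  by move=> j; have [_ _ [C [n H']]] := H j; exists (C, n).
move=> /choice[F HF].
exists (\sum_j (F j).1), (\sum_j (F j).2)%N; split.
  by apply: sumr_ge0 => j _; have [] := HF j.
move=> j; have [h1 h2] := HF j; apply: TPb_mono h2 => //.
  by rewrite (bigD1 j)//= lerDl; apply: sumr_ge0 => k _; have [] := HF k.
by rewrite (bigD1 j)//= leq_addr.
Qed.

Lemma cmeas_comp (J : finType) (phi : (J -> R) -> R) (G : J -> (I -> R) -> R) :
  cmeas phi -> (forall j, cmeas (G j)) -> cmeas (fun x => phi (fun j => G j x)).
Proof. by move=> mp mG d T Y mY; apply: mp => j; exact: mG. Qed.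

Lemma TP_comp (J : finType) (phi : (J -> R) -> R) dphi (G : J -> (I -> R) -> R) dG :
  BT phi dphi -> (forall j, TP (G j) (dG j)) ->
  TP (fun x => phi (fun j => G j x)) (fun i x => \sum_j dphi j (fun j => G j x) * dG j i x).
Proof.
move=> [mp mdp [B [B0 HB]]] HG.
have mG j : cmeas (G j) by have [] := HG j.
have mdG j i : cmeas (dG j i) by have [] := HG j.
have [C [n [C0 HC]]] := TP_unif HG.
split; first exact: cmeas_comp.
  by move=> i; apply: cmeas_sum => j; apply: cmeasM => //; exact: cmeas_comp.
pose m : R := #|J|%:R; have m0 : 0 <= m by [].
have c1 : 0 <= m * B * C by rewrite !mulr_ge0.
have c2 : 0 <= B * (2 * m * C) ^+ 2 by rewrite mulr_ge0 ?sqr_ge0.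
exists (B + m * B * C + B * (2 * m * C) ^+ 2), (2 * n).+2; split; first by rewrite !addr_ge0.
move=> x; have [p1 p2 p3] := HB (fun j => G j x).
have Nn k : (k <= (2 * n).+2)%N -> N1 x ^+ k <= N1 x ^+ (2 * n).+2.
  by move=> kn; rewrite ler_weXn2l// N1_ge1.
have D : 0 <= N1 x ^+ (2 * n).+2 by rewrite exprn_ge0// N1_ge0.
have sumJ (F : J -> R) b : (forall j, `|F j| <= b) -> `|\sum_j F j| <= m * b.
  move=> Fb; apply: (le_trans (ler_norm_sum _ _ _)).
  apply: (le_trans (ler_sum _ (fun j _ => Fb j))).
  by rewrite sumr_const mulr_natl.
split.
- apply: (@le_trans _ _ (B * N1 x ^+ (2 * n).+2)).
    by apply: (le_trans p1); rewrite -[leLHS]mulr1 ler_wpM2l// exprn_ege1// N1_ge1.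
  by rewrite ler_wpM2r//; lra.
- move=> i; apply: (le_trans (@sumJ _ (B * (C * N1 x ^+ n)) _)).
    move=> j; rewrite normrM; apply: ler_pM => //.
    by have [_ + _] := HC j x; apply.
  have : m * (B * (C * N1 x ^+ n)) <= m * B * C * N1 x ^+ (2 * n).+2.
    have -> : m * (B * (C * N1 x ^+ n)) = m * B * C * N1 x ^+ n by ring.
    apply: ler_wpM2l => //; apply: Nn.
    by rewrite mul2n -addnn; do 2! apply: leqW; exact: leq_addr.
  move/le_trans; apply; rewrite ler_wpM2r//; lra.
move=> h.
pose k j := G j (fun i => x i + h i) - G j x.
have -> : (fun j => G j (fun i => x i + h i)) = (fun j => G j x + k j).
  by apply/funext => j; rewrite /k; ring.
have W1 := W_ge1 x h; set W := N1 x * N1 h in W1 *.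
have W0 : 0 <= W by apply: le_trans W1.
have L0 := L1_ge0 h.
have kb j : `|k j| <= 2 * C * W ^+ n.+1 * L1 h by have [] := incr_bound x h C0 (HC j).
have Lk : L1 k <= m * (2 * C * W ^+ n.+1 * L1 h).
  rewrite -[leLHS]ger0_norm ?L1_ge0//; apply: sumJ => j; by rewrite normr_id.
have -> : phi (fun j => G j x + k j) - phi (fun j => G j x) - \sum_i (\sum_j dphi j (fun j => G j x) * dG j i x) * h i =
  (phi (fun j => G j x + k j) - phi (fun j => G j x) - \sum_j dphi j (fun j => G j x) * k j) +
  \sum_j dphi j (fun j => G j x) * (k j - \sum_i dG j i x * h i).
  have -> : \sum_j dphi j (fun j => G j x) * (k j - \sum_i dG j i x * h i) =
     \sum_j dphi j (fun j => G j x) * k j - \sum_i (\sum_j dphi j (fun j => G j x) * dG j i x) * h i.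
    under [X in _ = _ - X]eq_bigr do rewrite mulr_suml.
    rewrite exchange_big -sumrB; apply: eq_bigr => j _; rewrite mulrBr; congr (_ - _).
    by rewrite mulr_sumr; apply: eq_bigr => i _; rewrite mulrA.
  by ring.
apply: (le_trans (ler_normD _ _)).
have b1 : `|\sum_j dphi j (fun j => G j x) * (k j - \sum_i dG j i x * h i)| <= m * (B * (C * W ^+ n * L1 h ^+ 2)).
  apply: sumJ => j; rewrite normrM; apply: ler_pM => //.
  by have [_ _] := HC j x; apply.
have b2 : B * L1 k ^+ 2 <= B * (m * (2 * C * W ^+ n.+1 * L1 h)) ^+ 2.
  by rewrite ler_wpM2l// lerXn2r ?nnegrE ?L1_ge0// !mulr_ge0// exprn_ge0.
apply: (le_trans (lerD (le_trans (p3 k) b2) b1)).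
set w := W ^+ (2 * n).+2.
have w0 : 0 <= w by rewrite exprn_ge0.
have -> : B * (m * (2 * C * W ^+ n.+1 * L1 h)) ^+ 2 = B * (2 * m * C) ^+ 2 * w * L1 h ^+ 2.
  have -> : w = W ^+ n.+1 * W ^+ n.+1 by rewrite /w -exprD mul2n -addnn addSn addnS.
  by ring.
have b3 : m * (B * (C * W ^+ n * L1 h ^+ 2)) <= m * B * C * w * L1 h ^+ 2.
  have -> : m * (B * (C * W ^+ n * L1 h ^+ 2)) = m * B * C * W ^+ n * L1 h ^+ 2 by ring.
  apply: ler_wpM2r; first exact: sqr_ge0.
  apply: ler_wpM2l => //; apply: ler_weXn2l => //.
  by rewrite mul2n -addnn; do 2! apply: leqW; exact: leq_addr.
apply: (le_trans (lerD (lexx _) b3)).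
have : 0 <= B * w * L1 h ^+ 2 by apply: mulr_ge0; [exact: mulr_ge0|exact: sqr_ge0].
move: (L1 h ^+ 2) => l2; lra.
Qed.

End TPcalc.

(** * Integration by parts for centred quadratic forms *)

Section ibp2.
Context {I : finType} {R : realType} {d} {T : measurableType d}.
Variables (P : probability T R) (Y : I -> T -> R) (K : I -> I -> R).
Hypotheses (GY : gauss P Y K).
Hypothesis symK : forall i j, K i j = K j i.

(** The mean of y' M y when y has covariance K, that is, the trace of M K; [qf] subtracts it. *)
Definition mtr (M : I -> I -> R) : R := \sum_i \sum_j M i j * K i j.
Definition qf (M : I -> I -> R) (y : I -> R) : R := quad M y y - mtr M.
Definition mv (M : I -> I -> R) (y : I -> R) (i : I) : R := dot (M i) y.

Lemma dotE (M : I -> I -> R) y : quad M y y = dot y (mv M y).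
Proof.
rewrite /quad /dot; apply: eq_bigr => i _; rewrite /mv /dot mulr_sumr.
by apply: eq_bigr => j _; rewrite mulrA.
Qed.

Lemma TP_dot (a : I -> R) : TP (fun y => dot a y) (fun i _ => a i).
Proof.
apply: eq_TP (TP_sum (index_enum I) (fun i => TP_scale (a i) (TP_coord i))) => // i x.
by rewrite (bigD1 i)//= eqxx mulr1 big1 ?addr0// => j ji; rewrite eq_sym (negbTE ji) mulr0.
Qed.

Lemma TP_qf (M : I -> I -> R) : (forall i j, M i j = M j i) ->
  TP (qf M) (fun k y => 2 * mv M y k).
Proof.
move=> sM.
have H := TP_add (TP_sum (index_enum I) (fun i => TP_mul (TP_coord i) (TP_dot (M i)))) (TP_cst (- mtr M)).
apply: eq_TP H => [y|k y]; first by rewrite /qf dotE.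
rewrite addr0 big_split/= (bigD1 k)//= eqxx mul1r big1 ?addr0; last first.
  by move=> i; rewrite eq_sym => /negbTE ->; rewrite mul0r.
have -> : \sum_i y i * M i k = mv M y k.
  by rewrite /mv /dot; apply: eq_bigr => i _; rewrite mulrC sM.
by rewrite /mv; ring.
Qed.

(** [ibp] is applied to (M y)_i f and summed over i. Differentiating (M y)_i produces [mtr M] times
    E f, which the centring in [qf] removes. *)
Lemma ibp2 M f df : TP f df ->
  Ex P (fun w => qf M (fun i => Y i w) * f (fun i => Y i w)) =
  Ex P (fun w => quad K (mv M (fun i => Y i w)) (fun k => df k (fun i => Y i w))).
Proof.
move=> Hf; have [Lf Ldf] := Lall_TP GY Hf.
have LY k : Lall P (Y k) by exact: (Lall_gauss GY).
have Lmv i : Lall P (fun w => mv M (fun i => Y i w) i) by exact: (Lall_gauss_dot GY).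
have H i := ibp GY symK i (TP_mul (TP_dot (M i)) Hf).
have E1 : Ex P (fun w => qf M (fun i => Y i w) * f (fun i => Y i w)) =
  \sum_i Ex P (fun w => Y i w * (dot (M i) (fun i => Y i w) * f (fun i => Y i w))) - mtr M * Ex P (fun w => f (fun i => Y i w)).
  have L1 i : Li P (fun w => Y i w * (dot (M i) (fun i => Y i w) * f (fun i => Y i w))).
    by apply: Lall_Li; apply: LallM => //; apply: LallM => //; exact: Lmv.
  rewrite -Ex_sum// -ExZ; last exact: Lall_Li.
  rewrite -ExB; [|exact: Li_sum|by apply: LiZ; exact: Lall_Li].
  apply: eq_Ex => w; rewrite /qf dotE mulrBl; congr (_ - _).
  by rewrite /dot mulr_suml; apply: eq_bigr => i _; rewrite /mv mulrA.
rewrite E1; under eq_bigr do rewrite H.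
have E2 i j : Ex P (fun w => M i j * f (fun i => Y i w) + dot (M i) (fun i => Y i w) * df j (fun i => Y i w)) =
  M i j * Ex P (fun w => f (fun i => Y i w)) + Ex P (fun w => dot (M i) (fun i => Y i w) * df j (fun i => Y i w)).
  rewrite ExD ?ExZ//; [exact: Lall_Li|apply: LiZ; exact: Lall_Li|].
  by apply: Lall_Li; apply: LallM => //; exact: Lmv.
have -> : \sum_i \sum_j K i j * Ex P (fun w => M i j * f (fun i => Y i w) + dot (M i) (fun i => Y i w) * df j (fun i => Y i w)) =
  mtr M * Ex P (fun w => f (fun i => Y i w)) + \sum_i \sum_j K i j * Ex P (fun w => dot (M i) (fun i => Y i w) * df j (fun i => Y i w)).
  rewrite /mtr mulr_suml -big_split/=; apply: eq_bigr => i _.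
  rewrite mulr_suml -big_split/=; apply: eq_bigr => j _.
  by rewrite E2; ring.
rewrite addrAC subrr add0r.
have L2 i j : Li P (fun w => mv M (fun i => Y i w) i * K i j * df j (fun i => Y i w)).
  by apply: Lall_Li; apply: LallM => //; apply: LallM => //; exact: Lall_cst.
rewrite /quad Ex_sum; last by move=> i; exact: Li_sum.
apply: eq_bigr => i _; rewrite Ex_sum//; apply: eq_bigr => j _.
rewrite -ExZ; last by apply: Lall_Li; apply: LallM => //; exact: Lmv.
by apply: eq_Ex => w; rewrite /mv; ring.
Qed.

End ibp2.

(** * Moments of quadratic forms *)

Section quadlemmas.
Context {I : finType} {R : realType}.
Variables (K : I -> I -> R).
Hypothesis symK : forall i j, K i j = K j i.

Lemma quadC a b : quad K a b = quad K b a.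
Proof.
rewrite /quad exchange_big /=; apply: eq_bigr => i _; apply: eq_bigr => j _.
by rewrite symK; ring.
Qed.

Lemma quadZr c a b : quad K a (fun i => c * b i) = c * quad K a b.
Proof.
rewrite /quad mulr_sumr; apply: eq_bigr => i _; rewrite mulr_sumr; apply: eq_bigr => j _; ring.
Qed.

(* [sandw M] is the matrix M K M, so that [quad (sandw M) y y = quad K (M y) (M y)]. *)
Definition sandw (M : I -> I -> R) (i j : I) : R := quad K (M i) (M j).

Lemma quad_mv (M : I -> I -> R) a b : (forall i j, M i j = M j i) ->
  quad K (mv M a) (mv M b) = quad (sandw M) a b.
Proof.
move=> sM.
have E c : mv M c = fun i => \sum_j c j * M j i.
  by apply/funext => i; rewrite /mv /dot; apply: eq_bigr => j _; rewrite mulrC sM.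
by rewrite !E quad_lin.
Qed.

End quadlemmas.

(** The larger of u and 2 t decides which term dominates. The factor 1/2 in front of the power of u
    is what allows that term to be absorbed later. *)
Lemma young_pow {R : realType} (t u : R) (N : nat) : 0 <= t -> 0 <= u -> t * u ^+ N <= u ^+ N.+1 / 2 + (2 * t) ^+ N.+1.
Proof.
move=> t0 u0; have uN : 0 <= u ^+ N by rewrite exprn_ge0.
have [h|h] := leP (2 * t) u.
  have : 0 <= (2 * t) ^+ N.+1 by rewrite exprn_ge0// mulr_ge0.
  rewrite [u ^+ N.+1]exprS; move: ((2 * t) ^+ _) (u ^+ N) uN => a b b0; nra.
have : u ^+ N <= (2 * t) ^+ N by rewrite lerXn2r ?nnegrE ?mulr_ge0// ltW.
have : 0 <= u ^+ N.+1 by rewrite exprn_ge0.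
have : 0 <= (2 * t) ^+ N by rewrite exprn_ge0// mulr_ge0.
rewrite [(2 * t) ^+ N.+1]exprS; move: ((2 * t) ^+ N) (u ^+ N) (u ^+ N.+1) uN => a b c b0; nra.
Qed.

Section concentration.
Context {I : finType} {R : realType} {d} {T : measurableType d}.
Variables (P : probability T R) (Y : I -> T -> R) (K M : I -> I -> R).
Hypotheses (GY : gauss P Y K).
Hypothesis symK : forall i j, K i j = K j i.
Hypothesis symM : forall i j, M i j = M j i.
(** Plays the role of the operator norm of K^(1/2) M K^(1/2): [kapP] bounds the form of M K M K M by
    [kap] times the form of M K M. *)
Variable kap : R.
Hypothesis kap0 : 0 <= kap.
Hypothesis kapP : forall z : I -> R, `|quad K (mv (sandw K M) z) (mv M z)| <= kap * quad K (mv M z) (mv M z).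

Let y w := fun i => Y i w.
Let F w := qf K M (y w).
Let G w := quad K (mv M (y w)) (mv M (y w)).
Let H w := quad K (mv (sandw K M) (y w)) (mv M (y w)).
Let v := mtr K (sandw K M).

Let LF : Lall P F. Proof. by have [] := Lall_TP GY (TP_qf K symM). Qed.
Let Lmv N i : Lall P (fun w => mv N (y w) i).
Proof. exact: (Lall_gauss_dot GY). Qed.
Let Lq (N N' : I -> I -> R) : Lall P (fun w => quad K (mv N (y w)) (mv N' (y w))).
Proof.
apply: Lall_sum => i; apply: Lall_sum => j; apply: LallM => //; apply: LallM => //; exact: Lall_cst.
Qed.

Let TPF q := TP_exp q (TP_qf K symM).

(** One factor F is integrated by parts against the others; the gradient of F is 2 M Y, whence the
    form G of M K M. *)
Let rec1 q : Ex P (fun w => F w ^+ q.+1) = 2 * q%:R * Ex P (fun w => G w * F w ^+ q.-1).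
Proof.
have := ibp2 GY symK M (TPF q).
rewrite (_ : Ex P (fun w => qf K M _ * _) = Ex P (fun w => F w ^+ q.+1)); last first.
  by apply: eq_Ex => w; rewrite exprS.
move=> ->; rewrite -ExZ; last by apply: Lall_Li; apply: LallM; [exact: Lq|exact: LallX].
apply: eq_Ex => w.
rewrite -[LHS]/(quad K (mv M (y w)) (fun k => q%:R * F w ^+ q.-1 * (2 * mv M (y w) k))).
have -> : (fun k => q%:R * F w ^+ q.-1 * (2 * mv M (y w) k)) = fun k => (q%:R * F w ^+ q.-1 * 2) * mv M (y w) k.
  by apply/funext => k; ring.
by rewrite quadZr /G; ring.
Qed.

(** G is its mean v plus a centred quadratic form, so the same integration by parts applies and
    yields the form H of M K M K M. *)
Let rec2 q : Ex P (fun w => G w * F w ^+ q) = v * Ex P (fun w => F w ^+ q) + 2 * q%:R * Ex P (fun w => H w * F w ^+ q.-1).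
Proof.
have := ibp2 GY symK (sandw K M) (TPF q).
have EG w : G w = qf K (sandw K M) (y w) + v by rewrite /G quad_mv// /qf /v subrK.
have LFq k : Li P (fun w => F w ^+ k) by apply: Lall_Li; exact: LallX.
have LGF k : Li P (fun w => G w * F w ^+ k) by apply: Lall_Li; apply: LallM; [exact: Lq|exact: LallX].
have LHF k : Li P (fun w => H w * F w ^+ k) by apply: Lall_Li; apply: LallM; [exact: Lq|exact: LallX].
rewrite (_ : Ex P (fun w => qf K (sandw K M) _ * _) = Ex P (fun w => G w * F w ^+ q) - v * Ex P (fun w => F w ^+ q)); last first.
  rewrite -ExZ// -ExB//; last exact: LiZ.
  by apply: eq_Ex => w; rewrite EG /F /y; ring.
move=> E; apply/eqP; rewrite addrC -subr_eq E -ExZ//; apply/eqP.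
apply: eq_Ex => w.
rewrite -[LHS]/(quad K (mv (sandw K M) (y w)) (fun k => q%:R * F w ^+ q.-1 * (2 * mv M (y w) k))).
have -> : (fun k => q%:R * F w ^+ q.-1 * (2 * mv M (y w) k)) = fun k => (q%:R * F w ^+ q.-1 * 2) * mv M (y w) k.
  by apply/funext => k; ring.
by rewrite quadZr /H; ring.
Qed.

Let G0 w : 0 <= G w. Proof. exact: (quad_ge0 GY). Qed.

Let EG : Ex P G = v.
Proof.
have := rec2 0; rewrite /= mulr0 mul0r addr0.
rewrite (_ : Ex P (fun w => F w ^+ 0) = 1); last by under eq_Ex do rewrite expr0; rewrite Ex_cst.
by rewrite mulr1 => <-; apply: eq_Ex => w; rewrite expr0 mulr1.
Qed.

Let v0 : 0 <= v. Proof. by rewrite -EG; exact: Ex_ge0. Qed.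

Let even_ge0 (x : R) k : 0 <= x ^+ k.*2.
Proof. by rewrite -mul2n exprM exprn_ge0// sqr_ge0. Qed.

(** [kapP] replaces H by [kap] G, and [young_pow] splits [kap] |F|^(2r+1) into half of F^(2r+2) and
    a deterministic power, which is weighted by E G = v. *)
Let key r : 2 * (r.+1.*2)%:R * Ex P (fun w => H w * F w ^+ r.+1.*2.-1) <=
  Ex P (fun w => G w * F w ^+ r.+1.*2) / 2 + v * (8 * r.+2%:R * kap) ^+ r.+1.*2.
Proof.
have LGF k : Li P (fun w => G w * F w ^+ k) by apply: Lall_Li; apply: LallM; [exact: Lq|exact: LallX].
have LHF k : Li P (fun w => H w * F w ^+ k) by apply: Lall_Li; apply: LallM; [exact: Lq|exact: LallX].
have LG : Li P G by exact: Lall_Li (Lq _ _).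
set Q := _ ^+ r.+1.*2.
rewrite -EG (mulrC _ 2^-1) (mulrC (Ex P G)) -!ExZ// -ExD; [|exact: LiZ|exact: LiZ].
apply: Ex_le.
- exact: LiZ.
- by apply: LiD; exact: LiZ.
move=> w; rewrite doubleS -pred_Sn.
apply: (le_trans (ler_norm _)); rewrite !normrM !normr_nat normrX.
have HG : `|H w| <= kap * G w by exact: kapP.
set u := `|F w|.
have -> : F w ^+ r.*2.+2 = u ^+ r.*2.+2.
  by rewrite /u -normrX ger0_norm// -doubleS; exact: even_ge0.
apply: (@le_trans _ _ (2 * (r.*2.+2)%:R * ((kap * G w) * u ^+ r.*2.+1))).
  have a0 : 0 <= 2 * (r.*2.+2)%:R :> R by rewrite mulr_ge0.
  have u0 : 0 <= u ^+ r.*2.+1 by apply: exprn_ge0; exact: normr_ge0.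
  by apply: (ler_wpM2l a0); exact: (ler_wpM2r u0 HG).
have k1 : 0 <= 4 * r.+2%:R * kap by rewrite !mulr_ge0.
have := @young_pow R (4 * r.+2%:R * kap) u r.*2.+1 k1 (normr_ge0 _).
have -> : 2 * (4 * r.+2%:R * kap) = 8 * r.+2%:R * kap :> R by ring.
rewrite -doubleS -/Q => Yg.
have k2 : (2 * (r.+1.*2)%:R * kap) * u ^+ r.*2.+1 <= 4 * r.+2%:R * kap * u ^+ r.*2.+1.
  apply: ler_wpM2r; first by apply: exprn_ge0; exact: normr_ge0.
  apply: ler_wpM2r => //.
  have -> : 4 * r.+2%:R = 2 * (2 * r.+2)%:R :> R by rewrite natrM; ring.
  by rewrite ler_wpM2l// ler_nat; clear; lia.
have := ler_wpM2l (G0 w) (le_trans k2 Yg).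
have -> : 2 * (r.+1.*2)%:R * (kap * G w * u ^+ r.*2.+1) = G w * (2 * (r.+1.*2)%:R * kap * u ^+ r.*2.+1) by ring.
move/le_trans; apply; rewrite le_eqVlt; apply/orP; left; apply/eqP; ring.
Qed.

Let step r :
  Ex P (fun w => F w ^+ r.+1.*2) <= 8 * r.+1%:R * v * (Ex P (fun w => F w ^+ r.*2) + (8 * r.+1%:R * kap) ^+ r.*2).
Proof.
rewrite doubleS rec1 -pred_Sn.
set A := Ex P (fun w => F w ^+ r.*2).
set x := Ex P (fun w => G w * F w ^+ r.*2).
set Q := (8 * r.+1%:R * kap) ^+ r.*2.
have Q0 : 0 <= Q by exact: even_ge0.
have A0 : 0 <= A by apply: Ex_ge0 => w; exact: even_ge0.
have x0 : 0 <= x by apply: Ex_ge0 => w; apply: mulr_ge0 => //; exact: even_ge0.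
have xle : x <= 2 * v * (A + Q).
  have : 2 * (r.*2)%:R * Ex P (fun w => H w * F w ^+ r.*2.-1) <= x / 2 + v * Q.
    case: r @Q Q0 @A A0 @x x0 => [|r] Q Q0 A A0 x x0; last exact: key.
    by rewrite mulr0 mul0r addr_ge0// ?mulr_ge0// ?divr_ge0.
  by have := rec2 r.*2; rewrite -/x -/A => E; rewrite {}E; nra.
have -> : 8 * r.+1%:R * v * (A + Q) = 4 * r.+1%:R * (2 * v * (A + Q)) by ring.
apply: (@le_trans _ _ (4 * r.+1%:R * x)); last by rewrite ler_wpM2l// mulr_ge0.
rewrite ler_wpM2r//.
have -> : 4 * r.+1%:R = 2 * (2 * r.+1)%:R :> R by rewrite natrM; ring.
by rewrite ler_wpM2l// ler_nat; clear; lia.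
Qed.

(** Both terms in the bracket of [step] are at most B^(2r), so each step costs at most 16 r0 v <=
    B^2. One B, fitted to the top order r0, serves all lower orders. *)
Lemma qf_moment (B : R) (r0 r : nat) : 0 <= B -> 16 * r0%:R * v <= B ^+ 2 -> 8 * r0%:R * kap <= B ->
  (r <= r0)%N -> Ex P (fun w => F w ^+ r.*2) <= B ^+ r.*2.
Proof.
move=> B0 Bv Bk; elim: r => [|r IH] rr.
  by under eq_Ex do rewrite expr0; rewrite Ex_cst expr0.
apply: (le_trans (step r)).
have {}IH := IH (ltnW rr).
have rR : r.+1%:R <= r0%:R :> R by rewrite ler_nat.
have Q : (8 * r.+1%:R * kap) ^+ r.*2 <= B ^+ r.*2.
  rewrite lerXn2r ?nnegrE ?mulr_ge0//; apply: (le_trans _ Bk).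
  by rewrite ler_wpM2r// ler_wpM2l.
have Bp : 0 <= B ^+ r.*2 by exact: even_ge0.
apply: (@le_trans _ _ (8 * r.+1%:R * v * (2 * B ^+ r.*2))).
  by rewrite ler_wpM2l ?mulr_ge0//; move: IH Q; move: (Ex _ _) (_ ^+ r.*2) (B ^+ _) => a b c; lra.
have -> : 8 * r.+1%:R * v * (2 * B ^+ r.*2) = (16 * r.+1%:R * v) * B ^+ r.*2 by ring.
rewrite doubleS [B ^+ r.*2.+2]exprS [B ^+ r.*2.+1]exprS mulrA -expr2.
apply: ler_wpM2r => //; apply: (le_trans _ Bv).
by rewrite ler_wpM2r// ler_wpM2l.
Qed.

End concentration.

(** * Smoothed rectangles *)

Definition twopi {R : realType} : R := pi *+ 2.

Section clamp.
Context {R : realType}.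
Implicit Types x h : R.
Notation p2 := (@twopi R).

Lemma p2_gt0 : 0 < p2. Proof. by rewrite mulrn_wgt0// pi_gt0. Qed.
Lemma p2_neq0 : p2 != 0. Proof. by rewrite gt_eqF// p2_gt0. Qed.
(** The rational width 8 of the transition layers stems from this bound. *)
Lemma p2_le8 : p2 <= 8.
Proof. by have [/andP[_ h] _] := @pihalf_02_cos_pihalf R; rewrite /twopi mulr2n; lra. Qed.

Definition clamp x : R := Num.max 0 (Num.min x p2).

Lemma clamp_bounds x : 0 <= clamp x <= p2.
Proof. by rewrite /clamp le_max lexx/= ge_max (ltW p2_gt0) ge_min lexx orbT. Qed.

Lemma clamp_le0 x : x <= 0 -> clamp x = 0.
Proof. by move=> x0; rewrite /clamp max_l// ge_min x0. Qed.

Lemma clamp_ge x : p2 <= x -> clamp x = p2.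
Proof. by move=> h; rewrite /clamp min_r// max_r// ltW// p2_gt0. Qed.

Lemma clamp_id x : 0 <= x <= p2 -> clamp x = x.
Proof. by move=> /andP[h1 h2]; rewrite /clamp min_l// max_r. Qed.

Lemma max0_lip (a b : R) : `|Num.max 0 a - Num.max 0 b| <= `|a - b|.
Proof.
have := ler_norm (a - b); have := ler_norm (- (a - b)); rewrite normrN => h1 h2.
by case: (leP 0 a) => ?; case: (leP 0 b) => ?; rewrite ler_norml; apply/andP; split; lra.
Qed.

Lemma min_lip (q a b : R) : `|Num.min a q - Num.min b q| <= `|a - b|.
Proof.
have := ler_norm (a - b); have := ler_norm (- (a - b)); rewrite normrN => h1 h2.
by case: (leP a q) => ?; case: (leP b q) => ?; rewrite ler_norml; apply/andP; split; lra.
Qed.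

Lemma clamp_lip x h : `|clamp (x + h) - clamp x| <= `|h|.
Proof. by apply: (le_trans (max0_lip _ _)); apply: (le_trans (min_lip _ _ _)); rewrite addrC addKr. Qed.

(* Where the clamp is active, the argument is close to an end point. *)
Lemma clamp_cross x h : clamp (x + h) - clamp x = h \/
  (`|clamp x| <= `|clamp (x + h) - clamp x| \/ `|p2 - clamp x| <= `|clamp (x + h) - clamp x|).
Proof.
have q := p2_gt0.
have [x0|x0] := leP x 0; first by right; left; rewrite (clamp_le0 x0) normr0.
have [x1|x1] := leP p2 x; first by right; right; rewrite (clamp_ge x1) subrr normr0.
have cx : clamp x = x by rewrite clamp_id// !ltW.
have [y0|y0] := leP (x + h) 0; first by right; left; rewrite (clamp_le0 y0) sub0r normrN.
have [y1|y1] := leP p2 (x + h); first by right; right; rewrite (clamp_ge y1).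
by left; rewrite cx clamp_id ?ltW// addrC addKr.
Qed.

Lemma one_sub_cos_le (t : R) : `|1 - cos t| <= `|t|.
Proof.
have /andP[h1 h2] := one_sub_cos t; rewrite ger0_norm//.
have [t2|t2] := leP `|t| 2.
  apply: (le_trans h2); rewrite -real_normK ?num_real//.
  have := normr_ge0 t; move: (`|t|) t2 => u u2 u0; nra.
have := cos_geN1 t; lra.
Qed.

Lemma cos_p2 t : cos (p2 - t) = cos t.
Proof. by rewrite cosB /twopi cos2pi sin2pi mul1r mul0r addr0. Qed.
Lemma sin_p2 t : sin (p2 - t) = - sin t.
Proof. by rewrite sinB /twopi cos2pi sin2pi mul1r mul0r sub0r. Qed.

(** Clamping keeps the second-order bound because b' vanishes at both end points: when the clamp
    cuts the step, [clamp_cross] bounds b' at the base point by the length actually travelled, so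
    the part cut off is again quadratic in h. *)
Lemma clamp_taylor (b b' : R -> R) (B : R) x h : 0 <= B ->
  (forall u v, `|b (u + v) - b u - v * b' u| <= B * v ^+ 2) ->
  (forall u, `|b' u| <= `|u|) -> (forall u, `|b' u| <= `|p2 - u|) ->
  `|b (clamp (x + h)) - b (clamp x) - h * b' (clamp x)| <= (B + 2) * h ^+ 2.
Proof.
move=> B0 H H0 H1.
set c := clamp x; set k := clamp (x + h) - c.
have kh : `|k| <= `|h| by exact: clamp_lip.
have k2 : k ^+ 2 <= h ^+ 2 by rewrite -[k ^+ 2]real_normK ?num_real// -[h ^+ 2]real_normK ?num_real// lerXn2r ?nnegrE.
have E : clamp (x + h) = c + k by rewrite /k; ring.
have Hck := H c k.
have -> : b (clamp (x + h)) - b c - h * b' c = (b (c + k) - b c - k * b' c) + (k - h) * b' c by rewrite E; ring.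
apply: (le_trans (ler_normD _ _)); rewrite [X in _ <= X]mulrDl; apply: lerD.
  by apply: (le_trans Hck); apply: ler_wpM2l.
have [kE|kE] := clamp_cross x h; first by rewrite /k kE subrr mul0r normr0 mulr_ge0// sqr_ge0.
have bk : `|b' c| <= `|k| by case: kE => kE; [apply: (le_trans (H0 c))|apply: (le_trans (H1 c))].
rewrite normrM -[h ^+ 2]real_normK ?num_real// expr2 mulrA.
apply: ler_pM => //; last exact: (le_trans bk).
by apply: (le_trans (ler_normB _ _)); lra.
Qed.

(* A step from 1 to 0 on [0, 2 pi], and its first two derivatives. *)
Definition kst x : R := 1 - (clamp x - sin (clamp x)) / p2.
Definition kst1 x : R := - (1 - cos (clamp x)) / p2.
Definition kst2 x : R := - sin (clamp x) / p2.

Lemma p2_ge2 : 2 <= p2. Proof. by have := @pi_ge2 R; rewrite /twopi mulr2n; lra. Qed.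

Lemma kst_le0 x : x <= 0 -> kst x = 1.
Proof. by move=> h; rewrite /kst clamp_le0// sin0 subrr mul0r subr0. Qed.

Lemma kst_ge8 x : 8 <= x -> kst x = 0.
Proof.
move=> h; rewrite /kst clamp_ge; last first.
  exact: le_trans p2_le8 h.
by rewrite /twopi sin2pi subr0 divff ?subrr// p2_neq0.
Qed.

Lemma kst2_le0 x : x <= 0 -> kst2 x = 0 /\ kst1 x = 0.
Proof. by move=> h; rewrite /kst2 /kst1 clamp_le0// sin0 cos0 subrr oppr0 mul0r. Qed.

Lemma kst2_ge8 x : 8 <= x -> kst2 x = 0 /\ kst1 x = 0.
Proof.
move=> h; rewrite /kst2 /kst1 clamp_ge; last first.
  exact: le_trans p2_le8 h.
by rewrite /twopi sin2pi cos2pi subrr oppr0 mul0r.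
Qed.

Lemma sin_le_id (t : R) : 0 <= t -> sin t <= t.
Proof. by move=> t0; have := abs_sin_le t; rewrite (ger0_norm t0); apply: le_trans; exact: ler_norm. Qed.

Lemma kst_bounds x : 0 <= kst x <= 1.
Proof.
have /andP[c0 c1] := clamp_bounds x; rewrite /kst; apply/andP; split.
  rewrite subr_ge0 ler_pdivrMr ?p2_gt0// mul1r.
  have : sin (p2 - clamp x) <= p2 - clamp x by apply: sin_le_id; rewrite subr_ge0.
  by rewrite sin_p2; lra.
by rewrite gerBl divr_ge0 ?(ltW p2_gt0)// subr_ge0 sin_le_id.
Qed.

Lemma norm_div_p2 (t c : R) : `|t| <= c -> 0 <= c -> `|t / p2| <= c / 2.
Proof.
move=> tc c0; rewrite normrM normfV (gtr0_norm p2_gt0).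
by apply: ler_pM => //; [rewrite invr_ge0 ltW// p2_gt0|rewrite lef_pV2 ?posrE ?p2_gt0// p2_ge2].
Qed.

Lemma kst1_le x : `|kst1 x| <= 1.
Proof.
have -> : (1 : R) = 2 / 2 by field.
apply: norm_div_p2 => //; rewrite normrN.
have := cos_geN1 (clamp x); have := cos_le1 (clamp x).
move=> ? ?; rewrite ger0_norm; lra.
Qed.

Lemma kst2_le x : `|kst2 x| <= 1.
Proof.
have -> : (1 : R) = 2 / 2 by field.
apply: norm_div_p2 => //; rewrite normrN; have := sin_max (clamp x); lra.
Qed.

Lemma kst_taylor x h : `|kst (x + h) - kst x - h * kst1 x| <= 2 * h ^+ 2.
Proof.
have t1 (u v : R) : `|u + v - sin (u + v) - (u - sin u) - v * (1 - cos u)| <= 2 * v ^+ 2.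
  have -> : u + v - sin (u + v) - (u - sin u) - v * (1 - cos u) = - (sin (u + v) - sin u - v * cos u) by ring.
  by rewrite normrN; exact: sin_taylor.
have t2 (u : R) : `|1 - cos u| <= `|p2 - u| by rewrite -cos_p2; exact: one_sub_cos_le.
have := @clamp_taylor (fun u => u - sin u) (fun u => 1 - cos u) 2 x h (ler0n _ _) t1 one_sub_cos_le t2.
move=> H; rewrite /kst /kst1.
set A := clamp (x + h); set B := clamp x.
have -> : 1 - (A - sin A) / p2 - (1 - (B - sin B) / p2) - h * (- (1 - cos B) / p2) =
   (- (A - sin A - (B - sin B) - h * (1 - cos B))) / p2 by move: (p2^-1) => i; ring.
have -> : 2 * h ^+ 2 = ((2 + 2) * h ^+ 2) / 2 by field.
by apply: norm_div_p2; rewrite ?normrN// mulr_ge0 ?sqr_ge0.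
Qed.

Lemma kst1_taylor x h : `|kst1 (x + h) - kst1 x - h * kst2 x| <= 2 * h ^+ 2.
Proof.
have t1 (u v : R) : `|1 - cos (u + v) - (1 - cos u) - v * sin u| <= 2 * v ^+ 2.
  have -> : 1 - cos (u + v) - (1 - cos u) - v * sin u = - (cos (u + v) - cos u + v * sin u) by ring.
  by rewrite normrN; exact: cos_taylor.
have t2 (u : R) : `|sin u| <= `|p2 - u| by rewrite -normrN -sin_p2; exact: abs_sin_le.
have := @clamp_taylor (fun u => 1 - cos u) (fun u => sin u) 2 x h (ler0n _ _) t1 (@abs_sin_le R) t2.
move=> H; rewrite /kst1 /kst2.
set A := clamp (x + h); set B := clamp x.
have -> : - (1 - cos A) / p2 - - (1 - cos B) / p2 - h * (- sin B / p2) =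
   (- (1 - cos A - (1 - cos B) - h * sin B)) / p2 by move: (p2^-1) => i; ring.
have -> : 2 * h ^+ 2 = ((2 + 2) * h ^+ 2) / 2 by field.
by apply: norm_div_p2; rewrite ?normrN// mulr_ge0 ?sqr_ge0.
Qed.

Lemma lip_abs_cos (u v : R) : `|cos u - cos v| <= `|u - v|.
Proof.
wlog uv : u v / v <= u.
  move=> H; case: (leP v u) => [/H//|/ltW /H]; by rewrite distrC (distrC v).
have [c [_ _ ->]] := @MVT_le R cos (fun x => - sin x) v u uv (fun x => is_derive_cos x).
by rewrite normrM ler_piMl// normrN sin_max.
Qed.

Lemma lip_abs_sin (u v : R) : `|sin u - sin v| <= `|u - v|.
Proof.
wlog uv : u v / v <= u.
  move=> H; case: (leP v u) => [/H//|/ltW /H]; by rewrite distrC (distrC v).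
have [c [_ _ ->]] := @MVT_le R sin cos v u uv (fun x => is_derive_sin x).
by rewrite normrM ler_piMl// cos_max.
Qed.

Lemma kst_lip x h : `|kst (x + h) - kst x| <= `|h|.
Proof.
rewrite /kst; set A := clamp (x + h); set B := clamp x.
have -> : 1 - (A - sin A) / p2 - (1 - (B - sin B) / p2) = (- (A - B - (sin A - sin B))) / p2 by move: (p2^-1) => i; ring.
have -> : `|h| = (2 * `|h|) / 2 by field.
apply: norm_div_p2; rewrite ?mulr_ge0//.
rewrite normrN; apply: (le_trans (ler_normB _ _)).
have := clamp_lip x h; have := lip_abs_sin A B; rewrite -/A -/B; lra.
Qed.

Lemma kst1_lip x h : `|kst1 (x + h) - kst1 x| <= `|h|.
Proof.
rewrite /kst1; set A := clamp (x + h); set B := clamp x.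
have -> : - (1 - cos A) / p2 - - (1 - cos B) / p2 = (cos A - cos B) / p2 by move: (p2^-1) => i; ring.
have -> : `|h| = (2 * `|h|) / 2 by field.
apply: norm_div_p2; rewrite ?mulr_ge0//.
have := clamp_lip x h; have := lip_abs_cos A B; rewrite -/A -/B; have := normr_ge0 h; lra.
Qed.

Lemma measurable_clamp : measurable_fun [set: R] clamp.
Proof. by apply: measurable_maxr => //; exact: measurable_minr. Qed.

Lemma measurable_kst : measurable_fun [set: R] kst.
Proof.
apply: measurable_funB => //; apply: measurable_funM => //; apply: measurable_funB; first exact: measurable_clamp.
exact: (measurableT_comp (@measurable_sin R) measurable_clamp).
Qed.
Lemma measurable_kst1 : measurable_fun [set: R] kst1.
Proof.
apply: measurable_funM => //; apply: measurableT_comp => //; apply: measurable_funB => //.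
exact: (measurableT_comp (@measurable_cos R) measurable_clamp).
Qed.
Lemma measurable_kst2 : measurable_fun [set: R] kst2.
Proof.
apply: measurable_funM => //; apply: measurableT_comp => //.
exact: (measurableT_comp (@measurable_sin R) measurable_clamp).
Qed.

End clamp.

(** * Uniform Lipschitz and Taylor bounds *)

Section LT.
Context {J : finType} {R : realType}.
Implicit Types (f g : (J -> R) -> R) (u k : J -> R).

(** Unlike in [BT], f itself may be unbounded, as the log-sum-exp function is; the Lipschitz bound
    takes the place of the bound on f. *)
Definition LT f (df : J -> (J -> R) -> R) : Prop :=
  [/\ cmeas f, (forall j, cmeas (df j)) & exists B : R, 0 <= B /\ forall u,
   (forall j, `|df j u| <= B) /\ forall k,
     `|f (fun j => u j + k j) - f u| <= B * L1 k /\
     `|f (fun j => u j + k j) - f u - \sum_j df j u * k j| <= B * L1 k ^+ 2].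

Lemma LT_BT f df (B0 : R) : LT f df -> (forall u, `|f u| <= B0) -> BT f df.
Proof.
move=> [mf mdf [B [B0' H]]] fB; split => //; exists (B + `|B0|); split; first exact: addr_ge0.
move=> u; have [h1 h2] := H u; split.
- by apply: (le_trans (fB u)); apply: (le_trans (ler_norm _)); rewrite lerDr.
- by move=> j; apply: (le_trans (h1 j)); rewrite lerDl.
- by move=> k; have [_ h] := h2 k; apply: (le_trans h); apply: ler_wpM2r; rewrite ?sqr_ge0 ?lerDl.
Qed.

(** The conditions on b concern values of f only, because the exponential satisfies them on the
    nonpositive half-line and not everywhere. *)
Lemma LT_comp (b b' : R -> R) f df : LT f df -> measurable_fun setT b -> measurable_fun setT b' ->
  (forall u v, [/\ `|b' (f u)| <= 1, `|b (f v) - b (f u)| <= `|f v - f u| &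
     `|b (f v) - b (f u) - (f v - f u) * b' (f u)| <= 2 * (f v - f u) ^+ 2]) ->
  LT (fun u => b (f u)) (fun j u => b' (f u) * df j u).
Proof.
move=> [mf mdf [B [B0 H]]] mb mb' hb; split.
- by move=> d T Y mY; exact: (measurableT_comp mb (mf _ _ _ mY)).
- move=> j; apply: cmeasM; last exact: mdf.
  by move=> d T Y mY; exact: (measurableT_comp mb' (mf _ _ _ mY)).
exists (B + 2 * B ^+ 2); split; first by rewrite addr_ge0// mulr_ge0// sqr_ge0.
have BB : B <= B + 2 * B ^+ 2 by rewrite lerDl mulr_ge0// sqr_ge0.
move=> u; have [h1 h2] := H u; split.
  move=> j; have [b1 _ _] := hb u u; rewrite normrM; apply: (le_trans _ BB).
  by rewrite -[leRHS]mul1r; apply: ler_pM.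
move=> k; have [h3 h4] := h2 k; set v := (fun j => u j + k j) in h3 h4 *.
have [b1 b2 b3] := hb u v; have l0 := L1_ge0 k.
split.
  by apply: (le_trans b2); apply: (le_trans h3); apply: ler_wpM2r.
under eq_bigr do rewrite -mulrA; rewrite -mulr_sumr.
have -> : b (f v) - b (f u) - b' (f u) * (\sum_j df j u * k j) =
  (b (f v) - b (f u) - (f v - f u) * b' (f u)) + b' (f u) * (f v - f u - \sum_j df j u * k j) by ring.
apply: (le_trans (ler_normD _ _)); rewrite [X in _ <= X]mulrDl addrC; apply: lerD.
  by rewrite normrM -[leRHS]mul1r; apply: ler_pM.
apply: (le_trans b3); rewrite -mulrA -exprMn; apply: ler_wpM2l => //.
by rewrite -[leLHS]real_normK ?num_real// lerXn2r ?nnegrE// mulr_ge0.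
Qed.

Lemma LT_scale c f df : LT f df -> LT (fun u => c * f u) (fun j u => c * df j u).
Proof.
move=> [mf mdf [B [B0 H]]]; split.
- by apply: cmeasM => //; exact: cmeas_cst.
- by move=> j; apply: cmeasM => //; exact: cmeas_cst.
exists (`|c| * B); split; first exact: mulr_ge0.
move=> u; have [h1 h2] := H u; split; first by move=> j; rewrite normrM ler_wpM2l.
move=> k; have [h3 h4] := h2 k; split; first by rewrite -mulrBr normrM -mulrA ler_wpM2l.
under eq_bigr do rewrite -mulrA.
by rewrite -mulr_sumr -!mulrBr normrM -mulrA; apply: ler_wpM2l.
Qed.

Lemma LT_sub f df g dg : LT f df -> LT g dg -> LT (fun u => f u - g u) (fun j u => df j u - dg j u).
Proof.
move=> [mf mdf [B [B0 H]]] [mg mdg [C [C0 H']]]; split.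
- move=> d T Y mY; apply: measurable_funB; [exact: mf|exact: mg].
- move=> j d T Y mY; apply: measurable_funB; [exact: mdf|exact: mdg].
exists (B + C); split; first exact: addr_ge0.
move=> u; have [h1 h2] := H u; have [h1' h2'] := H' u; split.
  by move=> j; apply: (le_trans (ler_normB _ _)); apply: lerD.
move=> k; have [h3 h4] := h2 k; have [h3' h4'] := h2' k; set v := (fun j => u j + k j) in h3 h4 h3' h4' *.
split.
  have -> : f v - g v - (f u - g u) = (f v - f u) - (g v - g u) by ring.
  by apply: (le_trans (ler_normB _ _)); rewrite [X in _ <= X]mulrDl; apply: lerD.
under eq_bigr do rewrite mulrBl; rewrite sumrB.
have -> : f v - g v - (f u - g u) - (\sum_j df j u * k j - \sum_j dg j u * k j) =
 (f v - f u - \sum_j df j u * k j) - (g v - g u - \sum_j dg j u * k j) by ring.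
by apply: (le_trans (ler_normB _ _)); rewrite [X in _ <= X]mulrDl; apply: lerD.
Qed.

Lemma LT_mul f df g dg (M : R) : 0 <= M -> LT f df -> LT g dg -> (forall u, `|f u| <= M) -> (forall u, `|g u| <= M) ->
  LT (fun u => f u * g u) (fun j u => df j u * g u + f u * dg j u).
Proof.
move=> M0 [mf mdf [B [B0 H]]] [mg mdg [C [C0 H']]] fM gM; split.
- exact: cmeasM.
- by move=> j; apply: cmeasD; apply: cmeasM.
exists (B * M + M * C + B * C); split; first by rewrite !addr_ge0 ?mulr_ge0.
move=> u; have [h1 h2] := H u; have [h1' h2'] := H' u.
have le1 : B * M + M * C <= B * M + M * C + B * C by rewrite lerDl mulr_ge0.
split.
  move=> j; apply: (le_trans _ le1); apply: (le_trans (ler_normD _ _)); rewrite !normrM.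
  by apply: lerD; apply: ler_pM.
move=> k; have [h3 h4] := h2 k; have [h3' h4'] := h2' k; set v := (fun j => u j + k j) in h3 h4 h3' h4' *.
have l0 := L1_ge0 k.
split.
  have -> : f v * g v - f u * g u = (f v - f u) * g v + f u * (g v - g u) by ring.
  apply: (@le_trans _ _ ((B * M + M * C) * L1 k)); last exact: ler_wpM2r.
  apply: (le_trans (ler_normD _ _)); rewrite !normrM [X in _ <= X]mulrDl; apply: lerD.
    by rewrite mulrAC; apply: ler_pM.
  by rewrite -mulrA; apply: ler_pM.
have -> : \sum_j (df j u * g u + f u * dg j u) * k j = (\sum_j df j u * k j) * g u + f u * (\sum_j dg j u * k j).
  rewrite mulr_suml mulr_sumr -big_split/=; apply: eq_bigr => j _; ring.
have -> : f v * g v - f u * g u - ((\sum_j df j u * k j) * g u + f u * (\sum_j dg j u * k j)) =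
  (f v - f u - \sum_j df j u * k j) * g u + f u * (g v - g u - \sum_j dg j u * k j) + (f v - f u) * (g v - g u) by ring.
apply: (le_trans (ler_normD _ _)); rewrite [X in _ <= X]mulrDl; apply: lerD; last first.
  rewrite normrM expr2 mulrACA; by apply: ler_pM.
apply: (le_trans (ler_normD _ _)); rewrite !normrM [X in _ <= X]mulrDl; apply: lerD.
  by rewrite mulrAC; apply: ler_pM.
by rewrite -mulrA; apply: ler_pM.
Qed.

Lemma LT_coord c x (j0 : J) : LT (fun u => c * (u j0 - x)) (fun j _ => c * (j == j0)%:R).
Proof.
split.
- move=> d T Y mY; apply: measurable_funM => //; exact: measurable_funB.
- by move=> j; exact: cmeas_cst.
exists `|c|; split => // u; split.
  by move=> j; rewrite normrM ler_piMr//; case: eqP => _; rewrite ?normr0 ?normr1.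
move=> k; have E : c * (u j0 + k j0 - x) - c * (u j0 - x) = c * k j0 by ring.
rewrite E; split; first by rewrite normrM ler_wpM2l// le_L1.
rewrite (bigD1 j0)//= big1; last by move=> j /negbTE ->; rewrite mulr0 mul0r.
by rewrite eqxx mulr1 addr0 subrr normr0 mulr_ge0// sqr_ge0.
Qed.

End LT.

(** * Log-sum-exp and soft-max weights *)

Section lse.
Context {R : realType}.

Lemma expR1_le4 : expR 1 <= 4 :> R.
Proof.
have h : 1 / 2 <= expR (- (1 / 2)) :> R by have := expR_ge1Dx (- (1 / 2) : R); lra.
have : expR (1 / 2) <= 2 :> R.
  by rewrite -[expR _]invrK -expRN invf_ple ?posrE ?expR_gt0// (le_trans _ h)//; lra.
have -> : expR (1 : R) = expR (1 / 2) * expR (1 / 2) by rewrite -expRD; congr expR; field.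
by move=> h2; apply: (@le_trans _ _ (2 * 2)); [apply: ler_pM => //; rewrite expR_ge0|lra].
Qed.

Lemma expR_nonpos_lip (x y : R) : x <= 0 -> y <= 0 -> `|expR y - expR x| <= `|y - x|.
Proof.
move=> x0 y0; wlog xy : x y x0 y0 / x <= y.
  move=> H; case: (leP x y) => [|/ltW] h; first exact: H.
  by rewrite distrC (distrC y); exact: H.
have [c [_ cy ->]] := @MVT_le R expR expR x y xy (fun x => is_derive_expR x).
rewrite normrM ler_piMl// ger0_norm ?expR_ge0// expR_le1; exact: le_trans y0.
Qed.

Lemma expR_nonpos_taylor (x y : R) : x <= 0 -> y <= 0 ->
  `|expR y - expR x - (y - x) * expR x| <= 2 * (y - x) ^+ 2.
Proof.
move=> x0 y0.
have E : exists2 c, `|c - x| <= `|y - x| & c <= 0 /\ expR y - expR x = expR c * (y - x).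
  case: (leP x y) => [|/ltW] h.
    have [c [xc cy e]] := @MVT_le R expR expR x y h (fun x => is_derive_expR x).
    exists c; last by split => //; exact: le_trans y0.
    by rewrite !ger0_norm ?subr_ge0// lerB.
  have [c [xc cy e]] := @MVT_le R expR expR y x h (fun x => is_derive_expR x).
  exists c; last by split; [exact: le_trans x0|rewrite -opprB e; ring].
  by rewrite distrC (distrC y) !ger0_norm ?subr_ge0// lerB.
have [c cx [c0 ->]] := E.
have -> : expR c * (y - x) - (y - x) * expR x = (expR c - expR x) * (y - x) by ring.
rewrite normrM; apply: (@le_trans _ _ (`|y - x| * `|y - x|)).
  by apply: ler_wpM2r => //; apply: (le_trans (expR_nonpos_lip x0 c0)).
by rewrite -expr2 real_normK ?num_real// ler_peMl ?sqr_ge0// ler1n.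
Qed.

Context {J : finType} (j0 : J) (x : J -> R) (phi : R).
Hypothesis phi0 : 0 <= phi.
Implicit Types u k : J -> R.

Definition esum u : R := \sum_j expR (phi * (u j - x j)).
Definition lse u : R := ln (esum u).
(** Written as one exponential of a nonpositive number, so that [LT_comp] applies; [smaxE] gives the
    usual quotient. *)
Definition smax j u : R := expR (phi * (u j - x j) - lse u).

Lemma esum_gt0 u : 0 < esum u.
Proof. by rewrite /esum (bigD1 j0)//= ltr_pwDl ?expR_gt0// sumr_ge0// => j _; exact: expR_ge0. Qed.

Lemma esum_ge u j : expR (phi * (u j - x j)) <= esum u.
Proof. by rewrite /esum (bigD1 j)//= lerDl sumr_ge0// => i _; exact: expR_ge0. Qed.

Lemma lse_ge u j : phi * (u j - x j) <= lse u.
Proof. by rewrite /lse -[leLHS]expRK ler_ln ?posrE ?expR_gt0 ?esum_gt0//; exact: esum_ge. Qed.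

Lemma smaxE j u : smax j u = expR (phi * (u j - x j)) / esum u.
Proof. by rewrite /smax expRD expRN lnK// posrE esum_gt0. Qed.

Lemma smax_ge0 j u : 0 <= smax j u. Proof. exact: expR_ge0. Qed.
Lemma smax_le1 j u : smax j u <= 1.
Proof. by rewrite /smax expR_le1 subr_le0 lse_ge. Qed.
Lemma sum_smax u : \sum_j smax j u = 1.
Proof.
under eq_bigr do rewrite smaxE; rewrite -mulr_suml divff// gt_eqF//; exact: esum_gt0.
Qed.

Lemma cmeas_lse : cmeas lse.
Proof.
move=> d T Y mY; apply: (measurableT_comp (@measurable_ln R)).
apply: measurable_sum => j; apply: measurableT_comp => //; apply: measurable_funM => //; exact: measurable_funB.
Qed.

Lemma cmeas_smax j : cmeas (smax j).
Proof.
move=> d T Y mY; apply: measurableT_comp => //; apply: measurable_funB; last exact: cmeas_lse.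
apply: measurable_funM => //; exact: measurable_funB.
Qed.

Lemma lse_incr u k : exists2 W : R, 0 < W & lse (fun j => u j + k j) - lse u = ln W /\
  W = \sum_j smax j u * expR (phi * k j).
Proof.
exists (\sum_j smax j u * expR (phi * k j)).
  rewrite (bigD1 j0)//= ltr_pwDl ?mulr_gt0 ?expR_gt0// sumr_ge0// => j _; rewrite mulr_ge0 ?expR_ge0//.
split => //; rewrite /lse.
have -> : esum (fun j => u j + k j) = esum u * (\sum_j smax j u * expR (phi * k j)).
  rewrite /esum mulr_sumr; apply: eq_bigr => j _.
  rewrite smaxE mulrA mulrCA divff ?gt_eqF ?esum_gt0// mulr1 -expRD; congr expR; ring.
rewrite lnM ?posrE ?esum_gt0//; last first.
  rewrite (bigD1 j0)//= ltr_pwDl ?mulr_gt0 ?expR_gt0// sumr_ge0// => j _; rewrite mulr_ge0 ?expR_ge0//.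
by rewrite addrC addKr.
Qed.

(** The increment is ln W, where W is the mean of exp (phi k_j) under the soft-max weights. It lies
    between the mean [hb] of phi k_j and W - 1, and these differ by at most 4 M^2 when M <= 1. *)
Lemma LT_lse : LT lse (fun j u => phi * smax j u).
Proof.
split; first exact: cmeas_lse.
  by move=> j; apply: cmeasM; [exact: cmeas_cst|exact: cmeas_smax].
exists (phi + 4 * phi ^+ 2); split; first by rewrite addr_ge0// mulr_ge0 ?sqr_ge0.
have pp : phi <= phi + 4 * phi ^+ 2 by rewrite lerDl mulr_ge0 ?sqr_ge0.
move=> u; split.
  move=> j; rewrite ger0_norm ?mulr_ge0 ?smax_ge0//; apply: (le_trans _ pp).
  by rewrite ler_piMr// smax_le1.
move=> k; have [W W0 [-> WE]] := lse_incr u k.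
pose M := phi * L1 k; pose hb := \sum_j smax j u * (phi * k j).
have -> : \sum_j phi * smax j u * k j = hb by apply: eq_bigr => j _; ring.
have M0 : 0 <= M by rewrite mulr_ge0 ?L1_ge0.
have hM j : `|phi * k j| <= M by rewrite normrM ger0_norm// ler_wpM2l// le_L1.
have hj j : phi * k j <= M by apply: le_trans (hM j); exact: ler_norm.
have hj' j : - M <= phi * k j by have := hM j; rewrite ler_norml => /andP[].
have cst c : \sum_j smax j u * c = c by rewrite -mulr_suml sum_smax mul1r.
have Wu : W <= expR M.
  by rewrite WE -[leRHS]cst; apply: ler_sum => j _; rewrite ler_wpM2l ?smax_ge0// ler_expR.
have Wl : expR (- M) <= W.
  by rewrite WE -[leLHS]cst; apply: ler_sum => j _; rewrite ler_wpM2l ?smax_ge0// ler_expR.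
have lu : ln W <= M by rewrite -[leRHS]expRK ler_ln ?posrE ?expR_gt0.
have ll : - M <= ln W by rewrite -[leLHS]expRK ler_ln ?posrE ?expR_gt0.
have hbu : hb <= M by rewrite -[leRHS]cst; apply: ler_sum => j _; rewrite ler_wpM2l ?smax_ge0.
have hbl : - M <= hb by rewrite -[leLHS]cst; apply: ler_sum => j _; rewrite ler_wpM2l ?smax_ge0.
split.
  apply: (@le_trans _ _ M); first by rewrite ler_norml ll.
  by rewrite /M; apply: ler_wpM2r => //; exact: L1_ge0.
apply: (@le_trans _ _ (4 * M ^+ 2)); last first.
  by rewrite /M exprMn mulrA; apply: ler_wpM2r; rewrite ?sqr_ge0// lerDr.
(* Jensen's inequality, from the tangent to the exponential at [hb]. *)
have J1 : hb <= ln W.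
  rewrite -[leLHS]expRK ler_ln ?posrE ?expR_gt0//.
  rewrite -[leLHS]mulr1 -ler_pdivlMl ?expR_gt0// -expRN WE mulr_sumr.
  rewrite -(sum_smax u) -[leLHS]addr0 -[X in _ + X](subrr hb) -{2}(cst hb) -sumrB -big_split/=.
  apply: ler_sum => j _; rewrite [leRHS]mulrCA -[X in _ <= _ * X]expRD.
  have -> : smax j u + (smax j u * (phi * k j) - smax j u * hb) = smax j u * (1 + (- hb + phi * k j)) by ring.
  by rewrite ler_wpM2l ?smax_ge0// expR_ge1Dx.
rewrite ger0_norm ?subr_ge0//.
(* For M > 1 the trivial bound 2 M on the difference is already below 4 M^2. *)
have [M1|M1] := leP M 1; last first.
  apply: (@le_trans _ _ (2 * M)); first lra.
  have : M * 1 <= M * M by apply: ler_wpM2l => //; exact: ltW.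
  by rewrite expr2; lra.
have W2 : W <= 1 + (hb + 4 * M ^+ 2).
  have -> : 1 + (hb + 4 * M ^+ 2) = \sum_j (smax j u + (smax j u * (phi * k j) + smax j u * (4 * M ^+ 2))).
    by rewrite !big_split/= sum_smax cst.
  rewrite WE; apply: ler_sum => j _.
  have -> : smax j u + (smax j u * (phi * k j) + smax j u * (4 * M ^+ 2)) = smax j u * (1 + phi * k j + 4 * M ^+ 2) by ring.
  rewrite ler_wpM2l ?smax_ge0//.
  have := @expR_taylor R (phi * k j); rewrite ler_norml => /andP[_].
  have : (phi * k j) ^+ 2 * expR `|phi * k j| <= M ^+ 2 * 4.
    apply: ler_pM; rewrite ?sqr_ge0 ?expR_ge0//; first by rewrite -[leLHS]real_normK ?num_real// lerXn2r ?nnegrE.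
    by apply: (le_trans _ expR1_le4); rewrite ler_expR; exact: le_trans M1.
  lra.
have : ln W <= W - 1.
  by have := expR_ge1Dx (ln W); rewrite lnK ?posrE//; lra.
lra.
Qed.

Lemma LT_smax j : LT (smax j) (fun i u => smax j u * (phi * (i == j)%:R - phi * smax i u)).
Proof.
have H := LT_sub (LT_coord phi (x j) j) LT_lse.
apply: (@LT_comp J R expR expR _ _ H) => // u v.
have n0 w : phi * (w j - x j) - lse w <= 0 by rewrite subr_le0 lse_ge.
split; first by rewrite ger0_norm ?expR_ge0// expR_le1.
- exact: expR_nonpos_lip.
- exact: expR_nonpos_taylor.
Qed.
End lse.

(** * The smoothed indicator of a rectangle *)

Section smooth_step.
Context {R : realType} {J : finType} (j0 : J) (x : J -> R) (psi L : R).
Hypotheses (psi0 : 0 < psi) (L1' : 1 <= L) (DL : ln #|J|%:R <= L).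
Implicit Types u : J -> R.
(** Since L is at least the logarithm of the number of coordinates, [lam] exceeds psi max_j (u_j -
    x_j) by at most 1. *)
Let phi : R := psi * L.
Let lam u := L^-1 * lse x phi u.
Let q j u : R := L^-1 * (phi * smax x phi j u).

Let L0 : 0 < L. Proof. exact: lt_le_trans L1'. Qed.
Let phi0 : 0 <= phi. Proof. by rewrite mulr_ge0// ltW. Qed.
Let pE : psi / psi = 1. Proof. by rewrite divff// gt_eqF. Qed.
Let qE j u : q j u = psi * smax x phi j u.
Proof. by rewrite /q /phi !mulrA -(mulrA _ psi) mulrCA mulVf ?gt_eqF// mulr1. Qed.

Definition sstep u : R := kst (lam u).
Definition sstep1 j u : R := kst1 (lam u) * q j u.
Definition sstep2 j k u : R :=
  kst2 (lam u) * q k u * q j u + kst1 (lam u) * (L^-1 * (phi * (smax x phi j u * (phi * (k == j)%:R - phi * smax x phi k u)))).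

Let LTlam : LT lam q. Proof. exact: (LT_scale _ (LT_lse j0 x phi0)). Qed.

Lemma LT_sstep : LT sstep sstep1.
Proof.
apply: (@LT_comp J R kst kst1 _ _ LTlam measurable_kst measurable_kst1) => u v; split.
- exact: kst1_le.
- by have := kst_lip (lam u) (lam v - lam u); rewrite [lam u + _]addrC subrK.
- by have := kst_taylor (lam u) (lam v - lam u); rewrite [lam u + _]addrC subrK.
Qed.

Lemma BT_sstep : BT sstep sstep1.
Proof.
apply: (LT_BT (B0 := 1) LT_sstep).
by move=> u; have /andP[h1 h2] := kst_bounds (lam u); rewrite ger0_norm.
Qed.

Lemma BT_sstep1 j : BT (sstep1 j) (fun k => sstep2 j k).
Proof.
have q_le u : `|q j u| <= 1 + psi.
  rewrite qE ger0_norm ?mulr_ge0 ?smax_ge0 ?(ltW psi0)//.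
  by apply: (@le_trans _ _ psi); [rewrite ler_piMr ?smax_le1// ltW|rewrite lerDr].
have k1_le u : `|kst1 (lam u)| <= 1 + psi.
  by apply: (le_trans (kst1_le _)); rewrite lerDl ltW.
apply: (@LT_BT J R _ _ ((1 + psi) * (1 + psi))); last first.
  by move=> u; rewrite normrM; apply: ler_pM.
have H1 : LT (fun u => kst1 (lam u)) (fun k u => kst2 (lam u) * q k u).
  apply: (@LT_comp J R kst1 kst2 _ _ LTlam measurable_kst1 measurable_kst2) => u v; split.
  - exact: kst2_le.
  - by have := kst1_lip (lam u) (lam v - lam u); rewrite [lam u + _]addrC subrK.
  - by have := kst1_taylor (lam u) (lam v - lam u); rewrite [lam u + _]addrC subrK.
have H2 := LT_scale L^-1 (LT_scale phi (LT_smax j0 x phi0 j)).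
have p0 : 0 <= 1 + psi by rewrite addr_ge0// ltW.
exact: (LT_mul p0 H1 H2).
Qed.

Lemma sstep_bounds u : 0 <= sstep u <= 1. Proof. exact: kst_bounds. Qed.

(** The soft-max weights sum to 1, so the dimension enters only through L: the contributions are
    psi^2 and twice psi phi = psi^2 L. *)
Lemma sum_sstep2 u : \sum_j \sum_k `|sstep2 j k u| <= 3 * psi ^+ 2 * L.
Proof.
pose s j := smax x phi j u.
have s0 j : 0 <= s j by exact: smax_ge0.
have S1 : \sum_j s j = 1 by exact: sum_smax.
have B j k : `|sstep2 j k u| <= psi ^+ 2 * (s j * s k) + psi * phi * (s j * (k == j)%:R + s j * s k).
  apply: (le_trans (ler_normD _ _)); apply: lerD.
    rewrite -mulrA normrM -[leRHS]mul1r; apply: ler_pM => //; first exact: kst2_le.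
    by rewrite !qE -/(s j) -/(s k) ger0_norm ?mulr_ge0 ?(ltW psi0)//; lra.
  rewrite normrM -[leRHS]mul1r; apply: ler_pM => //; first exact: kst1_le.
  have -> : L^-1 * (phi * (smax x phi j u * (phi * (k == j)%:R - phi * smax x phi k u))) =
     psi * phi * (s j * (k == j)%:R - s j * s k).
    rewrite /phi; have := @mulVf _ L; rewrite gt_eqF// => /(_ isT) e.
    transitivity ((L^-1 * L) * (psi * (psi * L) * (s j * (k == j)%:R - s j * s k))); last by rewrite e mul1r.
    by rewrite /s /phi; ring.
  have pp : 0 <= psi * phi by rewrite mulr_ge0// ltW.
  rewrite normrM (ger0_norm pp); apply: ler_wpM2l => //.
  by apply: (le_trans (ler_normB _ _)); rewrite !ger0_norm ?mulr_ge0.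
have C j : \sum_k `|sstep2 j k u| <= psi ^+ 2 * s j + psi * phi * (s j + s j).
  apply: (le_trans (ler_sum _ (fun k _ => B j k))).
  rewrite big_split/= -!mulr_sumr S1 big_split/= -!mulr_sumr S1 mulr1 (bigD1 j)//= big1; last by move=> k /negbTE ->.
  by rewrite eqxx addr0 mulr1.
apply: (le_trans (ler_sum _ (fun j _ => C j))).
rewrite big_split/= -!mulr_sumr big_split/= S1 /phi.
have : 0 <= psi ^+ 2 * (L - 1) by rewrite mulr_ge0 ?sqr_ge0 ?subr_ge0.
lra.
Qed.

(** The margin 1/psi makes each summand of [esum] at most exp (- L), hence at most one over the
    number of coordinates, and [lam] nonpositive. *)
Lemma sstep_low u : (forall j, u j <= x j - psi^-1) -> sstep u = 1 /\ forall j k, sstep2 j k u = 0.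
Proof.
move=> h.
have l0 : lam u <= 0.
  rewrite /lam pmulr_rle0 ?invr_gt0//.
  rewrite /lse -[leRHS]ln1 ler_ln ?posrE ?(esum_gt0 j0)//.
  have D0 : 0 < #|J|%:R :> R by rewrite ltr0n; apply/card_gt0P; exists j0.
  apply: (@le_trans _ _ (\sum_(j : J) #|J|%:R^-1)); last first.
    by rewrite sumr_const -[X in X <= _]mulr_natr mulVf// gt_eqF.
  apply: ler_sum => j _.
  rewrite -[X in _ <= X^-1]lnK ?posrE// -expRN ler_expR.
  apply: (@le_trans _ _ (- L)); last by rewrite lerN2.
  have : phi * (u j - x j) <= phi * (- psi^-1) by apply: ler_wpM2l => //; have := h j; lra.
  have -> : phi * - psi^-1 = - (L * (psi / psi)) by rewrite /phi; ring.
  by rewrite pE mulr1.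
split; first exact: kst_le0.
by move=> j k; rewrite /sstep2; have [-> ->] := kst2_le0 l0; rewrite !mul0r addr0.
Qed.

Lemma sstep_high u j : x j + 8 / psi <= u j -> sstep u = 0 /\ forall i k, sstep2 i k u = 0.
Proof.
move=> h.
have l8 : 8 <= lam u.
  rewrite /lam mulrC ler_pdivlMr//.
  apply: (le_trans _ (lse_ge j0 x phi u j)).
  have : phi * (8 / psi) <= phi * (u j - x j) by apply: ler_wpM2l => //; lra.
  have -> : phi * (8 / psi) = 8 * L * (psi / psi) by rewrite /phi; ring.
  by rewrite pE mulr1; apply: le_trans.
split; first exact: kst_ge8.
by move=> i k; rewrite /sstep2; have [-> ->] := kst2_ge8 l8; rewrite !mul0r addr0.
Qed.
End smooth_step.

(** * Anti-concentration *)

Section exp_moments.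
Context {R : realType} {I : finType} {d} {T : measurableType d} (P : probability T R).
Variables (Z : I -> T -> R) (K : I -> I -> R).
Hypothesis GZ : gauss P Z K.

Lemma gauss_exp (i : I) (a : R) : 0 < K i i ->
  Li P (fun w => expR (a * Z i w)) /\ Ex P (fun w => expR (a * Z i w)) = expR (a ^+ 2 * K i i / 2).
Proof.
move=> K0.
have s0 : Num.sqrt (K i i) != 0 by rewrite sqrtr_eq0 -ltNge.
have G1 := gauss_lin GZ (fun (_ : unit) (j : I) => (j == i)%:R).
have E1 (y : I -> R) : dot (fun j => (j == i)%:R) y = y i.
  by rewrite /dot (bigD1 i)//= eqxx mul1r big1 ?addr0// => j /negbTE ->; rewrite mul0r.
have Y1 : (fun (_ : unit) (w : T) => dot (fun j => (j == i)%:R) (fun i => Z i w)) = (fun _ w => Z i w).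
  by apply/funext => _; apply/funext => w; rewrite E1.
have K1 : (fun _ _ : unit => quad K (fun j => (j == i)%:R) (fun j => (j == i)%:R)) = (fun _ _ => K i i).
  apply/funext => _; apply/funext => _; rewrite /quad.
  transitivity (\sum_i0 (i0 == i)%:R * dot (fun j => (j == i)%:R) (K i0)).
    apply: eq_bigr => i0 _; rewrite /dot mulr_sumr; apply: eq_bigr => j _; ring.
  by rewrite -[RHS](E1 (fun i0 => K i0 i)); apply: eq_bigr => i0 _; rewrite E1.
rewrite Y1 K1 in G1.
have G0 := gauss_normal s0; rewrite sqr_sqrtr ?ltW// in G0.
have mh : cmeas (fun y : unit -> R => expR (a * y tt)).
  apply: (cmeas1 (h := fun x => expR (a * x))); apply: measurableT_comp => //; exact: measurable_funM.
have [e h] := gauss_law G0 G1 mh.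
split; first by apply: h; exact: Li_expR.
rewrite -e.
have eq_le1 : `|1 : R| <= 1 by rewrite normr1.
have := @normal_shift R _ s0 a (fun _ => 1) 1 (measurable_cst _) (fun _ => eq_le1).
rewrite Ex_cst sqr_sqrtr ?(ltW K0)// => /(congr1 (fun z => expR (a ^+ 2 * K i i / 2) * z)).
rewrite mulr1 mulrA -expRD addrN expR0 mul1r => ->.
by apply: eq_Ex => w; rewrite mul1r.
Qed.
End exp_moments.

Section BT_TP.
Context {I : finType} {R : realType}.

Lemma BT_TP (f : (I -> R) -> R) df : BT f df -> TP f df.
Proof.
move=> H; have := TP_comp H (fun j => TP_coord j); apply: eq_TP => // i x.
rewrite (bigD1 i)//= eqxx mulr1 big1 ?addr0// => j; rewrite eq_sym => /negbTE ->; exact: mulr0.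
Qed.
End BT_TP.

Definition rect {J : finType} {R : realType} (x u : J -> R) : R := ([forall j, u j < x j] : nat)%:R.

Section rect.
Context {J : finType} {R : realType}.
Implicit Types x u : J -> R.

Lemma rect_bounds x u : 0 <= rect x u <= 1.
Proof. by rewrite /rect; case: ([forall j, u j < x j]); rewrite ?lexx ?ler01. Qed.

Lemma rectE x u : rect x u = \prod_(j : J) ((u j < x j)%R : nat)%:R.
Proof.
rewrite /rect; case: forallP => h; first by rewrite big1// => j _; rewrite h.
move/existsNP: h => [j /negP hj]; by rewrite (bigD1 j)//= (negbTE hj) mul0r.
Qed.

Lemma cmeas_rect x : cmeas (rect x).
Proof.
move=> d T Y mY; rewrite (_ : (fun w => _) = (fun w => \prod_(j : J) ((Y j w < x j)%R : nat)%:R)); last first.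
  by apply/funext => w; rewrite rectE.
by apply: measurable_prod => j _; exact: mlt.
Qed.
End rect.

Section antic.
Context {R : realType}.
(** The interval [2, 3] lies between pi/2 and 3 pi/2, where the cosine is nonpositive; so the slope
    is at least 1/(2 pi) >= 1/8 in absolute value. *)
Lemma kst1_mid (x : R) : 2 <= x <= 3 -> 1 <= 8 * - kst1 x.
Proof.
move=> /andP[h1 h2].
have p := @pi_ge2 R; have /andP[_ p4] := (pihalf_02_cos_pihalf R).1.
have cx : clamp x = x by rewrite clamp_id//; apply/andP; split; rewrite ?/twopi ?mulr2n; lra.
have c0 : cos x <= 0.
  have := @cos_ge0_pihalf R (x - pi); rewrite -[X in 0 <= X]opprK -cosDpi subrK oppr_ge0; apply.
  by apply/andP; split; lra.
rewrite /kst1 cx -mulNr opprK mulrA ler_pdivlMr ?p2_gt0// mul1r.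
have := @p2_le8 R; lra.
Qed.
End antic.

Section nazarov.
Context {R : realType} {J : finType} (j0 : J) {d} {T : measurableType d} (P : probability T R).
Variables (Z : J -> T -> R) (K : J -> J -> R) (s2 k2 L : R).
Hypothesis GZ : gauss P Z K.
Hypothesis symK : forall i j, K i j = K j i.
Hypotheses (s20 : 0 < s2) (Ks : forall j, s2 <= K j j) (Kk : forall j, K j j <= k2).
Hypotheses (L1' : 1 <= L) (DL : ln #|J|%:R <= L).

Let kap := Num.sqrt k2.
Let sL := Num.sqrt L.
Let k20 : 0 < k2. Proof. exact: lt_le_trans (le_trans (Ks j0) (Kk j0)). Qed.
Let kap0 : 0 < kap. Proof. by rewrite sqrtr_gt0. Qed.
Let L0 : 0 < L. Proof. exact: lt_le_trans L1'. Qed.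
Let sL0 : 0 < sL. Proof. by rewrite sqrtr_gt0. Qed.
Let t := 2 * kap * sL.
Let s := sL / kap.
Let s0 : 0 < s. Proof. by rewrite divr_gt0. Qed.

(** An integrable bound for max_j |u_j|: the excess of |u_j| over t is at most exp (s (|u_j| - t)) /
    s. The choices s t = 2 L and s^2 k2 = L let the exponential moments beat the number of
    coordinates, and the mean is of order sqrt (k2 L). *)
Let mx (u : J -> R) : R := t + s^-1 * (\sum_j (expR (s * u j) + expR (- s * u j))) * expR (- (s * t)).

Let mx_ge u j : `|u j| <= mx u.
Proof.
have e1 : `|u j| <= t + s^-1 * expR (s * (`|u j| - t)).
  have := expR_ge1Dx (s * (`|u j| - t)) => h.
  have : s^-1 * (s * (`|u j| - t)) <= s^-1 * expR (s * (`|u j| - t)).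
    by apply: ler_wpM2l; [rewrite invr_ge0 ltW|lra].
  by rewrite mulrA mulVf ?gt_eqF// mul1r; lra.
apply: (le_trans e1); rewrite lerD2l -mulrA; apply: ler_wpM2l; first by rewrite invr_ge0 ltW.
rewrite mulrBr expRD; apply: ler_wpM2r; first exact: expR_ge0.
rewrite (bigD1 j)//=; apply: (@le_trans _ _ (expR (s * u j) + expR (- s * u j))); last first.
  by rewrite lerDl sumr_ge0// => i _; rewrite addr_ge0// expR_ge0.
case: (ger0P (u j)) => _; first by rewrite lerDl expR_ge0.
by rewrite mulrN mulNr lerDr expR_ge0.
Qed.

Let Kj0 j : 0 < K j j. Proof. exact: lt_le_trans (Ks j). Qed.

Let Li_mx : Li P (fun w => mx (fun j => Z j w)).
Proof.
apply: LiD; first exact: Li_cst.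
rewrite (_ : (fun w => _) = (fun w => (s^-1 * expR (- (s * t))) * \sum_j (expR (s * Z j w) + expR (- s * Z j w)))); last first.
  by apply/funext => w; ring.
apply: LiZ; apply: Li_sum => j; apply: LiD; [exact: (proj1 (gauss_exp GZ s (Kj0 j)))|exact: (proj1 (gauss_exp GZ (- s) (Kj0 j)))].
Qed.

Let Ex_mx : Ex P (fun w => mx (fun j => Z j w)) <= 4 * kap * sL.
Proof.
have E : Ex P (fun w => mx (fun j => Z j w)) = t + (s^-1 * expR (- (s * t))) * \sum_j (2 * expR (s ^+ 2 * K j j / 2)).
  have -> : Ex P (fun w => mx (fun j => Z j w)) = Ex P (fun w => t + (s^-1 * expR (- (s * t))) * \sum_j (expR (s * Z j w) + expR (- s * Z j w))).
    by apply: eq_Ex => w; rewrite /mx; ring.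
  have Lj j : Li P (fun w => expR (s * Z j w) + expR (- s * Z j w)).
    by apply: LiD; [exact: (proj1 (gauss_exp GZ s (Kj0 j)))|exact: (proj1 (gauss_exp GZ (- s) (Kj0 j)))].
  rewrite ExD ?Ex_cst; [|exact: Li_cst|by apply: LiZ; apply: Li_sum].
  rewrite ExZ; last by apply: Li_sum.
  rewrite Ex_sum//; congr (_ + _ * _); apply: eq_bigr => j _.
  have [a1 b1] := gauss_exp GZ s (Kj0 j); have [a2 b2] := gauss_exp GZ (- s) (Kj0 j).
  by rewrite ExD// b1 b2 sqrrN; ring.
rewrite E.
have st : s * t = 2 * L.
  have e : kap / kap = 1 by rewrite divff// gt_eqF.
  transitivity (2 * (sL ^+ 2) * (kap / kap)); first by rewrite /s /t; ring.
  by rewrite e mulr1 sqr_sqrtr// ltW.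
have s2E : s ^+ 2 * k2 = L.
  by rewrite /s expr_div_n !sqr_sqrtr ?ltW// divfK// gt_eqF.
have D0 : 0 < #|J|%:R :> R by rewrite ltr0n; apply/card_gt0P; exists j0.
have B : \sum_j (2 * expR (s ^+ 2 * K j j / 2)) <= 2 * expR L * expR (L / 2).
  apply: (@le_trans _ _ (\sum_(j : J) 2 * expR (L / 2))).
    apply: ler_sum => j _; rewrite ler_wpM2l// ler_expR -s2E.
    by apply: ler_wpM2r => //; apply: ler_wpM2l; [exact: sqr_ge0|exact: Kk].
  rewrite sumr_const -[X in X <= _]mulr_natr mulrAC; apply: ler_wpM2r; first exact: expR_ge0.
  by apply: ler_wpM2l => //; rewrite -[leLHS]lnK ?posrE// ler_expR.
have : s^-1 * expR (- (s * t)) * (\sum_j (2 * expR (s ^+ 2 * K j j / 2))) <= 2 * kap * sL.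
  apply: (@le_trans _ _ (s^-1 * expR (- (s * t)) * (2 * expR L * expR (L / 2)))).
    by apply: ler_wpM2l => //; rewrite mulr_ge0 ?expR_ge0// invr_ge0 ltW.
  have -> : s^-1 * expR (- (s * t)) * (2 * expR L * expR (L / 2)) = 2 * s^-1 * expR (- (L / 2)).
    have -> : - (L / 2) = - (s * t) + (L + L / 2) by rewrite st; field.
    by rewrite !expRD; ring.
  have e1 : expR (- (L / 2)) <= 1 by rewrite expR_le1 oppr_le0 divr_ge0// ltW.
  have sV : s^-1 <= kap * sL.
    have sL1 : 1 <= sL by have := ler_wsqrtr L1'; rewrite sqrtr1.
    rewrite /s invf_div; apply: ler_wpM2l; first exact: ltW.
    by apply: (le_trans _ sL1); rewrite invf_le1.
  have : s^-1 * expR (- (L / 2)) <= (kap * sL) * 1.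
    by apply: ler_pM; rewrite ?expR_ge0// invr_ge0 ltW.
  lra.
by rewrite /t; lra.
Qed.

Section layer.
Variables (x : J -> R) (psi : R).
Hypothesis psi0 : 0 < psi.
(** Doubling L halves the excess of the soft maximum: if psi max_j (u_j - x_j) lies in [2, 5/2],
    then [lam] lies in [2, 3], where [kst1_mid] applies. *)
Let L' := 2 * L.
Let L'1 : 1 <= L'. Proof. by rewrite /L'; have := L1'; lra. Qed.
Let phi := psi * L'.
Let phi0 : 0 <= phi. Proof. by rewrite mulr_ge0 ?(ltW psi0)// (le_trans _ L'1). Qed.
Let eta := L'^-1.
Let eta0 : 0 < eta. Proof. by rewrite invr_gt0 (lt_le_trans _ L'1). Qed.
Let etaphi : eta * phi = psi.
Proof. by rewrite /eta /phi mulrCA mulVf ?mulr1// gt_eqF// (lt_le_trans _ L'1). Qed.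
Let sg := smax x phi.
Let lam u := L'^-1 * lse x phi u.
(** The offset [eta] keeps G away from 0: differentiating the soft-max weights contributes phi G
    times a nonnegative quantity, and phi eta = psi makes this contribution comparable with that of
    the derivative of the step. *)
Let G u := eta + 1 - sstep x psi L' u.
Let F j u := sg j u * G u.
Let dF j k u := sg j u * (phi * (k == j)%:R - phi * sg k u) * G u + sg j u * (0 - sstep1 x psi L' k u).

Let G_bounds u : eta <= G u <= 1 + 1.
Proof.
have /andP[h1 h2] := sstep_bounds x psi L' u.
have : eta <= 1 by rewrite /eta invf_le1// (lt_le_trans _ L'1).
by rewrite /G => h3; apply/andP; split; lra.
Qed.

Let TPF j : TP (F j) (dF j).
Proof.
apply: BT_TP.
have HG : LT G (fun k u => 0 - sstep1 x psi L' k u).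
  apply: LT_sub (LT_sstep j0 x psi0 L'1).
  split; [exact: cmeas_cst|by move=> k; exact: cmeas_cst|exists 0; split=> // u; split; first by move=> k; rewrite normr0].
  by move=> k; rewrite subrr big1 ?subr0 ?normr0 ?mul0r// => k' _; rewrite mul0r.
have sgb i u : `|sg i u| <= 2 by rewrite ger0_norm ?smax_ge0// (le_trans (smax_le1 j0 x phi i u))// ler1n.
have Gb u : `|G u| <= 2.
  have /andP[h1 h2] := G_bounds u; rewrite ger0_norm; [lra|exact: le_trans (ltW eta0) h1].
have H := LT_mul (ler0n R 2) (LT_smax j0 x phi0 j) HG (sgb j) Gb.
apply: (LT_BT (B0 := 4) H) => u; rewrite normrM; have -> : (4 : R) = 2 * 2 by lra.
by apply: ler_pM.
Qed.

Let key : Ex P (fun w => \sum_j Z j w * F j (fun j => Z j w)) =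
  Ex P (fun w => \sum_j \sum_k K j k * dF j k (fun j => Z j w)).
Proof.
have H j := Lall_TP GZ (TPF j).
have LZ j : Lall P (Z j) by exact: Lall_gauss GZ j.
rewrite Ex_sum; last by move=> j; apply: Lall_Li; apply: LallM; [exact: LZ|exact: (proj1 (H j))].
rewrite Ex_sum; last first.
  by move=> j; apply: Li_sum => k; apply: LiZ; apply: Lall_Li; exact: (proj2 (H j)).
apply: eq_bigr => j _; rewrite (ibp GZ symK j (TPF j)) Ex_sum; last first.
  by move=> k; apply: LiZ; apply: Lall_Li; exact: (proj2 (H j)).
by apply: eq_bigr => k _; rewrite ExZ//; apply: Lall_Li; exact: (proj2 (H j)).
Qed.

(** The derivatives give phi G (A - Q) + psi (- kst1) Q. Here A - Q is the weighted mean of the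
    forms of K at e_j - p, hence nonnegative, and phi G >= psi >= psi (- kst1). So Q may be replaced
    by A, which involves only variances; no invertibility of K enters. *)
Let lower u : s2 * psi * - kst1 (lam u) <= \sum_j \sum_k K j k * dF j k u.
Proof.
pose p j := sg j u.
have p0 j : 0 <= p j by exact: smax_ge0.
have S1 : \sum_j p j = 1 by exact: (sum_smax j0).
pose A := \sum_j p j * K j j; pose Q := quad K p p.
have q0 : 0 <= - kst1 (lam u).
  rewrite /kst1 -mulNr opprK; apply: divr_ge0; last exact: ltW p2_gt0.
  by rewrite subr_ge0 cos_le1.
have q1 : - kst1 (lam u) <= 1 by have := kst1_le (lam u); rewrite ler_norml => /andP[? _]; lra.
have E : \sum_j \sum_k K j k * dF j k u = phi * G u * (A - Q) + psi * - kst1 (lam u) * Q.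
  have E1 j : \sum_k K j k * dF j k u = phi * G u * (p j * K j j) + (psi * - kst1 (lam u) - phi * G u) * \sum_k p j * K j k * p k.
    transitivity (\sum_k (phi * G u * p j * (K j k * (k == j)%:R) + (psi * - kst1 (lam u) - phi * G u) * (p j * K j k * p k))).
      apply: eq_bigr => k _; rewrite /dF /sstep1 -/phi -/(lam u) -/(sg k u) -/(p k) -/(p j).
      have -> : L'^-1 * (phi * p k) = psi * p k by rewrite mulrA etaphi.
      ring.
    rewrite big_split/= -!mulr_sumr; congr (_ + _).
    rewrite (bigD1 j)//= eqxx mulr1 big1 ?addr0 ?mulrA// => k /negbTE ->; exact: mulr0.
  under eq_bigr do rewrite E1.
  rewrite big_split/= -!mulr_sumr -/A -[\sum_i \sum_k _]/Q; ring.
have V0 : 0 <= A - Q.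
  have : 0 <= \sum_j p j * quad K (fun i => (i == j)%:R - p i) (fun i => (i == j)%:R - p i).
    by apply: sumr_ge0 => j _; apply: mulr_ge0 => //; exact: (quad_ge0 GZ).
  have e j : quad K (fun i => (i == j)%:R - p i) (fun i => (i == j)%:R - p i) = K j j - \sum_i K j i * p i - \sum_i K j i * p i + Q.
    have e1 (f g : J -> R) : quad K (fun i => f i - g i) (fun i => f i - g i) = quad K f f - quad K f g - quad K g f + quad K g g.
      rewrite /quad -!sumrB -big_split/=; apply: eq_bigr => i _; rewrite -!sumrB -big_split/=.
      by apply: eq_bigr => k _; ring.
    rewrite e1 -/Q; congr (_ - _ - _ + _).
    - rewrite /quad (bigD1 j)//= [X in _ + X]big1 ?addr0; last by move=> i /negbTE ->; apply: big1 => k _; rewrite !mul0r.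
      by rewrite (bigD1 j)//= eqxx mul1r mulr1 big1 ?addr0// => k /negbTE ->; rewrite mulr0.
    - rewrite /quad (bigD1 j)//= [X in _ + X]big1 ?addr0; last by move=> i /negbTE ->; apply: big1 => k _; rewrite !mul0r.
      by apply: eq_bigr => k _; rewrite eqxx mul1r.
    - rewrite /quad; apply: eq_bigr => i _; rewrite (bigD1 j)//= eqxx mulr1 big1 ?addr0; last by move=> k /negbTE ->; rewrite mulr0.
      by rewrite mulrC symK.
  under eq_bigr do rewrite e.
  have -> : \sum_j p j * (K j j - \sum_i K j i * p i - \sum_i K j i * p i + Q) = A - Q - Q + (\sum_j p j) * Q.
    have eQ : Q = \sum_j p j * \sum_i K j i * p i.
      by apply: eq_bigr => j _; rewrite mulr_sumr; apply: eq_bigr => i _; rewrite mulrA.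
    rewrite (eq_bigr (fun j => p j * K j j - p j * (\sum_i K j i * p i) - p j * (\sum_i K j i * p i) + p j * Q)); last by move=> j _; ring.
    by rewrite big_split/= !sumrB -eQ -mulr_suml.
  by rewrite S1 mul1r addrNK.
have A2 : s2 <= A.
  rewrite -[leLHS]mul1r -S1 mulr_suml; apply: ler_sum => j _; exact: ler_wpM2l.
rewrite E.
have /andP[G1 G2] := G_bounds u.
have h1 : psi * - kst1 (lam u) * (A - Q) <= phi * G u * (A - Q).
  apply: ler_wpM2r => //; rewrite -etaphi (mulrC eta) -mulrA; apply: ler_wpM2l => //.
  by apply: (le_trans _ G1); rewrite ler_piMr// ltW.
have h2 : psi * - kst1 (lam u) * s2 <= psi * - kst1 (lam u) * A.
  by apply: ler_wpM2l => //; rewrite mulr_ge0// ltW.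
lra.
Qed.

Let mlam : cmeas (fun u => - kst1 (lam u)).
Proof.
move=> d' T' Y mY; apply: measurableT_comp => //; apply: (measurableT_comp (@measurable_kst1 R)).
by apply: measurable_funM => //; exact: (cmeas_lse x phi mY).
Qed.

(** In [key] the side without derivatives is at most twice max_j |Z_j|, because the weights sum to 1
    and G <= 2; the other side is bounded below by [lower]. *)
Lemma layer_mid : Ex P (fun w => - kst1 (lam (fun j => Z j w))) <= 8 * kap * sL / (psi * s2).
Proof.
have mZ := gauss_meas GZ.
have H j := Lall_TP GZ (TPF j).
have LZ j : Lall P (Z j) by exact: Lall_gauss GZ j.
have Lk : Li P (fun w => - kst1 (lam (fun j => Z j w))).
  by apply: (@Li_bnd _ _ _ P _ 1); [exact: mlam|move=> w; rewrite normrN; exact: kst1_le].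
rewrite ler_pdivlMr ?mulr_gt0// mulrC.
have -> : psi * s2 = s2 * psi by rewrite mulrC.
rewrite -ExZ//.
apply: (@le_trans _ _ (Ex P (fun w => \sum_j \sum_k K j k * dF j k (fun j => Z j w)))).
  apply: Ex_le; first exact: LiZ.
    by apply: Li_sum => j; apply: Li_sum => k; apply: LiZ; apply: Lall_Li; exact: (proj2 (H j)).
  by move=> w; exact: lower.
rewrite -key.
apply: (@le_trans _ _ (Ex P (fun w => 2 * mx (fun j => Z j w)))); last first.
  by rewrite ExZ//; have := Ex_mx; lra.
apply: Ex_le; last 1 first.
- move=> w; set u := fun j => Z j w.
  apply: (le_trans (ler_norm _)); apply: (le_trans (ler_norm_sum _ _ _)).
  have S1 : \sum_j sg j u = 1 by exact: (sum_smax j0).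
  apply: (@le_trans _ _ (\sum_j sg j u * (2 * mx u))); last by rewrite -mulr_suml S1 mul1r.
  apply: ler_sum => j _.
  have /andP[G1 G2] := G_bounds u.
  have G0 : 0 <= G u by apply: le_trans G1; exact: ltW.
  rewrite /F !normrM (ger0_norm (smax_ge0 _ _ _ _)) (ger0_norm G0) mulrCA; apply: ler_wpM2l; first exact: smax_ge0.
  by rewrite mulrC; apply: ler_pM => //; exact: (mx_ge u j).
- by apply: Li_sum => j; apply: Lall_Li; apply: LallM; [exact: LZ|exact: (proj1 (H j))].
- exact: LiZ.
Qed.

(* The soft maximum of [psi * (u - x)] exceeds the maximum by at most 1/2. *)
Lemma layer_mid_ge u : rect (fun j => x j + 5 / 2 / psi) u - rect (fun j => x j + 2 / psi) u <= 8 * - kst1 (lam u).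
Proof.
have q0 : 0 <= - kst1 (lam u).
  rewrite /kst1 -mulNr opprK; apply: divr_ge0; last exact: ltW p2_gt0.
  by rewrite subr_ge0 cos_le1.
rewrite /rect; case: forallP => h1; last first.
  by apply: (@le_trans _ _ 0); [case: ([forall _, _]) => /=; rewrite ?subrr ?sub0r ?lerN10|rewrite mulr_ge0].
case: forallP => h2; first by rewrite subrr mulr_ge0.
rewrite subr0; apply: kst1_mid.
move/existsNP: h2 => [j /negP]; rewrite -leNgt => hj.
have pE : psi / psi = 1 by rewrite divff// gt_eqF.
have L'0 : 0 < L' by exact: lt_le_trans L'1.
rewrite /lam mulrC ler_pdivlMr// ler_pdivrMr//; apply/andP; split.
  apply: (le_trans _ (lse_ge j0 x phi u j)).
  have : phi * (2 / psi) <= phi * (u j - x j) by apply: ler_wpM2l => //; lra.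
  have -> : phi * (2 / psi) = 2 * L' * (psi / psi) by rewrite /phi; ring.
  by rewrite pE mulr1.
have D0 : 0 < #|J|%:R :> R by rewrite ltr0n; apply/card_gt0P; exists j0.
rewrite /lse -[leRHS]expRK ler_ln ?posrE ?expR_gt0 ?(esum_gt0 j0)//.
apply: (@le_trans _ _ (\sum_(i : J) expR (5 / 2 * L'))).
  apply: ler_sum => i _; rewrite ler_expR.
  have : phi * (u i - x i) <= phi * (5 / 2 / psi) by apply: ler_wpM2l => //; have := h1 i; lra.
  have -> : phi * (5 / 2 / psi) = 5 / 2 * L' * (psi / psi) by rewrite /phi; ring.
  by rewrite pE mulr1.
rewrite sumr_const -[X in X <= _]mulr_natr -[X in _ * X]lnK ?posrE// -expRD ler_expR /L'; have := DL; have := L1'; lra.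
Qed.
End layer.

Lemma rect_layer (x : J -> R) (w : R) : 0 < w ->
  Ex P (fun z => rect (fun j => x j + w) (fun j => Z j z)) - Ex P (fun z => rect x (fun j => Z j z))
   <= 128 * w * Num.sqrt k2 * Num.sqrt L / s2.
Proof.
move=> w0.
have mZ := gauss_meas GZ.
have Lr y : Li P (fun z => rect y (fun j => Z j z)).
  apply: (@Li_bnd _ _ _ P _ 1); first exact: (cmeas_rect y mZ).
  by move=> z; have /andP[h1 h2] := rect_bounds y (fun j => Z j z); rewrite ger0_norm.
(* With this [psi] the layer between 2/psi and (5/2)/psi has width w. The constant 128 is 8 from
   [kst1_mid], 8 from [layer_mid] and 2 from 1/psi = 2 w. *)
pose psi := (2 * w)^-1; have psi0 : 0 < psi by rewrite invr_gt0 mulr_gt0.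
pose x' j := x j - 2 / psi.
have e1 : (fun j => x j + w) = (fun j => x' j + 5 / 2 / psi).
  by apply/funext => j; rewrite /x' /psi invrK; field.
have e2 : x = (fun j => x' j + 2 / psi) by apply/funext => j; rewrite /x'; ring.
rewrite e1 [X in _ - X](_ : _ = Ex P (fun z => rect (fun j => x' j + 2 / psi) (fun j => Z j z))); last first.
  by apply: eq_Ex => z; rewrite -e2.
rewrite -ExB//.
apply: (@le_trans _ _ (8 * (8 * kap * sL / (psi * s2)))); last first.
  by rewrite /psi invfM invrK le_eqVlt; apply/orP; left; apply/eqP; rewrite /kap /sL; ring.
apply: (le_trans _ (ler_wpM2l (ler0n R 8) (layer_mid x' psi0))).
have Lk : Li P (fun z => - kst1 ((2 * L)^-1 * lse x' (psi * (2 * L)) (fun j => Z j z))).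
  apply: (@Li_bnd _ _ _ P _ 1); last by move=> z; rewrite normrN; exact: kst1_le.
  apply: measurableT_comp => //; apply: (measurableT_comp (@measurable_kst1 R)).
  by apply: measurable_funM => //; exact: (cmeas_lse x' _ mZ).
rewrite -ExZ//; apply: Ex_le; [exact: LiB|exact: LiZ|].
by move=> z; exact: layer_mid_ge.
Qed.
End nazarov.

(** * Comparison of quadratic forms with a Gaussian vector *)

Lemma two_sided {R : realType} (ev ez a1 b1 a2 b2 z1 z2 n s : R) : `|a1 - b1| <= s -> `|a2 - b2| <= s ->
  ev <= a1 -> b1 <= z1 -> z1 - ez <= n -> a2 <= ev -> z2 <= b2 -> ez - z2 <= n -> `|ev - ez| <= n + s.
Proof. by rewrite !ler_norml => /andP[? ?] /andP[? ?] ? ? ? ? ? ?; apply/andP; split; lra. Qed.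

Section comparison.
Context {R : realType} {I J : finType} (j0 : J).
Context {d} {T : measurableType d} {d'} {T' : measurableType d'}.
Variables (P : probability T R) (P' : probability T' R).
Variables (Y : I -> T -> R) (K : I -> I -> R) (Z : J -> T' -> R) (S : J -> J -> R).
Variable Q : J -> I -> I -> R.
Hypothesis GY : gauss P Y K.
Hypothesis GZ : gauss P' Z S.
Hypothesis symK : forall i j, K i j = K j i.
Hypothesis symQ : forall j a b, Q j a b = Q j b a.
(** Symmetrised matrix of the form y -> 2 (Q_j y)' K (Q_k y), so that its centred version is a [qf]
    to which moment bounds apply; [SE] says that Z has its mean as covariance. *)
Let Q2 j k a b := quad K (Q j a) (Q k b) + quad K (Q k a) (Q j b).
Hypothesis SE : forall j k, S j k = mtr K (Q2 j k).

Let symS j k : S j k = S k j.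
Proof. by rewrite !SE /mtr; apply: eq_bigr => a _; apply: eq_bigr => b _; rewrite /Q2 addrC. Qed.

Let O : J -> J -> R := fun _ _ => 0.
Let KS := blk K S.
Let PPP := PP P P'.
Let W := pairf Y Z.
(** A single Gaussian family on the product space carries Y and Z, so both integrations by parts are
    instances of one; a form in Y alone becomes a form in [W] with a zero block. *)
Let GW : gauss PPP W KS. Proof. exact: gauss_pair. Qed.
Let symKS i j : KS i j = KS j i.
Proof. by case: i => i; case: j => j; rewrite /KS /blk. Qed.
Let QO j := blk (Q j) O.
Let symQO j a b : QO j a b = QO j b a.
Proof. by case: a; case: b => //= a b; rewrite symQ. Qed.

Let lft (u : I + J -> R) (i : I) : R := u (inl i).
Let V j (y : I -> R) := qf K (Q j) y.
Let U s c (u : I + J -> R) (j : J) : R := s * V j (lft u) + c * u (inr j).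
Let dU s c j (t : I + J) (u : I + J -> R) : R :=
  s * (2 * match t with inl i => mv (Q j) (lft u) i | inr _ => 0 end) + c * (t == inr j)%:R.

Let qfO j u : qf KS (QO j) u = V j (lft u).
Proof.
rewrite /V /qf quad_blk [X in _ + X - _](_ : _ = 0) ?addr0; last first.
  by rewrite /quad big1// => a _; apply: big1 => b _; rewrite mulr0 mul0r.
congr (_ - _).
rewrite /mtr big_sumType/= [X in _ + X]big1 ?addr0; last first.
  by move=> a _; apply: big1 => -[b|b] _ /=; rewrite mul0r.
by apply: eq_bigr => a _; rewrite big_sumType/= [X in _ + X]big1 ?addr0// => b _; rewrite mul0r.
Qed.

Let mvO j u t : mv (QO j) u t = match t with inl i => mv (Q j) (lft u) i | inr _ => 0 end.
Proof.
rewrite /mv dot_sum; case: t => i /=.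
  by rewrite [X in _ + X](_ : _ = 0) ?addr0// /dot big1// => b _; rewrite mul0r.
by rewrite /dot big1 ?add0r ?big1// => b _; rewrite mul0r.
Qed.

Let TP_U s c j : TP (fun u => U s c u j) (dU s c j).
Proof.
have H := TP_add (TP_scale s (TP_qf KS (symQO j))) (TP_scale c (TP_coord (inr j))).
by apply: eq_TP H => [u|t u]; rewrite /U /dU ?qfO ?mvO.
Qed.

Let Vv j (w : T * T') := V j (fun i => Y i w.1).
Let UW s c (w : T * T') := U s c (fun t => W t w).

Let ibpV s c j (f : (J -> R) -> R) df : BT f df ->
  Ex PPP (fun w => Vv j w * f (UW s c w)) =
  Ex PPP (fun w => s * \sum_k df k (UW s c w) * (2 * quad K (mv (Q j) (fun i => Y i w.1)) (mv (Q k) (fun i => Y i w.1)))).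
Proof.
move=> Hf; have H := TP_comp Hf (fun k => TP_U s c k).
have := ibp2 GW symKS (QO j) H; rewrite (@eq_Ex _ _ _ PPP _ (fun w => Vv j w * f (UW s c w))); last first.
  by move=> w; rewrite qfO.
move=> ->; apply: eq_Ex => w; rewrite quad_blk.
rewrite [X in _ + X](_ : _ = 0) ?addr0; last first.
  by rewrite /quad big1// => a _; apply: big1 => b _; rewrite mvO !mul0r.
set y := fun i => Y i w.1.
rewrite (_ : (fun i => mv _ _ (inl i)) = mv (Q j) y); last by apply/funext => i; rewrite mvO.
rewrite (_ : (fun i => \sum_k _) = (fun i => \sum_k (df k (UW s c w) * (s * 2)) * mv (Q k) y i)); last first.
  apply/funext => i; apply: eq_bigr => k _; rewrite /dU /= mulr0 addr0 /y /lft /=; ring.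
rewrite quad_sumr mulr_sumr; apply: eq_bigr => k _; ring.
Qed.

Let mUW s c j : measurable_fun setT (fun w => UW s c w j).
Proof. have [m _ _] := TP_U s c j; exact: (m _ _ _ (gauss_meas GW)). Qed.

Let LB s c f df : BT f df -> Lall PPP (fun w => f (UW s c w)).
Proof. by move=> Hf; have [h _] := Lall_TP GW (TP_comp Hf (fun k => TP_U s c k)). Qed.

Let LB1 s c f df j : BT f df -> Lall PPP (fun w => df j (UW s c w)).
Proof.
move=> [_ mdf [B [B0 H]]]; apply: (Lall_dom (g := fun _ => B)); last exact: Lall_cst.
  exact: (mdf j _ _ (fun j w => UW s c w j) (mUW s c)).
by move=> w; have [_ h _] := H (UW s c w); rewrite (ger0_norm B0); exact: h.
Qed.

Let ibpZ s c j (f : (J -> R) -> R) df : BT f df ->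
  Ex PPP (fun w => Z j w.2 * f (UW s c w)) = Ex PPP (fun w => c * \sum_k S j k * df k (UW s c w)).
Proof.
move=> Hf; have H := TP_comp Hf (fun k => TP_U s c k).
have := ibp GW symKS (inr j) H => /= ->.
have Ldf k : Li PPP (fun w => df k (UW s c w)) by apply: Lall_Li; exact: LB1 Hf.
rewrite big_sumType/= [X in X + _]big1 ?add0r; last by move=> a _; rewrite mul0r.
rewrite ExZ; last by apply: Li_sum => k; exact: LiZ.
rewrite Ex_sum; last by move=> k; exact: LiZ.
rewrite mulr_sumr; apply: eq_bigr => k _; rewrite ExZ// mulrCA; congr (_ * _).
rewrite -ExZ//; apply: eq_Ex => w.
rewrite (bigD1 k)//= big1 ?addr0; last first.
  move=> l lk; rewrite /dU !mulr0 add0r (_ : (_ == _) = false) ?mulr0//.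
  by apply/eqP => -[] /eqP; rewrite eq_sym (negbTE lk).
by rewrite /dU !mulr0 add0r eqxx mulr1 mulrC.
Qed.

Let Fq j k (y : I -> R) := qf K (Q2 j k) y.

Let FqE j k y : Fq j k y = 2 * quad K (mv (Q j) y) (mv (Q k) y) - S j k.
Proof.
rewrite /Fq /qf SE; congr (_ - _).
have E c : mv (Q c) y = fun i => \sum_a y a * Q c a i.
  by apply/funext => i; rewrite /mv /dot; apply: eq_bigr => a _; rewrite mulrC symQ.
have H a b : quad K (mv (Q a) y) (mv (Q b) y) = \sum_i \sum_l y i * quad K (Q a i) (Q b l) * y l.
  rewrite !E quad_suml; apply: eq_bigr => i _; rewrite quad_sumr mulr_sumr; apply: eq_bigr => l _; ring.
have -> : 2 * quad K (mv (Q j) y) (mv (Q k) y) = quad K (mv (Q j) y) (mv (Q k) y) + quad K (mv (Q k) y) (mv (Q j) y).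
  by rewrite (quadC symK (mv (Q k) y)); ring.
rewrite !H -big_split/=; apply: eq_bigr => a _; rewrite -big_split/=; apply: eq_bigr => b _.
by rewrite /Q2; ring.
Qed.

Let symQ2 j k a b : Q2 j k a b = Q2 j k b a.
Proof. by rewrite /Q2 (quadC symK (Q j a)) (quadC symK (Q k a)) addrC. Qed.

Let LFq j k : Lall P (fun w => Fq j k (fun i => Y i w)).
Proof. by have [h _] := Lall_TP GY (TP_qf K (symQ2 j k)). Qed.

Let LVv j : Lall P (fun w => V j (fun i => Y i w)).
Proof. by have [h _] := Lall_TP GY (TP_qf K (symQ j)). Qed.

Let Lall1 (f : T -> R) : Lall P f -> Lall PPP (fun w => f w.1).
Proof. by move=> [mf If]; split; [exact: (measurableT_comp mf)|move=> k; exact: (Li_fst P' (If k))]. Qed.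

Let Lall2 (f : T' -> R) : Lall P' f -> Lall PPP (fun w => f w.2).
Proof. by move=> [mf If]; split; [exact: (measurableT_comp mf)|move=> k; exact: (Li_snd P (If k))]. Qed.

Let LZ j : Lall P' (Z j). Proof. exact: Lall_gauss GZ j. Qed.

(** Integrating V_j by parts gives the factor s and the form 2 (Q_j Y)' K (Q_k Y), integrating Z_j
    gives the factor c and S_jk. With the prefactors c and s both terms carry c s, and their
    difference is the centred form [Fq]. *)
Let Dlem s c (dm : J -> (J -> R) -> R) (ddm : J -> J -> (J -> R) -> R) : (forall j, BT (dm j) (ddm j)) ->
  Ex PPP (fun w => \sum_j dm j (UW s c w) * (c * Vv j w - s * Z j w.2)) =
  c * s * Ex PPP (fun w => \sum_j \sum_k ddm j k (UW s c w) * Fq j k (fun i => Y i w.1)).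
Proof.
move=> H.
have LV j : Lall PPP (fun w => Vv j w) by apply: (Lall1 (f := fun w => V j (fun i => Y i w))); exact: LVv.
have LZ2 j : Lall PPP (fun w => Z j w.2) by exact: Lall2 (LZ j).
have Ldm j : Lall PPP (fun w => dm j (UW s c w)) by exact: LB (H j).
have Ldd j k : Lall PPP (fun w => ddm j k (UW s c w)) by exact: LB1 (H j).
have LF j k : Lall PPP (fun w => Fq j k (fun i => Y i w.1)) by apply: (Lall1 (f := fun w => Fq j k (fun i => Y i w))); exact: LFq.
have Lt j k : Lall PPP (fun w => ddm j k (UW s c w) * Fq j k (fun i => Y i w.1)) by exact: LallM.
rewrite Ex_sum; last first.
  move=> j; apply: Lall_Li; apply: LallM => //.
  have := LallD (LallZ c (LV j)) (LallZ (- s) (LZ2 j)).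
  by congr Lall; apply/funext => w; rewrite mulNr.
rewrite Ex_sum; last by move=> j; apply: Li_sum => k; exact: Lall_Li.
rewrite mulr_sumr; apply: eq_bigr => j _.
transitivity (c * Ex PPP (fun w => Vv j w * dm j (UW s c w)) - s * Ex PPP (fun w => Z j w.2 * dm j (UW s c w))).
  have l1 : Li PPP (fun w => Vv j w * dm j (UW s c w)) by apply: Lall_Li; exact: LallM.
  have l2 : Li PPP (fun w => Z j w.2 * dm j (UW s c w)) by apply: Lall_Li; exact: LallM.
  rewrite -!ExZ// -ExB; [|exact: LiZ|exact: LiZ].
  by apply: eq_Ex => w; ring.
rewrite (ibpV s c j (H j)) (ibpZ s c j (H j)).
have l1 k : Li PPP (fun w => ddm j k (UW s c w) * (2 * quad K (mv (Q j) (fun i => Y i w.1)) (mv (Q k) (fun i => Y i w.1)))).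
  rewrite (_ : (fun w => _) = (fun w => ddm j k (UW s c w) * Fq j k (fun i => Y i w.1) + S j k * ddm j k (UW s c w))).
    by apply: LiD; [exact: Lall_Li|apply: LiZ; exact: Lall_Li].
  by apply/funext => w; rewrite FqE; ring.
have l2 k : Li PPP (fun w => S j k * ddm j k (UW s c w)) by apply: LiZ; exact: Lall_Li.
rewrite !ExZ; [|exact: Li_sum|exact: Li_sum].
rewrite mulrA [s * (c * _)]mulrA (mulrC s c) -mulrBr; congr (_ * _).
rewrite -ExB; [|exact: Li_sum|exact: Li_sum].
apply: eq_Ex => w; rewrite -sumrB; apply: eq_bigr => k _; rewrite FqE; ring.
Qed.

Variables (L N0 B delta : R) (r : nat).
Hypotheses (L1' : 1 <= L) (DL : ln #|J|%:R <= L) (delta0 : 0 < delta) (B0 : 0 <= B) (r0 : (0 < r)%N).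
Hypothesis FB : forall j k, Ex P (fun w => qf K (Q2 j k) (fun i => Y i w) ^+ r.*2) <= B ^+ r.*2.
Hypothesis naz : forall x w, 0 < w ->
  Ex P' (fun z => rect (fun j => x j + w) (fun j => Z j z)) - Ex P' (fun z => rect x (fun j => Z j z)) <= N0 * w.

Let EV x := Ex P (fun w => rect x (fun j => qf K (Q j) (fun i => Y i w))).
Let EZ x := Ex P' (fun z => rect x (fun j => Z j z)).

Let Li_rect d1 (T1 : measurableType d1) (P1 : probability T1 R) (X : J -> T1 -> R) y :
  (forall j, measurable_fun setT (X j)) -> Li P1 (fun w => rect y (fun j => X j w)).
Proof.
move=> mX; apply: (@Li_bnd _ _ _ P1 _ 1); first exact: (cmeas_rect y mX).
by move=> z; have /andP[h1 h2] := rect_bounds y (fun j => X j z); rewrite ger0_norm.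
Qed.

Let mZ := gauss_meas GZ.
Let mV j : measurable_fun setT (fun w => V j (fun i => Y i w)). Proof. exact: (LVv j).1. Qed.

(** Given Z, a rectangle event for s V + c Z is a rectangle event for V. Replacing V by an
    independent copy of Z therefore costs at most rho', and the resulting mixture of the two copies
    has the law of Z. *)
Let rect_mix s c rho' y : 0 < s -> c ^+ 2 + s ^+ 2 = 1 -> (forall x, `|EV x - EZ x| <= rho') ->
  `|Ex PPP (fun w => rect y (UW s c w)) - EZ y| <= rho'.
Proof.
move=> s0 cs H.
pose ZZ j (z : T' * T') := s * Z j z.1 + c * Z j z.2.
have mZZ j : measurable_fun setT (ZZ j).
  by apply: measurable_funD; apply: measurable_funM => //; exact: (measurableT_comp (mZ j)).
have GZZ : gauss (PP P' P') ZZ S.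
  have := gauss_lin (gauss_pair GZ GZ) (fun j (t : J + J) => match t with inl i => s * (i == j)%:R | inr i => c * (i == j)%:R end).
  have sum1 (a : R) j (y' : J -> R) : \sum_i a * (i == j)%:R * y' i = a * y' j.
    by rewrite (bigD1 j)//= eqxx mulr1 big1 ?addr0// => i /negbTE ->; rewrite mulr0 mul0r.
  congr gauss.
    by apply/funext => j; apply/funext => z; rewrite dot_sum /dot /= !sum1.
  apply/funext => j; apply/funext => k; rewrite quad_blk.
  have q (a : R) : quad S (fun i => a * (i == j)%:R) (fun i => a * (i == k)%:R) = a ^+ 2 * S j k.
    rewrite /quad; under eq_bigr => i _ do under eq_bigr => l _ do rewrite mulrC.
    under eq_bigr => i _ do rewrite (sum1 a k (fun l => a * (i == j)%:R * S i l)).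
    rewrite (eq_bigr (fun i => a * (i == j)%:R * (a * S i k))); last by move=> i _; ring.
    by rewrite sum1; ring.
  by rewrite !q -mulrDl addrC cs mul1r.
have -> : EZ y = Ex (PP P' P') (fun z => rect y (fun j => ZZ j z)).
  by have [] := gauss_law GZ GZZ (cmeas_rect y).
have L1 : Li PPP (fun w => rect y (UW s c w)) by exact: (Li_rect PPP y (mUW s c)).
have L2 := Li_rect (PP P' P') y mZZ.
rewrite !Ex_fubini2//.
have b d1 (T1 : measurableType d1) (P1 : probability T1 R) (F : T1 -> R) : (forall w, 0 <= F w <= 1) -> Li P1 F -> `|Ex P1 F| <= 1.
  move=> F01 LF; rewrite -(Ex_cst P1 1); apply: Ex_bnd; [exact: Li_meas LF|exact: Li_cst|].
  by move=> w; have /andP[h1 h2] := F01 w; rewrite ger0_norm.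
rewrite -ExB; last 2 first.
- apply: (@Li_bnd _ _ _ P' _ 1); first exact: (Ex_meas2 L1).
  move=> z; apply: b => [w|]; first exact: rect_bounds.
  apply: (@Li_bnd _ _ _ P _ 1); last by move=> w; have /andP[h1 h2] := rect_bounds y (UW s c (w, z)); rewrite ger0_norm.
  apply: (cmeas_rect y (Y := fun j w => s * V j (fun i => Y i w) + c * Z j z)) => j.
  by apply: measurable_funD => //; apply: measurable_funM.
- apply: (@Li_bnd _ _ _ P' _ 1); first exact: (Ex_meas2 L2).
  move=> z; apply: b => [w|]; first exact: rect_bounds.
  apply: (Li_rect P' y (X := fun j w => s * Z j w + c * Z j z)) => j.
  by apply: measurable_funD => //; apply: measurable_funM.
rewrite -[leRHS](Ex_cst P').
apply: Ex_bnd; [|exact: Li_cst|].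
  by apply: measurable_funB; [exact: (Ex_meas2 L1)|exact: (Ex_meas2 L2)].
move=> z.
pose y' j := (y j - c * Z j z) / s.
have e1 : Ex P (fun w => rect y (UW s c (w, z))) = EV y'.
  apply: eq_Ex => w; rewrite /rect; congr (nat_of_bool _)%:R; apply: eq_forallb => j.
  by rewrite /y' ltr_pdivlMr// ltrBrDr mulrC.
have e2 : Ex P' (fun w => rect y (fun j => ZZ j (w, z))) = EZ y'.
  apply: eq_Ex => w; rewrite /rect; congr (nat_of_bool _)%:R; apply: eq_forallb => j.
  by rewrite /y' ltr_pdivlMr// ltrBrDr mulrC.
by rewrite e1 e2.
Qed.

Let A0c psi : 0 <= 3 * psi ^+ 2 * L.
Proof.
apply: mulr_ge0; first by apply: mulr_ge0 => //; exact: sqr_ge0.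
exact: (le_trans ler01 L1').
Qed.

Section fixx.
Variables (x : J -> R) (psi rho' : R).
Hypothesis psi0 : 0 < psi.
Hypothesis Hrho : forall x, `|EV x - EZ x| <= rho'.
Let m := sstep x psi L.
Let dm := sstep1 x psi L.
Let ddm := sstep2 x psi L.
(** The moment bounds [FB], divided by delta^(2r) and summed over all pairs (j, k). *)
Let e := #|J|%:R ^+ 2 * (B / delta) ^+ r.*2.

(** Each |Fq| is at most delta + delta (Fq/delta)^(2r): small values are paid for by the layer,
    large ones by a moment. The second derivatives vanish unless the rectangles at x - 1/psi and x +
    8/psi differ at u, whence the width 9/psi. *)
Let Fsum_le u y : `|\sum_j \sum_k ddm j k u * Fq j k y| <=
  3 * psi ^+ 2 * L * delta * (rect (fun j => x j - psi^-1 + 9 / psi) u - rect (fun j => x j - psi^-1) u)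
   + 3 * psi ^+ 2 * L * delta * \sum_j \sum_k (Fq j k y / delta) ^+ r.*2.
Proof.
pose A := 3 * psi ^+ 2 * L.
have A0 : 0 <= A by exact: A0c.
have S2 : \sum_j \sum_k `|ddm j k u| <= A by exact: sum_sstep2.
have x8 j : x j - psi^-1 + 9 / psi = x j + 8 / psi by ring.
have lay : \sum_j \sum_k `|ddm j k u| <= A * (rect (fun j => x j - psi^-1 + 9 / psi) u - rect (fun j => x j - psi^-1) u).
  rewrite /rect; case: forallP => h1; last first.
    have z : forall j k, ddm j k u = 0.
      move/existsNP: h1 => [j /negP]; rewrite -leNgt x8 => hj.
      exact: (sstep_high j0 psi0 L1' hj).2.
    rewrite big1; last by move=> j _; apply: big1 => k _; rewrite z normr0.
    case: forallP => h2; last by rewrite subrr mulr0.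
    exfalso; apply: h1 => j; apply: (lt_trans (h2 j)); rewrite ltrDl divr_gt0//.
  case: forallP => h2; last by rewrite subr0 mulr1.
  have z : forall j k, ddm j k u = 0.
    by apply: (sstep_low j0 psi0 L1' DL _).2 => j; apply: ltW; exact: h2.
  by rewrite subrr mulr0 big1// => j _; apply: big1 => k _; rewrite z normr0.
have F1 j k : `|Fq j k y| <= delta + delta * (Fq j k y / delta) ^+ r.*2.
  set F := Fq j k y.
  have -> : F = delta * (F / delta) by rewrite mulrCA divff ?mulr1// gt_eqF.
  rewrite normrM (gtr0_norm delta0) [delta * (F / delta) / delta]mulrAC divff ?gt_eqF// mul1r.
  set t := F / delta.
  rewrite -[X in X + _]mulr1 -mulrDr; apply: ler_wpM2l; first exact: ltW.
  have -> : t ^+ r.*2 = `|t| ^+ r.*2 by rewrite -!mul2n !exprM real_normK ?num_real.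
  have [t1|t1] := leP `|t| 1.
    by apply: (le_trans t1); rewrite lerDl exprn_ge0.
  apply: (@le_trans _ _ (`|t| ^+ r.*2)); last by rewrite lerDr.
  by apply: ler_eXnr; [rewrite double_gt0|exact: ltW].
apply: (le_trans (ler_norm_sum _ _ _)).
apply: (@le_trans _ _ (\sum_j \sum_k (`|ddm j k u| * delta + A * (delta * (Fq j k y / delta) ^+ r.*2)))).
  apply: ler_sum => j _; apply: (le_trans (ler_norm_sum _ _ _)); apply: ler_sum => k _.
  rewrite normrM; apply: (le_trans (ler_wpM2l (normr_ge0 _) (F1 j k))); rewrite mulrDr lerD2l.
  have p0 : 0 <= (Fq j k y / delta) ^+ r.*2 by rewrite -mul2n exprM exprn_ge0// sqr_ge0.
  apply: ler_wpM2r; first by rewrite mulr_ge0// ltW.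
  apply: (le_trans _ S2); rewrite (bigD1 j)//= (bigD1 k)//= -addrA lerDl addr_ge0 ?sumr_ge0// => *; exact: sumr_ge0.
under eq_bigr do rewrite big_split/= -mulr_suml -!mulr_sumr.
rewrite big_split/= -mulr_suml -!mulr_sumr; apply: lerD; last by rewrite mulrA.
rewrite -/A [A * delta]mulrC -mulrA mulrC; apply: ler_wpM2l lay; exact: ltW.
Qed.

Let Dbound s c : 0 < s -> c ^+ 2 + s ^+ 2 = 1 ->
  `|Ex PPP (fun w => \sum_j \sum_k ddm j k (UW s c w) * Fq j k (fun i => Y i w.1))| <=
   3 * psi ^+ 2 * L * delta * (N0 * (9 / psi) + 2 * rho' + e).
Proof.
move=> s0 cs.
pose A := 3 * psi ^+ 2 * L * delta.
have A0 : 0 <= A by apply: mulr_ge0 (A0c psi) (ltW delta0).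
pose xl j := x j - psi^-1; pose xh j := xl j + 9 / psi.
have Lr y : Li PPP (fun w => rect y (UW s c w)) by exact: (Li_rect PPP y (mUW s c)).
have LF j k : Lall PPP (fun w => (Fq j k (fun i => Y i w.1) / delta) ^+ r.*2).
  apply: LallX; have := LallZ delta^-1 (Lall1 (LFq j k)).
  by congr Lall; apply/funext => w; rewrite mulrC.
have LFs : Li PPP (fun w => \sum_j \sum_k (Fq j k (fun i => Y i w.1) / delta) ^+ r.*2).
  by apply: Li_sum => j; apply: Li_sum => k; exact: Lall_Li.
have Ldd j k : Lall PPP (fun w => ddm j k (UW s c w)) by exact: LB1 (BT_sstep1 j0 x psi0 L1' j).
have LFF j k : Lall PPP (fun w => Fq j k (fun i => Y i w.1)) by apply: (Lall1 (f := fun w => Fq j k (fun i => Y i w))); exact: LFq.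
apply: (@le_trans _ _ (Ex PPP (fun w => A * (rect xh (UW s c w) - rect xl (UW s c w)) + A * \sum_j \sum_k (Fq j k (fun i => Y i w.1) / delta) ^+ r.*2))).
  apply: Ex_bnd.
  - by apply: Li_meas; apply: Li_sum => j; apply: Li_sum => k; apply: Lall_Li; exact: LallM.
  - by apply: LiD; apply: LiZ => //; exact: LiB.
  - by move=> w; exact: Fsum_le.
rewrite ExD; [|by apply: LiZ; exact: LiB|exact: LiZ].
rewrite !ExZ//; last exact: LiB.
rewrite -mulrDr; apply: ler_wpM2l => //; rewrite ExB//; apply: lerD.
  have h1 := rect_mix xh s0 cs Hrho; have h2 := rect_mix xl s0 cs Hrho.
  have h3 : EZ xh - EZ xl <= N0 * (9 / psi) by apply: naz; rewrite divr_gt0.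
  move: h1 h2; rewrite !ler_norml => /andP[_ h1] /andP[h2 _].
  lra.
rewrite Ex_sum; last by move=> j; apply: Li_sum => k; exact: Lall_Li.
rewrite /e; have -> : #|J|%:R ^+ 2 * (B / delta) ^+ r.*2 = \sum_(j : J) \sum_(k : J) (B / delta) ^+ r.*2.
  by rewrite sumr_const sumr_const -mulrnA -[RHS]mulr_natl natrM expr2.
apply: ler_sum => j _; rewrite Ex_sum; last by move=> k; exact: Lall_Li.
apply: ler_sum => k _.
rewrite (eq_Ex PPP (g := fun w => delta^-1 ^+ r.*2 * Fq j k (fun i => Y i w.1) ^+ r.*2)); last by move=> w; rewrite exprMn mulrC.
rewrite ExZ; last by apply: Lall_Li; exact: LallX.
rewrite exprMn mulrC; apply: ler_wpM2r; first by rewrite exprn_ge0// invr_ge0 ltW.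
apply: (le_trans _ (FB j k)); rewrite Ex_fubini1; last by apply: Lall_Li; exact: LallX.
by rewrite le_eqVlt; apply/orP; left; apply/eqP/eq_Ex => w; rewrite /= Ex_cst.
Qed.

Let gm t := Ex PPP (fun w => m (UW (sin t) (cos t) w)).

(** Differentiation under the expectation with an explicit quadratic remainder: a change h of the
    angle moves each coordinate by at most |h| times its summand of [N], which has all moments. *)
Let gm_derive : exists C : R, forall t h, `|gm (t + h) - gm t -
   h * Ex PPP (fun w => \sum_j dm j (UW (sin t) (cos t) w) * (cos t * Vv j w - sin t * Z j w.2))| <= C * h ^+ 2.
Proof.
have H := BT_sstep j0 x psi0 L1'.
have [_ _ [M [M0 HM]]] := H.
pose N w : R := \sum_j (`|Vv j w| + `|Z j w.2|).
have LV j : Lall PPP (fun w => Vv j w) by apply: (Lall1 (f := fun w => V j (fun i => Y i w))); exact: LVv.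
have LZ2 j : Lall PPP (fun w => Z j w.2) by exact: Lall2 (LZ j).
have LN : Lall PPP N by apply: Lall_sum => j; apply: LallD; exact: Lall_abs.
have N0' w : 0 <= N w by apply: sumr_ge0 => j _; exact: addr_ge0.
have Lm s c : Li PPP (fun w => m (UW s c w)) by apply: Lall_Li; exact: LB H.
have LD s c j : Lall PPP (fun w => dm j (UW s c w) * (c * Vv j w - s * Z j w.2)).
  apply: LallM; first exact: LB1 H.
  have := LallD (LallZ c (LV j)) (LallZ (- s) (LZ2 j)).
  by congr Lall; apply/funext => w; rewrite mulNr.
have LNN : Li PPP (fun w => M * N w ^+ 2 + 2 * M * N w).
  by apply: LiD; apply: LiZ; apply: Lall_Li => //; exact: LallX.
exists (Ex PPP (fun w => M * N w ^+ 2 + 2 * M * N w)) => t h.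
have LDs : Li PPP (fun w => \sum_j dm j (UW (sin t) (cos t) w) * (cos t * Vv j w - sin t * Z j w.2)).
  by apply: Li_sum => j; exact: Lall_Li.
rewrite /gm -ExB// -ExZ// -ExB; [|exact: LiB|exact: LiZ].
rewrite mulrC -ExZ//; apply: Ex_bnd; [by apply: Li_meas; apply: LiB; [exact: LiB|exact: LiZ]|exact: LiZ|].
move=> w; set s := sin t; set c := cos t; set u := UW s c w.
pose k j := (sin (t + h) - s) * Vv j w + (cos (t + h) - c) * Z j w.2.
have -> : UW (sin (t + h)) (cos (t + h)) w = (fun j => u j + k j).
  apply/funext => j; rewrite /u /k /UW /U /s /c /W /=; rewrite /Vv /lft; ring.
have [_ dB tB] := HM u.
have k1 j : `|k j| <= `|h| * (`|Vv j w| + `|Z j w.2|).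
  apply: (le_trans (ler_normD _ _)); rewrite !normrM mulrDr; apply: lerD; apply: ler_wpM2r => //.
    by apply: (le_trans (lip_abs_sin _ _)); rewrite addrAC subrr add0r.
  by apply: (le_trans (lip_abs_cos _ _)); rewrite addrAC subrr add0r.
have k2 : L1 k <= `|h| * N w by rewrite /L1 /N mulr_sumr; apply: ler_sum => j _.
have k3 j : `|k j - h * (c * Vv j w - s * Z j w.2)| <= 2 * h ^+ 2 * (`|Vv j w| + `|Z j w.2|).
  have -> : k j - h * (c * Vv j w - s * Z j w.2) = (sin (t + h) - s - h * c) * Vv j w + (cos (t + h) - c + h * s) * Z j w.2 by rewrite /k; ring.
  apply: (le_trans (ler_normD _ _)); rewrite !normrM mulrDr; apply: lerD; apply: ler_wpM2r => //.
    exact: sin_taylor.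
  exact: cos_taylor.
have -> : m (fun j => u j + k j) - m u - h * \sum_j dm j u * (c * Vv j w - s * Z j w.2) =
  (m (fun j => u j + k j) - m u - \sum_j dm j u * k j) + \sum_j dm j u * (k j - h * (c * Vv j w - s * Z j w.2)).
  have -> : \sum_j dm j u * (k j - h * (c * Vv j w - s * Z j w.2)) = \sum_j dm j u * k j - h * \sum_j dm j u * (c * Vv j w - s * Z j w.2).
    by rewrite mulr_sumr -sumrB; apply: eq_bigr => j _; ring.
  by ring.
apply: (le_trans (ler_normD _ _)).
have -> : h ^+ 2 * (M * N w ^+ 2 + 2 * M * N w) = M * (`|h| * N w) ^+ 2 + M * (2 * h ^+ 2 * N w).
  by rewrite exprMn real_normK ?num_real//; ring.
apply: lerD.
  apply: (le_trans (tB k)); apply: ler_wpM2l => //; rewrite lerXn2r ?nnegrE ?L1_ge0// mulr_ge0//.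
apply: (le_trans (ler_norm_sum _ _ _)); rewrite [2 * h ^+ 2 * N w]mulr_sumr mulr_sumr; apply: ler_sum => j _.
by rewrite normrM; apply: ler_pM => //; exact: dB.
Qed.

Lemma smooth_cmp : `|Ex P (fun w => m (fun j => V j (fun i => Y i w))) - Ex P' (fun z => m (fun j => Z j z))| <=
   6 * psi ^+ 2 * L * delta * (N0 * (9 / psi) + 2 * rho' + e).
Proof.
pose A := 3 * psi ^+ 2 * L * delta * (N0 * (9 / psi) + 2 * rho' + e).
have H := BT_sstep j0 x psi0 L1'.
have [C HC] := gm_derive.
have der t := @is_derive_sq R gm t _ C (fun h _ => HC t h).
have p0 : 0 <= pi / 2 :> R by rewrite divr_ge0// pi_ge0.
have [c [c0 cp E]] := @MVT_le R gm _ 0 (pi / 2) p0 der.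
have E1 : gm (pi / 2) = Ex P (fun w => m (fun j => V j (fun i => Y i w))).
  rewrite /gm sin_pihalf cos_pihalf.
  rewrite (eq_Ex PPP (g := fun w => m (fun j => V j (fun i => Y i w.1)))); last first.
    by move=> w; congr m; apply/funext => j; rewrite /UW /U mul1r mul0r addr0.
  rewrite Ex_fubini1; first by apply: eq_Ex => w; rewrite /= Ex_cst.
  have := Lall_Li (LB 1 0 H); congr Li; apply/funext => w; congr sstep.
  by apply/funext => j; rewrite /UW /U mul1r mul0r addr0.
have E2 : gm 0 = Ex P' (fun z => m (fun j => Z j z)).
  rewrite /gm sin0 cos0.
  rewrite (eq_Ex PPP (g := fun w => m (fun j => Z j w.2))); last first.
    by move=> w; congr m; apply/funext => j; rewrite /UW /U mul1r mul0r add0r.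
  rewrite Ex_fubini2; first by apply: eq_Ex => w; rewrite /= Ex_cst.
  have := Lall_Li (LB 0 1 H); congr Li; apply/funext => w; congr sstep.
  by apply/funext => j; rewrite /UW /U mul1r mul0r add0r.
rewrite -E1 -E2 E subr0.
have A0 : 0 <= A.
  have b1 : 0 <= 3 * psi ^+ 2 * L * delta by apply: mulr_ge0 (A0c psi) (ltW delta0).
  apply: mulr_ge0 => //; rewrite !addr_ge0//.
  - apply: le_trans (naz x (w := 9 / psi) _); last by rewrite divr_gt0.
    rewrite subr_ge0; apply: Ex_le; [exact: Li_rect|exact: Li_rect|].
    move=> z; rewrite /rect; case: forallP => h1; last by rewrite ler0n.
    by case: forallP => // h2; case: h2 => j; apply: (lt_trans (h1 j)); rewrite ltrDl divr_gt0.
  - by rewrite mulr_ge0//; apply: le_trans (Hrho x).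
  - by rewrite /e mulr_ge0 ?exprn_ge0// divr_ge0// ltW.
rewrite normrM (ger0_norm p0).
have -> : 6 * psi ^+ 2 * L * delta * (N0 * (9 / psi) + 2 * rho' + e) = A * 2 by rewrite /A; ring.
have p2 : pi / 2 <= 2 :> R by have [/andP[_ h] _] := @pihalf_02_cos_pihalf R.
apply: ler_pM => //.
rewrite (Dlem (sin c) (cos c) (fun j => BT_sstep1 j0 x psi0 L1' j)).
have sc : cos c ^+ 2 + sin c ^+ 2 = 1 by exact: cos2Dsin2.
(* [Dbound] needs a positive sine; at sine 0 the factor cos c sin c from [Dlem] already vanishes. *)
have [s0|s0] := eqVneq (sin c) 0; first by rewrite s0 mulr0 mul0r normr0.
have sp : 0 < sin c.
  rewrite lt_def s0 sin_ge0_pi//; apply/andP; split => //; apply: (le_trans cp).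
  by rewrite ler_pdivrMr// ler_peMr ?pi_ge0// ler1n.
rewrite normrM -[leRHS]mul1r; apply: ler_pM => //; last exact: Dbound.
by rewrite normrM -[leRHS]mul1r; apply: ler_pM => //; [rewrite cos_max|rewrite sin_max].
Qed.
End fixx.

(** The condition on psi makes the prefactor in [smooth_cmp] at most 1/4, so the term 2 rho' returns
    as rho'/2. Enclosing a rectangle between smoothed indicators costs one more layer of width
    9/psi, hence the factor 5/4. *)
Lemma comparison_step (psi rho' : R) : 0 < psi -> 24 * psi ^+ 2 * L * delta <= 1 ->
  (forall x, `|EV x - EZ x| <= rho') ->
  forall x, `|EV x - EZ x| <= rho' / 2 + (5 / 4 * (N0 * (9 / psi)) + #|J|%:R ^+ 2 * (B / delta) ^+ r.*2 / 4).
Proof.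
move=> psi0 hp Hrho x.
set e := #|J|%:R ^+ 2 * (B / delta) ^+ r.*2.
have naz9 y : EZ (fun j => y j + 9 / psi) - EZ y <= N0 * (9 / psi) by apply: naz; rewrite divr_gt0.
have n0 : 0 <= N0 * (9 / psi).
  apply: le_trans (naz9 x).
  rewrite subr_ge0; apply: Ex_le; [exact: Li_rect|exact: Li_rect|].
  move=> z; rewrite /rect; case: forallP => h1; last by rewrite ler0n.
  by case: forallP => // h2; case: h2 => j; apply: (lt_trans (h1 j)); rewrite ltrDl divr_gt0.
have r0' : 0 <= rho' by apply: le_trans (Hrho x).
have e0 : 0 <= e by rewrite /e mulr_ge0 ?exprn_ge0// divr_ge0// ltW.
have small y : `|Ex P (fun w => sstep y psi L (fun j => V j (fun i => Y i w))) - Ex P' (fun z => sstep y psi L (fun j => Z j z))| <=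
   N0 * (9 / psi) / 4 + rho' / 2 + e / 4.
  apply: (le_trans (smooth_cmp y psi0 Hrho)); rewrite -/e.
  have -> : N0 * (9 / psi) / 4 + rho' / 2 + e / 4 = 1 * ((N0 * (9 / psi) + 2 * rho' + e) / 4) by field; rewrite gt_eqF.
  have -> : 6 * psi ^+ 2 * L * delta * (N0 * (9 / psi) + 2 * rho' + e) = 24 * psi ^+ 2 * L * delta * ((N0 * (9 / psi) + 2 * rho' + e) / 4) by field; rewrite gt_eqF.
  by apply: ler_wpM2r => //; rewrite divr_ge0// !addr_ge0// mulr_ge0.
have Lm d1 (T1 : measurableType d1) (P1 : probability T1 R) (X : J -> T1 -> R) y :
    (forall j, measurable_fun setT (X j)) -> Li P1 (fun w => sstep y psi L (fun j => X j w)).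
  move=> mX; have [mm _ _] := BT_sstep j0 y psi0 L1'.
  apply: (@Li_bnd _ _ _ P1 _ 1); first exact: (mm _ _ _ mX).
  by move=> w; have /andP[h1 h2] := sstep_bounds y psi L (fun j => X j w); rewrite ger0_norm.
have up (u y : J -> R) : rect (fun j => y j - psi^-1) u <= sstep y psi L u.
  rewrite /rect; case: forallP => h; last by have /andP[] := sstep_bounds y psi L u.
  by rewrite (sstep_low j0 psi0 L1' DL (fun j => ltW (h j))).1.
have dn (u y : J -> R) : sstep y psi L u <= rect (fun j => y j + 8 / psi) u.
  rewrite /rect; case: forallP => h; first by have /andP[] := sstep_bounds y psi L u.
  move/existsNP: h => [j /negP]; rewrite -leNgt => hj.
  by rewrite (sstep_high j0 psi0 L1' hj).1.
pose x1 j := x j + psi^-1; pose x2 j := x j - 8 / psi.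
have x1E : (fun j => x1 j - psi^-1) = x by apply/funext => j; rewrite /x1 addrK.
have x2E : (fun j => x2 j + 8 / psi) = x by apply/funext => j; rewrite /x2 subrK.
have n9 : 9 / psi = psi^-1 + 8 / psi by ring.
have x1E' : (fun j => x1 j + 8 / psi) = (fun j => x j + 9 / psi) by apply/funext => j; rewrite /x1 n9 addrA.
have x2E' : (fun j => (x2 j - psi^-1) + 9 / psi) = x.
  by apply/funext => j; rewrite /x2 n9; ring.
have u1 : EV x <= Ex P (fun w => sstep x1 psi L (fun j => V j (fun i => Y i w))).
  apply: Ex_le; [exact: (Li_rect P x mV)|exact: Lm|] => w; have := up (fun j => V j (fun i => Y i w)) x1; by rewrite x1E.
have u2 : Ex P' (fun z => sstep x1 psi L (fun j => Z j z)) <= EZ (fun j => x j + 9 / psi).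
  apply: Ex_le; [exact: Lm|exact: Li_rect|] => w; have := dn (fun j => Z j w) x1; by rewrite x1E'.
have d1 : Ex P (fun w => sstep x2 psi L (fun j => V j (fun i => Y i w))) <= EV x.
  apply: Ex_le; [exact: Lm|exact: (Li_rect P x mV)|] => w; have := dn (fun j => V j (fun i => Y i w)) x2; by rewrite x2E.
have d2 : EZ (fun j => x2 j - psi^-1) <= Ex P' (fun z => sstep x2 psi L (fun j => Z j z)).
  apply: Ex_le; [exact: Li_rect|exact: Lm|] => w; exact: up.
have s1 := small x1; have s2 := small x2.
have n1 := naz9 x; have n2 := naz9 (fun j => x2 j - psi^-1); rewrite x2E' in n2.
apply: (le_trans (two_sided s1 s2 u1 u2 n1 d1 d2 n2)).
by move: (N0 * (9 / psi)) => n; rewrite le_eqVlt; apply/orP; left; apply/eqP; field.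
Qed.

(** [comparison_step] is applied with rho' the supremum of the distances, which is finite because
    they are at most 1; the term sup / 2 can then be subtracted. *)
Lemma comparison psi : 0 < psi -> 24 * psi ^+ 2 * L * delta <= 1 ->
  forall x, `|EV x - EZ x| <= 5 / 2 * (N0 * (9 / psi)) + #|J|%:R ^+ 2 * (B / delta) ^+ r.*2 / 2.
Proof.
move=> psi0 hp.
set A := 5 / 4 * (N0 * (9 / psi)) + #|J|%:R ^+ 2 * (B / delta) ^+ r.*2 / 4.
pose E := [set `|EV x - EZ x| | x in [set: J -> R]].
have E01 y : 0 <= EV y <= 1 /\ 0 <= EZ y <= 1.
  have b d1 (T1 : measurableType d1) (P1 : probability T1 R) (X : J -> T1 -> R) :
    (forall j, measurable_fun setT (X j)) -> 0 <= Ex P1 (fun w => rect y (fun j => X j w)) <= 1.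
    move=> mX; apply/andP; split; first by apply: Ex_ge0 => w; have /andP[] := rect_bounds y (fun j => X j w).
    by rewrite -(Ex_cst P1 1); apply: Ex_le; [exact: Li_rect|exact: Li_cst|] => w; have /andP[] := rect_bounds y (fun j => X j w).
  by split; [exact: (b _ _ P (fun j w => V j (fun i => Y i w)) mV)|exact: b].
have hE : has_ubound E.
  exists 1 => _ [y _ <-]; have [/andP[h1 h2] /andP[h3 h4]] := E01 y.
  by rewrite ler_norml; apply/andP; split; lra.
have Eub y : `|EV y - EZ y| <= sup E by apply: ub_le_sup => //; exists y.
have step := comparison_step psi0 hp Eub.
have : sup E <= sup E / 2 + A.
  by apply: ge_sup; [exists `|EV 0 - EZ 0|; exists 0|move=> _ [y _ <-]; exact: step].
move=> h y; apply: (le_trans (Eub y)); rewrite /A in h; lra.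
Qed.
End comparison.

(** * The linear process *)

Section gv.
Context {d} {T : measurableType d} {R : realType} (P : probability T R).

Lemma sigma_of_lt k (Y : T -> 'cV[R]_k) (b : 'I_k -> R) (c : R) :
  sigma_of Y [set w | \sum_i b i * Y w i 0 < c].
Proof.
pose G : set (set T) := \big[setU/set0]_(i < k) preimage_set_system setT (fun w => Y w i 0) measurable.
pose TT := g_sigma_algebraType G.
have mY i : measurable_fun [set: TT] (fun w : TT => Y w i 0 : measurableTypeR R).
  move=> _ B mB; rewrite setTI; apply: sub_sigma_algebra.
  rewrite /G (bigD1 i)//=; left; exists B => //; by rewrite setTI.
have mL : measurable_fun [set: TT] (fun w : TT => \sum_i b i * Y w i 0 : R).
  by apply: measurable_sum => i; apply: measurable_funM => //; exact: mY.
have := mL measurableT `]-oo, c[%classic (measurable_itv _); rewrite setTI.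
rewrite (_ : _ @^-1` _ = [set w | \sum_i b i * Y w i 0 < c])//.
Qed.

Lemma gv_lt k (Y : T -> 'cV[R]_k) (C : 'M[R]_k) (b : 'I_k -> R) (c : R) : gaussian_vector P Y 0 C ->
  P [set w | \sum_i b i * Y w i 0 < c] = normal_law 0 (\sum_i \sum_j b i * C i j * b j) `]-oo, c[%classic.
Proof.
move=> [_ H]; have := H (\col_i b i) `]-oo, c[%classic (measurable_itv _).
rewrite mulmx0 mxE.
have -> : ((\col_i b i)^T *m C *m (\col_i b i)) 0 0 = \sum_i \sum_j b i * C i j * b j.
  rewrite mxE; under eq_bigr do rewrite mxE mulr_suml.
  rewrite exchange_big/=; apply: eq_bigr => i _; apply: eq_bigr => j _; rewrite !mxE//.
have E w : ((\col_i b i)^T *m Y w) 0 0 = \sum_i b i * Y w i 0.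
  by rewrite mxE; apply: eq_bigr => i _; rewrite !mxE.
move=> <-; congr (P _); apply/seteqP; split => w /=; by rewrite E in_itv.
Qed.

(** The half-line probabilities of each linear combination fix its law, so its characteristic
    function is that of an explicit normal variable, or of the constant 0 when the variance
    vanishes. *)
Lemma gv_gauss k (Y : T -> 'cV[R]_k) (C : 'M[R]_k) : (forall a, 0 <= quad (fun i j => C i j) a a) ->
  gaussian_vector P Y 0 C -> gauss P (fun i w => Y w i 0) (fun i j => C i j).
Proof.
move=> C0 GY; have mY : forall i, measurable_fun setT (fun w => Y w i 0) by case: GY.
split => // a; set v := quad _ a a.
pose Y1 (_ : unit) w := dot a (fun i => Y w i 0).
have mY1 u : measurable_fun setT (Y1 u) by exact: measurable_dot.
have lt1 c : P [set w | forall i, Y1 i w < c i] = normal_law 0 v `]-oo, c tt[%classic.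
  rewrite -(gv_lt a (c tt) GY); congr (P _); apply/seteqP; split => w /=; first by move=> /(_ tt).
  by move=> h -[].
have uq (h : R -> R) : measurable_fun setT h -> cmeas (fun y : unit -> R => h (y tt)) by exact: cmeas1.
have [v0|v0] := eqVneq v 0.
  have H c : P [set w | forall i, Y1 i w < c i] = P [set w | forall i : unit, 0 < c i].
    rewrite lt1 /normal_law v0 eqxx diracE.
    have [c0|c0] := ltP 0 (c tt).
      rewrite mem_set/= ?in_itv//= (_ : [set w | _] = setT) ?probability_setT//.
      by apply/seteqP; split => w //= _ [].
    rewrite memNset/= ?in_itv/=; last by apply/negP; rewrite -leNgt.
    rewrite (_ : [set w | _] = set0) ?measure0//; apply/seteqP; split => w //= /(_ tt).
    by rewrite ltNge c0.
  have [e1 _] := law_eq mY1 (fun _ => measurable_cst (0 : R)) H (uq _ (@measurable_cos R)).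
  have [e2 _] := law_eq mY1 (fun _ => measurable_cst (0 : R)) H (uq _ (@measurable_sin R)).
  rewrite v0 mul0r oppr0 expR0; split.
    by rewrite -[LHS]/(Ex P (fun w => cos (Y1 tt w))) e1 -[RHS](Ex_cst P); apply: eq_Ex => w; rewrite /= cos0.
  by rewrite -[LHS]/(Ex P (fun w => sin (Y1 tt w))) e2 -[RHS](Ex_cst P); apply: eq_Ex => w; rewrite /= sin0.
have v1 : 0 <= v by exact: C0.
have s0 : Num.sqrt v != 0 by rewrite sqrtr_eq0 -ltNge lt_def v0.
have mid (u : unit) : measurable_fun [set: measurableTypeR R] (fun x : R => x) by exact: measurable_id.
have H c : P [set w | forall i, Y1 i w < c i] = (normal_prob 0 (Num.sqrt v) : probability (measurableTypeR R) R) [set w | forall i : unit, w < c i].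
  rewrite lt1 /normal_law (negbTE v0); congr (normal_prob _ _ _); apply/seteqP; split => w /=; rewrite in_itv//=; first by move=> h [].
have [e1 _] := law_eq mY1 mid H (uq _ (@measurable_cos R)).
have [e2 _] := law_eq mY1 mid H (uq _ (@measurable_sin R)).
split.
  rewrite -[LHS]/(Ex P (fun w => cos (Y1 tt w))) e1.
  have := normal_cos s0 1; rewrite sqr_sqrtr// expr1n mulr1 => <-.
  by apply: eq_Ex => w; rewrite mul1r.
rewrite -[LHS]/(Ex P (fun w => sin (Y1 tt w))) e2; apply: etrans (normal_sin s0 1).
by apply: eq_Ex => w; rewrite mul1r.
Qed.
End gv.

(** * Sums of independent Gaussian innovations *)

Section independent_sums.
Context {d} {T : measurableType d} {R : realType} (P : probability T R) {k : nat}.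
Variables (eps : int -> T -> 'cV[R]_k) (M : int) (b : nat -> 'I_k -> R).
Hypothesis Heps : iid_standard_gaussian P eps.

Definition xi v w : R := \sum_c b v c * eps (M - v%:Z) w c 0.

Let quad1 a : quad (fun i j : 'I_k => (1%:M : 'M[R]_k) i j) a a = \sum_c a c ^+ 2.
Proof.
rewrite /quad; apply: eq_bigr => c _; rewrite (bigD1 c)//= mxE eqxx mulr1 big1 ?addr0// => c' cc.
by rewrite mxE eq_sym (negbTE cc) mulr0 mul0r.
Qed.

Let Geps t : gauss P (fun i w => eps t w i 0) (fun i j => (1%:M : 'M[R]_k) i j).
Proof.
apply: gv_gauss; last by case: Heps.
by move=> a; rewrite quad1; apply: sumr_ge0 => i _; exact: sqr_ge0.
Qed.

Let mxi v : measurable_fun setT (xi v).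
Proof. exact: (measurable_dot (b v) (gauss_meas (Geps (M - v%:Z)))). Qed.

Let xi_cos v : Ex P (fun w => cos (xi v w)) = expR (- ((\sum_c b v c ^+ 2) / 2)) /\ Ex P (fun w => sin (xi v w)) = 0.
Proof.
have [_ /(_ (b v)) [h1 h2]] := Geps (M - v%:Z); split => //; rewrite -[LHS]/(Ex P _) h1; by rewrite quad1.
Qed.

Lemma xi_indep (c : nat -> R) N : P [set w | forall v, (v < N)%N -> xi v w < c v] =
  (\prod_(v < N) P [set w | (xi v w < c v)%R])%E.
Proof.
have [_ ind] := Heps.
pose J := [seq M - v%:Z | v <- iota 0 N].
(* Independence is stated for events indexed by times i = M - v; the absolute value recovers v from
   i. *)
pose E (i : int) := [set w | \sum_j b `|(M - i)%R|%N j * eps i w j 0 < c `|(M - i)%R|%N].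
have av (v : nat) : `|(M - (M - v%:Z))%R|%N = v by rewrite opprB addrCA subrr addr0 absz_nat.
have uJ : uniq J by rewrite map_inj_uniq ?iota_uniq// => v v' /(congr1 (fun i => `|(M - i)%R|%N)); rewrite !av.
have H : P (\bigcap_(i in [set` J]) E i) = (\prod_(i <- J) P (E i))%E.
  by apply: ind => // i _; exact: sigma_of_lt.
rewrite big_map in H.
transitivity (P (\bigcap_(i in [set` J]) E i)).
  congr (P _); apply/seteqP; split => w /= h.
    move=> i /= /mapP[v]; rewrite mem_iota add0n => /andP[_ vN] ->; rewrite /E/= av; exact: h.
  move=> v vN; have := h (M - v%:Z); rewrite /E/= av; apply.
  by apply/mapP; exists v => //; rewrite mem_iota.
rewrite H -(big_mkord xpredT (fun v => P [set w | xi v w < c v])) /index_iota subn0.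
by apply: eq_bigr => v _; rewrite /E av.
Qed.

Definition xisum N w : R := \sum_(v < N) xi v w.

(** Induction on N. Independence factors the rectangle probabilities, so by [law_eq] the last
    summand may be moved to a second coordinate of a product space, where characteristic functions
    multiply. *)
Lemma xisum_cos N : Ex P (fun w => cos (xisum N w)) = expR (- ((\sum_(v < N) \sum_c b v c ^+ 2) / 2)) /\
  Ex P (fun w => sin (xisum N w)) = 0.
Proof.
elim: N => [|N [IH1 IH2]].
  rewrite big_ord0 mul0r oppr0 expR0; split.
    by under eq_Ex do rewrite /xisum big_ord0 cos0; rewrite Ex_cst.
  by under eq_Ex do rewrite /xisum big_ord0 sin0; rewrite Ex_cst.
pose Y (i : 'I_N + unit) w := match i with inl v => xi v w | inr _ => xi N w end.
pose Y' (i : 'I_N + unit) (z : T * T) := match i with inl v => xi v z.1 | inr _ => xi N z.2 end.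
have mY i : measurable_fun setT (Y i) by case: i => [v|u]; exact: mxi.
have mY' i : measurable_fun setT (Y' i) by case: i => [v|u]; apply: (measurableT_comp (mxi _)).
have lt_meas v (c : R) : measurable [set w | xi v w < c].
  have := mxi v measurableT (measurable_itv `]-oo, c[); rewrite setTI.
  by rewrite (_ : _ @^-1` _ = [set w | xi v w < c])//; apply/seteqP; split => w /=; rewrite in_itv.
have rE (c : 'I_N + unit -> R) : P [set w | forall i, Y i w < c i] = PP P P [set z | forall i, Y' i z < c i].
  (* Extends the thresholds from ordinals to natural numbers; the default value is the threshold of
     the last summand, read off at v = N. *)
  pose c1 v := if insub v is Some v' then c (inl v') else c (inr tt).
  have c1E (v : 'I_N) : c1 v = c (inl v) by rewrite /c1 valK.
  have c1N : c1 N = c (inr tt) by rewrite /c1 insubF ?ltnn.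
  pose A := [set w | forall v, (v < N)%N -> xi v w < c1 v].
  have mA : measurable A.
    rewrite (_ : A = \bigcap_(v in [set v | (v < N)%N]) [set w | xi v w < c1 v]).
      by apply: fin_bigcap_measurable => [|v _]; [exact: finite_II|exact: lt_meas].
    by apply/seteqP; split => w h v; exact: h.
  transitivity (P A * P [set w | (xi N w < c (inr tt))%R])%E.
    rewrite -c1N /A xi_indep -(big_ord_recr N (fun v => P [set w | (xi v w < c1 v)%R]))/= -xi_indep.
    congr (P _); apply/seteqP; split => w /= h.
      move=> v; rewrite ltnS leq_eqVlt => /orP[/eqP ->|vN]; first by rewrite c1N; exact: h (inr tt).
      by have := h (inl (Ordinal vN)); rewrite /= -c1E.
    by case=> [v|[]] /=; [rewrite -c1E; apply: h; rewrite ltnS ltnW|rewrite -c1N; exact: h].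
  rewrite -(@product_measure1E _ _ _ _ _ P P)//; congr (PP P P _); apply/seteqP; split => z /=.
    by move=> [h1 h2] [v|[]] //=; rewrite -c1E; exact: h1.
  move=> h; split; last exact: h (inr tt).
  by move=> v vN; have := h (inl (Ordinal vN)); rewrite /= -c1E.
have cc (h : R -> R) : measurable_fun setT h -> cmeas (fun y : 'I_N + unit -> R => h (\sum_v y (inl v) + y (inr tt))).
  move=> mh d1 T1 Y1 mY1; apply: (measurableT_comp mh); apply: measurable_funD => //; exact: measurable_sum.
have mS : measurable_fun setT (xisum N) by exact: measurable_sum.
have [e1 _] := law_eq mY mY' rE (cc _ (@measurable_cos R)).
have [e2 _] := law_eq mY mY' rE (cc _ (@measurable_sin R)).
have [x1 x2] := xi_cos N.
rewrite big_ord_recr/=; split.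
  transitivity (Ex P (fun w => cos (\sum_(v < N) xi v w + xi N w))).
    by apply: eq_Ex => w; rewrite /xisum big_ord_recr.
  rewrite e1 (Ex_cosD P P mS (mxi N)) IH1 IH2 x1 x2 mul0r subr0 -expRD; congr expR; ring.
transitivity (Ex P (fun w => sin (\sum_(v < N) xi v w + xi N w))).
  by apply: eq_Ex => w; rewrite /xisum big_ord_recr.
by rewrite e2 (Ex_sinD P P mS (mxi N)) IH2 x2 mul0r mulr0 addr0.
Qed.
End independent_sums.

Lemma cvg_sumr {R : realType} (I : finType) (F : I -> nat -> R) (l : I -> R) :
  (forall i, F i N @[N --> \oo] --> l i) -> \sum_i F i N @[N --> \oo] --> \sum_i l i.
Proof.
move=> H; apply: (cvg_big (op := +%R) (x0 := 0)) => //; exact: add_continuous.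
Qed.

(** * Finite-dimensional laws of the process *)

Section process_law.
Context {d} {T : measurableType d} {R : realType} (P : probability T R) {p k : nat}.
Variables (eps : int -> T -> 'cV[R]_k) (A : nat -> 'M[R]_(p, k)) (X : int -> T -> 'cV[R]_p).
Hypothesis HX : gaussian_linear_process P eps A X.
Context {I : finType}.
Variables (M : int) (n : I -> nat) (comp : I -> 'I_p).

(** The coefficient of the innovation at time M - v in the component [comp i] of X at time M - n_i.
    The common origin M turns all variables into series in the same innovations. *)
Definition shA i v c : R := if (n i <= v)%N then A (v - n i)%N (comp i) c else 0.

(** Partial sums of a linear combination are sums of independent Gaussian variables. Their
    characteristic functions converge by bounded convergence along the almost sure limit, and their
    variances by hypothesis. *)
Lemma process_gauss K : (forall i j, \sum_(v < N) \sum_c shA i v c * shA j v c @[N --> \oo] --> (K i j : R)) ->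
  gauss P (fun i w => X (M - (n i)%:Z) w (comp i) 0) K.
Proof.
move=> HK; have [Heps mX cX] := HX.
split; first by move=> i; exact: mX.
move=> a.
pose b v c := \sum_i a i * shA i v c.
have cvx : {ae P, forall w, xisum eps M b N w @[N --> \oo] --> dot a (fun i => X (M - (n i)%:Z) w (comp i) 0)}.
  have : {ae P, forall w, forall i, series (fun t : nat => A t *m eps (M - (n i)%:Z - t%:Z) w) @ \oo --> X (M - (n i)%:Z) w}.
    by apply: filter_forall => i; exact: cX.
  apply: filterS => w H.
  have Hi i : \sum_(v < N) \sum_c shA i v c * eps (M - v%:Z) w c 0 @[N --> \oo] --> X (M - (n i)%:Z) w (comp i) 0.
    rewrite -(cvg_shiftn (n i)).
    have e N : \sum_(v < N + n i) \sum_c shA i v c * eps (M - v%:Z) w c 0 =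
       (series (fun t : nat => A t *m eps (M - (n i)%:Z - t%:Z) w) N) (comp i) 0.
      rewrite -(big_mkord xpredT (fun v => \sum_c shA i v c * eps (M - v%:Z) w c 0)) (@big_cat_nat _ _ _ (n i))//=; last exact: leq_addl.
      rewrite big1_seq ?add0r; last first.
        move=> v /andP[_]; rewrite mem_index_iota => /andP[_ vn]; apply: big1 => c _.
        by rewrite /shA leqNgt vn mul0r.
      rewrite -{1}[n i]add0n big_addn addnK /series/= summxE; apply: eq_bigr => t _.
      rewrite mxE; apply: eq_bigr => c _; rewrite /shA leq_addl addnK; congr (_ * eps _ w c 0).
      by rewrite PoszD opprD addrA addrAC.
    rewrite (_ : (fun N => _) = (fun N => (series (fun t : nat => A t *m eps (M - (n i)%:Z - t%:Z) w) N) (comp i) 0)); last first.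
      by apply/funext => N; exact: e.
    apply: (@cvg_comp _ _ _ _ (fun B : 'cV[R]_p => B (comp i) 0) _ _ _ (H i)).
    exact: coord_continuous.
  have -> : xisum eps M b ^~ w = (fun N => \sum_i a i * \sum_(v < N) \sum_c shA i v c * eps (M - v%:Z) w c 0).
    apply/funext => N; rewrite /xisum /xi; under [RHS]eq_bigr do rewrite mulr_sumr.
    rewrite [RHS]exchange_big/=; apply: eq_bigr => v _.
    under [RHS]eq_bigr do rewrite mulr_sumr.
    rewrite [RHS]exchange_big/=; apply: eq_bigr => c _.
    by rewrite /b mulr_suml; apply: eq_bigr => i _; rewrite mulrA.
  by rewrite /dot; apply: cvg_sumr => i; apply: cvgM; [exact: cvg_cst|exact: Hi].
have mS N : measurable_fun setT (xisum eps M b N).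
  apply: measurable_sum => v; apply: measurable_sum => c; apply: measurable_funM => //.
  by have [/(_ (M - v%:Z))[]] := Heps.
have mL : measurable_fun setT (fun w => dot a (fun i => X (M - (n i)%:Z) w (comp i) 0)).
  by apply: measurable_dot => i; exact: mX.
have lim (h : R -> R) : measurable_fun setT h -> continuous h -> (forall x, `|h x| <= 1) ->
   Ex P (fun w => h (xisum eps M b N w)) @[N --> \oo] --> Ex P (fun w => h (dot a (fun i => X (M - (n i)%:Z) w (comp i) 0))).
  move=> mh ch h1; apply: (@Ex_dct _ _ _ P (fun N w => h (xisum eps M b N w)) _ 1).
  - by move=> N; exact: (measurableT_comp mh (mS N)).
  - exact: (measurableT_comp mh mL).
  - by move=> N w; exact: h1.
  - by apply: filterS cvx => w Hw; apply: (cvg_comp _ _ Hw); exact: ch.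
have lc := lim _ (@measurable_cos R) (@continuous_cos R) (@cos_max R).
have ls := lim _ (@measurable_sin R) (@continuous_sin R) (@sin_max R).
split; last first.
  have : Ex P (fun w => sin (xisum eps M b N w)) @[N --> \oo] --> (0 : R).
    rewrite (_ : (fun N => _) = (fun _ => 0)); first exact: cvg_cst.
    by apply/funext => N; exact: (xisum_cos M b Heps N).2.
  exact: (cvg_unique _ ls).
have : Ex P (fun w => cos (xisum eps M b N w)) @[N --> \oo] --> expR (- (quad K a a / 2)).
  rewrite (_ : (fun N => _) = (fun N => expR (- ((\sum_i \sum_j a i * (\sum_(v < N) \sum_c shA i v c * shA j v c) * a j) / 2)))); last first.
    apply/funext => N; rewrite (xisum_cos M b Heps N).1; congr (expR (- (_ / 2))).
    transitivity (\sum_(v < N) \sum_c \sum_i \sum_j (a i * shA i v c * (shA j v c * a j))).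
      apply: eq_bigr => v _; apply: eq_bigr => c _; rewrite expr2 /b mulr_suml; apply: eq_bigr => i _.
      by rewrite mulr_sumr; apply: eq_bigr => j _; rewrite (mulrC (a j)).
    under eq_bigr do rewrite exchange_big/=.
    rewrite exchange_big/=; apply: eq_bigr => i _.
    under eq_bigr do rewrite exchange_big/=.
    rewrite exchange_big/=; apply: eq_bigr => j _.
    rewrite mulr_sumr mulr_suml; apply: eq_bigr => v _.
    rewrite mulr_sumr mulr_suml; apply: eq_bigr => c _; ring.
  apply: (@cvg_comp _ _ _ _ (fun x : R => expR (- (x / 2))) _ _ _ _ _); last first.
    apply: (@continuous_comp _ _ _ (fun x : R => - (x / 2)) expR); last exact: continuous_expR.
    by move=> x; apply: cvgN; apply: cvgM; [exact: cvg_id|exact: cvg_cst].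
  rewrite /quad; apply: cvg_sumr => i; apply: cvg_sumr => j.
  by apply: cvgM; [apply: cvgM; [exact: cvg_cst|exact: HK]|exact: cvg_cst].
exact: (cvg_unique _ lc).
Qed.
End process_law.

(** * Power sums *)

Section powersums.
Context {R : realType}.
Implicit Types (x a s theta : R) (m n N k l : nat).

Lemma powRE x a : 0 < x -> x `^ a = expR (a * ln x).
Proof. by move=> x0; rewrite /powR gt_eqF. Qed.

(* Two tangent inequalities for exp at the point [theta * u]. *)
Lemma expR_convex theta u : 0 <= theta <= 1 -> expR (theta * u) <= 1 - theta + theta * expR u.
Proof.
move=> /andP[t0 t1].
have e0 := expR_gt0 (theta * u); set E := expR (theta * u) in e0 *.
have h1 : E * (1 + (1 - theta) * u) <= expR u.
  have -> : u = theta * u + (1 - theta) * u by ring.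
  rewrite expRD -/E; apply: ler_wpM2l; first exact: ltW.
  have -> : (1 - theta) * (theta * u + (1 - theta) * u) = (1 - theta) * u by ring.
  exact: expR_ge1Dx.
have h2 : E * (1 - theta * u) <= 1.
  have -> : (1 : R) = E * expR (- (theta * u)) by rewrite /E -expRD addrN expR0.
  by apply: ler_wpM2l; [exact: ltW|have := expR_ge1Dx (- (theta * u)); rewrite /E -expRD addrN expR0].
have h3 : theta * (E * (1 + (1 - theta) * u)) <= theta * expR u by exact: ler_wpM2l.
have h4 : (1 - theta) * (E * (1 - theta * u)) <= (1 - theta) * 1 by apply: ler_wpM2l => //; rewrite subr_ge0.
have -> : E = (1 - theta) * (E * (1 - theta * u)) + theta * (E * (1 + (1 - theta) * u)) by ring.
lra.
Qed.

(** A telescoping form of the comparison with the integral of x^(theta - 1); concavity of the power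
    enters as [expR_convex] at the logarithm of l/(l+1). *)
Lemma powR_step1 theta l : 0 < theta <= 1 -> l.+1%:R `^ (theta - 1) <= (l.+1%:R `^ theta - l%:R `^ theta) / theta.
Proof.
move=> /andP[t0 t1]; set x : R := l.+1%:R; have x0 : 0 < x by rewrite ltr0n.
rewrite ler_pdivlMr//.
have -> : x `^ (theta - 1) = x `^ theta / x by rewrite powRB ?(gt_eqF x0) ?implybT// powRr1// ltW.
case: l @x x0 => [|l] x x0.
  by rewrite powR0 ?gt_eqF// subr0 /x powR1 invr1 !mul1r.
have l0 : 0 < l.+1%:R :> R by rewrite ltr0n.
have e : l.+1%:R `^ theta <= x `^ theta * (1 - theta + theta * (l.+1%:R / x)).
  have -> : l.+1%:R `^ theta = x `^ theta * (l.+1%:R / x) `^ theta.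
    by rewrite -powRM ?divr_ge0 ?ltW//; congr (_ `^ _); rewrite mulrCA divff ?mulr1// gt_eqF.
  apply: ler_wpM2l; first exact: powR_ge0.
  have q0 : 0 < l.+1%:R / x by rewrite divr_gt0.
  rewrite (powRE _ q0); have := @expR_convex theta (ln (l.+1%:R / x)).
  by rewrite lnK ?posrE//; apply; rewrite ltW.
have xx : l.+1%:R / x = 1 - x^-1.
  have -> : l.+1%:R = x - 1 :> R by rewrite /x -[l.+2%:R]natr1 addrK.
  by rewrite mulrBl divff ?gt_eqF// mul1r.
move: e; rewrite xx; move: (x `^ theta) (x^-1) (l.+1%:R `^ theta) => a b c e; lra.
Qed.

Lemma powsum_lt1 theta N : 0 < theta <= 1 -> \sum_(l < N) l.+1%:R `^ (theta - 1) <= N%:R `^ theta / theta.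
Proof.
move=> t01; have /andP[t0 _] := t01; elim: N => [|N IH].
  by rewrite big_ord0 divr_ge0 ?powR_ge0// ltW.
rewrite big_ord_recr/=; have := powR_step1 N t01; rewrite mulrBl; lra.
Qed.

(** The telescoping comparison for summable powers, which controls tails beyond a given index. *)
Lemma powR_step2 s l : 1 < s -> (0 < l)%N -> l.+1%:R `^ (- s) <= (l%:R `^ (1 - s) - l.+1%:R `^ (1 - s)) / (s - 1).
Proof.
move=> s1 l0; set x : R := l.+1%:R; have x0 : 0 < x by rewrite ltr0n.
have l0' : 0 < l%:R :> R by rewrite ltr0n.
have s10 : 0 < s - 1 by rewrite subr_gt0.
rewrite ler_pdivlMr//.
have -> : x `^ (- s) = x `^ (1 - s) / x.
  have e : - s = (1 - s) - 1 by ring.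
  by rewrite [in LHS]e powRB ?(gt_eqF x0) ?implybT// powRr1// ltW.
have q0 : 0 < l%:R / x by rewrite divr_gt0.
have xx : l%:R / x = 1 - x^-1.
  have -> : l%:R = x - 1 :> R by rewrite /x -natr1 addrK.
  by rewrite mulrBl divff ?gt_eqF// mul1r.
have -> : l%:R `^ (1 - s) = x `^ (1 - s) * (l%:R / x) `^ (1 - s).
  by rewrite -powRM ?divr_ge0 ?ltW//; congr (_ `^ _); rewrite mulrCA divff ?mulr1// gt_eqF.
have h : 1 + (s - 1) / x <= (l%:R / x) `^ (1 - s).
  rewrite (powRE _ q0); apply: (le_trans _ (expR_ge1Dx _)); rewrite lerD2l.
  have : ln (l%:R / x) <= - x^-1.
    by have := expR_ge1Dx (ln (l%:R / x)); rewrite lnK ?posrE//; move: (ln _) => t; rewrite xx; move: (x^-1) => b; lra.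
  move: (ln (l%:R / x)) => t; move: (x^-1) => b h.
  have : (s - 1) * t <= (s - 1) * - b by apply: ler_wpM2l => //; exact: ltW.
  lra.
have : x `^ (1 - s) * (1 + (s - 1) / x) <= x `^ (1 - s) * (l%:R / x) `^ (1 - s).
  by apply: ler_wpM2l => //; exact: powR_ge0.
move: ((l%:R / x) `^ (1 - s)) => b; move: (x `^ (1 - s)) (x^-1) => a c; lra.
Qed.

Lemma powsum_gt1 s m N : 1 < s -> (0 < m)%N ->
  \sum_(l < N) (m + l).+1%:R `^ (- s) <= m%:R `^ (1 - s) / (s - 1).
Proof.
move=> s1 m0; have s10 : 0 < s - 1 by rewrite subr_gt0.
apply: (@le_trans _ _ ((m%:R `^ (1 - s) - (m + N)%:R `^ (1 - s)) / (s - 1))); last first.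
  by apply: ler_wpM2r; [rewrite invr_ge0 ltW|rewrite gerBl powR_ge0].
elim: N => [|N IH]; first by rewrite big_ord0 addn0 subrr mul0r.
rewrite big_ord_recr/=; have := @powR_step2 s (m + N) s1; rewrite addn_gt0 m0 => /(_ isT).
rewrite addnS; move: IH; rewrite !mulrBl; lra.
Qed.

Definition al s k : R := (maxn 1 k)%:R `^ (- s).

Lemma al_ge0 s k : 0 <= al s k. Proof. exact: powR_ge0. Qed.
Lemma al_gt0 s k : 0 < al s k. Proof. by apply: powR_gt0; rewrite ltr0n leq_max. Qed.

Lemma al_le s k l : 0 <= s -> (k <= l)%N -> al s l <= al s k.
Proof.
move=> s0 kl; rewrite /al !powRN lef_pV2 ?posrE ?powR_gt0 ?ltr0n ?leq_max//.
by apply: ge0_ler_powR; rewrite ?nnegrE ?ler0n// ler_nat geq_max leq_maxl/= (leq_trans kl (leq_maxr _ _)).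
Qed.

Lemma al_mono s s' k : s <= s' -> al s' k <= al s k.
Proof. by move=> ss; rewrite /al; apply: ler_powR; rewrite ?lerN2// ler1n leq_max. Qed.

Lemma al_sq s k : al s k ^+ 2 = al (2 * s) k.
Proof. by rewrite /al -powR_mulrn ?powR_ge0// -powRrM; congr (_ `^ _); ring. Qed.

Lemma al0 s : al s 0 = 1. Proof. by rewrite /al maxn0 powR1. Qed.
Lemma alS s k : al s k.+1 = k.+1%:R `^ (- s). Proof. by rewrite /al (maxn_idPr _). Qed.

Lemma sum_shift (f : nat -> R) m N : (forall l, 0 <= f l) -> \sum_(l < N) f l <= \sum_(l < m) f l + \sum_(l < N) f (m + l)%N.
Proof.
move=> f0.
apply: (@le_trans _ _ (\sum_(l < m + N) f l)).
  rewrite addnC big_split_ord/= lerDl sumr_ge0//.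
by rewrite big_split_ord.
Qed.

Lemma al_sum_gt1 s m N : 1 < s -> (0 < m)%N -> \sum_(l < N) al s (m + l) <= m%:R `^ (- s) + m%:R `^ (1 - s) / (s - 1).
Proof.
move=> s1 m0; have s10 : 0 < s - 1 by rewrite subr_gt0.
have a0 : 0 <= m%:R `^ (1 - s) / (s - 1) by rewrite divr_ge0 ?powR_ge0// ltW.
case: N => [|N]; first by rewrite big_ord0 addr_ge0// powR_ge0.
rewrite big_ord_recl/= addn0; apply: lerD.
  by case: m m0 {a0} => // m _; rewrite alS.
by apply: (le_trans _ (powsum_gt1 N s1 m0)); apply: ler_sum => l _; rewrite /bump/= ?add1n addnS alS.
Qed.

Lemma al_sum_gt1' s N : 1 < s -> \sum_(l < N) al s l <= 2 + 1 / (s - 1).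
Proof.
move=> s1; have := @sum_shift (al s) 1 N (al_ge0 s); rewrite big_ord1 al0.
have := @al_sum_gt1 s 1 N s1 isT; rewrite !powR1; lra.
Qed.

Lemma al_sum_lt1 theta N : 0 < theta <= 1 -> \sum_(l < N) al (1 - theta) l <= 1 + N%:R `^ theta / theta.
Proof.
move=> t01; have /andP[t0 t1] := t01.
have a0 : 0 <= N%:R `^ theta / theta by rewrite divr_ge0 ?powR_ge0// ltW.
case: N a0 => [|N] a0; first by rewrite big_ord0 addr_ge0.
rewrite big_ord_recl al0 lerD2l.
apply: (le_trans _ (powsum_lt1 N.+1 t01)); rewrite big_ord_recr/= -[leLHS]addr0; apply: lerD; last exact: powR_ge0.
by apply: ler_sum => l _; rewrite /bump/= ?add1n alS opprB.
Qed.

(** The sum is split at l = m. Below m the shifted factor is at most m^(-beta) and the other sums to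
    order m^(1 - beta); beyond m both factors are at most l^(-beta). Each part is of order m^(1 - 2
    beta). The range of beta bounds 1/(1 - beta) by 16 and 1/(2 beta - 1) by 2, so the constant 20 =
    17 + 3 is uniform. *)
Lemma al_corr_lo beta m N : 3 / 4 < beta -> beta <= 15 / 16 ->
  \sum_(l < N) al beta (l + m) * al beta l <= 20 * al (2 * beta - 1) m.
Proof.
move=> b1 b2.
have b0 : 0 <= beta by lra.
have s1 : 1 < 2 * beta by lra.
have iv : 1 / (2 * beta - 1) <= 2.
  by rewrite div1r invf_ple ?posrE ?subr_gt0//; lra.
have f0 l : 0 <= al beta (l + m) * al beta l by rewrite mulr_ge0// al_ge0.
case: m f0 => [|m] f0.
  rewrite al0 mulr1; apply: (@le_trans _ _ (\sum_(l < N) al (2 * beta) l)).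
    by apply: ler_sum => l _; rewrite addn0 -al_sq expr2.
  by have := al_sum_gt1' N s1; lra.
apply: (le_trans (sum_shift m.+1 N f0)).
set x : R := m.+1%:R; have x0 : 0 < x by rewrite ltr0n.
have E : al (2 * beta - 1) m.+1 = x `^ (- beta) * x `^ (1 - beta).
  rewrite alS -/x -powRD ?(gt_eqF x0) ?implybT//.
  by congr (_ `^ _); ring.
have E2 : x `^ (1 - 2 * beta) = al (2 * beta - 1) m.+1 by rewrite alS -/x; congr (_ `^ _); ring.
have x1 : 1 <= x by rewrite ler1n.
have le1 : x `^ 0 <= x `^ (1 - beta) by apply: ler_powR => //; lra.
rewrite powRr0 in le1.
have h1 : \sum_(l < m.+1) al beta (l + m.+1) * al beta l <= 17 * al (2 * beta - 1) m.+1.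
  apply: (@le_trans _ _ (\sum_(l < m.+1) x `^ (- beta) * al beta l)).
    apply: ler_sum => l _; apply: ler_wpM2r; first exact: al_ge0.
    by rewrite -alS; apply: al_le => //; exact: leq_addl.
  rewrite -mulr_sumr E mulrCA; apply: ler_wpM2l; first exact: powR_ge0.
  have := @al_sum_lt1 (1 - beta) m.+1; rewrite opprB addrCA subrr addr0 => H.
  have {}H := H _.
  apply: (le_trans (H _)); first by apply/andP; split; lra.
  have : x `^ (1 - beta) / (1 - beta) <= x `^ (1 - beta) * 16.
    apply: ler_wpM2l; first exact: powR_ge0.
    by rewrite invf_ple ?posrE; lra.
  by rewrite -/x; lra.
have h2 : \sum_(l < N) al beta (m.+1 + l + m.+1) * al beta (m.+1 + l) <= 3 * al (2 * beta - 1) m.+1.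
  apply: (@le_trans _ _ (\sum_(l < N) al (2 * beta) (m.+1 + l))).
    apply: ler_sum => l _; rewrite -al_sq expr2; apply: ler_wpM2r; first exact: al_ge0.
    by apply: al_le => //; exact: leq_addr.
  apply: (le_trans (al_sum_gt1 N s1 (ltn0Sn m))); rewrite -/x E2.
  have : x `^ (- (2 * beta)) <= al (2 * beta - 1) m.+1.
    by rewrite alS -/x; apply: ler_powR => //; lra.
  have : al (2 * beta - 1) m.+1 / (2 * beta - 1) <= al (2 * beta - 1) m.+1 * 2.
    by apply: ler_wpM2l; [exact: al_ge0|rewrite -[leLHS]div1r].
  lra.
by apply: (le_trans (lerD h1 h2)); rewrite -mulrDl; apply: ler_wpM2r; [exact: al_ge0|lra].
Qed.

Lemma al_corr_hi m N : \sum_(l < N) al 2 (l + m) * al 2 l <= 20 * al 2 m :> R.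
Proof.
apply: (@le_trans _ _ (\sum_(l < N) al 2 m * al 2 l)).
  by apply: ler_sum => l _; apply: ler_wpM2r; [exact: al_ge0|apply: al_le => //; exact: leq_addl].
rewrite -mulr_sumr mulrC; apply: ler_wpM2r; first exact: al_ge0.
have s1 : 1 < 2 :> R by lra.
have := al_sum_gt1' N s1; have -> : 2 - 1 = 1 :> R by ring.
lra.
Qed.
End powersums.

(** * Autocovariances *)

Section autocov.
Context {R : realType} {p k : nat}.
Variables (A : nat -> 'M[R]_(p, k)) (C0 beta : R).
Hypotheses (C0_gt0 : 0 < C0) (HA : condition_A beta C0 A).

Lemma condition_A_mono beta' : beta' <= beta -> condition_A beta' C0 A.
Proof.
move=> bb t j; apply: (le_trans (HA t j)); apply: ler_wpM2l; first exact: ltW.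
exact: (al_mono t bb).
Qed.

Definition rdot l l' s t : R := \sum_c A l s c * A l' t c.

(** Cauchy-Schwarz, through 2 u v <= u^2 y/x + v^2 x/y with the decay bounds x and y as weights. *)
Lemma rdot_le l l' s t : `|rdot l l' s t| <= C0 ^+ 2 * (al beta l * al beta l').
Proof.
have x0 := al_gt0 beta l; have y0 := al_gt0 beta l'.
set x := al beta l in x0 *; set y := al beta l' in y0 *.
have sq m j : \sum_c A m j c ^+ 2 <= C0 ^+ 2 * al beta m ^+ 2.
  have h := HA m j; rewrite -exprMn -[leLHS]sqr_sqrtr; last by apply: sumr_ge0 => c _; exact: sqr_ge0.
  by rewrite lerXn2r ?nnegrE ?sqrtr_ge0// mulr_ge0 ?(ltW C0_gt0)// al_ge0.
apply: (le_trans (ler_norm_sum _ _ _)).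
apply: (@le_trans _ _ (\sum_c (A l s c ^+ 2 * (y / x) / 2 + A l' t c ^+ 2 * (x / y) / 2))).
  apply: ler_sum => c _; rewrite normrM.
  set u := `|A l s c|; set v := `|A l' t c|.
  have -> : A l s c ^+ 2 = u ^+ 2 by rewrite real_normK ?num_real.
  have -> : A l' t c ^+ 2 = v ^+ 2 by rewrite real_normK ?num_real.
  have e : u ^+ 2 * (y / x) / 2 + v ^+ 2 * (x / y) / 2 - u * v = (u * y - v * x) ^+ 2 / (2 * x * y).
    by field; rewrite ?gt_eqF.
  by rewrite -subr_ge0 e divr_ge0 ?sqr_ge0// ?mulr_ge0 ?ltW.
rewrite big_split/= -!mulr_suml.
have h1 : (\sum_c A l s c ^+ 2) * (y / x) <= C0 ^+ 2 * x ^+ 2 * (y / x).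
  by apply: ler_wpM2r; [rewrite divr_ge0 ?ltW|exact: sq].
have h2 : (\sum_c A l' t c ^+ 2) * (x / y) <= C0 ^+ 2 * y ^+ 2 * (x / y).
  by apply: ler_wpM2r; [rewrite divr_ge0 ?ltW|exact: sq].
have e1 : C0 ^+ 2 * x ^+ 2 * (y / x) = C0 ^+ 2 * (x * y) by field; rewrite gt_eqF.
have e2 : C0 ^+ 2 * y ^+ 2 * (x / y) = C0 ^+ 2 * (x * y) by field; rewrite gt_eqF.
rewrite e1 in h1; rewrite e2 in h2; lra.
Qed.

Variables (R1 tau : R).
Hypothesis corr : forall m N, \sum_(l < N) al beta (l + m) * al beta l <= R1 * al tau m.

Lemma rdot_abs_sum m N s t : \sum_(l < N) `|rdot (l + m) l s t| <= C0 ^+ 2 * (R1 * al tau m).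
Proof.
apply: (@le_trans _ _ (\sum_(l < N) C0 ^+ 2 * (al beta (l + m) * al beta l))).
  by apply: ler_sum => l _; exact: rdot_le.
by rewrite -mulr_sumr; apply: ler_wpM2l; [exact: sqr_ge0|exact: corr].
Qed.

Definition gam m s t : R := limn (series (fun l => rdot (l + m) l s t)).

Lemma gam_cvg m s t : \sum_(l < N) rdot (l + m) l s t @[N --> \oo] --> gam m s t.
Proof.
have : cvgn (series (fun l => rdot (l + m) l s t)).
  apply: normed_cvg; apply: nondecreasing_is_cvgn.
    by apply: nondecreasing_series => l _ _; exact: normr_ge0.
  exists (C0 ^+ 2 * (R1 * al tau m)) => _ [N _ <-].
  by rewrite /= /series/= big_mkord; exact: rdot_abs_sum.
rewrite /gam => /cvg_ex[g cg]; rewrite (cvg_lim _ cg)//.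
rewrite (_ : (fun N => _) = series (fun l => rdot (l + m) l s t))//.
by apply/funext => N; rewrite /series/= big_mkord.
Qed.

Lemma gam_le m s t : `|gam m s t| <= C0 ^+ 2 * R1 * al tau m.
Proof.
have H : `|\sum_(l < N) rdot (l + m) l s t| @[N --> \oo] --> `|gam m s t| by apply: cvg_norm; exact: gam_cvg.
rewrite -(cvg_lim _ H)//; apply: limr_le; first by apply/cvg_ex; exists `|gam m s t|.
near=> N; rewrite /= -mulrA; apply: (le_trans _ (rdot_abs_sum m N s t)); exact: ler_norm_sum.
Unshelve. all: by end_near.
Qed.

(** [Negz m] is -(m+1), and the autocovariance at a negative lag is the transpose of that at the
    opposite lag. *)
Definition acov (z : int) s t : R := match z with Posz m => gam m s t | Negz m => gam m.+1 t s end.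

Lemma acov_le z s t : `|acov z s t| <= C0 ^+ 2 * R1 * al tau `|z|%N.
Proof. by case: z => m; exact: gam_le. Qed.

Lemma gam0C s t : gam 0 s t = gam 0 t s.
Proof.
rewrite /gam; congr (limn (series _)); apply/funext => l; rewrite /rdot; apply: eq_bigr => c _.
by rewrite addn0 mulrC.
Qed.

Lemma acovN z s t : acov (- z) s t = acov z t s.
Proof. by case: z => [[|m]|m] //=; rewrite ?oppr0; exact: gam0C. Qed.

Section family.
Context {d} {T : measurableType d} (P : probability T R).
Variables (eps : int -> T -> 'cV[R]_k) (X : int -> T -> 'cV[R]_p).
Hypothesis HX : gaussian_linear_process P eps A X.
Context {I : finType}.
Variables (idx : I -> int) (comp : I -> 'I_p).

Lemma family_gauss : gauss P (fun i w => X (idx i) w (comp i) 0) (fun i j => acov (idx i - idx j) (comp i) (comp j)).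
Proof.
(* A time origin not before any of the finitely many times, so that every M - idx i is a natural
   number. *)
pose M : int := \sum_i `|idx i|.
pose n i := `|(M - idx i)%R|%N.
have nE i : M - (n i)%:Z = idx i.
  rewrite /n gez0_abs ?subKr// subr_ge0 /M (bigD1 i)//=.
  by apply: (le_trans (ler_norm _)); rewrite lerDl sumr_ge0.
have := @process_gauss _ _ _ P _ _ _ _ _ HX I M n comp (fun i j => acov (idx i - idx j) (comp i) (comp j)).
move=> H; have {}H := H _.
have -> : (fun i w => X (idx i) w (comp i) 0) = (fun i w => X (M - (n i)%:Z) w (comp i) 0) by apply/funext => i; rewrite nE.
apply: H => i j.
have shE a b (ba : (n b <= n a)%N) N : \sum_(v < N + n a) \sum_c shA A n comp a v c * shA A n comp b v c =
   \sum_(l < N) rdot l (l + (n a - n b)) (comp a) (comp b).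
  rewrite -(big_mkord xpredT (fun v => \sum_c shA A n comp a v c * shA A n comp b v c)) (@big_cat_nat _ _ _ (n a))//=; last exact: leq_addl.
  rewrite big1_seq ?add0r; last first.
    move=> v /andP[_]; rewrite mem_index_iota => /andP[_ vn]; apply: big1 => c _.
    by rewrite /shA leqNgt vn mul0r.
  rewrite -{1}[n a]add0n big_addn addnK big_mkord; apply: eq_bigr => l _; apply: eq_bigr => c _.
  rewrite /shA leq_addl addnK (leq_trans ba (leq_addl _ _)); congr (_ * A _ _ _); by rewrite addnBA.
have [ij|ji] := leqP (n i) (n j).
  rewrite -(cvg_shiftn (n j)).
  have -> : idx i - idx j = (n j - n i)%N.
    by rewrite -!nE -subzn//; ring.
  rewrite (_ : (fun N => _) = (fun N => \sum_(l < N) rdot (l + (n j - n i)) l (comp i) (comp j))).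
    exact: gam_cvg.
  apply/funext => N /=.
  transitivity (\sum_(v < N + n j) \sum_c shA A n comp j v c * shA A n comp i v c).
    by apply: eq_bigr => v _; apply: eq_bigr => c _; rewrite mulrC.
  rewrite shE//; apply: eq_bigr => l _; rewrite /rdot; apply: eq_bigr => c _; exact: mulrC.
rewrite -(cvg_shiftn (n i)).
have -> : idx i - idx j = - (n i - n j)%N%:Z.
  by rewrite -!nE -subzn ?(ltnW ji)//; ring.
rewrite acovN.
rewrite (_ : (fun N => _) = (fun N => \sum_(l < N) rdot (l + (n i - n j)) l (comp j) (comp i))).
  exact: gam_cvg.
apply/funext => N /=; rewrite shE ?(ltnW ji)//; apply: eq_bigr => l _; rewrite /rdot; apply: eq_bigr => c _; exact: mulrC.
Qed.
End family.
End autocov.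

(** * The quadratic forms of the sample covariance *)

Section distances.
Context {R : realType}.

Lemma sum_dist_le (f : nat -> R) n (i : 'I_n) : (forall k, 0 <= f k) ->
  \sum_(l < n) f `|i%:Z - l%:Z|%N <= 2 * \sum_(k < n) f k.
Proof.
move=> f0; have iln := ltn_ord i.
rewrite -(big_mkord xpredT (fun l => f `|i%:Z - l%:Z|%N)) (@big_cat_nat _ _ _ i)//=; last exact: ltnW.
have -> : \sum_(0 <= l < i) f `|i%:Z - l%:Z|%N = \sum_(0 <= l < i) f (i - l)%N.
  by rewrite !big_nat; apply: eq_bigr => l /andP[_ li]; rewrite distnEl// ltnW.
have -> : \sum_(i <= l < n) f `|i%:Z - l%:Z|%N = \sum_(0 <= l < n - i) f l.
  rewrite -{1}[nat_of_ord i]add0n big_addn; apply: eq_bigr => l _.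
  by rewrite distnEr ?leq_addl// addnK.
have h1 : \sum_(0 <= l < n - i) f l <= \sum_(k < n) f k.
  rewrite -(big_mkord xpredT f) (@big_cat_nat _ _ _ (n - i) 0 n)//=; last exact: leq_subr.
  by rewrite lerDl sumr_ge0.
have h2 : \sum_(0 <= l < i) f (i - l)%N <= \sum_(k < n) f k.
  rewrite big_nat_rev/= add0n; under eq_big_nat => l /andP[_ li].
    rewrite subKn//; over.
  rewrite -(big_mkord xpredT f) (@big_cat_nat _ _ _ i.+1 0 n)//= big_nat_recl//= -addrA addrCA lerDl addr_ge0// sumr_ge0//.
lra.
Qed.

(** A positive lag k occurs 2 (n - k) times in the square and lag 0 occurs n times; the correction
    removes the second count of lag 0. *)
Lemma sum_dist2 (f : nat -> R) n :
  \sum_(i < n) \sum_(l < n) f `|i%:Z - l%:Z|%N = 2 * (\sum_(k < n) (n%:R - k%:R) * f k) - n%:R * f 0%N.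
Proof.
elim: n => [|n IH]; first by rewrite !big_ord0 mulr0 mul0r subrr.
rewrite big_ord_recr/=; under eq_bigr do rewrite big_ord_recr/=.
rewrite big_split/= IH.
have e1 : \sum_(i < n) f `|i%:Z - n%:Z|%N = \sum_(k < n) f k.+1.
  rewrite (reindex_inj rev_ord_inj)/=; apply: eq_bigr => i _.
  rewrite distnEr ?leq_subr//; congr f; rewrite subKn//.
have e2 : \sum_(l < n.+1) f `|n%:Z - l%:Z|%N = \sum_(k < n) f k.+1 + f 0%N.
  rewrite big_ord_recr/= subrr absz0; congr (_ + _); rewrite -e1; apply: eq_bigr => l _.
  by rewrite distnC.
rewrite e1 e2.
have -> : \sum_(k < n.+1) (n.+1%:R - k%:R) * f k = \sum_(k < n) (n%:R - k%:R) * f k + \sum_(k < n.+1) f k.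
  rewrite [in LHS]big_ord_recr/= [in RHS]big_ord_recr/= addrA -big_split/=; congr (_ + _).
    by apply: eq_bigr => k _; rewrite -natr1; ring.
  by rewrite -natr1; ring.
by rewrite big_ord_recl/= -natr1; ring.
Qed.
End distances.

(** * Dimension-free bounds for the trace and the operator norm *)

Section domination.
Context {R : realType} {n p : nat}.
Notation I := ('I_n * 'I_p)%type.
Variables (K : I -> I -> R) (rr : 'I_n -> 'I_n -> R) (w W2 : R).
Hypothesis symK : forall x y, K x y = K y x.
Hypothesis psdK : forall a, 0 <= quad K a a.
Hypothesis Kr : forall x y, `|K x y| <= rr x.1 y.1.
Hypothesis rrC : forall i l, rr i l = rr l i.
Hypothesis w0 : 0 < w.
Hypothesis roww : forall i, \sum_l rr i l <= w.
Hypothesis sqW : \sum_i \sum_l rr i l ^+ 2 <= W2.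

Hypothesis rr0 : forall i l, 0 <= rr i l.
Variables (M : I -> I -> R) (c2 : R) (m : 'I_p -> 'I_p -> R).
Hypothesis symM : forall x y, M x y = M y x.
Hypothesis c20 : 0 <= c2.
Hypothesis m0 : forall a b, 0 <= m a b.
Hypothesis mC : forall a b, m a b = m b a.
Hypothesis m8 : \sum_a \sum_b m a b = 8.
Hypothesis Mr : forall x y, `|M x y| <= c2 * (m x.2 y.2 * rr x.1 y.1).

Let pairsum (F : I -> R) : \sum_x F x = \sum_i \sum_a F (i, a).
Proof. by rewrite pair_bigA; apply: eq_bigr => -[]. Qed.

Let sum_sep (f : 'I_n -> 'I_n -> R) : \sum_(x : I) \sum_(u : I) m x.2 u.2 * f x.1 u.1 = 8 * \sum_i \sum_l f i l.
Proof.
rewrite pairsum mulr_sumr; apply: eq_bigr => i _.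
under eq_bigr do rewrite pairsum.
rewrite exchange_big/= mulr_sumr; apply: eq_bigr => l _.
under eq_bigr do rewrite -mulr_suml.
by rewrite -mulr_suml m8.
Qed.

(** The product runs over a cycle of four edges. The arithmetic-geometric inequality for two
    opposite edges leaves one squared edge, and the two remaining edges are summed by rows to at
    most w each. *)
Let four : \sum_i \sum_l \sum_o \sum_k rr i l * rr l k * rr o k * rr i o <= w ^+ 2 * W2.
Proof.
have b1 : \sum_i \sum_l \sum_o \sum_k rr i l ^+ 2 * (rr l k * rr i o) <= w ^+ 2 * W2.
  apply: (@le_trans _ _ (w ^+ 2 * \sum_i \sum_l rr i l ^+ 2)); last by apply: ler_wpM2l => //; exact: sqr_ge0.
  rewrite mulr_sumr; apply: ler_sum => i _; rewrite mulr_sumr; apply: ler_sum => l _.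
  under eq_bigr do rewrite -mulr_sumr -mulr_suml.
  rewrite -mulr_sumr mulrC; apply: ler_wpM2r; first exact: sqr_ge0.
  rewrite -mulr_sumr expr2; apply: ler_pM => //; exact: sumr_ge0.
have b2 : \sum_i \sum_l \sum_o \sum_k rr o k ^+ 2 * (rr l k * rr i o) <= w ^+ 2 * W2.
  apply: (@le_trans _ _ (w ^+ 2 * \sum_i \sum_l rr i l ^+ 2)); last by apply: ler_wpM2l => //; exact: sqr_ge0.
  under eq_bigr do rewrite exchange_big/=.
  rewrite exchange_big/= mulr_sumr; apply: ler_sum => o _.
  under eq_bigr do rewrite exchange_big/=.
  rewrite exchange_big/= mulr_sumr; apply: ler_sum => k _.
  under eq_bigr do rewrite -mulr_sumr -mulr_suml.
  rewrite -mulr_sumr mulrC; apply: ler_wpM2r; first exact: sqr_ge0.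
  rewrite -mulr_sumr expr2; apply: ler_pM; rewrite ?sumr_ge0//.
    by under eq_bigr do rewrite rrC.
  by under eq_bigr do rewrite rrC.
apply: (@le_trans _ _ (\sum_i \sum_l \sum_o \sum_k (rr i l ^+ 2 * (rr l k * rr i o) / 2 + rr o k ^+ 2 * (rr l k * rr i o) / 2))).
  apply: ler_sum => i _; apply: ler_sum => l _; apply: ler_sum => o _; apply: ler_sum => k _.
  have : 0 <= (rr i l - rr o k) ^+ 2 * (rr l k * rr i o) by rewrite mulr_ge0 ?sqr_ge0 ?mulr_ge0.
  lra.
under eq_bigr do under eq_bigr do under eq_bigr do rewrite big_split/= -!mulr_suml.
under eq_bigr do under eq_bigr do rewrite big_split/= -!mulr_suml.
under eq_bigr do rewrite big_split/= -!mulr_suml.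
rewrite big_split/= -!mulr_suml; lra.
Qed.

(** The trace of M K M K, entrywise dominated by the cycle sum [four]. The component weights of the
    two factors M sum to 8 each, so the number p of components does not appear. *)
Lemma dom_mtr : mtr K (sandw K M) <= 64 * c2 ^+ 2 * w ^+ 2 * W2.
Proof.
apply: (@le_trans _ _ (\sum_x \sum_u \sum_y \sum_v c2 ^+ 2 * (m x.2 u.2 * (m y.2 v.2 * (rr x.1 u.1 * rr u.1 v.1 * rr y.1 v.1 * rr x.1 y.1))))).
  rewrite /mtr /sandw /quad; apply: ler_sum => x _; rewrite [leRHS]exchange_big/=; apply: ler_sum => y _.
  apply: (le_trans (ler_norm _)); rewrite normrM.
  apply: (@le_trans _ _ (\sum_u \sum_v `|M x u * K u v * M y v| * `|K x y|)).
    rewrite (_ : \sum_u _ = (\sum_u \sum_v `|M x u * K u v * M y v|) * `|K x y|).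
      by apply: ler_wpM2r => //; apply: (le_trans (ler_norm_sum _ _ _)); apply: ler_sum => u _; exact: ler_norm_sum.
    by rewrite mulr_suml; apply: eq_bigr => u _; rewrite mulr_suml.
  apply: ler_sum => u _; apply: ler_sum => v _; rewrite !normrM.
  apply: (@le_trans _ _ ((c2 * (m x.2 u.2 * rr x.1 u.1)) * rr u.1 v.1 * (c2 * (m y.2 v.2 * rr y.1 v.1)) * rr x.1 y.1)).
    by apply: ler_pM; rewrite ?mulr_ge0//; apply: ler_pM; rewrite ?mulr_ge0//; apply: ler_pM.
  rewrite le_eqVlt; apply/orP; left; apply/eqP; ring.
under eq_bigr do under eq_bigr do under eq_bigr do rewrite -!mulr_sumr.
under eq_bigr do under eq_bigr do rewrite -!mulr_sumr.
under eq_bigr do rewrite -!mulr_sumr.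
rewrite -mulr_sumr.
under eq_bigr => x _ do under eq_bigr => u _ do rewrite (sum_sep (fun o k => rr x.1 u.1 * rr u.1 k * rr o k * rr x.1 o)) mulrCA.
under eq_bigr do rewrite -!mulr_sumr.
rewrite -mulr_sumr (sum_sep (fun i l => \sum_o \sum_k rr i l * rr l k * rr o k * rr i o)).
have -> : c2 ^+ 2 * (8 * (8 * \sum_i \sum_l \sum_o \sum_k rr i l * rr l k * rr o k * rr i o)) =
  64 * c2 ^+ 2 * (\sum_i \sum_l \sum_o \sum_k rr i l * rr l k * rr o k * rr i o) by ring.
rewrite -[leRHS]mulrA; apply: ler_wpM2l; last exact: four.
by rewrite mulr_ge0// sqr_ge0.
Qed.

Let sum1 (F : I -> R) a : \sum_x (x.2 == a)%:R * F x = \sum_i F (i, a).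
Proof.
rewrite pairsum; apply: eq_bigr => i _; rewrite (bigD1 a)//= eqxx mul1r big1 ?addr0// => b /negbTE ->.
by rewrite mul0r.
Qed.

Section kappa.
Variable u : I -> R.
Let g x := \sum_y K x y * u y.
Let G a := \sum_i g (i, a) ^+ 2.
Let G0 a : 0 <= G a. Proof. by apply: sumr_ge0 => i _; exact: sqr_ge0. Qed.

(* The restriction [v] of [K u] to the component [a] satisfies [v' K v <= w |v|^2]. *)
Let G_le a : G a <= w * quad K u u.
Proof.
pose v (x : I) := (x.2 == a)%:R * g x.
have vu : quad K v u = G a.
  rewrite /quad; transitivity (\sum_x v x * g x).
    by apply: eq_bigr => x _; rewrite mulr_sumr; apply: eq_bigr => y _; rewrite mulrA.
  by rewrite /v; under eq_bigr do rewrite -mulrA -expr2; rewrite (sum1 (fun x => g x ^+ 2)).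
have vv : quad K v v <= w * G a.
  have e : quad K v v = \sum_i \sum_l g (i, a) * K (i, a) (l, a) * g (l, a).
    rewrite /quad; transitivity (\sum_x (x.2 == a)%:R * \sum_l (g x * K x (l, a) * g (l, a))).
      apply: eq_bigr => x _; rewrite mulr_sumr -[RHS](sum1 (fun y => (x.2 == a)%:R * (g x * K x y * g y))).
      by apply: eq_bigr => y _; rewrite /v; ring.
    by rewrite sum1.
  rewrite e.
  apply: (@le_trans _ _ (\sum_i \sum_l (rr i l * g (i, a) ^+ 2 / 2 + rr i l * g (l, a) ^+ 2 / 2))).
    apply: ler_sum => i _; apply: ler_sum => l _.
    apply: (le_trans (ler_norm _)); rewrite !normrM.
    have h := Kr (i, a) (l, a); rewrite /= in h.
    have h' : `|g (i, a)| * `|g (l, a)| * `|K (i, a) (l, a)| <= `|g (i, a)| * `|g (l, a)| * rr i l.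
      by apply: ler_wpM2l => //; exact: mulr_ge0.
    have : 0 <= rr i l * (`|g (i, a)| - `|g (l, a)|) ^+ 2 by rewrite mulr_ge0// sqr_ge0.
    rewrite -[g (i, a) ^+ 2]real_normK ?num_real// -[g (l, a) ^+ 2]real_normK ?num_real//.
    move: (`|g (i, a)|) (`|g (l, a)|) (`|K (i, a) (l, a)|) (rr i l) h' => x1 x2 x3 x4 h'; lra.
  under eq_bigr do rewrite big_split/= -!mulr_suml.
  rewrite big_split/= -!mulr_suml.
  have b1 : \sum_i (\sum_l rr i l) * g (i, a) ^+ 2 <= w * G a.
    by rewrite /G mulr_sumr; apply: ler_sum => i _; apply: ler_wpM2r => //; exact: sqr_ge0.
  have b2 : \sum_i \sum_l rr i l * g (l, a) ^+ 2 <= w * G a.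
    rewrite exchange_big/= /G mulr_sumr; apply: ler_sum => l _; rewrite -mulr_suml.
    by apply: ler_wpM2r; [exact: sqr_ge0|under eq_bigr do rewrite rrC].
  lra.
(* Positivity at u - v/w: the cross terms give - 2 G/w and the square of v at most G/w, which leaves
   G/w <= u' K u. *)
have := psdK (fun x => 1 * u x + (- w^-1) * v x); rewrite quad_comb (quadC symK u v) vu.
have wv : w^-1 * w^-1 * quad K v v <= w^-1 * w^-1 * (w * G a).
  by apply: ler_wpM2l => //; rewrite mulr_ge0 ?invr_ge0 ?ltW.
have e2 : w^-1 * w^-1 * (w * G a) = w^-1 * G a by field; rewrite gt_eqF.
rewrite e2 in wv.
move=> h; have : w^-1 * G a <= quad K u u by lra.
by rewrite ler_pdivrMl// mulrC.
Qed.

(** A Schur test: g_x g_y is split into squares, the rows of [rr] give one factor w, and [G_le]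
    gives the other for each component. Only the total component weight 8 enters. *)
Lemma dom_gMg : `|\sum_x \sum_y M x y * (g x * g y)| <= 8 * c2 * w ^+ 2 * quad K u u.
Proof.
pose Qu := quad K u u; have Q0 : 0 <= Qu by exact: psdK.
have half : \sum_x \sum_y m x.2 y.2 * rr x.1 y.1 * g x ^+ 2 <= 8 * (w ^+ 2 * Qu).
  apply: (@le_trans _ _ (\sum_(x : I) (w * g x ^+ 2) * \sum_b m x.2 b)).
    apply: ler_sum => x _; rewrite pairsum.
    rewrite exchange_big/= mulr_sumr; apply: ler_sum => b _.
    rewrite -mulr_suml -mulr_sumr mulrAC [leRHS]mulrC -mulrA; apply: ler_wpM2l => //.
    by rewrite mulrC; apply: ler_wpM2r => //; exact: sqr_ge0.
  rewrite pairsum exchange_big/= -m8 mulr_suml; apply: ler_sum => a _.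
  rewrite -mulr_suml mulrC; apply: ler_wpM2l; first exact: sumr_ge0.
  by rewrite -mulr_sumr expr2 -mulrA; apply: ler_wpM2l; [exact: ltW|exact: G_le].
have half' : \sum_x \sum_y m x.2 y.2 * rr x.1 y.1 * g y ^+ 2 <= 8 * (w ^+ 2 * Qu).
  apply: (le_trans _ half); rewrite exchange_big/=; apply: ler_sum => x _; apply: ler_sum => y _.
  by rewrite mC rrC.
apply: (le_trans (ler_norm_sum _ _ _)).
apply: (@le_trans _ _ (c2 * ((\sum_x \sum_y m x.2 y.2 * rr x.1 y.1 * g x ^+ 2) / 2 + (\sum_x \sum_y m x.2 y.2 * rr x.1 y.1 * g y ^+ 2) / 2))).
  rewrite -mulrDl -big_split/= mulr_suml mulr_sumr; apply: ler_sum => x _.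
  apply: (le_trans (ler_norm_sum _ _ _)); rewrite -big_split/= mulr_suml mulr_sumr; apply: ler_sum => y _.
  rewrite !normrM; apply: (le_trans (ler_wpM2r (mulr_ge0 (normr_ge0 _) (normr_ge0 _)) (Mr x y))).
  rewrite -[leLHS]mulrA; apply: ler_wpM2l => //; rewrite -mulrDr -[leRHS]mulrA; apply: ler_wpM2l; first exact: mulr_ge0.
  have := sqr_ge0 (`|g x| - `|g y|).
  rewrite -[g x ^+ 2]real_normK ?num_real// -[g y ^+ 2]real_normK ?num_real//.
  move: (`|g x|) (`|g y|) => x1 x2; lra.
have -> : 8 * c2 * w ^+ 2 * quad K u u = c2 * (8 * (w ^+ 2 * Qu)) by rewrite /Qu; ring.
apply: ler_wpM2l => //; lra.
Qed.
End kappa.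

(** With u = M z and g = K u, the form of M K M K M at z is g' M g. This supplies the hypothesis
    [kapP] of the moment bound. *)
Lemma dom_kappa z : `|quad K (mv (sandw K M) z) (mv M z)| <= 8 * c2 * w ^+ 2 * quad K (mv M z) (mv M z).
Proof.
set u := mv M z; pose g x := \sum_y K x y * u y.
have E : quad K (mv (sandw K M) z) u = \sum_x \sum_y M x y * (g x * g y).
  have e1 x : mv (sandw K M) z x = \sum_a M x a * g a.
    rewrite /mv /dot /sandw.
    have -> : \sum_y quad K (M x) (M y) * z y = quad K (M x) (fun a => \sum_y z y * M y a).
      by rewrite quad_sumr; apply: eq_bigr => y _; rewrite mulrC.
    rewrite /quad; apply: eq_bigr => a _; rewrite /g mulr_sumr; apply: eq_bigr => b _; rewrite -mulrA; congr (_ * (_ * _)).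
    by rewrite /u /mv /dot; apply: eq_bigr => y _; rewrite mulrC symM.
  transitivity (\sum_x mv (sandw K M) z x * g x).
    by rewrite /quad; apply: eq_bigr => x _; rewrite /g mulr_sumr; apply: eq_bigr => y _; rewrite mulrA.
  apply: eq_bigr => x _; rewrite e1 mulr_suml; apply: eq_bigr => a _; ring.
by rewrite E; exact: (dom_gMg u).
Qed.
End domination.

(** * The matrices of the sample covariance entries *)

Section entries.
Context {R : realType} {n p : nat}.
Notation I := ('I_n * 'I_p)%type.
Notation J := (bool * ('I_p * 'I_p))%type.
Variables (g : int -> 'I_p -> 'I_p -> R) (rho : nat -> R).
Hypothesis gN : forall z s t, g (- z) s t = g z t s.
Hypothesis g_le : forall z s t, `|g z s t| <= rho `|z|%N.

Definition Kg (x y : I) : R := g (x.1%:Z - y.1%:Z) x.2 y.2.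
Let cn : R := (Num.sqrt n%:R)^-1.
(* The sign in [J] turns the maximum absolute entry into a maximum over [J]. *)
Definition qc (j : J) : R := (if j.1 then 1 else -1) * (cn / 2).
(** Symmetrised over the two components s and t, so that the form is the sign times n^(-1/2) times
    the sum over i of y_is y_it; hence the half in [qc]. *)
Definition Qj (j : J) (x u : I) : R :=
  qc j * ((x.2 == j.2.1)%:R * (u == (x.1, j.2.2))%:R + (x.2 == j.2.2)%:R * (u == (x.1, j.2.1))%:R).

Lemma symKg x y : Kg x y = Kg y x.
Proof. by rewrite /Kg -gN opprB. Qed.

Lemma symQj j x u : Qj j x u = Qj j u x.
Proof.
case: j x u => [b [s t]] [i a] [l c]; rewrite /Qj/= !xpair_eqE (eq_sym l i).
case: (i == l) => /=; last by rewrite !mulr0.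
rewrite addrC; congr (_ * (_ + _)); rewrite -!natrM !mulnb andbC//.
Qed.

Let deltaS (F : I -> R) a : \sum_u (u == a)%:R * F u = F a.
Proof. by rewrite (bigD1 a)//= eqxx mul1r big1 ?addr0// => u /negbTE ->; rewrite mul0r. Qed.

Lemma sum_Qj j x F : \sum_u Qj j x u * F u =
  qc j * ((x.2 == j.2.1)%:R * F (x.1, j.2.2) + (x.2 == j.2.2)%:R * F (x.1, j.2.1)).
Proof.
rewrite -[F (x.1, j.2.2)]deltaS -[F (x.1, j.2.1)]deltaS !mulr_sumr -big_split/= mulr_sumr.
by apply: eq_bigr => u _; rewrite /Qj; ring.
Qed.

Lemma quad_Qj j k x y : quad Kg (Qj j x) (Qj k y) = qc j * qc k *
  ((x.2 == j.2.1)%:R * ((y.2 == k.2.1)%:R * Kg (x.1, j.2.2) (y.1, k.2.2) + (y.2 == k.2.2)%:R * Kg (x.1, j.2.2) (y.1, k.2.1))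
 + (x.2 == j.2.2)%:R * ((y.2 == k.2.1)%:R * Kg (x.1, j.2.1) (y.1, k.2.2) + (y.2 == k.2.2)%:R * Kg (x.1, j.2.1) (y.1, k.2.1))).
Proof.
rewrite /quad; transitivity (\sum_u Qj j x u * \sum_v Qj k y v * Kg u v).
  by apply: eq_bigr => u _; rewrite mulr_sumr; apply: eq_bigr => v _; ring.
by rewrite sum_Qj !sum_Qj; ring.
Qed.

Definition Q2g j k (x y : I) := quad Kg (Qj j x) (Qj k y) + quad Kg (Qj k x) (Qj j y).

Lemma symQ2g j k x y : Q2g j k x y = Q2g j k y x.
Proof. by rewrite /Q2g (quadC symKg (Qj j x)) (quadC symKg (Qj k x)) addrC. Qed.

Hypothesis n0 : (0 < n)%N.
Let n0' : 0 < n%:R :> R. Proof. by rewrite ltr0n. Qed.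

Lemma qc_sq j : qc j ^+ 2 = (4 * n%:R)^-1.
Proof.
have c2 : cn ^+ 2 = n%:R^-1 by rewrite /cn exprVn sqr_sqrtr// ltW.
have -> : qc j ^+ 2 = cn ^+ 2 / 4 by rewrite /qc; case: j.1; field.
by rewrite c2 invfM mulrC.
Qed.

Lemma abs_qc j : `|qc j| = cn / 2.
Proof.
have c0 : 0 <= cn / 2 by rewrite divr_ge0 ?invr_ge0 ?sqrtr_ge0.
by rewrite /qc normrM (ger0_norm c0); case: j.1; rewrite ?normrN normr1 mul1r.
Qed.

(** Counts with multiplicity, so that the totals 2 and 8 below hold also when the two components of
    the entry coincide. *)
Definition ee (j : J) (a : 'I_p) : R := (a == j.2.1)%:R + (a == j.2.2)%:R.
Definition mm j k a b : R := ee j a * ee k b + ee k a * ee j b.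

Lemma ee_ge0 j a : 0 <= ee j a. Proof. exact: addr_ge0. Qed.
Lemma mm_ge0 j k a b : 0 <= mm j k a b. Proof. by rewrite addr_ge0// mulr_ge0 ?ee_ge0. Qed.
Lemma mmC j k a b : mm j k a b = mm j k b a. Proof. by rewrite /mm; ring. Qed.

Lemma sum_ee j : \sum_a ee j a = 2.
Proof.
have d (s : 'I_p) : \sum_a (a == s)%:R = 1 :> R by rewrite (bigD1 s)//= eqxx big1 ?addr0// => a /negbTE ->.
by rewrite big_split/= !d; ring.
Qed.

Lemma sum_mm j k : \sum_a \sum_b mm j k a b = 8.
Proof.
under eq_bigr do rewrite big_split/= -!mulr_sumr !sum_ee.
by rewrite big_split/= -!mulr_suml !sum_ee; ring.
Qed.

Lemma Kg_le x y : `|Kg x y| <= rho `|x.1%:Z - y.1%:Z|%N. Proof. exact: g_le. Qed.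

Lemma quad_Qj_le j k x y : `|quad Kg (Qj j x) (Qj k y)| <= (4 * n%:R)^-1 * (ee j x.2 * ee k y.2 * rho `|x.1%:Z - y.1%:Z|%N).
Proof.
have q2 : `|qc j * qc k| = (4 * n%:R)^-1.
  by rewrite normrM !abs_qc -expr2 -(abs_qc j) real_normK ?num_real// qc_sq.
rewrite quad_Qj normrM q2; apply: ler_wpM2l; first by rewrite invr_ge0 mulr_ge0// ltW.
set r := rho _.
have hK a b : `|Kg (x.1, a) (y.1, b)| <= r by exact: (Kg_le (x.1, a) (y.1, b)).
have i0 (b : bool) : 0 <= b%:R :> R by exact: ler0n.
rewrite /ee mulrDl mulrDl; apply: (le_trans (ler_normD _ _)).
have h (c c1 c2 : bool) (k1 k2 : R) : `|k1| <= r -> `|k2| <= r -> `|c%:R * (c1%:R * k1 + c2%:R * k2)| <= c%:R * (c1%:R + c2%:R) * r.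
  move=> h1 h2; rewrite normrM (ger0_norm (i0 c)) -mulrA; apply: ler_wpM2l => //.
  apply: (le_trans (ler_normD _ _)); rewrite !normrM !(ger0_norm (i0 _)) mulrDl.
  by apply: lerD; apply: ler_wpM2l.
by apply: lerD; apply: h.
Qed.

Lemma Q2g_le j k x y : `|Q2g j k x y| <= (4 * n%:R)^-1 * (mm j k x.2 y.2 * rho `|x.1%:Z - y.1%:Z|%N).
Proof.
apply: (le_trans (ler_normD _ _)); rewrite /mm [X in _ <= _ * X]mulrDl [X in _ <= X]mulrDr.
by apply: lerD; exact: quad_Qj_le.
Qed.

Lemma qf_Qj j y : qf Kg (Qj j) y = (if j.1 then 1 else -1) * cn * \sum_(i < n) (y (i, j.2.1) * y (i, j.2.2) - g 0 j.2.1 j.2.2).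
Proof.
have pairsum (F : I -> R) : \sum_x F x = \sum_i \sum_a F (i, a).
  by rewrite pair_bigA; apply: eq_bigr => -[].
have dl (F : 'I_p -> R) s : \sum_a (a == s)%:R * F a = F s.
  by rewrite (bigD1 s)//= eqxx mul1r big1 ?addr0// => a /negbTE ->; rewrite mul0r.
have e1 : quad (Qj j) y y = \sum_i qc j * (2 * (y (i, j.2.1) * y (i, j.2.2))).
  rewrite /quad; transitivity (\sum_x y x * \sum_u Qj j x u * y u).
    by apply: eq_bigr => x _; rewrite mulr_sumr; apply: eq_bigr => u _; rewrite mulrA.
  under eq_bigr do rewrite sum_Qj.
  rewrite pairsum; apply: eq_bigr => i _ /=.
  transitivity (\sum_a (a == j.2.1)%:R * (qc j * (y (i, a) * y (i, j.2.2))) + \sum_a (a == j.2.2)%:R * (qc j * (y (i, a) * y (i, j.2.1)))).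
    by rewrite -big_split/=; apply: eq_bigr => a _; ring.
  by rewrite !dl; ring.
have e2 : mtr Kg (Qj j) = \sum_(i < n) qc j * (2 * g 0 j.2.1 j.2.2).
  rewrite /mtr; under eq_bigr do rewrite sum_Qj.
  rewrite pairsum; apply: eq_bigr => i _ /=.
  transitivity (\sum_a (a == j.2.1)%:R * (qc j * Kg (i, a) (i, j.2.2)) + \sum_a (a == j.2.2)%:R * (qc j * Kg (i, a) (i, j.2.1))).
    by rewrite -big_split/=; apply: eq_bigr => a _; ring.
  rewrite !dl /Kg/= subrr -[g 0 j.2.2 j.2.1]gN oppr0; ring.
rewrite /qf e1 e2 -sumrB mulr_sumr; by apply: eq_bigr => i _; rewrite /qc; field.
Qed.

(** The fourth-moment formula for Gaussian products, in the form that matches the summands of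
    condition (G). *)
Lemma mtr_Q2g j : mtr Kg (Q2g j j) = n%:R^-1 * \sum_(i < n) \sum_(l < n)
  (g (i%:Z - l%:Z) j.2.1 j.2.1 * g (i%:Z - l%:Z) j.2.2 j.2.2 + g (i%:Z - l%:Z) j.2.1 j.2.2 * g (i%:Z - l%:Z) j.2.2 j.2.1).
Proof.
have pairsum (F : I -> R) : \sum_x F x = \sum_i \sum_a F (i, a).
  by rewrite pair_bigA; apply: eq_bigr => -[].
have dl (F : 'I_p -> R) s : \sum_a (a == s)%:R * F a = F s.
  by rewrite (bigD1 s)//= eqxx mul1r big1 ?addr0// => a /negbTE ->; rewrite mul0r.
rewrite /mtr pairsum mulr_sumr; apply: eq_bigr => i _.
under eq_bigr do rewrite pairsum.
rewrite exchange_big/= mulr_sumr; apply: eq_bigr => l _.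
set s := j.2.1; set t := j.2.2; pose q := qc j * qc j.
pose h a b := g (i%:Z - l%:Z) a b.
have qE : q = (4 * n%:R)^-1 by rewrite /q -expr2 qc_sq.
transitivity (\sum_a \sum_b ((a == s)%:R * ((b == s)%:R * (2 * q * h t t * h a b) + (b == t)%:R * (2 * q * h t s * h a b)) +
   (a == t)%:R * ((b == s)%:R * (2 * q * h s t * h a b) + (b == t)%:R * (2 * q * h s s * h a b)))).
  apply: eq_bigr => a _; apply: eq_bigr => b _; rewrite /Q2g quad_Qj /Kg/= -/s -/t -!/(h _ _) -/q; ring.
under eq_bigr do rewrite big_split/= -!mulr_sumr !big_split/= !dl.
rewrite big_split/= !dl -!/(h _ _) qE invfM; field; rewrite gt_eqF//.
Qed.
End entries.

Definition Sg {R : realType} (n : nat) {p : nat} (g : int -> 'I_p -> 'I_p -> R) (j k : bool * ('I_p * 'I_p)) : R :=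
  mtr (@Kg R n p g) (Q2g g j k).

(** * The distance at a fixed sample size *)

Section core.
Context {R : realType} {n p : nat}.
Notation I := ('I_n * 'I_p)%type.
Notation J := (bool * ('I_p * 'I_p))%type.
Variables (g : int -> 'I_p -> 'I_p -> R) (rho : nat -> R).
Hypothesis gN : forall z s t, g (- z) s t = g z t s.
Hypothesis g_le : forall z s t, `|g z s t| <= rho `|z|%N.
Hypothesis rho0 : forall k, 0 <= rho k.
Hypothesis n0 : (0 < n)%N.
Context {d} {T : measurableType d} {d'} {T' : measurableType d'}.
Variables (P : probability T R) (P' : probability T' R) (Y : I -> T -> R) (Z : J -> T' -> R).
Hypothesis GY : gauss P Y (Kg g).
Hypothesis GZ : gauss P' Z (Sg n g).
Variables (j0 : J) (w q s2 L : R).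
Hypotheses (w0 : 0 < w) (Hw : 2 * (\sum_(k < n) rho k) <= w) (Hq : \sum_(k < n) rho k ^+ 2 <= q) (q1 : 1 <= q).
Hypotheses (s20 : 0 < s2) (Hs2 : forall j, s2 <= Sg n g j j).
Hypotheses (L1' : 1 <= L) (DL : ln #|{: J}|%:R <= L).
Let theta := w ^+ 2 / n%:R.
Hypothesis Lth : 2 * L * theta <= 1.

Let K : I -> I -> R := Kg g.
Let symK (x y : I) : K x y = K y x. Proof. exact: symKg gN x y. Qed.
Let rr (i l : 'I_n) := rho `|i%:Z - l%:Z|%N.
Let n0' : 0 < n%:R :> R. Proof. by rewrite ltr0n. Qed.
Let th0 : 0 < theta. Proof. by apply: divr_gt0 => //; apply: exprn_gt0. Qed.
Let L0 : 0 < L. Proof. exact: lt_le_trans L1'. Qed.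
Let q0 : 0 < q. Proof. exact: lt_le_trans q1. Qed.
Let rrC i l : rr i l = rr l i. Proof. by rewrite /rr distnC. Qed.
Let roww i : \sum_l rr i l <= w. Proof. exact: le_trans (sum_dist_le i rho0) Hw. Qed.
Let sqW : \sum_i \sum_l rr i l ^+ 2 <= n%:R * (2 * q).
Proof.
apply: (@le_trans _ _ (\sum_(i < n) 2 * q)); last by rewrite sumr_const card_ord -[X in X <= _]mulr_natl.
apply: ler_sum => i _; have := @sum_dist_le R (fun k => rho k ^+ 2) n i (fun k => sqr_ge0 _).
rewrite /rr => h; apply: (le_trans h); exact: ler_wpM2l.
Qed.

Let S := Sg n g.

Lemma mtr_Q2g_le j : S j j <= 4 * q.
Proof.
rewrite /S /Sg mtr_Q2g// ler_pdivrMl//.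
apply: (@le_trans _ _ (\sum_(i < n) \sum_(l < n) 2 * rr i l ^+ 2)).
  apply: ler_sum => i _; apply: ler_sum => l _.
  have h a b c e : g (i%:Z - l%:Z) a b * g (i%:Z - l%:Z) c e <= rr i l ^+ 2.
    by apply: (le_trans (ler_norm _)); rewrite normrM expr2; apply: ler_pM => //; exact: g_le.
  have := lerD (h j.2.1 j.2.1 j.2.2 j.2.2) (h j.2.1 j.2.2 j.2.2 j.2.1); lra.
under eq_bigr do rewrite -mulr_sumr.
rewrite -mulr_sumr; have := sqW; lra.
Qed.

(** The scale of the centred forms of [Q2g]: their moments of order 2 r, with r between L and 2 L,
    are at most (32 y)^(2r). *)
Let y := Num.sqrt (L * q * theta).
Let Lqt0 : 0 < L * q * theta. Proof. by apply: mulr_gt0 => //; exact: mulr_gt0. Qed.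
Let y0 : 0 < y. Proof. by rewrite sqrtr_gt0. Qed.
Let y2 : y ^+ 2 = L * q * theta. Proof. by rewrite sqr_sqrtr// ltW. Qed.
Let r := (Num.truncn L).+1.
Let rL : L <= r%:R. Proof. by rewrite ltW// truncnS_gt. Qed.
Let r2L : r%:R <= 2 * L :> R.
Proof. by rewrite /r -natr1; have /andP[h _] := truncn_itv (ltW L0); have := L1'; lra. Qed.

Let FB j k : Ex P (fun w => qf K (Q2g g j k) (fun i => Y i w) ^+ r.*2) <= (32 * y) ^+ r.*2.
Proof.
have c20 : 0 <= (4 * n%:R)^-1 :> R by rewrite invr_ge0 mulr_ge0// ltW.
have psdK a : 0 <= quad K a a by exact: (quad_ge0 GY).
have kap0 : 0 <= 8 * (4 * n%:R)^-1 * w ^+ 2 :> R by rewrite mulr_ge0 ?sqr_ge0// mulr_ge0.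
have Mr := Q2g_le (n := n) g_le j k.
have KR (a b : I) : `|K a b| <= rr a.1 b.1 by exact: Kg_le g_le a b.
have kapP := dom_kappa symK psdK KR rrC w0 roww (fun i l => rho0 _) (symQ2g gN j k) c20 (mm_ge0 j k) (mmC j k) (sum_mm j k) Mr.
have vle := dom_mtr KR rrC roww sqW (fun i l => rho0 _) (sum_mm j k) Mr.
apply: (qf_moment GY symK (symQ2g gN j k) kap0 kapP (r0 := r)) => //.
- by rewrite mulr_ge0// ltW.
- apply: (@le_trans _ _ (16 * r%:R * (64 * (4 * n%:R)^-1 ^+ 2 * w ^+ 2 * (n%:R * (2 * q))))).
    by apply: ler_wpM2l vle; rewrite mulr_ge0.
  have -> : 16 * r%:R * (64 * (4 * n%:R)^-1 ^+ 2 * w ^+ 2 * (n%:R * (2 * q))) = 128 * (q * theta) * r%:R.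
    by rewrite /theta; field; rewrite gt_eqF.
  rewrite exprMn y2.
  have : 128 * (q * theta) * r%:R <= 128 * (q * theta) * (2 * L) by apply: ler_wpM2l => //; rewrite !mulr_ge0// ltW.
  have : 0 <= q * theta * L by rewrite !mulr_ge0// ltW.
  lra.
- have -> : 8 * r%:R * (8 * (4 * n%:R)^-1 * w ^+ 2) = 16 * theta * r%:R by rewrite /theta; field; rewrite gt_eqF.
  have h1 : 16 * theta * r%:R <= 16 * theta * (2 * L) by apply: ler_wpM2l => //; rewrite mulr_ge0// ltW.
  (* Here the smallness of L theta and q >= 1 are used: (L theta)^2 <= L theta <= L q theta. Thus
     the operator-norm condition of [qf_moment] follows from the same scale as the trace
     condition. *)
  have h2 : L * theta <= y.
    have Lt0 : 0 <= L * theta by rewrite mulr_ge0 ?ltW.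
    have L1 : L * theta <= 1 by have := Lth; rewrite -mulrA; lra.
    rewrite /y -[leLHS]ger0_norm// -sqrtr_sqr; apply: ler_wsqrtr.
    have -> : L * q * theta = L * theta * q by ring.
    rewrite expr2; apply: ler_wpM2l => //; exact: le_trans q1.
  lra.
Qed.

Lemma core x : `|Ex P (fun w => rect x (fun j => qf K (Qj j) (fun i => Y i w))) - Ex P' (fun z => rect x (fun j => Z j z))| <=
  640 * 1000 * Num.sqrt q * L * Num.sqrt y / s2 + expR (- (2 * L)) / 2.
Proof.
have symS j k : S j k = S k j by rewrite /S /Sg /mtr; apply: eq_bigr => a _; apply: eq_bigr => b _; rewrite /Q2g addrC.
have naz y' w' (w'0 : 0 < w') := rect_layer j0 GZ symS s20 Hs2 mtr_Q2g_le L1' DL y' w'0.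
pose N0 := 128 * Num.sqrt (4 * q) * Num.sqrt L / s2.
have {}naz y' w' : 0 < w' -> Ex P' (fun z => rect (fun j => y' j + w') (fun j => Z j z)) - Ex P' (fun z => rect y' (fun j => Z j z)) <= N0 * w'.
  move=> w'0; apply: (le_trans (naz y' w' w'0)); rewrite le_eqVlt; apply/orP; left; apply/eqP.
  by rewrite /N0; move: (s2^-1) => i; ring.
have B1 : 0 < 32 * y by apply: mulr_gt0.
have B0 := ltW B1.
(* Sixteen exceeds exp 2, so (B/delta)^(2r) is at most exp (- 4 L), which beats the at most exp (2
   L) pairs of coordinates. *)
pose delta := 16 * (32 * y); have d0 : 0 < delta by apply: mulr_gt0.
pose A := 24 * L * delta; have A0 : 0 < A by apply: mulr_gt0 => //; apply: mulr_gt0.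
(* The largest value allowed by [comparison]: 24 psi^2 L delta = 1. *)
pose psi := (Num.sqrt A)^-1.
have psi0 : 0 < psi by rewrite invr_gt0 sqrtr_gt0.
have hp : 24 * psi ^+ 2 * L * delta <= 1.
  have -> : 24 * psi ^+ 2 * L * delta = A / A by rewrite /psi exprVn sqr_sqrtr ?(ltW A0)// /A; move: (A^-1) => i; ring.
  by rewrite divff// gt_eqF.
have H := comparison j0 GY GZ symK (fun j a b => symQj j a b) (fun j k => erefl) L1' DL d0 B0 (ltn0Sn _) FB naz psi0 hp x.
apply: (le_trans H); apply: lerD.
  have -> : 9 / psi = 9 * Num.sqrt A by rewrite /psi invrK.
  have e1 : Num.sqrt (4 * q) = 2 * Num.sqrt q.
    rewrite sqrtrM//; congr (_ * _); have -> : 4 = 2 ^+ 2 :> R by ring.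
    by rewrite sqrtr_sqr ger0_norm.
  have e2 : Num.sqrt A <= 111 * (Num.sqrt L * Num.sqrt y).
    have -> : A = 24 * (16 * 32) * (L * y) by rewrite /A /delta; ring.
    have c0 : 0 <= 24 * (16 * 32) :> R by apply: mulr_ge0 => //; exact: mulr_ge0.
    rewrite (sqrtrM _ c0) (sqrtrM y (ltW L0)); apply: ler_wpM2r; first by apply: mulr_ge0; exact: sqrtr_ge0.
    have -> : 111 = Num.sqrt (111 ^+ 2) :> R by rewrite sqrtr_sqr ger0_norm.
    by apply: ler_wsqrtr; lra.
  have sL : Num.sqrt L * Num.sqrt L = L by rewrite -expr2 sqr_sqrtr// ltW.
  apply: (@le_trans _ _ (5 / 2 * (N0 * (9 * (111 * (Num.sqrt L * Num.sqrt y)))))).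
    apply: ler_wpM2l => //; apply: ler_wpM2l; last by apply: ler_wpM2l.
    by rewrite /N0 !mulr_ge0 ?sqrtr_ge0// invr_ge0 ltW.
  rewrite /N0 e1.
  (* The factor 111 bounds the square root of 24 * 16 * 32 = 12288; the product of all factors is
     639360, rounded up to 640000. *)
  have -> : 5 / 2 * (128 * (2 * Num.sqrt q) * Num.sqrt L / s2 * (9 * (111 * (Num.sqrt L * Num.sqrt y)))) =
     5 / 2 * 128 * 2 * 9 * 111 * (Num.sqrt q * (Num.sqrt L * Num.sqrt L) * Num.sqrt y / s2) by field; rewrite gt_eqF.
  rewrite sL; have : 0 <= Num.sqrt q * L * Num.sqrt y / s2.
    by rewrite !mulr_ge0 ?sqrtr_ge0 ?(ltW L0)// invr_ge0 ltW.
  by move=> h; rewrite -!mulrA in h *; lra.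
apply: ler_wpM2r; first by rewrite invr_ge0.
have D0 : 0 < #|{: J}|%:R :> R by rewrite ltr0n; apply/card_gt0P; exists j0.
have DE : #|{: J}|%:R ^+ 2 <= expR (2 * L).
  have -> : expR (2 * L) = expR L ^+ 2 by rewrite expr2 -expRD; congr expR; ring.
  by rewrite lerXn2r ?nnegrE ?expR_ge0 ?(ltW D0)// -[leLHS]lnK ?posrE// ler_expR.
have e16 : 32 * y / delta <= expR (- 2).
  have -> : 32 * y / delta = 16^-1 by rewrite /delta invfM mulrCA divff ?mulr1// gt_eqF.
  rewrite expRN lef_pV2 ?posrE ?expR_gt0//.
  have -> : expR 2 = expR 1 * expR 1 :> R by rewrite -expRD; congr expR; ring.
  have -> : 16 = 4 * 4 :> R by ring.
  by apply: ler_pM; rewrite ?expR_ge0// expR1_le4.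
have b0 : 0 <= 32 * y / delta by rewrite divr_ge0 ?(ltW d0).
have e3 : (32 * y / delta) ^+ r.*2 <= expR (- (4 * L)).
  apply: (@le_trans _ _ (expR (- 2) ^+ r.*2)).
    by rewrite lerXn2r ?nnegrE ?expR_ge0.
  rewrite -expRM_natl ler_expR -mul2n natrM mulrN lerN2 mulrC; have := rL; lra.
apply: (@le_trans _ _ (expR (2 * L) * expR (- (4 * L)))).
  by apply: ler_pM; rewrite ?sqr_ge0// exprn_ge0.
by rewrite -expRD ler_expR; lra.
Qed.
End core.

(** A nonzero norm is attained at some entry; for the zero matrix the entry (i0, j0) yields u >
    0. *)
Lemma mx_norm_lt {R : realType} {m k : nat} (i0 : 'I_m) (j0 : 'I_k) (M : 'M[R]_(m, k)) (c u : R) : 0 <= c ->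
  (c * `|M| < u) <-> (forall i j, c * `|M i j| < u).
Proof.
move=> c0; split => [h i j|h].
  apply: (le_lt_trans _ h); apply: ler_wpM2l => //; rewrite [leRHS]/Num.norm/= mx_normrE.
  by apply: (le_trans _ (le_bigmax _ _ (i, j))).
have [z|nz] := eqVneq (mx_norm M) 0.
  by rewrite [`|M|]z mulr0; apply: le_lt_trans (h i0 j0); rewrite mulr_ge0.
by have [[i j] /= e] := mx_norm_neq0 nz; rewrite [`|M|]e; exact: h.
Qed.

(** * Means and covariances of quadratic forms *)

Section moments.
Context {R : realType} {d} {T : measurableType d} (P : probability T R).

Lemma fine_expectation (f : T -> R) : fine ('E_P[f])%E = Ex P f.
Proof. by rewrite unlock. Qed.

Lemma fine_cov0 (f h : T -> R) : Ex P f = 0 -> Ex P h = 0 -> fine (covariance P f h) = Ex P (fun w => f w * h w).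
Proof.
move=> f0 h0; rewrite unlock fine_expectation !fine_expectation f0 h0.
transitivity (Ex P (fun w => (f w - 0) * (h w - 0))) => //.
by apply: eq_Ex => w; rewrite !subr0.
Qed.

Context {I : finType} (Y : I -> T -> R) (K : I -> I -> R).
Hypothesis GY : gauss P Y K.
Hypothesis symK : forall i j, K i j = K j i.

Lemma qf_mean (Q : I -> I -> R) : Ex P (fun w => qf K Q (fun i => Y i w)) = 0.
Proof.
have := ibp2 GY symK Q (TP_cst 1); under eq_Ex do rewrite mulr1.
move=> ->; rewrite -[RHS](Ex_cst P); apply: eq_Ex => w; rewrite /quad big1// => i _; apply: big1 => j _.
by rewrite mulr0.
Qed.

Lemma quad_mv2 (M N : I -> I -> R) y : (forall i j, M i j = M j i) -> (forall i j, N i j = N j i) ->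
  quad K (mv M y) (mv N y) = quad (fun a b => quad K (M a) (N b)) y y.
Proof.
move=> sM sN.
have E (Q : I -> I -> R) : (forall i j, Q i j = Q j i) -> mv Q y = fun i => \sum_a y a * Q a i.
  by move=> sQ; apply/funext => i; rewrite /mv /dot; apply: eq_bigr => a _; rewrite mulrC sQ.
rewrite (E M sM) (E N sN) quad_suml /quad; apply: eq_bigr => i _.
by rewrite -/(quad K (M i) _) quad_sumr mulr_sumr; apply: eq_bigr => l _; rewrite /quad; ring.
Qed.

Lemma quad_addK (M N : I -> I -> R) y : quad (fun a b => M a b + N a b) y y = quad M y y + quad N y y.
Proof. by rewrite /quad -big_split/=; apply: eq_bigr => i _; rewrite -big_split/=; apply: eq_bigr => j _; ring. Qed.

(** One integration by parts turns the product into 2 (M Y)' K (N Y), whose mean is read off from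
    the vanishing mean of the centred form. *)
Lemma qf_cov (M N : I -> I -> R) : (forall i j, M i j = M j i) -> (forall i j, N i j = N j i) ->
  Ex P (fun w => qf K M (fun i => Y i w) * qf K N (fun i => Y i w)) =
  mtr K (fun a b => quad K (M a) (N b) + quad K (N a) (M b)).
Proof.
move=> sM sN; rewrite (ibp2 GY symK M (TP_qf K sN)).
set Q := fun a b => _ + _.
have := qf_mean Q => z.
have LQ : Li P (fun w => qf K Q (fun i => Y i w)).
  have sQ i j : Q i j = Q j i by rewrite /Q (quadC symK (M i)) (quadC symK (N i)) addrC.
  by apply: Lall_Li; have [] := Lall_TP GY (TP_qf K sQ).
rewrite -[RHS]add0r -z -[mtr K Q in RHS](Ex_cst P) -ExD//; last exact: Li_cst.
apply: eq_Ex => w; rewrite quadZr /qf subrK.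
have -> : quad Q (fun i => Y i w) (fun i => Y i w) = quad K (mv M (fun i => Y i w)) (mv N (fun i => Y i w)) + quad K (mv N (fun i => Y i w)) (mv M (fun i => Y i w)).
  by rewrite !quad_mv2// /Q quad_addK.
by rewrite (quadC symK (mv N _)); ring.
Qed.
End moments.

(** * From the process to the comparison *)

Section connect.
Context {R : realType} {p k n : nat} {d} {T : measurableType d} (P : probability T R).
Variables (A : nat -> 'M[R]_(p, k)) (C0 beta R1 tau : R).
Hypotheses (C0_gt0 : 0 < C0) (HA : condition_A beta C0 A).
Hypothesis corr : forall m N, \sum_(l < N) al beta (l + m) * al beta l <= R1 * al tau m.
Variables (eps : int -> T -> 'cV[R]_k) (X : int -> T -> 'cV[R]_p).
Hypothesis HX : gaussian_linear_process P eps A X.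
Hypothesis n0 : (0 < n)%N.
Variable (a0 : 'I_p).

Notation I := ('I_n * 'I_p)%type.
Notation J := (bool * ('I_p * 'I_p))%type.
Let g := acov A.
Let gN z s t : g (- z) s t = g z t s. Proof. exact: acovN. Qed.
Let fam := @family_gauss R p k A C0 beta C0_gt0 HA R1 tau corr d T P eps X HX.

Lemma process_mom a b s t : Ex P (fun w => X a w s 0 * X b w t 0) = g (a - b) s t.
Proof.
have G := fam (fun c : bool => if c then a else b) (fun c => if c then s else t).
have := Ex_gauss2 G _ true false => /=; apply => i j.
by rewrite -/g -gN opprB.
Qed.

Lemma process_mean a s : Ex P (fun w => X a w s 0) = 0.
Proof. by have G := fam (fun _ : unit => a) (fun _ => s); exact: (Ex_gauss G tt). Qed.

Lemma SigmaE s t : Sigma P X s t = g 0 s t.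
Proof. by rewrite mxE fine_expectation -[0 in RHS](subrr (0 : int)) -process_mom. Qed.

Lemma GammaE z s t : Gamma P X z s t = g z s t.
Proof. by rewrite mxE fine_cov0 ?process_mean// process_mom sub0r opprK. Qed.

(** Ordinals start at 0 and the sample at time 1; only differences of times enter the covariance, so
    the shift is harmless. *)
Definition Yf (x : I) w : R := X (x.1.+1)%:Z w x.2 0.

Lemma GYf : gauss P Yf (Kg g).
Proof.
have := fam (fun x : I => (x.1.+1)%:Z) (fun x => x.2); congr gauss.
apply/funext => x; apply/funext => y; rewrite /Kg; congr (g _ _ _).
by rewrite !intS opprD addrACA subrr add0r.
Qed.

Definition Vf (j : J) w : R := qf (Kg g) (Qj j) (fun x => Yf x w).

Lemma VfE (j : J) w : Vf j w = (if j.1 then 1 else -1) * (Num.sqrt n%:R * (Sigma_hat X n w - Sigma P X) j.2.1 j.2.2).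
Proof.
have n0' : 0 < n%:R :> R by rewrite ltr0n.
have sn : 0 < Num.sqrt n%:R :> R by rewrite sqrtr_gt0.
rewrite /Vf (qf_Qj gN) -mulrA; congr (_ * _).
have -> : (Sigma_hat X n w - Sigma P X) j.2.1 j.2.2 = n%:R^-1 * (\sum_(i < n) (X i.+1%:Z w *m (X i.+1%:Z w)^T) j.2.1 j.2.2) - g 0 j.2.1 j.2.2.
  by rewrite mxE [(- Sigma P X) _ _]mxE SigmaE /Sigma_hat mxE summxE big_add1 big_mkord.
rewrite sumrB sumr_const card_ord -[g 0 _ _ *+ n]mulr_natl.
have -> : \sum_(i < n) (X i.+1%:Z w *m (X i.+1%:Z w)^T) j.2.1 j.2.2 = \sum_(i < n) Yf (i, j.2.1) w * Yf (i, j.2.2) w.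
  by apply: eq_bigr => i _; rewrite mxE big_ord1 mxE.
set s := Num.sqrt n%:R in sn *; have nE : n%:R = s ^+ 2 :> R by rewrite sqr_sqrtr// ltW.
by rewrite nE; field; rewrite gt_eqF.
Qed.

Lemma Vf_cov (j l : J) : Ex P (fun w => Vf j w * Vf l w) = Sg n g j l.
Proof. exact: (qf_cov GYf (symKg gN) (symQj j) (symQj l)). Qed.

Lemma Vf_mean (j : J) : Ex P (Vf j) = 0.
Proof. exact: (qf_mean GYf (symKg gN)). Qed.

Lemma Vf_Lall (j : J) : Lall P (Vf j).
Proof. by have [] := Lall_TP GYf (TP_qf (Kg g) (symQj j)). Qed.

(** [Vec] stacks columns, so the entry (s, t) sits where the row-major order puts (t, s). *)
Let ix (s t : 'I_p) : 'I_(p * p) := mxvec_index t s.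

Lemma S_E s t w : S_ P X n w (ix s t) 0 = Vf (true, (s, t)) w.
Proof. by rewrite VfE mul1r mxE mxE mxvecE mxE. Qed.

Let C : 'M[R]_(p * p) := covmx P (S_ P X n).

Lemma covS s t s' t' : C (ix s t) (ix s' t') = Sg n g (true, (s, t)) (true, (s', t')).
Proof.
have e s1 t1 : (fun w => S_ P X n w (ix s1 t1) 0) = Vf (true, (s1, t1)) by apply/funext => w; rewrite S_E.
by rewrite mxE !e fine_cov0 ?Vf_mean// Vf_cov.
Qed.

Lemma covS_psd a : 0 <= quad (fun i j => C i j) a a.
Proof.
pose Sv i w := S_ P X n w i 0.
have LS i : Lall P (Sv i).
  case/mxvec_indexP: i => t s; rewrite (_ : Sv _ = Vf (true, (s, t))); first exact: Vf_Lall.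
  by apply/funext => w; rewrite -S_E.
have CE i j : C i j = Ex P (fun w => Sv i w * Sv j w).
  case/mxvec_indexP: i => t s; case/mxvec_indexP: j => t' s'; rewrite covS -Vf_cov.
  by apply: eq_Ex => w; rewrite -!S_E.
have -> : quad (fun i j => C i j) a a = Ex P (fun w => (\sum_i a i * Sv i w) ^+ 2).
  transitivity (Ex P (fun w => \sum_i \sum_j a i * a j * (Sv i w * Sv j w))).
    rewrite Ex_sum; last by move=> i; apply: Li_sum => j; apply: LiZ; apply: Lall_Li; exact: LallM.
    apply: eq_bigr => i _; rewrite Ex_sum; last by move=> j; apply: LiZ; apply: Lall_Li; exact: LallM.
    apply: eq_bigr => j _; rewrite ExZ; last by apply: Lall_Li; exact: LallM.
    by rewrite CE; ring.
  apply: eq_Ex => w; rewrite expr2 mulr_suml; apply: eq_bigr => i _; rewrite mulr_sumr.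
  by apply: eq_bigr => j _; ring.
by apply: Ex_ge0 => w; exact: sqr_ge0.
Qed.

Context {d'} {T' : measurableType d'} (P' : probability T' R) (Z : T' -> 'cV[R]_(p * p)).
Hypothesis HZ : gaussian_vector P' Z 0 C.

Definition Zf (j : J) w : R := (if j.1 then 1 else -1) * Z w (ix j.2.1 j.2.2) 0.

Lemma GZf : gauss P' Zf (Sg n g).
Proof.
have G0 := gv_gauss covS_psd HZ.
pose B (j : J) i : R := (if j.1 then 1 else -1) * (i == ix j.2.1 j.2.2)%:R.
have dl (c : R) i0 (F : 'I_(p * p) -> R) : \sum_i c * (i == i0)%:R * F i = c * F i0.
  by rewrite (bigD1 i0)//= eqxx mulr1 big1 ?addr0// => i /negbTE ->; rewrite mulr0 mul0r.
have := gauss_lin G0 B; congr gauss.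
  by apply/funext => j; apply/funext => w; rewrite /dot dl.
apply/funext => j; apply/funext => l.
have VS (i : J) w : Vf i w = (if i.1 then 1 else -1) * Vf (true, i.2) w by rewrite !VfE mul1r.
have -> : Sg n g j l = (if j.1 then 1 else -1) * (if l.1 then 1 else -1) * Sg n g (true, j.2) (true, l.2).
  rewrite -!Vf_cov -ExZ; last by apply: Lall_Li; apply: LallM; exact: Vf_Lall.
  by apply: eq_Ex => w; rewrite (VS j) (VS l); exact: mulrACA.
have -> : Sg n g (true, j.2) (true, l.2) = C (ix j.2.1 j.2.2) (ix l.2.1 l.2.2) by rewrite covS -!surjective_pairing.
rewrite /quad.
rewrite (eq_bigr (fun i => (if j.1 then 1 else -1) * (i == ix j.2.1 j.2.2)%:R * ((if l.1 then 1 else -1) * C i (ix l.2.1 l.2.2)))); last first.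
  move=> i _; transitivity (\sum_i' (if l.1 then 1 else -1) * (i' == ix l.2.1 l.2.2)%:R * (B j i * C i i')).
    by apply: eq_bigr => i' _; rewrite mulrC.
  by rewrite dl mulrCA.
by rewrite dl mulrA.
Qed.

Lemma rect_norm (V : J -> R) (M : 'I_p -> 'I_p -> R) u : (forall j, V j = (if j.1 then 1 else -1) * M j.2.1 j.2.2) ->
  [forall j : J, V j < u] <-> (forall s t, `|M s t| < u).
Proof.
move=> VE; split => [/forallP h s t|h].
  have := h (true, (s, t)); have := h (false, (s, t)); rewrite !VE/= => h1 h2.
  by rewrite ltr_norml; apply/andP; split; lra.
apply/forallP => -[b [s t]]; rewrite VE/=; have := h s t; rewrite ltr_norml => /andP[h1 h2].
by case: b; lra.
Qed.

Let meas_rect d1 (T1 : measurableType d1) (W : J -> T1 -> R) u : (forall j, measurable_fun setT (W j)) ->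
  measurable [set w | [forall j, W j w < u]].
Proof.
move=> mW; rewrite (_ : [set w | _] = \bigcap_(j in [set: J]) [set w | W j w < u]).
  apply: fin_bigcap_measurable => // j _.
  have := mW j measurableT _ (measurable_itv `]-oo, u[); rewrite setTI.
  by rewrite (_ : _ @^-1` _ = [set w | W j w < u])//; apply/seteqP; split => w /=; rewrite in_itv.
by apply/seteqP; split => w /=; [move=> /forallP h j _; exact: h|move=> h; apply/forallP => j; exact: h].
Qed.

(** The closed upper tail in [rho] is the complement of an open rectangle, which is why [rect] uses
    strict inequalities. *)
Let tail_rect d1 (T1 : measurableType d1) (P1 : probability T1 R) (W : J -> T1 -> R) (f : T1 -> R) u :
  (forall j, measurable_fun setT (W j)) -> (forall w, (f w < u) <-> [forall j, W j w < u]) ->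
  fine (P1 [set w | u <= f w]) = 1 - Ex P1 (fun w => rect (fun _ => u) (fun j => W j w)).
Proof.
move=> mW H; have mA := meas_rect u mW; set A' := [set w | [forall j, W j w < u]] in mA.
have -> : [set w | u <= f w] = ~` A'.
  apply/seteqP; split => w /=; first by rewrite leNgt => /negP h h'; apply: h; apply/H.
  by move=> h; rewrite leNgt; apply/negP => /H.
have -> : Ex P1 (fun w => rect (fun _ => u) (fun j => W j w)) = fine (P1 A').
  rewrite -Ex_indic//; apply: eq_Ex => w; rewrite /rect indicE; congr (nat_of_bool _)%:R.
  by apply/idP/idP; rewrite inE.
by rewrite probability_setC// fineB// ?prob_fin.
Qed.

Lemma rho_le (b : R) : (forall x : J -> R, `|Ex P (fun w => rect x (fun j => Vf j w)) - Ex P' (fun z => rect x (fun j => Zf j z))| <= b) ->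
  rho P X P' Z n <= b.
Proof.
move=> H; apply: ge_sup; first by eexists; exists 0.
move=> _ [u _ <-].
have i0 : 'I_(p * p) := ix a0 a0.
have sq0 : 0 <= Num.sqrt n%:R :> R by exact: sqrtr_ge0.
have mV j : measurable_fun setT (Vf j) by exact: (Vf_Lall j).1.
have mZ j : measurable_fun setT (Zf j) by exact: (gauss_meas GZf j).
have e1 : fine (P [set w | u <= Num.sqrt n%:R * `|Sigma_hat X n w - Sigma P X| ]) = 1 - Ex P (fun w => rect (fun _ => u) (fun j => Vf j w)).
  apply: tail_rect => // w.
  rewrite (mx_norm_lt a0 a0 _ u sq0).
  rewrite (@rect_norm (fun j => Vf j w) (fun s t => Num.sqrt n%:R * (Sigma_hat X n w - Sigma P X) s t)); last by move=> j; exact: VfE.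
  by split => h s t; have := h s t; rewrite normrM (ger0_norm sq0).
have e2 : fine (P' [set w | u <= `|Z w| ]) = 1 - Ex P' (fun w => rect (fun _ => u) (fun j => Zf j w)).
  apply: tail_rect => // w.
  rewrite -[`|Z w|]mul1r (mx_norm_lt i0 0 _ u ler01).
  rewrite (@rect_norm (fun j => Zf j w) (fun s t => Z w (ix s t) 0)); last by [].
  split => h => [s t|i j]; first by have := h (ix s t) 0; rewrite mul1r.
  by rewrite mul1r ord1; case/mxvec_indexP: i => t s; exact: h.
rewrite e1 e2; have := H (fun _ => u); rewrite distrC.
by congr (_ <= _); congr `|_|; ring.
Qed.

Variables (c0 : R) (rho_ : nat -> R) (w q t L : R).
Hypotheses (c0_gt0 : 0 < c0) (HG : condition_G P X c0).
Hypothesis g_le : forall z s t, `|g z s t| <= rho_ `|z|%N.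
Hypothesis rho0 : forall m, 0 <= rho_ m.
Hypotheses (w0 : 0 < w) (Hw : 2 * (\sum_(m < n) rho_ m) <= w) (Hq : forall N, \sum_(m < N) rho_ m ^+ 2 <= q) (q1 : 1 <= q).
Hypothesis Ht : forall N, \sum_(m < N) rho_ (n + m)%N ^+ 2 + n%:R^-1 * \sum_(m < n) m%:R * rho_ m ^+ 2 <= t.
Hypothesis tc : 8 * t <= c0.

(** Condition (G) bounds the full two-sided sum. The variance at sample size n lacks the lags from n
    on and weights lag k by 1 - k/n; by [Ht] these two defects amount to at most 4 t, which is at
    most c0/2. *)
Lemma Sg_ge (j : J) : c0 / 2 <= Sg n g j j.
Proof.
case: j => b [u v].
have n0' : 0 < n%:R :> R by rewrite ltr0n.
pose h (m : nat) : R := g m u u * g m v v + g m u v * g m v u.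
pose f (z : int) : R := Gamma P X z u u * Gamma P X z v v + Gamma P X z u v * Gamma P X z v u.
have hE (z : int) : g z u u * g z v v + g z u v * g z v u = h `|z|%N.
  case: z => m //; rewrite /h NegzE abszN absz_nat !gN; ring.
have h_le m : `|h m| <= 2 * rho_ m ^+ 2.
  have e a1 a2 b1 b2 : `|g m a1 a2 * g m b1 b2| <= rho_ m ^+ 2.
    by rewrite normrM expr2; apply: ler_pM => //; exact: (g_le m).
  by apply: (le_trans (ler_normD _ _)); have := e u u v v; have := e u v v u; lra.
have cvh : cvgn (series h).
  apply: normed_cvg; apply: nondecreasing_is_cvgn.
    by apply: nondecreasing_series => l _ _; exact: normr_ge0.
  exists (2 * q) => _ [N _ <-]; rewrite /= /series/= big_mkord.
  apply: (@le_trans _ _ (\sum_(m < N) 2 * rho_ m ^+ 2)); first by apply: ler_sum => m _; exact: h_le.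
  by rewrite -mulr_sumr; apply: ler_wpM2l.
pose H := limn (series h).
have cH : series h @ \oo --> H by exact: cvh.
have f1 : limn (series (fun m : nat => f m%:Z)) = H.
  by congr (limn (series _)); apply/funext => m; rewrite /f !GammaE.
(* The negative half starts at lag -1, so lag 0 is counted only once. *)
have f2 : limn (series (fun m : nat => f (- m.+1%:Z))) = H - h 0%N.
  have -> : series (fun m : nat => f (- m.+1%:Z)) = (fun N => series h N.+1 - h 0%N).
    apply/funext => N; rewrite /series/= big_nat_recl//= addrC addKr; apply: eq_bigr => m _.
    by rewrite /f !GammaE hE abszN absz_nat.
  apply: cvg_lim => //; apply: cvgB; last exact: cvg_cst.
  by rewrite (cvg_shiftS (series h)).
have := HG u v; rewrite /int_sum -/f f1 f2 => cG.
pose t1 := t - n%:R^-1 * \sum_(m < n) m%:R * rho_ m ^+ 2.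
have Hn : H <= \sum_(m < n) h m + 2 * t1.
  rewrite -(cvg_lim _ cH)//; apply: limr_le; first exact: cvh.
  near=> N.
  have nN : (n <= N)%N by near: N; exact: nbhs_infty_ge.
  rewrite /series/= (@big_cat_nat _ _ _ n)//= big_mkord lerD2l.
  rewrite -{1}[n]add0n big_addn big_mkord.
  apply: (@le_trans _ _ (\sum_(m < N - n) 2 * rho_ (n + m)%N ^+ 2)).
    by apply: ler_sum => m _; rewrite addnC; apply: (le_trans (ler_norm _)); exact: h_le.
  by rewrite -mulr_sumr; apply: ler_wpM2l => //; rewrite /t1 lerBrDr; exact: Ht.
have SE : Sg n g (b, (u, v)) (b, (u, v)) = 2 * \sum_(m < n) h m - h 0%N - 2 * (n%:R^-1 * \sum_(m < n) m%:R * h m).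
  rewrite /Sg mtr_Q2g//=.
  have -> : \sum_(i < n) \sum_(l < n) (g (i%:Z - l%:Z) u u * g (i%:Z - l%:Z) v v + g (i%:Z - l%:Z) u v * g (i%:Z - l%:Z) v u) =
    \sum_(i < n) \sum_(l < n) h `|i%:Z - l%:Z|%N.
    by apply: eq_bigr => i _; apply: eq_bigr => l _; rewrite hE.
  rewrite sum_dist2.
  have -> : \sum_(m < n) (n%:R - m%:R) * h m = n%:R * \sum_(m < n) h m - \sum_(m < n) m%:R * h m.
    by rewrite mulr_sumr -sumrB; apply: eq_bigr => m _; ring.
  by field; rewrite gt_eqF.
have mh : n%:R^-1 * (\sum_(m < n) m%:R * h m) <= 2 * (n%:R^-1 * \sum_(m < n) m%:R * rho_ m ^+ 2).
  rewrite mulrCA; apply: ler_wpM2l; first by rewrite invr_ge0 ltW.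
  rewrite mulr_sumr; apply: ler_sum => m _; rewrite mulrCA; apply: ler_wpM2l => //.
  by apply: (le_trans (ler_norm _)); exact: h_le.
rewrite SE; move: mh Hn; rewrite /t1.
move: (n%:R^-1 * \sum_(m < n) m%:R * h m) (n%:R^-1 * \sum_(m < n) m%:R * rho_ m ^+ 2) => x1 x2.
have := tc; move: cG; clear SE t1; move: (\sum_(m < n) h m) (h 0%N) => x3 x4; lra.
Unshelve. all: by end_near.
Qed.

Hypotheses (L1' : 1 <= L) (DL : ln #|{: J}|%:R <= L) (Lth : 2 * L * (w ^+ 2 / n%:R) <= 1).

Lemma rho_core : rho P X P' Z n <=
  640 * 1000 * Num.sqrt q * L * Num.sqrt (Num.sqrt (L * q * (w ^+ 2 / n%:R))) / (c0 / 2) + expR (- (2 * L)) / 2.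
Proof.
apply: rho_le => x.
have c2 : 0 < c0 / 2 by rewrite divr_gt0.
exact: (core gN g_le rho0 n0 GYf GZf (true, (a0, a0)) w0 Hw (Hq n) q1 c2 Sg_ge L1' DL Lth x).
Qed.
End connect.

(** * The rate *)

Section regimes.
Context {R : realType}.
Implicit Types (s tau b D : R).

(* The bounds on [m |-> D * al tau m] that the comparison uses at sample size n; b is the
   exponent of the resulting rate. *)
Definition regime tau b D n : Prop := [/\ 0 < b <= 1,
  exists w : R, [/\ 0 < w, 2 * (\sum_(m < n) D * al tau m) <= w & w ^+ 2 / n%:R <= 18 ^+ 2 * D ^+ 2 * n%:R `^ (- b)],
  forall N, \sum_(m < N) (D * al tau m) ^+ 2 <= D ^+ 2 * (2 + 1 / b) &
  forall N, \sum_(m < N) (D * al tau (n + m)) ^+ 2 + n%:R^-1 * \sum_(m < n) m%:R * (D * al tau m) ^+ 2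
     <= 6 * D ^+ 2 * (1 + 1 / b) * n%:R `^ (- b)].

Let sumsq D tau (f : nat -> R) (c : nat -> nat) N : \sum_(m < N) f m * (D * al tau (c m)) ^+ 2 = D ^+ 2 * \sum_(m < N) f m * al (2 * tau) (c m).
Proof. by rewrite mulr_sumr; apply: eq_bigr => m _; rewrite exprMn al_sq; ring. Qed.

Let sumsq1 D tau (c : nat -> nat) N : \sum_(m < N) (D * al tau (c m)) ^+ 2 = D ^+ 2 * \sum_(m < N) al (2 * tau) (c m).
Proof. by rewrite mulr_sumr; apply: eq_bigr => m _; rewrite exprMn al_sq. Qed.

Let al_nat s m : m%:R * al s m <= al (s - 1) m.
Proof.
case: m => [|m]; first by rewrite mul0r al_ge0.
rewrite !alS; have x0 : 0 < m.+1%:R :> R by rewrite ltr0n.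
have -> : - (s - 1) = 1 + - s by ring.
by rewrite powRD ?(gt_eqF x0) ?implybT// powRr1// ltW.
Qed.

Let powR_ge1 n a : (0 < n)%N -> 0 <= a -> 1 <= n%:R `^ a :> R.
Proof. by move=> n0 a0; have := @ler_powR R n%:R _ 0 a a0; rewrite powRr0; apply; rewrite ler1n. Qed.

(** The decay (1 + b)/2 is 2 beta - 1 for b = 4 beta - 3. Row sums grow like n^((1 - b)/2), so w^2/n
    is of order n^(-b). The cap 3/4 keeps every constant bounded except 1/b, the sum of the k^(-1 -
    b), which blows up as beta approaches 3/4. *)
Lemma regime_lo b D n : 0 < b -> b <= 3 / 4 -> 0 < D -> (0 < n)%N -> regime ((1 + b) / 2) b D n.
Proof.
move=> b0 b1 R20 n0; have n0' : 0 < n%:R :> R by rewrite ltr0n.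
have nD x y : n%:R `^ (x + y) = n%:R `^ x * n%:R `^ y :> R by rewrite powRD ?(gt_eqF n0') ?implybT.
have t2 : 2 * ((1 + b) / 2) = 1 + b by field.
have s1 : 1 < 1 + b by lra.
have sb : 1 + b - 1 = b by ring.
have X0 : 0 < n%:R `^ (- b) :> R by apply: powR_gt0.
split; first by apply/andP; split; lra.
- pose th := (1 - b) / 2; have th0 : 0 < th <= 1 by apply/andP; split; rewrite /th; lra.
  exists (18 * D * n%:R `^ th); split.
  + by rewrite !mulr_gt0// powR_gt0.
  + rewrite -mulr_sumr; have h := @al_sum_lt1 R th n th0.
    have e : 1 - th = (1 + b) / 2 by rewrite /th; field.
    rewrite e in h; have p1 := powR_ge1 n0 (ltW (andP th0).1).
    have h2 : n%:R `^ th / th <= n%:R `^ th * 8.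
      apply: ler_wpM2l; first exact: powR_ge0.
      by rewrite invf_ple ?posrE// /th; lra.
    have h3 : D * (\sum_(m < n) al ((1 + b) / 2) m) <= D * (9 * n%:R `^ th) by apply: ler_wpM2l; [exact: ltW|lra].
    lra.
  + have -> : (18 * D * n%:R `^ th) ^+ 2 / n%:R = 18 ^+ 2 * D ^+ 2 * (n%:R `^ th * n%:R `^ th / n%:R) by ring.
    rewrite -nD -[X in _ / X]powRr1 ?(ltW n0')// -powRB ?(gt_eqF n0') ?implybT//.
    by have -> : th + th - 1 = - b by rewrite /th; field.
- by move=> N; rewrite (sumsq1 D _ id) t2; apply: ler_wpM2l; [exact: sqr_ge0|have := al_sum_gt1' N s1; rewrite sb].
move=> N; rewrite (sumsq1 D _ (fun m => n + m)%N) (sumsq D _ (fun m => m%:R) id) t2.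
have h1 : \sum_(m < N) al (1 + b) (n + m) <= (1 + 1 / b) * n%:R `^ (- b).
  apply: (le_trans (al_sum_gt1 N s1 n0)); rewrite sb.
  have -> : 1 - (1 + b) = - b by ring.
  have : n%:R `^ (- (1 + b)) <= n%:R `^ (- b) :> R by apply: ler_powR; [rewrite ler1n|lra].
  by rewrite mulrDl; lra.
have h2 : n%:R^-1 * \sum_(m < n) m%:R * al (1 + b) m <= 5 * n%:R `^ (- b).
  have th1 : 0 < 1 - b <= 1 by apply/andP; split; lra.
  have := @al_sum_lt1 R (1 - b) n th1; have -> : 1 - (1 - b) = b by ring.
  move=> h; have p1 := powR_ge1 n0 (ltW (andP th1).1).
  have e2 : n%:R `^ (1 - b) / (1 - b) <= n%:R `^ (1 - b) * 4.
    apply: ler_wpM2l; first exact: powR_ge0.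
    by rewrite invf_ple ?posrE; lra.
  have e3 : \sum_(m < n) m%:R * al (1 + b) m <= 5 * n%:R `^ (1 - b).
    apply: (@le_trans _ _ (\sum_(m < n) al b m)); last lra.
    by apply: ler_sum => m _; have := al_nat (1 + b) m; rewrite sb.
  have -> : 5 * n%:R `^ (- b) = n%:R^-1 * (5 * n%:R `^ (1 - b)).
    rewrite nD powRr1 ?(ltW n0')//; move: (n%:R `^ (- b)) => X; field; by rewrite gt_eqF.
  by apply: ler_wpM2l => //; rewrite invr_ge0 ltW.
have -> : n%:R^-1 * (D ^+ 2 * \sum_(m < n) m%:R * al (1 + b) m) = D ^+ 2 * (n%:R^-1 * \sum_(m < n) m%:R * al (1 + b) m) by ring.
rewrite -mulrDr.
have -> : 6 * D ^+ 2 * (1 + 1 / b) * n%:R `^ (- b) = D ^+ 2 * (6 * (1 + 1 / b) * n%:R `^ (- b)) by ring.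
apply: ler_wpM2l; first exact: sqr_ge0.
have : 0 <= 1 / b * n%:R `^ (- b) by rewrite mulr_ge0 ?powR_ge0// divr_ge0// ltW.
lra.
Qed.

(** With summable autocovariances the row sums are bounded, and w^2/n is of order 1/n. *)
Lemma regime_hi D n : 0 < D -> (0 < n)%N -> regime 2 1 D n.
Proof.
move=> R20 n0; have n0' : 0 < n%:R :> R by rewrite ltr0n.
have nN : n%:R `^ (- 1) = n%:R^-1 :> R by rewrite powRN powRr1// ltW.
have i0 : 0 <= n%:R^-1 :> R by rewrite invr_ge0 ltW.
have s2 : 1 < 2 :> R by lra.
have s4 : 1 < 2 * 2 :> R by lra.
have S2 N : \sum_(m < N) al 2 m <= 3 :> R.
  have := al_sum_gt1' N s2; have -> : 2 - 1 = 1 :> R by ring.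
  by rewrite divr1; lra.
have al42 m : al (2 * 2) m <= al 2 m :> R by apply: al_mono; lra.
split; first by rewrite ltr01 lexx.
- exists (6 * D); split; first by rewrite mulr_gt0.
  + by rewrite -mulr_sumr; have : D * (\sum_(m < n) al 2 m) <= D * 3 by [apply: ler_wpM2l => //; exact: ltW]; lra.
  + rewrite nN; apply: ler_wpM2r => //; rewrite exprMn; apply: ler_wpM2r; first exact: sqr_ge0.
    by rewrite lerXn2r ?nnegrE//; lra.
- move=> N; rewrite (sumsq1 D _ id); apply: ler_wpM2l; first exact: sqr_ge0.
  rewrite divr1; apply: (@le_trans _ _ (\sum_(m < N) al 2 m)); first exact: ler_sum.
  by have := S2 N; lra.
move=> N; rewrite (sumsq1 D _ (fun m => n + m)%N) (sumsq D _ (fun m => m%:R) id) nN divr1.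
have h1 : \sum_(m < N) al (2 * 2) (n + m) <= 2 * n%:R^-1 :> R.
  apply: (le_trans (al_sum_gt1 N s4 n0)).
  have le1 x : x <= -1 -> n%:R `^ x <= n%:R^-1 :> R by move=> h; rewrite -nN; apply: ler_powR => //; rewrite ler1n.
  have a1 : n%:R `^ (- (2 * 2)) <= n%:R^-1 :> R by apply: le1; lra.
  have a2 : n%:R `^ (1 - 2 * 2) <= n%:R^-1 :> R by apply: le1; lra.
  have a3 : n%:R `^ (1 - 2 * 2) / (2 * 2 - 1) <= n%:R^-1 :> R.
    apply: (le_trans _ a2); rewrite ler_pdivrMr; last lra.
    by rewrite ler_peMr ?powR_ge0//; lra.
  by lra.
have h2 : \sum_(m < n) m%:R * al (2 * 2) m <= 3 :> R.
  apply: (le_trans _ (S2 n)); apply: ler_sum => m _; apply: (le_trans (al_nat _ _)); apply: al_mono; lra.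
have h3 : n%:R^-1 * (\sum_(m < n) m%:R * al (2 * 2) m) <= n%:R^-1 * 3 :> R by apply: ler_wpM2l.
have -> : n%:R^-1 * (D ^+ 2 * \sum_(m < n) m%:R * al (2 * 2) m) = D ^+ 2 * (n%:R^-1 * \sum_(m < n) m%:R * al (2 * 2) m) by ring.
rewrite -mulrDr.
have -> : 6 * D ^+ 2 * (1 + 1) / n%:R = D ^+ 2 * (12 * n%:R^-1) by ring.
apply: ler_wpM2l; first exact: sqr_ge0.
lra.
Qed.
End regimes.

(** * Absorbing logarithms and 1/b into the rate *)

Section rate.
Context {R : realType}.

Lemma ln2_ge : 1 / 2 <= ln 2 :> R.
Proof.
have h : 1 / 2 <= expR (- (1 / 2)) :> R by have := expR_ge1Dx (- (1 / 2) : R); lra.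
have : expR (1 / 2) <= 2 :> R.
  by rewrite -[expR _]invrK -expRN invf_ple ?posrE ?expR_gt0// (le_trans _ h)//; lra.
by move=> h2; rewrite -[leLHS]expRK ler_ln ?posrE ?expR_gt0.
Qed.

(** Here l stands for ln (p n), y for ln n, b for the exponent of the regime and b0 for
    [beta_tilde]; then [Ps] is the value of [Psi] and [X] is n^(-b). *)
Variables (b b0 l y C1 : R).
Hypotheses (b_gt0 : 0 < b) (b_le1 : b <= 1) (b0_gt0 : 0 < b0) (y0 : 0 <= y) (yl : y <= l) (l12 : 1 / 2 <= l) (C18 : 8 <= C1).
Let e1 := (5 * b0 + 12) / (4 * b0 + 8).
Let e2 := b0 / (4 * b0 + 8).
Let Ps := l `^ e1 / expR (e2 * y).
Hypothesis small : C1 * Ps < 1.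
(** Either b is the exponent in [Psi] and may be close to 0, or b is bounded below and n^(-b/4) is
    already at most n^(-e2). *)
Hypothesis cases : (b = b0 /\ b <= 3 / 4) \/ (3 / 4 <= b /\ 4 * e2 <= b).
Let H := 1 + 1 / b.
Let X := expR (- (b * y)).

Let l0 : 0 < l. Proof. by apply: lt_le_trans l12; rewrite divr_gt0. Qed.
Let C10 : 0 < C1. Proof. exact: lt_le_trans C18. Qed.
Let den : 0 < 4 * b0 + 8. Proof. by rewrite addr_gt0// mulr_gt0. Qed.
Let e1b : 5 / 4 <= e1 /\ e1 <= 3 / 2.
Proof. by have bp := b0_gt0; rewrite /e1 ler_pdivlMr// ler_pdivrMr//; split; lra. Qed.
Let e2b : 0 <= e2 /\ e2 <= 1 / 4.
Proof. by have bp := b0_gt0; rewrite /e2 ler_pdivrMr//; split; [rewrite divr_ge0// ltW|lra]. Qed.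
Let lam := ln l.
Let lE : l = expR lam. Proof. by rewrite /lam lnK// posrE. Qed.
Let PsE : Ps = expR (e1 * lam - e2 * y).
Proof. by rewrite /Ps powRE// expRD expRN. Qed.
Let c := ln C1.
Let cE : C1 = expR c. Proof. by rewrite /c lnK// posrE. Qed.
Let ineq : c + e1 * lam < e2 * y.
Proof. by have := small; rewrite PsE cE -expRD -[X in _ < X]expR0 ltr_expR; lra. Qed.
Let c1 : 1 <= c.
Proof.
rewrite -ler_expR -cE; apply: (le_trans (expR1_le4)); apply: (le_trans _ C18); lra.
Qed.

(** For l < 1, also y < 1 and e2 y <= 1/4, while C1 >= 8 and l >= 1/2 keep c + e1 ln l at least c/4
    >= 1/4; this contradicts [ineq]. *)
Lemma rate_l1 : 1 <= l.
Proof.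
rewrite leNgt; apply/negP => l1.
have lam0 : lam <= 0 by rewrite /lam -[leRHS]ln1 ler_ln ?posrE// ltW.
have lamh : - c / 2 <= lam.
  have : ln (1 / 2) <= lam by rewrite /lam ler_ln ?posrE ?divr_gt0.
  rewrite div1r lnV ?posrE//.
  have : 3 * ln 2 <= c.
    have -> : 3 * ln 2 = ln (2 ^+ 3) :> R by rewrite lnXn// mulr_natl.
    by rewrite /c ler_ln ?posrE ?exprn_gt0//; apply: (le_trans _ C18); lra.
  have := @ln2_ge; lra.
have [h1 h2] := e1b; have [h3 h4] := e2b.
have a1 : 3 / 2 * lam <= e1 * lam by apply: ler_wnM2r.
have a2 : e2 * y <= 1 / 4 * 1 by apply: ler_pM => //; have := yl; lra.
have := ineq; have := c1; lra.
Qed.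

Let lam0 : 0 <= lam. Proof. by rewrite /lam ln_ge0// rate_l1. Qed.
Let a1 : 5 / 4 * lam <= e1 * lam. Proof. by apply: ler_wpM2r => //; exact: e1b.1. Qed.
Let H0 : 0 < H. Proof. by rewrite addr_gt0// divr_gt0. Qed.

(* In the first case [n^b] beats a large power of l, which also absorbs [1 / b <= y <= l]. *)
Let lo : b = b0 -> 8 * c + 12 * lam <= b * y /\ H <= 2 * l.
Proof.
move=> bb; have h := ineq.
have k1 : (4 * b0 + 8) * (c + e1 * lam) <= (4 * b0 + 8) * (e2 * y) by apply: ler_wpM2l; exact: ltW.
have k2 : (4 * b0 + 8) * (e2 * y) = b * y by rewrite bb /e2; field; rewrite gt_eqF.
have k3 : (4 * b0 + 8) * (e1 * lam) = (5 * b0 + 12) * lam by rewrite /e1; field; rewrite gt_eqF.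
have k4 : 0 <= b0 * c by rewrite mulr_ge0 ?ltW//; have := c1; lra.
have k5 : 0 <= b0 * lam by rewrite mulr_ge0// ltW.
rewrite mulrDr k2 k3 in k1.
have k6 : 8 * c + 12 * lam <= b * y by lra.
split => //; have l1 := rate_l1.
have : 1 / b <= y by rewrite ler_pdivrMr// mulrC; have := c1; have := lam0; lra.
have := yl; rewrite /H; lra.
Qed.

Let hi : 3 / 4 <= b -> H <= 3 /\ 4 * (c + 5 / 4 * lam) <= y.
Proof.
move=> hb; split.
  rewrite /H; have : 1 / b <= 2 by rewrite ler_pdivrMr//; lra.
  lra.
have [h3 h4] := e2b; have : e2 * y <= 1 / 4 * y by apply: ler_wpM2r.
have := ineq; have := a1; lra.
Qed.

(** Provides the smallness conditions of [rho_regime]: a large C1 makes the variance defect small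
    against c0 and L theta small. *)
Lemma rate_small : l * H * X <= 4 / C1.
Proof.
have expc : expR (- c) = C1^-1 by rewrite expRN -cE.
case: cases => [[bb b34]|[b34 _]].
  have [k6 Hl] := lo bb.
  apply: (@le_trans _ _ (2 * expR (2 * lam) * X)).
    apply: ler_wpM2r; first exact: expR_ge0.
    have -> : 2 * expR (2 * lam) = l * (2 * l) by rewrite (_ : 2 * lam = lam + lam) ?expRD -?lE; ring.
    by apply: ler_wpM2l => //; exact: ltW.
  have : expR (2 * lam) * X <= C1^-1.
    rewrite -expc /X -expRD ler_expR; have := lam0; have := c1; lra.
  have : 0 < C1^-1 by rewrite invr_gt0.
  lra.
have [H3 hy] := hi b34.
apply: (@le_trans _ _ (3 * (expR lam * X))).
  rewrite -lE mulrA; apply: ler_wpM2r; first exact: expR_ge0.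
  by rewrite mulrC; apply: ler_wpM2r => //; exact: ltW.
have : expR lam * X <= C1^-1.
  rewrite -expc /X -expRD ler_expR.
  have : 3 / 4 * y <= b * y by apply: ler_wpM2r.
  have := lam0; have := c1; lra.
have : 0 < C1^-1 by rewrite invr_gt0.
lra.
Qed.

(** Fourth powers clear the roots and leave H^3 l^5 X against 81 Ps^4. In the first case H <= 2 l
    costs three more powers of l; they are paid for by half of n^b, since 4 e2 = b/(b0 + 2) is at
    most b/2. In the second case H <= 3 and 4 e2 <= b suffice. *)
Lemma rate_main : Num.sqrt H * l * Num.sqrt (Num.sqrt (l * H * X)) <= 3 * Ps.
Proof.
have Ps0 : 0 < Ps by rewrite PsE expR_gt0.
have X0 : 0 < X by exact: expR_gt0.
have v0 : 0 <= Num.sqrt H * l * Num.sqrt (Num.sqrt (l * H * X)).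
  by rewrite !mulr_ge0 ?sqrtr_ge0// ltW.
rewrite -(@ler_pXn2r _ 4) ?nnegrE//; last by rewrite mulr_ge0// ltW.
have -> : (Num.sqrt H * l * Num.sqrt (Num.sqrt (l * H * X))) ^+ 4 = (Num.sqrt H ^+ 2) ^+ 2 * l ^+ 4 * (Num.sqrt (Num.sqrt (l * H * X)) ^+ 2) ^+ 2 by ring.
rewrite !sqr_sqrtr ?sqrtr_ge0 ?(ltW H0)//; last by rewrite !mulr_ge0 ?ltW.
have -> : H ^+ 2 * l ^+ 4 * (l * H * X) = H ^+ 3 * (l ^+ 5 * X) by ring.
have lk k : l ^+ k = expR (k%:R * lam) by rewrite expRM_natl -lE.
have P4 : Ps ^+ 4 = expR (4 * (e1 * lam - e2 * y)) by rewrite PsE -expRM_natl.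
rewrite exprMn P4.
have H0' := ltW H0.
case: cases => [[bb b34]|[b34 b4e]].
  have [k6 Hl] := lo bb.
  have H3 : H ^+ 3 <= (2 * l) ^+ 3 by rewrite lerXn2r ?nnegrE// mulr_ge0// ltW.
  apply: (@le_trans _ _ ((2 * l) ^+ 3 * (l ^+ 5 * X))).
    by apply: ler_wpM2r => //; rewrite mulr_ge0 ?exprn_ge0 ?ltW.
  have -> : (2 * l) ^+ 3 * (l ^+ 5 * X) = 8 * (l ^+ 8 * X) by ring.
  apply: ler_pM; [by []|by apply: mulr_ge0; [apply: exprn_ge0; exact: (ltW l0)|exact: (ltW X0)]|lra|].
  rewrite lk /X -expRD ler_expR.
  have q : 4 * (e2 * y) <= b * y / 2.
    have -> : 4 * (e2 * y) = b * y * (b0 + 2)^-1.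
      by rewrite bb /e2; field; rewrite !gt_eqF// addr_gt0.
    apply: ler_wpM2l; first by rewrite mulr_ge0// ltW.
    by rewrite lef_pV2 ?posrE ?addr_gt0// lerDr ltW.
  have := a1; have := c1; have := lam0; lra.
have [H3 hy] := hi b34.
have H3' : H ^+ 3 <= 3 ^+ 3 by rewrite lerXn2r ?nnegrE.
apply: ler_pM; [exact: exprn_ge0|by apply: mulr_ge0; [apply: exprn_ge0; exact: (ltW l0)|exact: (ltW X0)]|by apply: (le_trans H3'); lra|].
rewrite lk /X -expRD ler_expR.
have : 4 * e2 * y <= b * y by apply: ler_wpM2r.
have := a1; lra.
Qed.

Lemma rate_tail : expR (- (6 * l)) <= Ps.
Proof.
rewrite PsE ler_expR; have [h3 h4] := e2b.
have : e2 * y <= 1 / 4 * y by apply: ler_wpM2r.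
have : 0 <= e1 * lam by have := a1; have := lam0; lra.
have := y0; have := yl; have := rate_l1; lra.
Qed.
End rate.

(** The supremum of a set of nonnegative numbers; where no supremum exists, [sup] takes the default
    value 0. *)
Lemma rho_ge0 {R : realType} {d} {T : measurableType d} {P : probability T R} {p} {X : int -> T -> 'cV[R]_p} {d'} {T' : measurableType d'} {P' : probability T' R} {Z : T' -> 'cV[R]_(p * p)} {n} :
  0 <= rho P X P' Z n.
Proof.
rewrite /rho; set S := [set _ | _ in _].
have [hs|hs] := pselect (has_sup S); last by rewrite sup_out.
have [v Sv] := hs.1; have v0 : 0 <= v by have [u _ <-] := Sv.
by apply: (le_trans v0); apply: ub_le_sup => //; exact: hs.2.
Qed.

Lemma main_term {R : realType} (M K H l V B W c : R) : 0 <= M -> 0 < K -> 0 < H -> 0 <= l -> 0 <= V -> 0 <= B -> 0 <= c ->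
  W <= V * B ->
  M * Num.sqrt (K * H) * (3 * l) * Num.sqrt (Num.sqrt (3 * l * (K * H) * W)) / c <=
  M * Num.sqrt K * 3 * Num.sqrt (Num.sqrt (3 * K * V)) / c * (Num.sqrt H * l * Num.sqrt (Num.sqrt (l * H * B))).
Proof.
move=> M0 K0 H0 l0 V0 B0 c0 WV.
have a0 : 0 <= 3 * K * V by do 2 (apply: mulr_ge0 => //); exact: ltW.
have a1 : 0 <= 3 * l * (K * H) by do 2 (apply: mulr_ge0 => //); exact: ltW.
have e1 : Num.sqrt (Num.sqrt (3 * l * (K * H) * W)) <=
    Num.sqrt (Num.sqrt (3 * K * V)) * Num.sqrt (Num.sqrt (l * H * B)).
  rewrite -sqrtrM ?sqrtr_ge0// -sqrtrM//.
  apply: ler_wsqrtr; apply: ler_wsqrtr.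
  have -> : 3 * K * V * (l * H * B) = 3 * l * (K * H) * (V * B) by ring.
  exact: ler_wpM2l.
rewrite (sqrtrM H (ltW K0)).
move: e1 (sqrtr_ge0 K) (sqrtr_ge0 H).
move: (Num.sqrt (Num.sqrt (3 * l * _ * W))) (Num.sqrt (Num.sqrt (3 * K * _))) (Num.sqrt (Num.sqrt (l * H * B))) (Num.sqrt K) (Num.sqrt H).
move=> u v v' s1 s2 e1 s10 s20.
have -> : M * s1 * 3 * v / c * (s2 * l * v') = M * (s1 * s2) * (3 * l) * (v * v') / c by ring.
apply: ler_wpM2r; first by rewrite invr_ge0.
apply: ler_wpM2l => //.
by apply: mulr_ge0; apply: mulr_ge0 => //; exact: mulr_ge0.
Qed.

(** * The distance in a given regime *)

Section rho_regime.
Context {R : realType} {p k n : nat} {d} {T : measurableType d} (P : probability T R).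
Variables (A : nat -> 'M[R]_(p, k)) (C0 c0 beta tau b : R).
Hypotheses (C0_gt0 : 0 < C0) (HA : condition_A beta C0 A) (c0_gt0 : 0 < c0).
Hypothesis corr : forall m N, \sum_(l < N) al beta (l + m) * al beta l <= 20 * al tau m.
Variables (eps : int -> T -> 'cV[R]_k) (X : int -> T -> 'cV[R]_p).
Hypothesis HX : gaussian_linear_process P eps A X.
Hypothesis n0 : (0 < n)%N.
Variable (a0 : 'I_p).
Context {d'} {T' : measurableType d'} {P' : probability T' R} {Z : T' -> 'cV[R]_(p * p)}.
Hypothesis HZ : gaussian_vector P' Z 0 (covmx P (S_ P X n)).
Hypothesis HG : condition_G P X c0.

(** Settles the claim whenever the asserted bound is at least 1. *)
Lemma rho_le1 : rho P X P' Z n <= 1.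
Proof.
have bd d0 (T0 : measurableType d0) (P0 : probability T0 R) (f : (bool * ('I_p * 'I_p)) -> T0 -> R) x :
    (forall j, measurable_fun setT (f j)) -> 0 <= Ex P0 (fun w => rect x (fun j => f j w)) <= 1.
  move=> mf; apply/andP; split; first by apply: Ex_ge0 => w; case/andP: (rect_bounds x (fun j => f j w)).
  rewrite -[leRHS](Ex_cst P0 1); apply: Ex_le; [|exact: Li_cst|by move=> w; case/andP: (rect_bounds x (fun j => f j w))].
  apply: (@Li_bnd _ _ _ _ _ 1); first exact: (cmeas_rect x).
  by move=> w; case/andP: (rect_bounds x (fun j => f j w)) => h1 h2; rewrite ger0_norm.
apply: (rho_le C0_gt0 HA corr HX n0 a0 HZ) => x.
have mV j : measurable_fun setT (Vf (n := n) A X j : T -> R) by have [] := Vf_Lall (n := n) C0_gt0 HA corr HX j.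
have mZ j : measurable_fun setT (Zf Z j : T' -> R) by exact: (gauss_meas (GZf C0_gt0 HA corr HX n0 HZ) j).
have := bd _ _ P (fun j => Vf (n := n) A X j) x mV; move=> /andP[h1 h2].
have := bd _ _ P' (fun j => Zf Z j) x mZ; move=> /andP[h3 h4].
by rewrite ler_norml; apply/andP; split; lra.
Qed.

Let D := C0 ^+ 2 * 20.
(** With this choice K H dominates the square sums D^2 (2 + 1/b) and is at least 1, as [rho_core]
    asks of q. *)
Let K := 2 * D ^+ 2 + 1.
Let H := 1 + 1 / b.
Let B := n%:R `^ (- b) : R.
Let l : R := ln (p * n)%:R.
Hypothesis reg : regime tau b D n.
Hypotheses (l1 : 1 <= l) (h48 : 48 * D ^+ 2 * (H * B) <= c0) (h6 : 6 * 18 ^+ 2 * D ^+ 2 * (l * B) <= 1).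

Let D0 : 0 < D. Proof. by rewrite mulr_gt0// exprn_gt0. Qed.

(** The 2 p^2 coordinates number at most (p n)^3 because p n >= 2; so L = 3 l may be used. *)
Let card_le : ln #|{: bool * ('I_p * 'I_p)}|%:R <= 3 * l.
Proof.
have p0 : (0 < p)%N by apply: leq_ltn_trans (ltn_ord a0).
have pn : (1 < p * n)%N.
  rewrite ltnNge; apply/negP => h; have := l1; rewrite leNgt => /negP; apply.
  by apply: le_lt_trans ltr01; apply: ln_le0; rewrite -[leRHS]/(1%:R) ler_nat.
rewrite !card_prod card_bool card_ord.
have -> : 3 * l = ln ((p * n)%:R ^+ 3) by rewrite lnXn ?ltr0n 1?ltnW// mulr_natl.
rewrite ler_ln ?posrE -?natrX ?ltr0n ?expn_gt0 ?muln_gt0 ?p0 ?n0//= ?ler_nat.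
have h1 : (p <= p * n)%N by rewrite leq_pmulr.
by rewrite !expnS expn0 muln1; apply: leq_mul => //; apply: leq_mul.
Qed.

Lemma rho_regime : rho P X P' Z n <=
  640 * 1000 * Num.sqrt K * 3 * Num.sqrt (Num.sqrt (3 * K * (18 ^+ 2 * D ^+ 2))) / (c0 / 2)
    * (Num.sqrt H * l * Num.sqrt (Num.sqrt (l * H * B))) + expR (- (6 * l)) / 2.
Proof.
have [/andP[b0 b1] [w [w0 Hw Hw2]] Hq Ht] := reg.
have H1 : 1 <= 1 / b by rewrite ler_pdivlMr// mul1r.
have H0 : 0 < H by rewrite /H; lra.
have K1 : 1 <= K by rewrite /K; have := sqr_ge0 D; lra.
have K0 : 0 < K by lra.
have B0 : 0 < B by rewrite /B powR_gt0// ltr0n.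
have D2 : 0 <= D ^+ 2 := sqr_ge0 D.
have l0 : 0 < l by apply: lt_le_trans l1.
have := @rho_core R p k n d T P A C0 beta 20 tau C0_gt0 HA corr eps X HX n0 a0 d' T' P' Z HZ c0
  (fun m => D * al tau m) w (K * H) (6 * D ^+ 2 * H * B) (3 * l) c0_gt0 HG.
move=> /(_ (acov_le C0_gt0 HA corr)).
move=> /(_ (fun m => mulr_ge0 (ltW D0) (al_ge0 tau m)) w0 Hw).
have q1 : forall N, \sum_(m < N) (D * al tau m) ^+ 2 <= K * H.
  move=> N; apply: (le_trans (Hq N)).
  have zz : 0 <= D ^+ 2 * (1 / b) by apply: mulr_ge0 => //; lra.
  have -> : K * H = D ^+ 2 * 2 + 2 * (D ^+ 2 * (1 / b)) + 1 + 1 / b by rewrite /K /H; ring.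
  by rewrite mulrDr; lra.
have q2 : 1 <= K * H by rewrite -[leLHS]mul1r; apply: ler_pM => //; rewrite /H; lra.
move=> /(_ q1 q2 Ht).
have t1 : 8 * (6 * D ^+ 2 * H * B) <= c0.
  by apply: le_trans h48; rewrite le_eqVlt; apply/orP; left; apply/eqP; ring.
have L1 : 1 <= 3 * l by apply: (le_trans l1); apply: ler_peMl; [exact: ltW|rewrite ler1n].
move=> /(_ t1 L1 card_le).
have th : 2 * (3 * l) * (w ^+ 2 / n%:R) <= 1.
  apply: le_trans h6.
  have -> : 6 * 18 ^+ 2 * D ^+ 2 * (l * B) = 2 * (3 * l) * (18 ^+ 2 * D ^+ 2 * B) by ring.
  by apply: ler_wpM2l => //; lra.
move=> /(_ th) h; apply: (le_trans h); clear h.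
have -> : 2 * (3 * l) = 6 * l by ring.
apply: lerD; last exact: lexx.
have M0 : 0 <= 640 * 1000 :> R by apply: mulr_ge0; exact: ler0n.
have V0 : 0 <= 18 ^+ 2 * D ^+ 2 by apply: mulr_ge0; [exact: exprn_ge0|exact: D2].
have c2 : 0 <= c0 / 2 by apply: ltW; exact: divr_gt0.
exact: (main_term M0 K0 H0 (ltW l0) V0 (ltW B0) c2 Hw2).
Qed.
End rho_regime.

(** * The constant and the choice of regime *)

Section final.
Context {R : realType}.
Variables (C0 c0 : R).
Hypotheses (C0_gt0 : 0 < C0) (c0_gt0 : 0 < c0).

Let D := C0 ^+ 2 * 20.
Let K := 2 * D ^+ 2 + 1.
Let M := 640 * 1000 * Num.sqrt K * 3 * Num.sqrt (Num.sqrt (3 * K * (18 ^+ 2 * D ^+ 2))) / (c0 / 2).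
(** The summand 8 serves the rate estimates, the second one the variance condition [h48], and the
    third one the condition [h6] on L theta. *)
Let C1 := 8 + 192 * D ^+ 2 / c0 + 6 * 18 ^+ 2 * 4 * D ^+ 2.

Let D0 : 0 < D. Proof. by apply: mulr_gt0 => //; exact: exprn_gt0. Qed.
Let D2 : 0 <= D ^+ 2. Proof. exact: sqr_ge0. Qed.
Let M0 : 0 <= M.
Proof.
apply: mulr_ge0; last by rewrite invr_ge0 ltW// divr_gt0.
apply: mulr_ge0; last exact: sqrtr_ge0.
apply: mulr_ge0; last exact: ler0n.
apply: mulr_ge0; last exact: sqrtr_ge0.
apply: mulr_ge0; exact: ler0n.
Qed.
Let t1 : 0 <= 192 * D ^+ 2 / c0.
Proof. by apply: mulr_ge0; [apply: mulr_ge0; [exact: ler0n|exact: D2]|rewrite invr_ge0 ltW]. Qed.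
Let t2 : 0 <= 6 * 18 ^+ 2 * 4 * D ^+ 2.
Proof. by apply: mulr_ge0; [apply: mulr_ge0; [apply: mulr_ge0; [exact: ler0n|exact: exprn_ge0]|exact: ler0n]|exact: D2]. Qed.
Let C18 : 8 <= C1.
Proof. by rewrite /C1 -addrA lerDl addr_ge0. Qed.
Let C10 : 0 < C1. Proof. exact: lt_le_trans C18. Qed.
Let C1a : 192 * D ^+ 2 <= c0 * C1.
Proof.
have : 192 * D ^+ 2 / c0 <= C1 by rewrite /C1 addrAC lerDr addr_ge0.
by rewrite ler_pdivrMr// (mulrC C1).
Qed.
Let C1b : 6 * 18 ^+ 2 * 4 * D ^+ 2 <= C1.
Proof. by rewrite /C1 lerDr addr_ge0. Qed.

Section step.
Context {p k n : nat} {d} {T : measurableType d} (P : probability T R).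
Variables (A : nat -> 'M[R]_(p, k)) (b0 : R).
Variables (eps : int -> T -> 'cV[R]_k) (X : int -> T -> 'cV[R]_p).
Hypothesis HX : gaussian_linear_process P eps A X.
Hypothesis n0 : (0 < n)%N.
Variable (a0 : 'I_p).
Hypothesis pn : (1 < p * n)%N.
Context {d'} {T' : measurableType d'} {P' : probability T' R} {Z : T' -> 'cV[R]_(p * p)}.
Hypothesis HZ : gaussian_vector P' Z 0 (covmx P (S_ P X n)).
Hypothesis HG : condition_G P X c0.
Let l : R := ln (p * n)%:R.
Let Ps := l `^ ((5 * b0 + 12) / (4 * b0 + 8)) / n%:R `^ (b0 / (4 * b0 + 8)).
Hypotheses (b0_gt0 : 0 < b0) (small : C1 * Ps < 1).

Lemma rho_step (beta tau b : R) : condition_A beta C0 A ->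
  (forall m N, \sum_(l < N) al beta (l + m) * al beta l <= 20 * al tau m) ->
  regime tau b D n ->
  (b = b0 /\ b <= 3 / 4) \/ (3 / 4 <= b /\ 4 * (b0 / (4 * b0 + 8)) <= b) ->
  rho P X P' Z n <= (3 * M + 1) * Ps.
Proof.
move=> HA corr reg cases.
have [/andP[b_gt0 b_le1] _ _ _] := reg.
have nR : 0 < n%:R :> R by rewrite ltr0n.
pose y : R := ln n%:R.
have y0 : 0 <= y by rewrite /y ln_ge0// ler1n.
have yl : y <= l.
  rewrite /y /l ler_ln ?posrE ?ltr0n ?(ltnW pn)// ler_nat leq_pmull//.
  exact: leq_ltn_trans (ltn_ord a0).
have l12 : 1 / 2 <= l.
  by apply: (le_trans ln2_ge); rewrite /l ler_ln ?posrE ?ltr0n ?(ltnW pn)// ler_nat.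
have PsE : Ps = l `^ ((5 * b0 + 12) / (4 * b0 + 8)) / expR (b0 / (4 * b0 + 8) * y) by rewrite /Ps (powRE _ nR).
have BE : n%:R `^ (- b) = expR (- (b * y)) by rewrite powRE// mulNr.
have small' := small; rewrite PsE in small'.
have l1 := rate_l1 b0_gt0 y0 yl l12 C18 small'.
have sm := rate_small b_gt0 b0_gt0 y0 yl l12 C18 small' cases.
have mn := rate_main b_gt0 b0_gt0 y0 yl l12 C18 small' cases.
have tl := rate_tail b0_gt0 y0 yl l12 C18 small'.
rewrite -PsE -BE in mn tl sm.
set B := n%:R `^ (- b) in mn sm.
have B0 : 0 < B by rewrite /B powR_gt0.
set H := 1 + 1 / b in mn sm.
have H1 : 1 <= H by rewrite /H lerDl divr_ge0// ltW.
have H0 : 0 <= H by exact: le_trans H1.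
have l0 : 0 <= l by exact: le_trans l1.
have h48 : 48 * D ^+ 2 * (H * B) <= c0.
  have k0 : 0 <= 48 * D ^+ 2 by apply: mulr_ge0; [exact: ler0n|exact: D2].
  have : 48 * D ^+ 2 * (l * H * B) <= 48 * D ^+ 2 * (4 / C1) by exact: ler_wpM2l.
  have -> : 48 * D ^+ 2 * (4 / C1) = 192 * D ^+ 2 / C1 by ring.
  move=> h; have h' : 192 * D ^+ 2 / C1 <= c0 by rewrite ler_pdivrMr//; exact: C1a.
  apply: le_trans (le_trans h h'); apply: ler_wpM2l => //.
  by rewrite -mulrA; apply: ler_peMl => //; apply: mulr_ge0 => //; exact: ltW.
have h6 : 6 * 18 ^+ 2 * D ^+ 2 * (l * B) <= 1.
  have k0 : 0 <= 6 * 18 ^+ 2 * D ^+ 2 by apply: mulr_ge0; [apply: mulr_ge0; [exact: ler0n|exact: exprn_ge0]|exact: D2].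
  have : 6 * 18 ^+ 2 * D ^+ 2 * (l * H * B) <= 6 * 18 ^+ 2 * D ^+ 2 * (4 / C1) by exact: ler_wpM2l.
  have -> : 6 * 18 ^+ 2 * D ^+ 2 * (4 / C1) = 6 * 18 ^+ 2 * 4 * D ^+ 2 / C1 by ring.
  move=> h; have h' : 6 * 18 ^+ 2 * 4 * D ^+ 2 / C1 <= 1 by rewrite ler_pdivrMr// mul1r; exact: C1b.
  apply: le_trans (le_trans h h'); apply: ler_wpM2l => //.
  by rewrite mulrAC -[leLHS]mulr1; apply: ler_wpM2l => //; apply: mulr_ge0 => //; exact: ltW.
have h := rho_regime C0_gt0 HA c0_gt0 corr HX n0 a0 HZ HG reg l1 h48 h6.
apply: (le_trans h); rewrite -/M.
have P0 : 0 <= Ps by rewrite /Ps divr_ge0// powR_ge0.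
have m1 : M * (Num.sqrt H * l * Num.sqrt (Num.sqrt (l * H * B))) <= M * (3 * Ps) by exact: ler_wpM2l.
have e (u v : R) : (3 * u + 1) * v = u * (3 * v) + v by ring.
rewrite e; apply: lerD; first exact: m1.
apply: le_trans tl; rewrite ler_pdivrMr//; apply: ler_peMr; first exact: expR_ge0.
by rewrite ler1n.
Qed.
End step.

Lemma rho_Psi (beta : R) p k n {d} {T : measurableType d} (P : probability T R)
  (eps : int -> T -> 'cV[R]_k) (A : nat -> 'M[R]_(p, k)) (X : int -> T -> 'cV[R]_p)
  {d'} {T' : measurableType d'} {P' : probability T' R} {Z : T' -> 'cV[R]_(p * p)} :
  3 / 4 < beta -> (1 < p * n)%N -> gaussian_linear_process P eps A X ->
  condition_A beta C0 A -> condition_G P X c0 ->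
  gaussian_vector P' Z 0 (covmx P (S_ P X n)) ->
  rho P X P' Z n <= (C1 + 3 * M + 1) * Psi beta p n.
Proof.
move=> hb pn HX HA HG HZ.
have n0 : (0 < n)%N by move: pn; case: (n) => //; rewrite muln0.
have p0 : (0 < p)%N by move: pn; case: (p) => //; rewrite mul0n.
pose a0 : 'I_p := Ordinal p0.
have b0_gt0 : 0 < beta_tilde beta :> R by rewrite /beta_tilde lt_min; apply/andP; split; lra.
have b0_4 : beta_tilde beta <= 4 * beta - 3 by rewrite /beta_tilde ge_min lexx.
have b0_2 : beta_tilde beta <= 2 * beta - 1 by rewrite /beta_tilde ge_min lexx orbT.
have b0_e : beta < 15 / 16 -> beta_tilde beta = 4 * beta - 3 by move=> h; rewrite /beta_tilde; apply/min_idPl; lra.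
set b0 := beta_tilde beta in b0_gt0 b0_4 b0_2 b0_e.
have P0 : 0 <= Psi beta p n :> R by rewrite /Psi divr_ge0// powR_ge0.
suff [h|h] : rho P X P' Z n <= C1 * Psi beta p n \/ rho P X P' Z n <= (3 * M + 1) * Psi beta p n.
- by apply: (le_trans h); apply: ler_wpM2r => //; rewrite -addrA lerDl addr_ge0// mulr_ge0.
- by apply: (le_trans h); apply: ler_wpM2r => //; rewrite -addrA lerDr ltW.
have den : 0 < 4 * b0 + 8 by lra.
(* Condition (A) passes to a smaller exponent b', so the low regime may be run at b' while [Psi]
   keeps the exponent of beta. *)
have lo_case b' : 3 / 4 < b' -> b' <= 15 / 16 -> b' <= beta ->
  (4 * b' - 3 = b0 /\ 4 * b' - 3 <= 3 / 4) \/ (3 / 4 <= 4 * b' - 3 /\ 4 * (b0 / (4 * b0 + 8)) <= 4 * b' - 3) ->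
  rho P X P' Z n <= C1 * Psi beta p n \/ rho P X P' Z n <= (3 * M + 1) * Psi beta p n.
  move=> b1 b2 b3 cases; have HA' := condition_A_mono C0_gt0 HA b3.
  have corr m N := al_corr_lo m N b1 b2.
  have [small|big] := ltP (C1 * Psi beta p n) 1; last by left; exact: le_trans (rho_le1 C0_gt0 HA' corr HX n0 a0 HZ) big.
  right; apply: (rho_step HX n0 a0 pn HZ HG b0_gt0 small HA' corr _ cases).
  have -> : 2 * b' - 1 = (1 + (4 * b' - 3)) / 2 by field.
  by apply: regime_lo => //; lra.
have [b1|b1] := ltP beta (15 / 16).
  by apply: (lo_case beta) => //; [lra|left; rewrite b0_e//; split => //; lra].
(* For beta from 15/16 to 2 the value 15/16 with b = 3/4 is enough: b0 <= 3 gives 4 b0/(4 b0 + 8) <=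
   3/5. *)
have [b2|b2] := leP beta 2.
  apply: (lo_case (15 / 16)) => //; [lra|right; split; first lra].
  rewrite mulrA ler_pdivrMr//; lra.
(* For larger beta the decay exponent 2 with b = 1 is enough, as 4 b0/(4 b0 + 8) is below 1 for
   every b0. *)
have HA' := condition_A_mono C0_gt0 HA (ltW b2).
have corr := @al_corr_hi R.
have [small|big] := ltP (C1 * Psi beta p n) 1; last by left; exact: le_trans (rho_le1 C0_gt0 HA' corr HX n0 a0 HZ) big.
right; apply: (rho_step HX n0 a0 pn HZ HG b0_gt0 small HA' corr (regime_hi D0 n0)).
right; split; first lra.
by rewrite mulrA ler_pdivrMr//; lra.
Qed.

Lemma rate_constant : exists C : R, 0 < C /\
    forall (beta : R), 3 / 4 < beta ->
    forall (p d n : nat), (1 < p * n)%N ->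
    forall (disp : measure_display) (Omega : measurableType disp)
      (P : probability Omega R) (eps : int -> Omega -> 'cV[R]_d)
      (A : nat -> 'M[R]_(p, d)) (X : int -> Omega -> 'cV[R]_p),
    gaussian_linear_process P eps A X ->
    condition_A beta C0 A ->
    condition_G P X c0 ->
    forall (disp' : measure_display) (Omega' : measurableType disp')
      (P' : probability Omega' R) (Z : Omega' -> 'cV[R]_(p * p)),
    gaussian_vector P' Z 0 (covmx P (S_ P X n)) ->
    rho P X P' Z n <= C * Psi beta p n.
Proof.
exists (C1 + 3 * M + 1); split; last first.
  move=> beta hb p k n pn dd T P eps A X HX HA HG dd' T' P' Z HZ; exact: rho_Psi HX HA HG HZ.
by have := C10; have := M0; move: (C1) (M) => x z; lra.
Qed.
End final.

Theorem theorem1 (R : realType) (C0 c0 : R) (C0_gt0 : 0 < C0) (c0_gt0 : 0 < c0) :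
  (exists C : R, 0 < C /\
    forall (beta : R), 3 / 4 < beta ->
    forall (p d n : nat), (1 < p * n)%N ->
    forall (disp : measure_display) (Omega : measurableType disp)
      (P : probability Omega R) (eps : int -> Omega -> 'cV[R]_d)
      (A : nat -> 'M[R]_(p, d)) (X : int -> Omega -> 'cV[R]_p),
    gaussian_linear_process P eps A X ->
    condition_A beta C0 A ->
    condition_G P X c0 ->
    forall (disp' : measure_display) (Omega' : measurableType disp')
      (P' : probability Omega' R) (Z : Omega' -> 'cV[R]_(p * p)),
    gaussian_vector P' Z 0 (covmx P (S_ P X n)) ->
    rho P X P' Z n <= C * Psi beta p n)
  /\
  (forall (beta : R), 3 / 4 < beta ->
    forall (p d : nat -> nat), (forall n, (0 < p n)%N) ->
    forall (disp : nat -> measure_display)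
      (Omega : forall n, measurableType (disp n))
      (P : forall n, probability (Omega n) R)
      (eps : forall n, int -> Omega n -> 'cV[R]_(d n))
      (A : forall n, nat -> 'M[R]_(p n, d n))
      (X : forall n, int -> Omega n -> 'cV[R]_(p n)),
    (forall n, gaussian_linear_process (P n) (eps n) (A n) (X n)) ->
    (forall n, condition_A beta C0 (A n)) ->
    (forall n, condition_G (P n) (X n) c0) ->
    forall (disp' : nat -> measure_display)
      (Omega' : forall n, measurableType (disp' n))
      (P' : forall n, probability (Omega' n) R)
      (Z : forall n, Omega' n -> 'cV[R]_(p n * p n)),
    (forall n, gaussian_vector (P' n) (Z n) 0 (covmx (P n) (S_ (P n) (X n) n))) ->
    Psi beta (p n) n @[n --> \oo] --> (0 : R) ->
    rho (P n) (X n) (P' n) (Z n) n @[n --> \oo] --> (0 : R)).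
Proof.
have [C [C_gt0 HC]] := rate_constant C0_gt0 c0_gt0.
split; first by exists C.
move=> beta hb p k p_gt0 dd Om P eps A X HX HA HG dd' Om' P' Z HZ HPsi.
apply: (@squeeze_cvgr _ _ _ _ (fun=> 0) (fun n => C * Psi beta (p n) n)).
- near=> n; rewrite rho_ge0/=.
  (* The uniform constant applies along the whole array once n >= 2, which with p >= 1 gives p n >
     1. *)
  apply: (HC beta hb _ _ _ _ _ _ _ _ _ _ (HX n) (HA n) (HG n) _ _ _ _ (HZ n)).
  apply: leq_trans (leq_pmull n (p_gt0 n)).
  by near: n; exists 2%N.
- exact: cvg_cst.
- by rewrite -(mulr0 C); apply: cvgMr.
Unshelve. all: by end_near.
Qed.
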